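(* Let $S \subseteq K^n$ be definable in $(K, \bm k)$ and nonempty. Then \[ \dim_2 S=0\ \iff\ S\ \text{is discrete}. \]
   Context: Let $(K,\dot{\mathcal O})$ be a pre-$H$-field that is differential-henselian and Liouville closed (real closed, closed under integration and exponential integration) with $\dot{\mathcal O}\neq K$, and let $\bm k\subseteq\dot{\mathcal O}$ be a lift of its differential residue field $\operatorname{res}(K,\dot{\mathcal O})$, i.e. a differential subfield of $\dot{\mathcal O}$ mapped isomorphically onto $\operatorname{res}(K,\dot{\mathcal O})$ by the residue map. The pair $(K,\bm k)$ is viewed as a structure in the language of ordered differential rings with a relation for the dominance relation of $\dot{\mathcal O}$, expanded by a unary predicate for $\bm k$; ''definable'' means definable with parameters in this structure. $K$ carries the order topology and $K^n$ the product topology. For nonempty $S\subseteq K^n$, $\dim_2 S=\max\{\operatorname{dtrdeg}(K\bm k^*\langle s\rangle\mid K\bm k^* ): s\in S^*\}$, where $(K^*,\bm k^*,S^* )$ is an $|K|^+$-saturated elementary extension of $(K,\bm k,S)$ and $\operatorname{dtrdeg}$ is differential transcendence degree; $\dim_2\emptyset=-\infty$. *)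

(* Defs.v *)
From HB Require Import structures.
From mathcomp Require Import all_boot all_order all_algebra.
From mathcomp Require Import boolp classical_sets functions cardinality.
From mathcomp Require Import topology function_spaces.
From mathcomp Require Import mpoly.

Set Implicit Arguments.
Unset Strict Implicit.
Unset Printing Implicit Defensive.

Import Order.TTheory GRing.Theory Num.Theory.
Local Open Scope classical_set_scope.
Local Open Scope ring_scope.
Local Open Scope card_scope.

(** * First-order logic *)

Record language := Language {
  fsym : Type;
  farity : fsym -> nat;
  rsym : Type;
  rarity : rsym -> nat }.

(* [term L V] and [formula L V] have their free variables in the type [V];
   parameters are handled by putting them into [V]. [All] binds the variable
   [None]. The connectives are complete since the metalogic is classical. *)
Inductive term (L : language) (V : Type) : Type :=
| Var of V
| App (f : fsym L) of ('I_(farity f) -> term L V).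

Inductive formula (L : language) (V : Type) : Type :=
| Fal
| Eq of term L V & term L V
| Rel (r : rsym L) of ('I_(rarity r) -> term L V)
| Imp of formula L V & formula L V
| All of formula L (option V).

Record structure (L : language) := Structure {
  carrier :> Type;
  fint : forall f : fsym L, ('I_(farity f) -> carrier) -> carrier;
  rint : forall r : rsym L, ('I_(rarity r) -> carrier) -> Prop }.

Section Semantics.
Context {L : language}.
Implicit Types M N : structure L.

Fixpoint eval M (V : Type) (e : V -> M) (t : term L V) : M :=
  match t with
  | Var v => e v
  | App f ts => fint (fun i => eval e (ts i))
  end.

Fixpoint holds M (V : Type) (e : V -> M) (phi : formula L V) : Prop :=
  match phi with
  | Fal => False
  | Eq t u => eval e t = eval e u
  | Rel r ts => rint (fun i => eval e (ts i))
  | Imp p q => holds e p -> holds e q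
  | All p => forall x : M, holds (oapp e x) p
  end.

Definition definable M (n : nat) (S : set ('I_n -> M)) : Prop :=
  exists phi : formula L ('I_n + M),
    S = [set s | holds (fun v => match v with inl i => s i | inr a => a end)
                       phi].

(* A formula with free variables in [M] is a sentence with parameters in [M]. *)
Definition elementary_embedding M N (j : M -> N) : Prop :=
  forall phi : formula L M, holds id phi <-> holds j phi.

(* |T|^+-saturation: a set of parameters has size < |T|^+ iff it has size at
   most |T|; the variable of a 1-type over A is [None : option A]. *)
Definition succ_saturated (T : Type) N : Prop :=
  forall (A : set N), A #<= [set: T] ->
  forall (Gamma : set (formula L (option (set_type A)))),
  (forall G, G `<=` Gamma -> finite_set G ->
     exists b : N, forall phi, G phi -> holds (oapp set_val b) phi) ->
  exists b : N, forall phi, Gamma phi -> holds (oapp set_val b) phi.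

End Semantics.

Definition expand_language (L : language) (n : nat) : language :=
  Language (@farity L)
    (fun r : option (rsym L) => if r is Some r' then rarity r' else n).

Definition expand (L : language) (n : nat) (M : structure L)
    (S : set ('I_n -> M)) : structure (expand_language L n) :=
  @Structure (expand_language L n) M (@fint L M)
    (fun r => match r with Some r' => @rint L M r' | None => S end).

(** * The language of ordered differential rings with a dominance relation and
    a unary predicate *)

Inductive pair_fsym := FZero | FOne | FAdd | FOpp | FMul | FDer.
Inductive pair_rsym := RLe | RDom | RSmall.

Definition pair_language : language :=
  Language
    (fun f => match f with
              | FZero | FOne => 0%N | FOpp | FDer => 1%N | FAdd | FMul => 2%N
              end)
    (fun r => match r with RLe | RDom => 2%N | RSmall => 1%N end).

Definition pair_structure (K : rcfType) (der : K -> K) (dom : K -> K -> Prop)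
    (k : set K) : structure pair_language :=
  @Structure pair_language K
    (fun f => match f with
              | FZero => fun _ => 0
              | FOne => fun _ => 1
              | FAdd => fun a => a ord0 + a ord_max
              | FOpp => fun a => - a ord0
              | FMul => fun a => a ord0 * a ord_max
              | FDer => fun a => der (a ord0)
              end)
    (fun r => match r with
              | RLe => fun a => a ord0 <= a ord_max
              | RDom => fun a => dom (a ord0) (a ord_max)
              | RSmall => fun a => k (a ord0)
              end).

(** * Differential fields *)

Section DifferentialField.
Context {K : fieldType} (der : K -> K).

Definition derivation : Prop :=
  (forall x y, der (x + y) = der x + der y) /\
  (forall x y, der (x * y) = der x * y + x * der y).

Definition diff_subfield (F : set K) : Prop :=
  [/\ F 1,
      forall x y, F x -> F y -> F (x - y),
      forall x y, F x -> F y -> F (x / y)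
    & forall x, F x -> F (der x)].

Definition diff_generated (A : set K) : set K :=
  \bigcap_(F in [set F | diff_subfield F /\ A `<=` F]) F.

Definition diff_algebraic (F : set K) (y : K) : Prop :=
  exists (r : nat) (P : {mpoly K[r]}),
    [/\ P <> 0, forall m, F P@_m
      & P.@[fun i : 'I_r => iter i der y] = 0].

(* The variable of index [v] stands for the derivative of order
   [(enum_val v).2] of the differential indeterminate [(enum_val v).1]. *)
Definition diff_alg_independent (F : set K) (d : nat) (b : 'I_d -> K) : Prop :=
  forall (r : nat) (P : {mpoly K[#|{: 'I_d * 'I_r}|]}),
    (forall m, F P@_m) ->
    P.@[fun v : 'I_#|{: 'I_d * 'I_r}| =>
          iter (enum_val v).2 der (b (enum_val v).1)] = 0 ->
    P = 0.

(* [is_dtrdeg F E d]: the differential field E has a differential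
   transcendence basis over its differential subfield F of size d. *)
Definition is_dtrdeg (F E : set K) (d : nat) : Prop :=
  exists b : 'I_d -> K,
    [/\ range b `<=` E, diff_alg_independent F b
      & forall y, E y -> diff_algebraic (diff_generated (F `|` range b)) y].

End DifferentialField.

(** * Valued differential fields *)

Section Valued.
Context {K : fieldType} (O : set K).

Definition valuation_ring : Prop :=
  [/\ O 1,
      forall x y, O x -> O y -> O (x - y),
      forall x y, O x -> O y -> O (x * y)
    & forall x, x != 0 -> O x \/ O x^-1].

Definition dominated (f g : K) : Prop := exists2 h, O h & f = h * g.
Definition strictly_dominated (f g : K) : Prop :=
  dominated f g /\ ~ dominated g f.
Definition asymp (f g : K) : Prop := dominated f g /\ dominated g f.

(* The maximal ideal of O; for f, g in O, the residue classes of f and g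
   coincide iff [maximal_ideal (f - g)]. *)
Definition maximal_ideal : set K := [set f | strictly_dominated f 1].

Variable der : K -> K.

Definition small_derivation : Prop :=
  forall f, maximal_ideal f -> maximal_ideal (der f).

(* Every nonzero linear differential operator a_0 + a_1 D + ... + a_r D^r over
   the differential residue field O/maximal_ideal is surjective, spelled out on
   representatives. *)
Definition residue_linearly_surjective : Prop :=
  forall (r : nat) (a : 'I_r.+1 -> K) (b : K),
    (forall i, O (a i)) -> (exists i, ~ maximal_ideal (a i)) -> O b ->
    exists2 y, O y &
      maximal_ideal (\sum_(i < r.+1) a i * iter i der y - b).

(* P ranges over O{Y}; its homogeneous parts of degree 0 and 1 satisfy
   P_0 < 1 and P_1 ~ 1. As all coefficients of P are in O, the latter says that
   some coefficient of P_1 is ~ 1. *)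
Definition diff_henselian : Prop :=
  [/\ small_derivation,
      residue_linearly_surjective
    & forall (r : nat) (P : {mpoly K[r.+1]}),
        (forall m, O P@_m) ->
        strictly_dominated P@_0%MM 1 ->
        (exists i : 'I_r.+1, asymp P@_U_(i)%MM 1) ->
        exists2 y, strictly_dominated y 1 &
          P.@[fun i : 'I_r.+1 => iter i der y] = 0].

(* The residue map is a ring morphism that commutes with the derivations, so
   it maps k isomorphically onto the differential residue field iff its
   restriction to k is a bijection. *)
Definition residue_field_lift (k : set K) : Prop :=
  [/\ diff_subfield der k, k `<=` O
    & forall f, O f -> exists! c, k c /\ maximal_ideal (f - c)].

End Valued.

(** * Pre-H-fields *)

Definition convex (K : rcfType) (O : set K) : Prop :=
  forall x y z, O x -> O z -> x <= y -> y <= z -> O y.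

Definition pre_H_field (K : rcfType) (der : K -> K) (O : set K) : Prop :=
  [/\ derivation der,
      valuation_ring O,
      convex O,
      forall f, (forall h, O h -> h < f) -> 0 < der f
    & forall f g, f != 0 -> g != 0 ->
        dominated O f 1 -> strictly_dominated O g 1 ->
        strictly_dominated O (der f) (der g / g)].

(* Real closedness is part of [rcfType]. *)
Definition Liouville_closed (K : rcfType) (der : K -> K) : Prop :=
  (forall f, exists g, der g = f) /\
  (forall f, exists2 g, g != 0 & der g / g = f).

(** * Topology and dimension *)

Definition discrete_subset (K : rcfType) (n : nat) (S : set ('I_n -> K)) :
    Prop :=
  S `<=` @isolated {ptws 'I_n -> order_topology K} S.

(* (K', k', S') with its derivation and dominance relation is a |K|^+-saturated
   elementary extension of (K, k, S). Taking K' to be an rcfType is no loss of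
   generality: elementary extensions of ordered real closed fields are such. *)
Record saturated_extension (K : rcfType) (der : K -> K) (O k : set K) (n : nat)
    (S : set ('I_n -> K)) := SaturatedExtension {
  ext_field : rcfType;
  ext_der : ext_field -> ext_field;
  ext_dom : ext_field -> ext_field -> Prop;
  ext_small : set ext_field;
  ext_set : set ('I_n -> ext_field);
  ext_emb : K -> ext_field;
  ext_structure := @expand pair_language n
    (pair_structure ext_der ext_dom ext_small) ext_set;
  ext_elementary : elementary_embedding
    (M := @expand pair_language n (pair_structure der (dominated O) k) S)
    (N := ext_structure) ext_emb;
  ext_saturated : succ_saturated K ext_structure }.

Arguments ext_der {K der O k n S} _ _.
Arguments ext_dom {K der O k n S} _ _ _.
Arguments ext_small {K der O k n S} _ _.
Arguments ext_set {K der O k n S} _ _.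
Arguments ext_emb {K der O k n S} _ _.

(* [is_dim2 E d]: d is the dimension dim_2 of S, as computed in the extension
   E; [None] stands for -oo. *)
Definition is_dim2 (K : rcfType) (der : K -> K) (O k : set K) (n : nat)
    (S : set ('I_n -> K)) (E : saturated_extension der O k S)
    (d : option nat) : Prop :=
  let der' := ext_der E in
  let F := diff_generated der' (range (ext_emb E) `|` ext_small E) in
  let dtrdeg_at (s : 'I_n -> ext_field E) :=
    is_dtrdeg der' F (diff_generated der' (F `|` range s)) in
  match d with
  | None => S = set0
  | Some m => (exists2 s, ext_set E s & dtrdeg_at s m) /\
              (forall s, ext_set E s ->
                 forall m', dtrdeg_at s m' -> (m' <= m)%N)
  end.

(* Main.v *)
Require Import Defs.
From HB Require Import structures.
From mathcomp Require Import all_boot all_order all_algebra.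
From mathcomp Require Import boolp classical_sets functions cardinality.
From mathcomp Require Import topology function_spaces.
From mathcomp Require Import mpoly ring lra zify.

Set Implicit Arguments.
Unset Strict Implicit.
Unset Printing Implicit Defensive.

Import Order.TTheory GRing.Theory Num.Theory.
Local Open Scope classical_set_scope.
Local Open Scope ring_scope.
Local Open Scope card_scope.

(** Let [M] be the saturated extension, [k*] its lift of the residue field and [F = K<k*>].

    If [s] in [S] is not isolated, then by saturation there is [t] in [S*] with [t <> s] such that
    [z = t_i - s_i] is nonzero and smaller than every positive element of [K]. The values of [z], [z†],
    [z††], ... ([x† = x'/x]) are then independent over the value group of [F], which is that of [K],
    so [z] is not differentially algebraic over [F], and [dim_2 S > 0].

    Conversely let [t] in [S*] be isolated in [S*] with radius [eps] and suppose that some [t_i] is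
    differentially transcendental over [F]. Let [M1] be a countable submodel of [M] that contains
    [t], [eps] and the parameters of [S]. By differential-henselianity, [t_i |-> t_i + a] with [a]
    smaller than all of [M1] extends to an embedding of [M1] into [M] over [M1 /\ F] that moves every
    element infinitesimally. It fixes [k* /\ M1], and partial isomorphisms with countable domains
    whose residues are fixed elements of [k*] form a back-and-forth system; hence the image of [t] is
    another point of [S*] within [eps] of [t].

    For the back-and-forth, a maximal extension inside a countable submodel is shown to be total. An
    element [w] outside its domain [E] is either a pseudo-limit, whose cut is filled by saturation if
    all differential polynomials are stable on it and otherwise by a zero of a minimal unstable
    polynomial, possibly after passing to a cut for logarithmic derivatives through a Riccati
    polynomial; or it generates a sequence [w_(i+1) = w_i† - h_i] of new values over [E], which is
    copied by saturation. *)

(** * Valued differential fields *)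

(** Saturation is available only over at most |K| parameters, while back-and-forth needs domains
    closed under all existence axioms; countable Skolem-closed submodels reconcile the two. The
    deformation fixes all of K<k*> inside the submodel, so residues stay fixed and the predicate for
    k* is preserved without any study of the residue field. The delicate case is the pseudo-limit.
    Differential-henselianity yields a zero of P in a ball with centre c and radius g only if the
    linear part of P(c + gZ) dominates the higher terms. Shrinking g multiplies terms of degree e by
    g^e, up to powers of g†, and such powers are usually negligible against g. If dominance
    nevertheless fails on all balls, then the logarithmic derivatives g† of the radii run through
    nested balls themselves. The family of those balls is closed under passing from a radius s to
    s†, and on a cut of this kind linear dominance cannot fail. So the detour through logarithmic
    derivatives is taken only once. The Riccati polynomial of the linearised P serves to find a
    point of this second cut in the submodel. *)

Definition dominatedb (F : fieldType) (O : set F) (x y : F) : bool :=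
  `[< dominated O x y >].

Section Domination.
Variables (F : fieldType) (O : set F) (OV : valuation_ring O).
Implicit Types x y z : F.
Local Notation "x ≼ y" := (dominatedb O x y) (at level 70, y at next level).
Local Notation "x ≺ y" := (~~ dominatedb O y x) (at level 70, y at next level).

Lemma valring0 : O 0.
Proof. by case: OV => O1 OB _ _; rewrite -(subrr 1); apply: OB. Qed.

Lemma valringN x : O x -> O (- x).
Proof. by case: OV => _ OB _ _ Ox; rewrite -sub0r; apply: OB => //; exact: valring0. Qed.

Lemma valringD x y : O x -> O y -> O (x + y).
Proof.
by case: (OV) => _ OB _ _ Ox Oy; rewrite -[y]opprK; apply: OB => //; apply: valringN.
Qed.

Lemma domP x y : y != 0 -> (x ≼ y) = `[< O (x / y) >].
Proof.
move=> y0; apply: asbool_equiv_eq; split=> [[h Oh ->]|Oxy]; first by rewrite mulfK.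
by exists (x / y) => //; rewrite divfK.
Qed.

Lemma dom1P x : (x ≼ 1) = `[< O x >].
Proof. by rewrite domP ?oner_eq0 // divr1. Qed.

Lemma dom_refl x : x ≼ x.
Proof. by apply/asboolP; exists 1; [case: OV | rewrite mul1r]. Qed.

Lemma dom0x x : 0 ≼ x.
Proof. by apply/asboolP; exists 0; [exact: valring0 | rewrite mul0r]. Qed.

Lemma domx0 x : (x ≼ 0) = (x == 0).
Proof.
apply/asboolP/eqP => [[h _ ->]|->]; first by rewrite mulr0.
by exists 0; [exact: valring0 | rewrite mul0r].
Qed.

Lemma dom_trans y x z : x ≼ y -> y ≼ z -> x ≼ z.
Proof.
move=> /asboolP[h Oh ->] /asboolP[l Ol ->]; apply/asboolP; exists (h * l).
  by case: OV => _ _ OM _; apply: OM.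
by rewrite mulrA.
Qed.

Lemma dom_total x y : (x ≼ y) || (y ≼ x).
Proof.
have [->|x0] := eqVneq x 0; first by rewrite dom0x.
have [->|y0] := eqVneq y 0; first by rewrite dom0x orbT.
rewrite !domP //; case: OV => _ _ _ /(_ (x / y)).
rewrite mulf_neq0 ?invr_eq0 // => /(_ isT)[] h; first by apply/orP; left; apply/asboolP.
by apply/orP; right; apply/asboolP; rewrite invf_div in h.
Qed.

(** By totality the boolean negation [~~ dominatedb O y x] can serve as strict dominance: it already
    contains [x ≼ y]. *)
Lemma domW x y : x ≺ y -> x ≼ y.
Proof. by move=> h; have := dom_total x y; rewrite (negPf h) orbF. Qed.

Lemma dom_lt_trans y x z : x ≼ y -> y ≺ z -> x ≺ z.
Proof. by move=> xy; apply: contra => zx; exact: dom_trans zx xy. Qed.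

Lemma lt_dom_trans y x z : x ≺ y -> y ≼ z -> x ≺ z.
Proof. by move=> xy yz; apply: contra xy => zx; exact: dom_trans yz zx. Qed.

Lemma lt_trans_dom y x z : x ≺ y -> y ≺ z -> x ≺ z.
Proof. by move=> xy /domW; exact: lt_dom_trans. Qed.

Lemma lt_dom_neq0 x y : x ≺ y -> y != 0.
Proof. by apply: contra => /eqP ->; exact: dom0x. Qed.

Lemma lt0_dom y : (0 ≺ y) = (y != 0).
Proof. by rewrite domx0. Qed.

Lemma dom_neq0 x y : x ≼ y -> x != 0 -> y != 0.
Proof. by move=> xy; apply: contra => /eqP y0; rewrite y0 domx0 in xy. Qed.

Lemma domN x y : (- x ≼ y) = (x ≼ y).
Proof.
suff h u : u ≼ y -> - u ≼ y by apply/idP/idP => /h; rewrite ?opprK.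
by move=> /asboolP[l Ol ->]; apply/asboolP; exists (- l); [exact: valringN | rewrite mulNr].
Qed.

Lemma domxN x y : (x ≼ - y) = (x ≼ y).
Proof.
suff h u : x ≼ u -> x ≼ - u by apply/idP/idP => /h; rewrite ?opprK.
by move=> /asboolP[l Ol ->]; apply/asboolP; exists (- l); [exact: valringN | rewrite mulrNN].
Qed.

Lemma domD x y z : x ≼ z -> y ≼ z -> x + y ≼ z.
Proof.
move=> /asboolP[h Oh ->] /asboolP[l Ol ->]; apply/asboolP; exists (h + l).
  exact: valringD.
by rewrite mulrDl.
Qed.

Lemma domB x y z : x ≼ z -> y ≼ z -> x - y ≼ z.
Proof. by move=> ? ?; apply: domD; rewrite ?domN. Qed.

Lemma domM x y x' y' : x ≼ y -> x' ≼ y' -> x * x' ≼ y * y'.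
Proof.
move=> /asboolP[h Oh ->] /asboolP[l Ol ->]; apply/asboolP; exists (h * l).
  by case: OV => _ _ OM _; apply: OM.
by rewrite mulrACA.
Qed.

Lemma domM2r z x y : z != 0 -> (x * z ≼ y * z) = (x ≼ y).
Proof.
move=> z0; apply/idP/idP => [h|h]; last by apply: domM => //; exact: dom_refl.
by have := domM h (dom_refl z^-1); rewrite !mulfK.
Qed.

Lemma domM2l z x y : z != 0 -> (z * x ≼ z * y) = (x ≼ y).
Proof. by move=> z0; rewrite ![z * _]mulrC domM2r. Qed.

Lemma domV x y : x != 0 -> y != 0 -> (x^-1 ≼ y^-1) = (y ≼ x).
Proof.
by move=> x0 y0; rewrite -(@domM2r (x * y)) ?mulf_neq0 // mulKf // [x * y]mulrC mulKf.
Qed.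

Lemma domV1 x : x != 0 -> (x^-1 ≼ 1) = (1 ≼ x).
Proof. by move=> x0; rewrite -{1}invr1 domV ?oner_eq0. Qed.

Lemma dom1V x : x != 0 -> (1 ≼ x^-1) = (x ≼ 1).
Proof. by move=> x0; rewrite -{1}invr1 domV ?oner_eq0. Qed.

Lemma dom_div x y z : z != 0 -> (x / z ≼ y) = (x ≼ y * z).
Proof. by move=> z0; rewrite -(@domM2r z) // divfK. Qed.

Lemma domx_div x y z : z != 0 -> (x ≼ y / z) = (x * z ≼ y).
Proof. by move=> z0; rewrite -(@domM2r z) // divfK. Qed.

Lemma lt_domM x y x' y' : x ≺ y -> x' ≼ y' -> y' != 0 -> x * x' ≺ y * y'.
Proof.
move=> xy xy' y0'; apply: (@dom_lt_trans (x * y')); first exact/domM/xy'/dom_refl.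
by rewrite domM2r.
Qed.

Lemma dom_ltM x y x' y' : x ≼ y -> x' ≺ y' -> y != 0 -> x * x' ≺ y * y'.
Proof. by move=> *; rewrite ![x * _]mulrC ![y * _]mulrC; apply: lt_domM. Qed.

Lemma lt_domD x y z : x ≺ z -> y ≺ z -> x + y ≺ z.
Proof.
move=> xz yz; have /orP[xy|yx] := dom_total x y.
  by apply: dom_lt_trans yz; apply: domD => //; exact: dom_refl.
by apply: dom_lt_trans xz; apply: domD => //; exact: dom_refl.
Qed.

Lemma lt_domN x y : (- x ≺ y) = (x ≺ y).
Proof. by rewrite domxN. Qed.

Lemma lt_domB x y z : x ≺ z -> y ≺ z -> x - y ≺ z.
Proof. by move=> ? ?; apply: lt_domD; rewrite ?lt_domN. Qed.

Lemma domX x y n : x ≼ y -> x ^+ n ≼ y ^+ n.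
Proof.
move=> xy; elim: n => [|n IH]; first by rewrite !expr0; exact: dom_refl.
by rewrite !exprS; exact: domM.
Qed.

Lemma domX1 x n : x ≼ 1 -> x ^+ n ≼ 1.
Proof. by move=> /(domX n); rewrite expr1n. Qed.

Lemma dom1X x n : 1 ≼ x -> 1 ≼ x ^+ n.
Proof. by move=> /(domX n); rewrite expr1n. Qed.

Lemma dom_expX x m n : 1 ≼ x -> (m <= n)%N -> x ^+ m ≼ x ^+ n.
Proof.
move=> x1 mn; rewrite -(subnKC mn) exprD -{1}[x ^+ m]mulr1.
by apply: domM; [exact: dom_refl | exact: dom1X].
Qed.

Lemma lt_domX x y n : x ≺ y -> x ^+ n.+1 ≺ y ^+ n.+1.
Proof.
move=> xy; elim: n => [|n IH]; first by rewrite !expr1.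
by rewrite ![_ ^+ n.+2]exprS; apply: lt_domM (domW IH) (lt_dom_neq0 IH).
Qed.

Lemma dom_sum (I : Type) (r : seq I) (p : pred I) (f : I -> F) y :
  (forall i, p i -> f i ≼ y) -> \sum_(i <- r | p i) f i ≼ y.
Proof. by move=> h; elim/big_ind: _ => //; [exact: dom0x | move=> *; exact: domD]. Qed.

Lemma lt_dom_sum (I : Type) (r : seq I) (p : pred I) (f : I -> F) y : y != 0 ->
  (forall i, p i -> f i ≺ y) -> \sum_(i <- r | p i) f i ≺ y.
Proof. by move=> y0 h; elim/big_ind: _ => //; [rewrite lt0_dom | move=> *; exact: lt_domD]. Qed.

Lemma lt_dom_add_l x y : x ≺ y -> y ≼ y + x.
Proof.
move=> xy; apply/negPn/negP => h; suff : y ≺ y by rewrite dom_refl.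
by rewrite -{2}[y](addrK x); apply: lt_domB.
Qed.

(** Since 0 is dominated by everything, [sim x y] forces [y] and then [x] to be nonzero; the
    asymmetry of the definition is only apparent ([sim_sym]). *)
Definition sim x y := x - y ≺ y.

Lemma sim_refl x : x != 0 -> sim x x.
Proof. by move=> x0; rewrite /sim subrr lt0_dom. Qed.

Lemma sim_neq0 x y : sim x y -> y != 0. Proof. exact: lt_dom_neq0. Qed.

Lemma sim_domr x y : sim x y -> y ≼ x.
Proof. by move=> /lt_dom_add_l; rewrite addrC subrK. Qed.

Lemma sim_doml x y : sim x y -> x ≼ y.
Proof. by move=> h; rewrite -[x](subrK y); apply: domD; [exact: domW | exact: dom_refl]. Qed.

Lemma sim_neq0l x y : sim x y -> x != 0.
Proof. by move=> h; apply: dom_neq0 (sim_domr h) (sim_neq0 h). Qed.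

Lemma sim_sym x y : sim x y -> sim y x.
Proof. by move=> h; rewrite /sim -opprB lt_domN; apply: lt_dom_trans (sim_domr h). Qed.

Lemma sim_trans y x z : sim x y -> sim y z -> sim x z.
Proof.
move=> xy yz; rewrite /sim -[x](subrK y) -addrA; apply: lt_domD => //.
exact: lt_dom_trans xy (sim_doml yz).
Qed.

Lemma simP (x y : F) : y != 0 -> sim x y = (x / y - 1 ≺ 1).
Proof.
move=> y0; rewrite /sim -(@domM2r y 1) // mul1r mulrBl mul1r divfK //.
Qed.

Lemma simM x y x' y' : sim x y -> sim x' y' -> sim (x * x') (y * y').
Proof.
move=> xy xy'; rewrite /sim (_ : _ - _ = (x - y) * x' + y * (x' - y')); last by ring.
apply: lt_domD; first by apply: lt_domM => //; [exact: sim_doml | exact: sim_neq0 xy'].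
by apply: dom_ltM => //; [exact: dom_refl | exact: sim_neq0 xy].
Qed.

Lemma simV x y : sim x y -> sim x^-1 y^-1.
Proof.
move=> xy; have x0 := sim_neq0l xy; have y0 := sim_neq0 xy.
rewrite /sim (_ : _ - _ = - (x - y) / (x * y)); last by field; rewrite x0 y0.
rewrite mulNr lt_domN -(@domM2r (x * y)) ?mulf_neq0 // divfK ?mulf_neq0 //.
by rewrite mulrCA mulVf // mulr1 -lt_domN opprB; exact: sim_sym.
Qed.

Lemma dom_max (I : finType) (i0 : I) (f : I -> F) : {i | forall j, f j ≼ f i}.
Proof.
suff h (s : seq I) : {i | forall j, j \in i0 :: s -> f j ≼ f i}.
  by have [i hi] := h (enum I); exists i => j; apply: hi; rewrite in_cons mem_enum orbT.
elim: s => [|a s [i hi]]; first by exists i0 => j; rewrite mem_seq1 => /eqP ->; exact: dom_refl.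
case: (boolP (f a ≼ f i)) => [ai|/domW ia].
  exists i => j; rewrite !in_cons => /or3P[/eqP ->|/eqP -> //|js].
    by apply: hi; rewrite in_cons eqxx.
  by apply: hi; rewrite in_cons js orbT.
exists a => j; rewrite !in_cons => /or3P[/eqP ->|/eqP -> |js]; last 1 first.
- by apply: dom_trans ia; apply: hi; rewrite in_cons js orbT.
- by apply: dom_trans ia; apply: hi; rewrite in_cons eqxx.
- exact: dom_refl.
Qed.

End Domination.

Definition logder (F : fieldType) (der : F -> F) (x : F) : F := der x / x.

(** The order is left out, and only consequences of the pre-H-field axioms that restrict to
    differential subfields are kept ([pull_vdf]). [v_log] and [v_mono] describe [†] on values: it is
    infinite at infinitesimals and does not get smaller as they do. [vO_nat] is equicharacteristic
    zero. *)
Record vdf (F : fieldType) := Vdf {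
  vder :> F -> F;
  vO : set F;
  vder_ax : derivation vder;
  vO_ring : valuation_ring vO;
  vO_nat : forall n, n.+1%:R != 0 :> F /\ vO (n.+1%:R)^-1;
  vO_der : forall x, vO x -> vO (vder x);
  v_small : forall x : F, ~~ dominatedb vO 1 x -> ~~ dominatedb vO 1 (vder x);
  v_log : forall x : F, x != 0 -> ~~ dominatedb vO 1 x ->
    ~~ dominatedb vO (logder vder x) 1;
  v_mono : forall x y : F, x != 0 -> ~~ dominatedb vO y x -> ~~ dominatedb vO 1 y ->
    dominatedb vO (logder vder y) (logder vder x) }.

(** * Sizes of derivatives and of logarithmic derivatives *)

Section VdfTheory.
Variables (F : fieldType) (V : vdf F).
Implicit Types x y z t q : F.
Local Notation "x ≼ y" := (dominatedb (vO V) x y) (at level 70, y at next level).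
Local Notation "x ≺ y" := (~~ dominatedb (vO V) y x) (at level 70, y at next level).
Local Notation "x ~~~ y" := (sim (vO V) x y) (at level 70, y at next level).
Local Notation d := (vder V).
Local Notation ld := (logder V).
Let OV := vO_ring V.

Lemma derD x y : d (x + y) = d x + d y. Proof. by case: (vder_ax V) => h _; apply: h. Qed.
Lemma derM x y : d (x * y) = d x * y + x * d y. Proof. by case: (vder_ax V) => _ h; apply: h. Qed.
Lemma der0 : d 0 = 0.
Proof. by apply: (addrI (d 0)); rewrite -derD !addr0. Qed.
Lemma der1 : d 1 = 0.
Proof.
have := derM 1 1; rewrite !mulr1 mul1r => h; apply: (addrI (d 1)).
by rewrite -h addr0.
Qed.
Lemma derN x : d (- x) = - d x.
Proof. by apply: (addrI (d x)); rewrite -derD !subrr der0. Qed.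
Lemma derB x y : d (x - y) = d x - d y.
Proof. by rewrite derD derN. Qed.
Lemma derMn x n : d (x *+ n) = d x *+ n.
Proof. by elim: n => [|n IH]; rewrite ?mulr0n ?der0 // !mulrS derD IH. Qed.
Lemma der_nat n : d n%:R = 0.
Proof. by rewrite derMn der1 mul0rn. Qed.
Lemma der_sum (I : Type) (r : seq I) (p : pred I) (f : I -> F) :
  d (\sum_(i <- r | p i) f i) = \sum_(i <- r | p i) d (f i).
Proof. exact: (big_morph d derD der0). Qed.
Lemma derV x : x != 0 -> d x^-1 = - d x / x ^+ 2.
Proof.
move=> x0; have := derM x x^-1; rewrite mulfV // der1 => /esym/eqP.
rewrite addrC addr_eq0 => /eqP h; apply: (mulfI x0); rewrite h; field; exact: x0.
Qed.

Lemma iter_derD i x y : iter i d (x + y) = iter i d x + iter i d y.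
Proof. by elim: i => //= i ->; rewrite derD. Qed.
Lemma iter_der0 i : iter i d 0 = 0.
Proof. by elim: i => //= i ->; rewrite der0. Qed.
Lemma iter_der1 i : iter i.+1 d 1 = 0.
Proof. by elim: i => [|i IH]; rewrite iterS ?der1 // IH der0. Qed.

Lemma ldM (x y : F) : x != 0 -> y != 0 -> ld (x * y) = ld x + ld y.
Proof. by move=> x0 y0; rewrite /logder derM; field; rewrite x0 y0. Qed.
Lemma ldV (x : F) : x != 0 -> ld x^-1 = - ld x.
Proof.
move=> x0; rewrite /logder derV // invrK !mulNr; congr (- _).
by rewrite expr2 invfM mulrA -mulrA mulVf // mulr1.
Qed.
Lemma ld_div x y : x != 0 -> y != 0 -> ld (x / y) = ld x - ld y.
Proof. by move=> x0 y0; rewrite ldM ?invr_eq0 // ldV. Qed.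
Lemma ldN x : ld (- x) = ld x.
Proof. by rewrite /logder derN invrN mulrNN. Qed.
Lemma ld1 : ld 1 = 0. Proof. by rewrite /logder der1 mul0r. Qed.
Lemma ldX x n : x != 0 -> ld (x ^+ n) = n%:R * ld x.
Proof.
move=> x0; elim: n => [|n IH]; first by rewrite expr0 ld1 mul0r.
by rewrite exprS ldM ?expf_neq0 // IH -[in RHS]natr1; ring.
Qed.
Lemma derE x : x != 0 -> d x = ld x * x. Proof. by move=> x0; rewrite /logder divfK. Qed.

Lemma natr_neq0 n : n.+1%:R != 0 :> F. Proof. by case: (vO_nat V n). Qed.
Lemma dom_nat n : n%:R ≼ (1 : F).
Proof.
elim: n => [|n IH]; first exact: dom0x.
by rewrite -natr1; apply: domD => //; exact: dom_refl.
Qed.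
Lemma nat_dom n : (1 : F) ≼ n.+1%:R.
Proof. by rewrite -domV1 ?natr_neq0 // dom1P //; apply/asboolP; case: (vO_nat V n). Qed.
Lemma natM_dom n x y : (n.+1%:R * x ≼ y) = (x ≼ y).
Proof.
apply/idP/idP => h; last by rewrite -[y]mul1r; apply: domM => //; exact: dom_nat.
by apply: dom_trans h => //; rewrite -{1}[x]mul1r; apply: domM; [|exact: nat_dom | exact: dom_refl].
Qed.
Lemma dom_natM n x y : (y ≼ n.+1%:R * x) = (y ≼ x).
Proof.
apply/idP/idP => h; last first.
  apply: dom_trans h _ => //; rewrite -{1}[x]mul1r.
  by apply: domM; [|exact: nat_dom | exact: dom_refl].
by apply: dom_trans h _ => //; rewrite natM_dom dom_refl.
Qed.

Lemma der_dom1 x : x ≼ 1 -> d x ≼ 1.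
Proof. by rewrite !dom1P // => /asboolP h; apply/asboolP; exact: vO_der. Qed.
Lemma iter_der_dom1 i x : x ≼ 1 -> iter i d x ≼ 1.
Proof. by move=> h; elim: i => //= i; exact: der_dom1. Qed.

Lemma ld_gt1 x : x != 0 -> x ≺ 1 -> 1 ≺ ld x. Proof. exact: v_log. Qed.
Lemma ld_gt1' x : 1 ≺ x -> 1 ≺ ld x.
Proof.
move=> x1; have x0 := lt_dom_neq0 OV x1.
by rewrite -[x]invrK ldV ?invr_eq0 // domN //; apply: ld_gt1; rewrite ?invr_eq0 // dom1V.
Qed.
Lemma ld_dom1 x : x ≼ 1 -> 1 ≼ x -> ld x ≼ 1.
Proof.
move=> x1 x1'; have x0 : x != 0 by apply: (dom_neq0 OV x1'); exact: oner_neq0.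
by rewrite /logder dom_div // mul1r; apply: dom_trans x1' => //; exact: der_dom1.
Qed.
Lemma ld_dom1E x : x != 0 -> (ld x ≼ 1) = (x ≼ 1) && (1 ≼ x).
Proof.
move=> x0; apply/idP/andP => [h|[]]; last exact: ld_dom1.
split; apply/negPn/negP; [move/ld_gt1'|move/(ld_gt1 x0)]; by rewrite h.
Qed.
(** Smallness of the derivation, applied to [x^-1], gives [d x ≺ x ^+ 2]. *)
Lemma ld_lt x : 1 ≺ x -> ld x ≺ x.
Proof.
move=> x1; have x0 := lt_dom_neq0 OV x1.
have : d x^-1 ≺ 1 by apply: v_small; rewrite dom1V.
rewrite derV // mulNr domxN // -(@domM2r _ _ OV (x ^+ 2)) ?expf_neq0 // divfK ?expf_neq0 //.
by rewrite mul1r /logder domx_div // -expr2.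
Qed.

Lemma ld_equiv x y : x != 0 -> x ≼ y -> y ≼ x -> ld y - ld x ≼ 1.
Proof.
move=> x0 xy yx; have y0 := dom_neq0 OV xy x0.
by rewrite -ld_div // ld_dom1 // ?dom_div ?domx_div // mul1r.
Qed.

Lemma ld_mono0 x y : x != 0 -> x ≼ y -> y ≺ 1 -> ld y ≼ ld x.
Proof.
move=> x0 xy y1; case: (boolP (y ≼ x)) => [yx|yx]; last exact: v_mono.
rewrite -[ld y](subrK (ld x)); apply: domD (dom_refl _ _) => //.
apply: dom_trans (ld_equiv x0 xy yx) _ => //.
by apply: domW => //; apply: ld_gt1 => //; exact: dom_lt_trans y1.
Qed.
Lemma ld_mono1 x y : 1 ≺ x -> x ≼ y -> ld x ≼ ld y.
Proof.
move=> x1 xy; have x0 := lt_dom_neq0 OV x1; have y0 := dom_neq0 OV xy x0.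
rewrite -(domN OV) -(domxN OV) -!ldV //; apply: ld_mono0; rewrite ?invr_eq0 //.
  by rewrite domV.
by rewrite dom1V.
Qed.

(** If [x ≼ ld x ^+ m], monotonicity of [ld] would give [ld x ≼ ld (ld x)], against [ld_lt] at
    [ld x]. Powers of [ld x] therefore never compete with [x], which makes the later losses of such
    powers harmless. *)
Lemma ldX_lt x m : 1 ≺ x -> ld x ^+ m ≺ x.
Proof.
move=> x1; case: m => [|m]; first by rewrite expr0.
have x0 := lt_dom_neq0 OV x1; have l1 := ld_gt1' x1; have l0 := lt_dom_neq0 OV l1.
apply/negP => h; have := ld_mono1 x1 h; rewrite ldX // dom_natM => h'.
by have := ld_lt l1; rewrite h'.
Qed.
Lemma ldX_lt0 (q : F) m : q != 0 -> q ≺ 1 -> q * ld q ^+ m ≺ 1.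
Proof.
move=> q0 q1; have : 1 ≺ q^-1 by rewrite domV1.
move=> /(@ldX_lt _ m); rewrite ldV // exprNn -signr_odd.
have -> : ((-1) ^+ odd m * ld q ^+ m ≺ q^-1) = (ld q ^+ m ≺ q^-1).
  by case: odd; rewrite ?expr1 ?expr0 ?mul1r ?mulN1r ?domxN.
by rewrite -(@domM2r _ _ OV q q^-1) // mulVf // mulrC.
Qed.

(** Since [1 ≼ t] implies [ld t ≼ t], each derivation costs at most one factor [t]. *)
Lemma der_domX x t i : 1 ≼ t -> x ≼ t ^+ i -> d x ≼ t ^+ i.+1.
Proof.
move=> t1; have t0 : t != 0 by apply: (dom_neq0 OV t1); exact: oner_neq0.
have tt : ld t ≼ t.
  case: (boolP (t ≼ 1)) => [h|/ld_lt/(domW OV) //].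
  exact: (dom_trans OV) (ld_dom1 h t1) t1.
move=> /asboolP[h Oh ->]; have h1 : h ≼ 1 by rewrite dom1P //; apply/asboolP.
rewrite derM exprSr; apply: domD => //.
  rewrite mulrC -{2}[t ^+ i]mulr1 -mulrA; apply: domM (dom_refl _ _) _ => //.
  by rewrite mul1r; apply: dom_trans (der_dom1 h1) t1.
have -> : h * d (t ^+ i) = t ^+ i * (ld t * (i%:R * h)).
  by rewrite (derE (expf_neq0 i t0)) ldX //; ring.
apply: domM (dom_refl _ _) _ => //; rewrite -{2}[t]mulr1; apply: domM => //.
by have := domM OV (dom_nat i) h1; rewrite mulr1.
Qed.

Lemma iter_der_dom x t i : 1 ≼ t -> ld x ≼ t -> iter i d x ≼ x * t ^+ i.
Proof.
move=> t1 xt; have [->|x0] := eqVneq x 0; first by rewrite iter_der0 dom0x.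
elim: i => [|i IH]; first by rewrite mulr1 dom_refl.
have [h Oh e] : exists2 h, h ≼ t ^+ i & iter i d x = x * h.
  by exists (iter i d x / x); [rewrite dom_div // mulrC | rewrite mulrCA mulfV // mulr1].
rewrite /= e derM (derE x0) exprS; apply: domD => //.
  rewrite [ld x * x]mulrC -mulrA; apply: (domM OV) (dom_refl OV _) _.
  exact: domM.
by apply: domM (dom_refl _ _) _ => //; rewrite -exprS; apply: der_domX.
Qed.

Lemma iter_der_sim z i : 1 ≺ ld z -> iter i d z / z ~~~ ld z ^+ i.
Proof.
move=> l1; have l0 := lt_dom_neq0 OV l1.
have z0 : z != 0 by apply: contra l0 => /eqP ->; rewrite /logder invr0 mulr0.
elim: i => [|i IH]; first by rewrite expr0 divff //; exact/sim_refl/oner_neq0.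
have li0 := expf_neq0 i l0.
pose e := iter i d z / z / ld z ^+ i - 1; have e1 : e ≺ 1 by rewrite -simP.
have eE : iter i d z = z * ld z ^+ i * (1 + e) by rewrite /e; field; rewrite z0 li0.
have de1 : d e ≼ 1 by apply: der_dom1; exact: domW.
rewrite /sim (_ : _ - _ = ld z ^+ i * (i%:R * ld (ld z) * (1 + e) + d e + ld z * e)); last first.
  rewrite iterS eE !derM (derE z0) (derE li0) ldX // derD der1 exprS.
  by field; rewrite z0.
rewrite exprSr domM2l //; apply: lt_domD => //; last first.
  by rewrite -{1}[ld z]mulr1 (domM2l OV).
apply: lt_domD => //; last exact: dom_lt_trans l1.
apply: (dom_lt_trans OV) (ld_lt l1); rewrite mulrAC -{2}[ld (ld z)]mul1r.
apply: domM (dom_refl _ _) => //; rewrite -[1 in X in _ ≼ X]mulr1; apply: domM => //; first exact: dom_nat.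
by apply: domD; rewrite ?dom_refl //; exact: domW.
Qed.

Lemma leibniz n x y :
  iter n d (x * y) = \sum_(l < n.+1) ('C(n, l)%:R * iter (n - l) d x) * iter l d y.
Proof.
elim: n => [|n IH]; first by rewrite big_ord1 bin0 mul1r.
rewrite iterS IH der_sum.
under eq_bigr => i _ do rewrite derM [d (_ * iter _ _ _)]derM der_nat mul0r add0r -!iterS.
rewrite big_split /= [RHS]big_ord_recl bin0 mul1r.
have -> : \sum_(i < n.+1) 'C(n.+1, lift ord0 i)%:R * iter (n.+1 - lift ord0 i) d x * iter (lift ord0 i) d y =
  \sum_(i < n.+1) 'C(n, i.+1)%:R * iter (n - i) d x * iter i.+1 d y +
  \sum_(i < n.+1) 'C(n, i)%:R * iter (n - i) d x * iter i.+1 d y.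
  rewrite -big_split /=; apply: eq_bigr => i _.
  by rewrite /bump /= add1n binS natrD subSS !mulrDl.
rewrite addrA; congr (_ + _).
rewrite big_ord_recl bin0 mul1r; congr (_ + _); first by rewrite subn0.
rewrite [RHS]big_ord_recr /= bin_small // mul0r mul0r addr0; apply: eq_bigr => i _.
rewrite /bump /= add1n; congr (_ * _ * _).
by rewrite -iterS -subSn // subSS.
Qed.

End VdfTheory.

Definition vembed (E F : fieldType) (VE : vdf E) (VF : vdf F)
    (f : {rmorphism E -> F}) : Prop :=
  (forall x, f (VE x) = VF (f x)) /\ (forall x, vO VE x <-> vO VF (f x)).

Section Embed.
Variables (E F : fieldType) (VE : vdf E) (VF : vdf F) (f : {rmorphism E -> F}).
Hypothesis fV : vembed VE VF f.

Lemma vembed_dom x y : dominatedb (vO VF) (f x) (f y) = dominatedb (vO VE) x y.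
Proof.
have [->|y0] := eqVneq y 0.
  by rewrite rmorph0 !domx0 ?fmorph_eq0 //; exact: vO_ring.
rewrite !domP ?fmorph_eq0 //; try exact: vO_ring.
by rewrite -fmorph_div; apply: asbool_equiv_eq; split; apply fV.
Qed.

Lemma vembed_sim x y : sim (vO VF) (f x) (f y) = sim (vO VE) x y.
Proof. by rewrite /sim -rmorphB vembed_dom. Qed.

Lemma vembed_der x : f (VE x) = VF (f x). Proof. by case: fV. Qed.

Lemma vembed_iter i x : f (iter i VE x) = iter i VF (f x).
Proof. by elim: i => //= i <-; rewrite vembed_der. Qed.

Lemma vembed_ld x : f (logder VE x) = logder VF (f x).
Proof. by rewrite /logder fmorph_div vembed_der. Qed.

End Embed.

(** * Affine substitutions in differential polynomials *)

Lemma bin_mul_bin i l k : (k <= l)%N -> (l <= i)%N ->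
  ('C(i, l) * 'C(l, k) = 'C(i, k) * 'C(i - k, l - k))%N.
Proof.
move=> kl li; have ki := leq_trans kl li.
have f0 : (0 < k`! * (l - k)`! * (i - l)`!)%N by rewrite !muln_gt0 !fact_gt0.
apply/eqP; rewrite -(eqn_pmul2r f0); apply/eqP.
have e1 := bin_fact li; have e2 := bin_fact kl; have e3 := bin_fact ki.
have lki : (l - k <= i - k)%N by exact: leq_sub2r.
have e4 := bin_fact lki; have e5 : (i - k - (l - k) = i - l)%N by lia.
rewrite e5 in e4.
transitivity (i`!); first by rewrite -e1 -e2; nia.
by rewrite -e3 -e4; nia.
Qed.

Lemma comp_mpolyA (R : comNzRingType) n1 n2 n3 (p : {mpoly R[n1]})
    (lq : n1.-tuple {mpoly R[n2]}) (lr : n2.-tuple {mpoly R[n3]}) :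
  (p \mPo lq) \mPo lr = p \mPo [tuple tnth lq i \mPo lr | i < n1].
Proof.
rewrite (comp_mpolyEX p lq) (comp_mpolyEX p) raddf_sum /=; apply: eq_bigr => m _.
rewrite linearZ /=; congr (_ *: _); rewrite !comp_mpolyX rmorph_prod; apply: eq_bigr => i _.
by rewrite rmorphXn tnth_mktuple.
Qed.

Lemma eq_comp_mpoly (R : comNzRingType) n1 n2 (p : {mpoly R[n1]})
    (lq lr : n1.-tuple {mpoly R[n2]}) :
  tnth lq =1 tnth lr -> p \mPo lq = p \mPo lr.
Proof. by move=> h; congr (p \mPo _); apply: eq_from_tnth. Qed.

Lemma mnm1B n (l : 'I_n) : (U_(l) - U_(l))%MM = 0%MM.
Proof. by apply/mnmP => i; rewrite mnmBE subnn mnm0E. Qed.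

Lemma mpoly_scaleE (R : comNzRingType) n (c : R) (p : {mpoly R[n]}) :
  c *: p = c%:MP * p.
Proof. by rewrite mul_mpolyC. Qed.

(** Stated for any [D] with the Leibniz rule, as it serves both for formal partial derivatives and
    for the derivation of the field. *)
Lemma deriv_prod_expn (R : comNzRingType) (D : R -> R) n (f : 'I_n -> R) (m : 'X_{1..n}) :
  (forall x y, D (x * y) = D x * y + x * D y) ->
  D (\prod_(i < n) f i ^+ m i) =
  \sum_(i < n) (m i)%:R * ((\prod_(j < n) f j ^+ (m - U_(i))%MM j) * D (f i)).
Proof.
move=> DM; have D1 : D 1 = 0.
  by have := DM 1 1; rewrite !mulr1 mul1r => h; apply: (addrI (D 1)); rewrite -h addr0.
have dX p e : D (p ^+ e) = e%:R * (p ^+ e.-1 * D p).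
  elim: e => [|e IH]; first by rewrite expr0 mul0r.
  rewrite exprS DM IH /= -[in RHS]natr1 mulrDl mul1r addrC.
  case: e {IH} => [|e]; first by rewrite !mul0r mulr0 expr0 mulr1 mul1r.
  by rewrite /= [p ^+ e.+1]exprS; ring.
pose a i := f i ^+ m i.
have big (s : seq 'I_n) : uniq s -> D (\prod_(i <- s) a i) =
    \sum_(i <- s) (\prod_(j <- s | j != i) a j) * D (a i).
  elim: s => [|x s IH] /=; first by rewrite !big_nil.
  case/andP=> xs us; rewrite !big_cons DM IH // eqxx /=; congr (_ + _).
    rewrite mulrC; congr (_ * _); rewrite big_seq [RHS]big_seq_cond; apply: eq_bigl => j.
    by case: (boolP (j \in s)) => //= js; apply/esym; apply: contra xs => /eqP <-.
  rewrite mulr_sumr big_seq [RHS]big_seq; apply: eq_bigr => i iS.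
  rewrite big_cons; have -> /= : x != i by apply: contra xs => /eqP ->.
  by rewrite mulrA.
rewrite (big (index_enum 'I_n) (index_enum_uniq _)); apply: eq_bigr => i _.
rewrite /a dX mulrCA; congr (_ * _); rewrite mulrA; congr (_ * _).
rewrite [in RHS](bigD1 i) //= mulrC; congr (_ * _); first by rewrite mnmBE mnm1E eqxx subn1.
by apply: eq_bigr => j ji; rewrite mnmBE mnm1E eq_sym (negPf ji) subn0.
Qed.

Lemma mderiv_comp (R : comNzRingType) n k (p : {mpoly R[n]}) (lq : n.-tuple {mpoly R[k]})
    (l : 'I_k) :
  (p \mPo lq)^`M(l) = \sum_(i < n) (p^`M(i) \mPo lq) * (tnth lq i)^`M(l).
Proof.
elim/mpolyind: p => [|c m p _ _ IH].
  rewrite comp_mpoly0 mderivC big1 // => i _.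
  by rewrite mderiv0 comp_mpoly0 mul0r.
rewrite comp_mpolyD mderivD IH comp_mpolyZ mderivZ comp_mpolyX (@deriv_prod_expn _ (mderiv l)); last exact: mderivM.
rewrite scaler_sumr -big_split /=; apply: eq_bigr => i _.
rewrite mderivD mderivZ mderivX comp_mpolyD mulrDl; congr (_ + _).
by rewrite !comp_mpolyZ comp_mpolyX -!scalerAl mulr_natl scaler_nat.
Qed.

Lemma euler_mpoly (R : comNzRingType) n (p : {mpoly R[n]}) m :
  (\sum_(l < n) 'X_l * p^`M(l))@_m = (mdeg m)%:R * p@_m.
Proof.
have h l : ('X_l * p^`M(l))@_m = (m l)%:R * p@_m.
  rewrite mulrC; case: (posnP (m l)) => [m0|m0].
    rewrite m0 mul0r mcoeffM big1 // => k /eqP mk; rewrite mcoeffX.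
    case: eqP => [e|]; last by rewrite mulr0.
    by have := congr1 (fun x : 'X_{1..n} => x l) mk; rewrite /= m0 -e mnmDE mnm1E eqxx addn1.
  have -> : m = (U_(l) + (m - U_(l)))%MM by rewrite addmC submK // lep1mP -lt0n.
  by rewrite mcoeffMX mcoeff_deriv addmC mnmDE mnm1E eqxx add1n -[LHS]mulr_natl.
by rewrite raddf_sum /= (eq_bigr _ (fun l _ => h l)) -mulr_suml -natr_sum mdegE.
Qed.

Section Affine.
Variables (F : fieldType) (V : vdf F) (n : nat).
Local Notation "x ≼ y" := (dominatedb (vO V) x y) (at level 70, y at next level).
Local Notation "x ≺ y" := (~~ dominatedb (vO V) y x) (at level 70, y at next level).
Local Notation d := (vder V).
Implicit Types (P Q : {mpoly F[n]}) (a b c g s t N : F) (m : 'X_{1..n}).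
Let OV := vO_ring V.

Definition jet (y : F) : 'I_n -> F := fun i => iter i d y.

(** By the Leibniz rule, the coefficient of the derivative of order [l] of [Z] in the derivative of
    order [i] of [b * Z]; thus [aff a b] is the jet of [a + b * Z]. *)
Definition aff_coef b (i l : nat) : F :=
  if (l <= i)%N then 'C(i, l)%:R * iter (i - l) d b else 0.

Definition aff a b : n.-tuple {mpoly F[n]} :=
  [tuple (iter i d a)%:MP + \sum_(l < n) aff_coef b i l *: 'X_l | i < n].

(* [P(a + b Z)] as a differential polynomial in [Z] *)
Definition psub a b P : {mpoly F[n]} := P \mPo aff a b.

Lemma sum_aff_coef b (i : 'I_n) (f : nat -> F) :
  \sum_(l < n) aff_coef b i l * f l =
  \sum_(l < i.+1) 'C(i, l)%:R * iter (i - l) d b * f l.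
Proof.
rewrite (big_ord_widen n (fun l => 'C(i, l)%:R * iter (i - l) d b * f l)) //.
rewrite [RHS]big_mkcond; apply: eq_bigr => l _; rewrite /aff_coef ltnS.
by case: ifP => // _; rewrite mul0r.
Qed.

Lemma psub_eval a b P z : (psub a b P).@[jet z] = P.@[jet (a + b * z)].
Proof.
rewrite /psub comp_mpoly_meval; apply: meval_eq => i.
rewrite tnth_mktuple mevalD mevalC raddf_sum /= /jet iter_derD leibniz.
rewrite -(@sum_aff_coef b i (fun l => iter l d z)); congr (_ + _).
by apply: eq_bigr => l _; rewrite mevalZ mevalXU.
Qed.

Lemma psub_comp a b a' b' P : psub a' b' (psub a b P) = psub (a + b * a') (b * b') P.
Proof.
rewrite /psub comp_mpolyA; apply: eq_comp_mpoly => i; rewrite !tnth_mktuple.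
rewrite comp_mpolyD comp_mpolyC raddf_sum /= iter_derD leibniz.
rewrite -(@sum_aff_coef b i (fun l => iter l d a')).
under eq_bigr => l _ do rewrite comp_mpolyZ comp_mpolyXU -tnth_nth tnth_mktuple scalerDr.
rewrite big_split /= mpolyCD addrA; congr (_ + _ + _).
  by rewrite raddf_sum /=; apply: eq_bigr => l _; rewrite mpolyCM mpoly_scaleE.
under eq_bigr => l _ do rewrite scaler_sumr.
rewrite exchange_big /=; apply: eq_bigr => k _.
under eq_bigr => l _ do rewrite scalerA.
rewrite -scaler_suml; congr (_ *: _).
rewrite {3}/aff_coef; case: ifP => [ki|ki]; last first.
  rewrite big1 // => l _; rewrite /aff_coef; case: ifP => li; last by rewrite mul0r.
  by case: ifP => kl; rewrite ?mulr0 //; move: (leq_trans kl li); rewrite ki.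
rewrite leibniz mulr_sumr (@sum_aff_coef b i (fun l => aff_coef b' l k)).
rewrite -(big_mkord xpredT (fun l => 'C(i, l)%:R * iter (i - l) d b * aff_coef b' l k)).
rewrite (big_cat_nat (n := k)) //=; last by rewrite ltnW // ltnS.
rewrite big_nat_cond big1 ?add0r; last first.
  move=> l /andP[/andP[_ lk] _]; rewrite /aff_coef.
  by rewrite leqNgt lk /= mulr0.
rewrite -{1}[k : nat]addn0 addnC big_addn subSn //= big_mkord; apply: eq_bigr => l _.
have kl : (k <= l + k)%N by rewrite leq_addl.
have li : (l + k <= i)%N by have := ltn_ord l; rewrite ltnS; lia.
rewrite /aff_coef kl addnK (_ : (i - k - l = i - (l + k))%N); last by lia.
have := bin_mul_bin kl li; rewrite addnK => /(congr1 (fun x => x%:R : F)).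
rewrite !natrM => h.
have := ltn_ord l => _.
transitivity (('C(i, l + k)%:R * 'C(l + k, k)%:R) * (iter (i - (l + k)) d b * iter l d b')); first by ring.
by rewrite h; ring.
Qed.

Lemma psub01 P : psub 0 1 P = P.
Proof.
rewrite -[RHS]comp_mpoly_id; apply: eq_comp_mpoly => i; rewrite !tnth_mktuple.
rewrite iter_der0 mpolyC0 add0r (bigD1 i) //= big1 ?addr0.
  by rewrite /aff_coef leqnn binn subnn mul1r scale1r.
move=> l li; rewrite /aff_coef; case: ifP => [le|_]; last by rewrite scale0r.
have -> : (i - l = (i - l).-1.+1)%N.
  by rewrite prednK // subn_gt0 ltn_neqAle le andbT; apply: contra li => /eqP h; apply/eqP/val_inj.
by rewrite iter_der1 mulr0 scale0r.
Qed.

Lemma psub_id a b P : b != 0 -> psub (- a / b) b^-1 (psub a b P) = P.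
Proof.
move=> b0; rewrite psub_comp mulfV // (_ : a + _ = 0) ?psub01 //.
by rewrite mulrC divfK // subrr.
Qed.

Lemma psubD a b P Q : psub a b (P + Q) = psub a b P + psub a b Q.
Proof. exact: comp_mpolyD. Qed.
Lemma psub0 a b : psub a b 0 = 0. Proof. exact: comp_mpoly0. Qed.
Lemma psub_eq0 a b P : b != 0 -> (psub a b P == 0) = (P == 0).
Proof.
move=> b0; apply/eqP/eqP => [h|->]; last exact: psub0.
by rewrite -(psub_id a P b0) h psub0.
Qed.

Lemma mcoeff0_eval (p : {mpoly F[n]}) : p@_0 = p.@[jet 0].
Proof.
elim/mpolyind: p => [|c m p _ _ IH]; first by rewrite mcoeff0 meval0.
rewrite mcoeffD mevalD IH mcoeffZ mevalZ mcoeffX mevalX; congr (_ * _ + _).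
have [->|m0] := eqVneq m 0%MM; first by rewrite big1 // => i _; rewrite mnm0E expr0.
have [i mi] : exists i, m i != 0%N.
  by apply/existsP; apply: contraR m0; rewrite negb_exists => /forallP h; apply/eqP/mnmP => i;
     move: (h i); rewrite negbK mnm0E => /eqP.
rewrite (bigD1 i) //= /jet iter_der0 expr0n (negPf mi) mul0r.
by [].
Qed.

Lemma psub_coef0 a b P : (psub a b P)@_0 = P.@[jet a].
Proof. by rewrite mcoeff0_eval psub_eval mulr0 addr0. Qed.

Lemma aff_coef_dom b s (i l : nat) : (forall j, (j < n)%N -> iter j d b ≼ s) -> (i < n)%N ->
  aff_coef b i l ≼ s.
Proof.
move=> h i_n; rewrite /aff_coef; case: ifP => _; last exact: dom0x.
rewrite -[s]mul1r; apply: domM => //; first exact: dom_nat.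
by apply: h; exact: leq_ltn_trans (leq_subr _ _) i_n.
Qed.

Definition homb (P : {mpoly F[n]}) (e : nat) (s : F) :=
  forall m, P@_m ≼ s /\ (mdeg m != e -> P@_m = 0).

Lemma hombM P Q e f s t : homb P e s -> homb Q f t -> homb (P * Q) (e + f) (s * t).
Proof.
move=> hP hQ m; split.
  by rewrite mcoeffM; apply: dom_sum => // k _; apply: domM => //; [case: (hP k.1) | case: (hQ k.2)].
move=> me; rewrite mcoeffM big1 // => k /eqP mk.
have [e1|e1] := eqVneq (mdeg k.1) e; last by rewrite (hP _).2 // mul0r.
have [e2|e2] := eqVneq (mdeg k.2) f; last by rewrite (hQ _).2 // mulr0.
by have := congr1 mdeg mk; rewrite mdegD e1 e2 => h; rewrite h eqxx in me.
Qed.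

Lemma homb1 : homb 1 0 1.
Proof.
move=> m; rewrite mcoeff1; split; first exact: dom_nat.
by rewrite mdeg_eq0 => /negPf ->.
Qed.

Lemma hombX P e s k : homb P e s -> homb (P ^+ k) (e * k) (s ^+ k).
Proof.
move=> h; elim: k => [|k IH]; first by rewrite muln0; exact: homb1.
by rewrite !exprS mulnS; exact: hombM.
Qed.

Lemma homb_aff b s (i : 'I_n) : (forall j, (j < n)%N -> iter j d b ≼ s) ->
  homb (tnth (aff 0 b) i) 1 s.
Proof.
move=> h m; rewrite tnth_mktuple iter_der0 mpolyC0 add0r raddf_sum /=; split.
  apply: dom_sum => // l _; rewrite mcoeffZ mcoeffX -[s]mulr1; apply: domM => //.
    exact: aff_coef_dom.
  exact: dom_nat.
move=> m1; rewrite big1 // => l _; rewrite mcoeffZ mcoeffX.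
by case: eqP => [e|]; rewrite ?mulr0 //; move: m1; rewrite -e mdeg1 eqxx.
Qed.

Lemma homb_monomial b s m : (forall j, (j < n)%N -> iter j d b ≼ s) ->
  homb ('X_[m] \mPo aff 0 b) (mdeg m) (s ^+ mdeg m).
Proof.
move=> h; rewrite comp_mpolyX mdegE -prodrXr.
apply: (big_ind3 (fun (P : {mpoly F[n]}) (e : nat) (t : F) => homb P e t)).
- exact: homb1.
- by move=> *; exact: hombM.
- by move=> i _; rewrite -[m i in X in homb _ X _]mul1n; apply: hombX; exact: homb_aff.
Qed.

(** An [O]-submodule of the field. Both [x ≼ s] and [x ≺ s] define one, so each coefficient estimate
    is proved once and used with either bound. *)
Record submod (A : F -> Prop) : Prop := Submod {
  submod0 : A 0; submodD : forall x y, A x -> A y -> A (x + y);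
  submodM : forall x y, x ≼ 1 -> A y -> A (x * y) }.

Lemma submod_dom s : submod (fun x => x ≼ s).
Proof.
split=> [|x y|x y x1 ys]; [exact: dom0x | exact: domD |].
by rewrite -[s]mul1r; exact: domM.
Qed.

Lemma submod_lt s : s != 0 -> submod (fun x => x ≺ s).
Proof.
move=> s0; split=> [|x y|x y x1 ys]; [by rewrite lt0_dom | exact: lt_domD |].
by apply: (dom_lt_trans OV) ys; rewrite -{2}[y]mul1r; apply: domM => //; exact: dom_refl.
Qed.

Lemma submod_sum A (I : Type) (r : seq I) (p : pred I) (f : I -> F) : submod A ->
  (forall i, p i -> A (f i)) -> A (\sum_(i <- r | p i) f i).
Proof. by move=> sA h; elim/big_ind: _ => //; [exact: submod0 | move=> *; exact: submodD]. Qed.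

(** Multiplicative conjugation respects homogeneous parts, and each monomial of degree [e] becomes a
    form with coefficients [≼ s ^+ e]. *)
Lemma psub_scale A b (s : F) P e : submod A -> s != 0 ->
  (forall j, (j < n)%N -> iter j d b ≼ s) ->
  (forall m, mdeg m = e -> A P@_m) ->
  forall m, mdeg m = e -> A ((psub 0 b P)@_m / s ^+ e).
Proof.
move=> sA s0 hb hP m me; rewrite /psub comp_mpolyEX raddf_sum /= mulr_suml.
apply: submod_sum => // k _; rewrite mcoeffZ.
have [h1 h2] := homb_monomial k hb m.
have [e1|e1] := eqVneq (mdeg k) e; last first.
  by rewrite h2 ?mulr0 ?mul0r ?me 1?eq_sym //; exact: submod0.
rewrite -mulrA mulrC; apply: submodM => //; last exact: hP.
by rewrite dom_div ?expf_neq0 // mul1r -e1.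
Qed.

Definition lowb (P : {mpoly F[n]}) (e : nat) :=
  forall m, P@_m ≼ 1 /\ ((e <= mdeg m)%N -> P@_m = 0).

Lemma lowbD P Q e : lowb P e -> lowb Q e -> lowb (P + Q) e.
Proof.
move=> hP hQ m; rewrite mcoeffD; split; first by apply: domD => //; [case: (hP m)|case: (hQ m)].
by move=> em; rewrite (hP m).2 // (hQ m).2 // addr0.
Qed.

Lemma lowbM P Q e f : lowb P e -> lowb Q f.+1 -> lowb (P * Q) (e + f).
Proof.
move=> hP hQ m; split.
  rewrite mcoeffM; apply: dom_sum => // k _; rewrite -[1]mulr1.
  by apply: domM => //; [case: (hP k.1) | case: (hQ k.2)].
move=> me; rewrite mcoeffM big1 // => k /eqP mk.
have [e1|e1] := leqP e (mdeg k.1); first by rewrite (hP _).2 // mul0r.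
have [e2|e2] := leqP f.+1 (mdeg k.2); first by rewrite (hQ _).2 // mulr0.
by have := leq_add e1 e2; rewrite !addSn !addnS ltnS -mdegD -mk ltnNge me.
Qed.

Lemma lowb_translate a m : a ≼ 1 -> lowb ('X_[m] \mPo aff a 1 - 'X_[m]) (mdeg m).
Proof.
move=> a1; have lX k : lowb 'X_[k] (mdeg k).+1.
  move=> m'; rewrite mcoeffX; split; first exact: dom_nat.
  by case: eqP => // <-; rewrite ltnn.
have aE i : tnth (aff a 1) i = 'X_i + (iter i d a)%:MP.
  have := congr1 (fun p => p) (psub01 'X_i); rewrite /psub comp_mpolyXU -tnth_nth !tnth_mktuple.
  by rewrite iter_der0 mpolyC0 add0r => ->; rewrite addrC.
have lC i : lowb (iter i d a)%:MP 1.
  move=> m'; rewrite mcoeffC; split.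
    by have := domM OV (iter_der_dom1 i a1) (dom_nat V (m' == 0%MM)); rewrite mulr1.
  by rewrite lt0n mdeg_eq0 => /negPf ->; rewrite mulr0.
pose Q k := lowb ('X_[k] \mPo aff a 1 - 'X_[k]) (mdeg k).
have Q1 i : Q U_(i)%MM by rewrite /Q comp_mpolyXU -tnth_nth aE addrC addKr mdeg1.
have QM k1 k2 : Q k1 -> Q k2 -> Q (k1 + k2)%MM.
  rewrite /Q => h1 h2; rewrite mpolyXD rmorphM /= mdegD.
  set A := _ \mPo _; set B := _ \mPo _.
  have -> : A * B - 'X_[k1] * 'X_[k2] = (A - 'X_[k1]) * ((B - 'X_[k2]) + 'X_[k2]) + (B - 'X_[k2]) * 'X_[k1] by ring.
  apply: lowbD; last by rewrite addnC; exact: lowbM.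
  by apply: lowbM => //; apply: lowbD => // m'; split; [case: (h2 m')|move=> /ltnW; case: (h2 m')].
have Q0 : Q 0%MM.
  by rewrite /Q mpolyX0 comp_mpoly1 subrr => m'; rewrite mcoeff0; split=> //; exact: dom0x.
suff : Q m by [].
rewrite (multinomUE_id m).
elim/big_ind: _ => // i _; elim: (m i) => [|k IH]; first by rewrite mulm0n.
by rewrite mulmS; exact: QM.
Qed.

(** Translating a monomial by [a ≼ 1] changes it by terms of lower degree with coefficients in [O],
    so coefficients of degree [e] are affected only by those of higher degree. *)
Lemma psub_translate A a P e : submod A -> a ≼ 1 ->
  (forall m, (e < mdeg m)%N -> A P@_m) ->
  forall m, mdeg m = e -> A ((psub a 1 P)@_m - P@_m).
Proof.
move=> sA a1 hP m me.
have -> : (psub a 1 P)@_m - P@_m = (\sum_(k <- msupp P) P@_k *: ('X_[k] \mPo aff a 1 - 'X_[k]))@_m.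
  rewrite /psub comp_mpolyEX -mcoeffB; congr (_@_m).
  by under [RHS]eq_bigr => k _ do rewrite scalerBr; rewrite sumrB -mpolyE.
rewrite raddf_sum /=; apply: submod_sum => // k _; rewrite mcoeffZ.
have [h1 h2] := lowb_translate k a1 m.
have [ke|ke] := leqP (mdeg k) e; first by rewrite h2 ?me // mulr0; exact: submod0.
by rewrite mulrC; apply: submodM => //; exact: hP.
Qed.

Lemma mderiv_aff a b (i l : 'I_n) : (tnth (aff a b) i)^`M(l) = (aff_coef b i l)%:MP.
Proof.
rewrite tnth_mktuple mderivD mderivC add0r raddf_sum /= (bigD1 l) //= big1 ?addr0.
  by rewrite mderivZ mderivX mnm1E eqxx mnm1B mpolyX0 scale1r -mul_mpolyC mulr1.
by move=> j jl; rewrite mderivZ mderivX mnm1E (negPf jl) scale0r scaler0.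
Qed.

Lemma aff_coef1 (i l : nat) : aff_coef 1 i l = (i == l)%:R.
Proof.
rewrite /aff_coef; have [->|il] := eqVneq i l; first by rewrite leqnn binn subnn mul1r.
case: ifP => // li; rewrite (_ : (i - l = (i - l).-1.+1)%N) ?iter_der1 ?mulr0 //; lia.
Qed.

Lemma psub_lin_eq a b P (l : 'I_n) :
  (psub a b P)@_U_(l) = \sum_(i < n) aff_coef b i l * (P^`M(i)).@[jet a].
Proof.
have -> : (psub a b P)@_U_(l) = ((psub a b P)^`M(l))@_0.
  by rewrite mcoeff_deriv mnm0E add0m mulr1n.
rewrite /psub mderiv_comp raddf_sum /=; apply: eq_bigr => i _.
rewrite mderiv_aff; by rewrite mulrC mcoeffCM -(@psub_coef0 a b).
Qed.

Lemma psub_euler b P m :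
  (mdeg m)%:R * (psub 0 b P)@_m =
  \sum_(i < n) (tnth (aff 0 b) i * psub 0 b (P^`M(i)))@_m.
Proof.
rewrite -euler_mpoly raddf_sum -[RHS]raddf_sum -raddf_sum /=; congr (_@_m).
under eq_bigr => l _ do rewrite /psub mderiv_comp mulr_sumr.
rewrite exchange_big /=; apply: eq_bigr => i _.
under eq_bigr => l _ do rewrite mulrCA.
rewrite -mulr_sumr mulrC; congr (_ * _).
rewrite tnth_mktuple iter_der0 mpolyC0 add0r; apply: eq_bigr => l _.
rewrite raddf_sum /= (bigD1 l) //= big1 ?addr0.
  by rewrite mderivZ mderivX mnm1E eqxx mnm1B mpolyX0 scale1r -scalerAr mulr1.
by move=> j jl; rewrite mderivZ mderivX mnm1E (negPf jl) scale0r scaler0.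
Qed.

(** Euler's identity turns a coefficient of degree at least 2 into products of coefficients of
    linear forms, bounded by [lam], with nonconstant coefficients of the partial derivatives of [P].
    Bounds on first partials thus control all higher terms at once. *)
Lemma psub_rest b P N (lam : 'I_n -> F) : N != 0 ->
  (forall i m, (tnth (aff 0 b) i)@_m ≼ lam i) ->
  (forall i m, m != 0%MM -> lam i * (psub 0 b (P^`M(i)))@_m ≺ N) ->
  forall m, (1 < mdeg m)%N -> (psub 0 b P)@_m ≺ N.
Proof.
move=> N0 hl hP m m2.
have -> : (psub 0 b P)@_m ≺ N = ((mdeg m)%:R * (psub 0 b P)@_m ≺ N).
  by rewrite -(prednK (ltnW m2)) dom_natM.
rewrite psub_euler; apply: lt_dom_sum => // i _; rewrite mcoeffM; apply: lt_dom_sum => // k /eqP mk.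
have [h|k2] := eqVneq (k.2 : 'X_{1..n}) 0%MM; last first.
  by apply: (dom_lt_trans OV) (hP i _ k2); apply: domM; rewrite ?dom_refl.
have k1 : mdeg k.1 != 1%N.
  by have := congr1 mdeg mk; rewrite mdegD h mdeg0 addn0 => <-; rewrite neq_ltn m2 orbT.
suff -> : (tnth (aff 0 b) i)@_k.1 = 0 by rewrite mul0r lt0_dom.
rewrite tnth_mktuple iter_der0 mpolyC0 add0r raddf_sum /= big1 // => l _.
rewrite mcoeffZ mcoeffX; case: eqP => [e|]; rewrite ?mulr0 //.
by move: k1; rewrite -e mdeg1 eqxx.
Qed.

End Affine.

Lemma map_psub (E F : fieldType) (VE : vdf E) (VF : vdf F) (f : {rmorphism E -> F}) n
    (P : {mpoly E[n]}) a b : vembed VE VF f ->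
  map_mpoly f (psub VE a b P) = psub VF (f a) (f b) (map_mpoly f P).
Proof.
move=> fV; elim/mpolyind: P => [|c m p _ _ IH]; first by rewrite !(psub0, rmorph0).
rewrite psubD !rmorphD /= psubD IH; congr (_ + _).
rewrite /psub comp_mpolyZ !map_mpolyZ comp_mpolyZ; congr (_ *: _).
rewrite map_mpolyX !comp_mpolyX rmorph_prod; apply: eq_bigr => i _.
rewrite rmorphXn /=; congr (_ ^+ _); rewrite !tnth_mktuple rmorphD /= map_mpolyC.
rewrite -(vembed_iter fV); congr (_ + _); rewrite raddf_sum; apply: eq_bigr => l _ /=.
rewrite map_mpolyZ map_mpolyX; congr (_ *: _); rewrite /aff_coef; case: ifP => _; last exact: rmorph0.
by rewrite rmorphM rmorph_nat -(vembed_iter fV).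
Qed.

Lemma map_mpoly_eval (E F : fieldType) (VE : vdf E) (VF : vdf F) (f : {rmorphism E -> F}) n
    (P : {mpoly E[n]}) a : vembed VE VF f ->
  f P.@[jet VE a] = (map_mpoly f P).@[jet VF (f a)].
Proof.
move=> fV; elim/mpolyind: P => [|c m p _ _ IH]; first by rewrite !(raddf0, meval0).
rewrite !rmorphD /= IH; congr (_ + _).
rewrite (mevalZ (jet VE a)) map_mpolyZ mevalZ rmorphM /= map_mpolyX !mevalX rmorph_prod; congr (_ * _).
by apply: eq_bigr => i _; rewrite rmorphXn /= /jet -(vembed_iter fV).
Qed.

(** * Stability of differential polynomials along cuts *)

Section Stability.
Variables (F : fieldType) (V : vdf F).
Local Notation "x ≼ y" := (dominatedb (vO V) x y) (at level 70, y at next level).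
Local Notation "x ≺ y" := (~~ dominatedb (vO V) y x) (at level 70, y at next level).
Local Notation "x ~~~ y" := (sim (vO V) x y) (at level 70, y at next level).
Local Notation d := (vder V).
Local Notation ld := (logder V).
Let OV := vO_ring V.
Local Notation psub := (psub V).
Local Notation jet := (jet V).
Implicit Types x y z c g s e t : F.

(* the constant term of [P(c + g Z)] strictly dominates all the others *)
Definition stable n (P : {mpoly F[n]}) (c g : F) :=
  forall m, m != 0%MM -> (psub c g P)@_m ≺ P.@[jet c].

(* the linear part of [P(c + g Z)] strictly dominates the higher degree terms *)
Definition lin_dom n (P : {mpoly F[n]}) (c g : F) :=
  exists j : 'I_n, [/\ ((psub c g P)@_U_(j) : F) != 0,
    forall i, (psub c g P)@_U_(i) ≼ (psub c g P)@_U_(j) &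
    forall m, (1 < mdeg m)%N -> (psub c g P)@_m ≺ (psub c g P)@_U_(j)].

Lemma eq_psub n (P : {mpoly F[n]}) (a b a' b' : F) : a = a' -> b = b' ->
  psub a b P = psub a' b' P.
Proof. by move=> -> ->. Qed.

Lemma psub_split n (P : {mpoly F[n]}) (c g c' g' : F) : g != 0 ->
  psub c' g' P = psub 0 (g' / g) (psub ((c' - c) / g) 1 (psub c g P)).
Proof.
move=> g0; rewrite !psub_comp; apply: eq_psub.
  by rewrite mulr0 addr0 mulrC divfK // addrC subrK.
by rewrite mul1r mulrC divfK.
Qed.

Lemma deg_eq0 n (m : 'X_{1..n}) : (m != 0%MM) = (0 < mdeg m)%N.
Proof. by rewrite lt0n mdeg_eq0. Qed.

(** Passing to a smaller ball is a translation by an element of [O] followed by a contraction;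
    neither creates terms as large as the constant one. Positivity of [n] provides a nonconstant
    exponent, whence the value of [P] is nonzero. *)
Lemma stable_mono n (P : {mpoly F[n]}) (c g c' g' : F) : g != 0 ->
  (0 < n)%N -> stable P c g -> g' ≼ g -> c' - c ≼ g ->
  stable P c' g' /\ P.@[jet c'] ~~~ P.@[jet c].
Proof.
move=> g0 n0 st gg cc; set s : F := P.@[jet c].
have s0 : s != 0.
  have h : U_(Ordinal n0)%MM != 0%MM by rewrite deg_eq0 mdeg1.
  by apply/eqP => e; have := lt_dom_neq0 OV (st _ h); rewrite -/s e eqxx.
pose a := (c' - c) / g; have a1 : a ≼ 1 by rewrite dom_div // mul1r.
have b1 : g' / g ≼ 1 by rewrite dom_div // mul1r.
pose p := psub c g P; pose p1 := psub a 1 p.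
have sub := submod_lt V s0.
have hp m : m != 0%MM -> p@_m ≺ s by exact: st.
have hp1 m : p1@_m - p@_m ≺ s.
  apply: (@psub_translate _ V _ _ _ _ (mdeg m) sub) => // k km.
  by apply: hp; rewrite deg_eq0; lia.
have sm : P.@[jet c'] ~~~ s.
  rewrite -(@psub_coef0 _ V n c' g') (@psub_split n P c g c' g') // psub_coef0 -mcoeff0_eval.
  have := hp1 0%MM; rewrite /p psub_coef0 -/s => h.
  exact: h.
split; last exact: sm.
move=> m m0; refine (lt_dom_trans OV _ (sim_domr OV sm)).
rewrite (@psub_split n P c g c' g') // -/a -/p -/p1.
have := @psub_scale _ V n _ (g' / g) 1 p1 (mdeg m) sub (oner_neq0 _) (fun j _ => iter_der_dom1 j b1).
move=> /(_ _ m (erefl _)); rewrite expr1n divr1; apply=> k ek.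
rewrite -[p1@_k](subrK p@_k); apply: (lt_domD OV) => //; apply: hp.
by move: m0; rewrite !deg_eq0 ek.
Qed.

(** [t] bounds the growth of the derivatives of [b], yet [b] absorbs all its powers: [t = 1] works
    for a unit [b], and [t = ld b] otherwise. *)
Lemma tau_exists (b : F) : b != 0 -> b ≼ 1 ->
  exists t, [/\ 1 ≼ t, ld b ≼ t & forall k, b * t ^+ k ≼ 1].
Proof.
move=> b0 b1; case: (boolP (1 ≼ b)) => b1'.
  exists 1; rewrite dom_refl // ld_dom1 //; split=> // k.
  by rewrite expr1n mulr1.
exists (ld b); rewrite dom_refl //; split=> //; first by apply: (domW OV); exact: ld_gt1.
by move=> k; apply: (domW OV); exact: ldX_lt0.
Qed.

Lemma iter_der_domn (n : nat) (b t : F) : 1 ≼ t -> ld b ≼ t ->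
  forall j, (j < n)%N -> iter j d b ≼ b * t ^+ n.
Proof.
move=> t1 bt j jn; apply: (dom_trans OV) (iter_der_dom j t1 bt) _.
by apply: domM; rewrite ?dom_refl //; apply: dom_expX => //; exact: ltnW.
Qed.

(** Conjugation by [b] is undone by conjugation by [b^-1], so the linear part shrinks at most by the
    factor [b * t ^- n]. *)
Lemma lin_scale_lower n (p : {mpoly F[n]}) (b t M : F) : b != 0 -> 1 ≼ t -> ld b ≼ t ->
  (forall i, (psub 0 b p)@_U_(i) ≼ M) -> forall i, p@_U_(i) ≼ M * (b^-1 * t ^+ n).
Proof.
move=> b0 t1 bt h i.
have t0 : t != 0 by apply: (dom_neq0 OV t1); exact: oner_neq0.
have s0 : b^-1 * t ^+ n != 0 by rewrite mulf_neq0 ?invr_eq0 ?expf_neq0.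
have e : psub 0 b^-1 (psub 0 b p) = p.
  by rewrite psub_comp mulr0 addr0 mulfV // psub01.
have := @psub_scale _ V n _ b^-1 _ (psub 0 b p) 1 (submod_dom V M) s0.
rewrite e => /(_ _ _ U_(i)%MM (mdeg1 i)); rewrite expr1 dom_div //; apply.
  by apply: iter_der_domn => //; rewrite ldV // domN.
by move=> m /eqP; rewrite mdeg_eq1 => /existsP[j /eqP ->]; exact: h.
Qed.

(** Contracting by [b ≼ 1] costs the linear part at most [b * t ^- n], whereas terms of degree at
    least 2 are multiplied by at most [(b * t ^+ n) ^+ 2]; the extra factor [b] absorbs the powers
    of [t]. *)
Lemma lin_dom_mono n (P : {mpoly F[n]}) (c g c' g' : F) : g != 0 -> g' != 0 ->
  lin_dom P c g -> g' ≼ g -> c' - c ≼ g -> lin_dom P c' g'.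
Proof.
move=> g0 g0' [j [N0 hl hr]] gg cc; set N : F := (psub c g P)@_U_(j) in N0 hl hr *.
pose a := (c' - c) / g; have a1 : a ≼ 1 by rewrite dom_div // mul1r.
pose b := g' / g; have b1 : b ≼ 1 by rewrite dom_div // mul1r.
have b0 : b != 0 by rewrite mulf_neq0 ?invr_eq0.
have [t [t1 bt tk]] := tau_exists b0 b1.
have t0 : t != 0 by apply: (dom_neq0 OV t1); exact: oner_neq0.
pose p := psub c g P; pose p1 := psub a 1 p; pose p2 := psub 0 b p1.
have sub := submod_lt V N0.
have hr1 m : (1 < mdeg m)%N -> p1@_m ≺ N.
  move=> m2; rewrite -[p1@_m](subrK p@_m); apply: (lt_domD OV); last exact: hr.
  apply: (@psub_translate _ V _ _ _ _ (mdeg m) sub) => // k km.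
  by apply: hr; lia.
have hl1 : p1@_U_(j) ~~~ N.
  apply: (@psub_translate _ V _ _ _ _ 1 sub); rewrite ?mdeg1 //.
have [k hk] := dom_max OV j (fun i => p2@_U_(i)).
have NM : N ≼ p2@_U_(k) * (b^-1 * t ^+ n).
  apply: (dom_trans OV) (sim_domr OV hl1) _.
  exact: (@lin_scale_lower n p1 b t).
have M0 : (p2@_U_(k) : F) != 0.
  by apply: contraNneq N0 => e; move: NM; rewrite e mul0r domx0.
have p2E : psub c' g' P = p2 by rewrite (@psub_split n P c g c' g').
exists k; rewrite p2E; split; [exact: M0 | exact: hk | move=> m m2].
pose s := b * t ^+ n; have s0 : s != 0 by rewrite mulf_neq0 ?expf_neq0.
have s1 : s ≼ 1 by exact: tk.
have := @psub_scale _ V n _ b s p1 (mdeg m) sub s0 (iter_der_domn t1 bt).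
move=> /(_ _ m (erefl _)) h.
have {}h : p2@_m / s ^+ mdeg m ≺ N by apply: h => m' e'; apply: hr1; rewrite e'.
have {}h : p2@_m ≺ N * s ^+ mdeg m by rewrite -(@domM2r _ _ OV (s ^+ mdeg m)) ?expf_neq0 // divfK ?expf_neq0 // in h.
apply: (lt_dom_trans OV) h _.
apply: (@dom_trans _ _ OV (N * s ^+ 2)).
  apply: domM; rewrite ?dom_refl // -(subnK m2) exprD -{2}[s ^+ 2]mul1r.
  by apply: domM; rewrite ?dom_refl //; exact: domX1.
apply: (@dom_trans _ _ OV (p2@_U_(k) * (b^-1 * t ^+ n) * s ^+ 2)).
  by apply: domM; rewrite ?dom_refl.
have -> : p2@_U_(k) * (b^-1 * t ^+ n) * s ^+ 2 = p2@_U_(k) * (b * t ^+ (n + n + n)).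
  by rewrite /s !exprD; field.
by rewrite -{2}[p2@_U_(k)]mulr1; apply: domM; rewrite ?dom_refl.
Qed.

Lemma mderiv_translate n (P : {mpoly F[n]}) (a : F) (j : 'I_n) :
  (psub a 1 P)^`M(j) = psub a 1 (P^`M(j)).
Proof.
rewrite /psub mderiv_comp (bigD1 j) //= [X in _ + X]big1 ?addr0.
  by rewrite mderiv_aff aff_coef1 eqxx mulr1.
move=> i ij; rewrite mderiv_aff aff_coef1 (_ : (i == j :> nat) = false) ?mpolyC0 ?mulr0 //.
exact: negPf.
Qed.

(** If [Q] is nonzero, its stability fixes the linear coefficient [b] up to [sim], independently of
    the smaller ball [(c'', g'')]. Contracting from radius [g'] to [g''] then pushes the nonconstant
    coefficients of the partial derivative below [b * (q * ld q ^+ n)]. *)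
Lemma partial_bound n (P : {mpoly F[n]}) (g c' g' c'' g'' : F) (i : 'I_n) :
  g != 0 -> g' != 0 -> g'' != 0 -> g'' ≺ g' -> c'' - c' ≼ g' ->
  let Q := (psub 0 g P)^`M(i) in
  Q = 0 \/ stable Q (c' / g) (g' / g) ->
  let q := g'' / g' in
  let b : F := (psub c'' g P)@_U_(i) in
  (Q = 0 \/ b != 0 /\ b ~~~ Q.@[jet (c' / g)]) /\
  forall m y, m != 0%MM -> y != 0 -> b * (q * ld q ^+ n) ≼ y ->
  (psub 0 (g'' / g) ((psub c'' g P)^`M(i)))@_m ≺ y.
Proof.
move=> g0 g0' g0'' gg cc Q hQ q b.
have n0 : (0 < n)%N by case: (n) i {Q q b hQ} => // -[].
have dE : (psub c'' g P)^`M(i) = psub (c'' / g) 1 Q.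
  rewrite /Q -mderiv_translate psub_comp mulr1 add0r mulrC divfK //.
have bE : b = Q.@[jet (c'' / g)].
  rewrite -(@psub_coef0 _ V n (c'' / g) 1) -dE mcoeff_deriv mnm0E add0m mulr1n //.
case: hQ => [Q0|st].
  split; first by left.
  by move=> m y _ y0 _; rewrite dE Q0 !psub0 mcoeff0 lt0_dom.
have q0 : q != 0 by rewrite mulf_neq0 ?invr_eq0.
have q1 : q ≺ 1 by rewrite domx_div // mul1r.
have [||st' sm] := stable_mono _ n0 st (dom_refl OV _) (c' := c'' / g).
- by rewrite mulf_neq0 ?invr_eq0.
- by rewrite -mulrBl domM2r ?invr_eq0.
rewrite -bE in sm; have b0 : b != 0 by apply/eqP => e; have := sim_neq0l OV sm; rewrite e eqxx.
split; first by right.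
move=> m y m0 y0 by_; rewrite dE psub_comp !mul1r addr0.
have -> : psub (c'' / g) (g'' / g) Q = psub 0 q (psub (c'' / g) (g' / g) Q).
  rewrite psub_comp mulr0 addr0; apply: eq_psub => //.
  by rewrite /q; field; rewrite g0 g0'.
have l1 : 1 ≺ ld q by exact: ld_gt1.
pose s := q * ld q ^+ n; have s1 : s ≺ 1 by exact: ldX_lt0.
have l0 := lt_dom_neq0 OV l1.
have s0 : s != 0 by rewrite mulf_neq0 ?expf_neq0.
have := @psub_scale _ V n _ q s (psub (c'' / g) (g' / g) Q) (mdeg m) (submod_lt V b0) s0
  (iter_der_domn (domW OV l1) (dom_refl OV _)).
move=> /(_ _ m (erefl _)) h.
have {}h : (psub 0 q (psub (c'' / g) (g' / g) Q))@_m / s ^+ mdeg m ≺ b.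
  by apply: h => k ek; rewrite bE; apply: st'; move: m0; rewrite !deg_eq0 ek.
rewrite -(@domM2r _ _ OV (s ^+ mdeg m)) ?expf_neq0 // divfK ?expf_neq0 // in h.
apply: (lt_dom_trans OV) h _; apply: (dom_trans OV) _ by_; apply: domM; rewrite ?dom_refl //.
rewrite deg_eq0 in m0; rewrite -(prednK m0) exprS -/s -[X in _ ≼ X]mulr1.
apply: (domM OV); [exact: dom_refl | apply: domX1 => //; exact: domW].
Qed.

Lemma aff_coefs_dom n (b t : F) (i : 'I_n) m : 1 ≼ t -> ld b ≼ t ->
  (tnth (aff V n 0 b) i)@_m ≼ b * t ^+ i.
Proof.
move=> t1 bt; rewrite tnth_mktuple iter_der0 mpolyC0 add0r raddf_sum /=.
apply: dom_sum => // l _; rewrite mcoeffZ mcoeffX -[b * _]mulr1; apply: domM => //; last exact: dom_nat.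
rewrite /aff_coef; case: ifP => li; last exact: dom0x.
rewrite -[b * _]mul1r; apply: domM => //; first exact: dom_nat.
apply: (dom_trans OV) (iter_der_dom _ t1 bt) _; apply: domM; rewrite ?dom_refl //.
by apply: dom_expX => //; exact: leq_subr.
Qed.

(** Nested balls [x - c ≼ g] whose radii have no smallest value: a pseudo-Cauchy sequence without
    the choice of an index set. *)
Record cut (C : F -> F -> Prop) : Prop := Cut {
  cut_ne : exists c g, C c g;
  cut_neq0 : forall c g, C c g -> g != 0;
  cut_nest : forall c g c' g', C c g -> C c' g' -> g' ≼ g -> c' - c ≼ g;
  cut_shrink : forall c g, C c g -> exists c' g', C c' g' /\ g' ≺ g }.

Definition cut_limit (C : F -> F -> Prop) (x : F) := forall c g, C c g -> x - c ≼ g.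

Definition stable_on (C : F -> F -> Prop) n (P : {mpoly F[n]}) :=
  exists c g, C c g /\ stable P c g.

Lemma cut_common C c g c' g' : cut C -> C c g -> C c' g' ->
  exists c'' g'', [/\ C c'' g'', g'' ≺ g & g'' ≺ g'].
Proof.
move=> cC Cc Cc'; have /orP[h|h] := dom_total OV g g'.
  have [c1 [g1 [C1 lt1]]] := cut_shrink cC Cc; exists c1, g1; split=> //.
  exact: (lt_dom_trans OV) lt1 h.
have [c1 [g1 [C1 lt1]]] := cut_shrink cC Cc'; exists c1, g1; split=> //.
exact: (lt_dom_trans OV) lt1 h.
Qed.

(** All scales [g] are needed, because the partial derivatives of [P(g Z)] mix those of [P]. For a
    minimal unstable [P] they are simpler than [P] ([minimal_partials_stable]). *)
Definition partials_stable (C : F -> F -> Prop) n (P : {mpoly F[n]}) :=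
  forall (g : F) (i : 'I_n), g != 0 -> let Q := (psub 0 g P)^`M(i) in
  Q = 0 \/ exists c' g', C c' g' /\ stable Q (c' / g) (g' / g).

Lemma partials_stable_common C n (P : {mpoly F[n]}) (g : F) : cut C -> partials_stable C P ->
  g != 0 -> exists c' g', C c' g' /\
  forall i, let Q := (psub 0 g P)^`M(i) in Q = 0 \/ stable Q (c' / g) (g' / g).
Proof.
move=> cC hP g0.
suff h (s : seq 'I_n) : exists c' g', C c' g' /\
    forall i, i \in s -> let Q := (psub 0 g P)^`M(i) in Q = 0 \/ stable Q (c' / g) (g' / g).
  by have [c' [g' [Cc h']]] := h (enum 'I_n); exists c', g'; split=> // i; apply: h'; rewrite mem_enum.
elim: s => [|i s [c1 [g1 [C1 h1]]]]; first by have [c [g' Cc]] := cut_ne cC; exists c, g'.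
have n0 : (0 < n)%N by case: (n) i {P hP s h1} => // -[].
have lift c g' c2 g2 (Q : {mpoly F[n]}) : C c g' -> C c2 g2 -> g2 ≺ g' -> stable Q (c / g) (g' / g) ->
    stable Q (c2 / g) (g2 / g) :> Prop.
  move=> Cc Cc2 lt; move=> /(@stable_mono n Q) h; apply h => //.
  - by rewrite mulf_neq0 ?invr_eq0 // (cut_neq0 cC Cc).
  - by rewrite domM2r ?invr_eq0 //; exact: domW.
  by rewrite -mulrBl domM2r ?invr_eq0 //; exact: (cut_nest cC Cc Cc2 (domW OV lt)).
case: (hP g i g0) => [Q0|[c2 [g2 [C2 st2]]]].
  exists c1, g1; split=> // k; rewrite in_cons => /orP[/eqP ->|]; [by left | exact: h1].
have [c3 [g3 [C3 l1 l2]]] := cut_common cC C1 C2.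
exists c3, g3; split=> // k; rewrite in_cons => /orP[/eqP ->|ks] /=.
  by right; apply: lift C2 C3 l2 st2.
by case: (h1 k ks) => /= [|st]; [left | right; apply: lift C1 C3 l1 st].
Qed.

(** With [x = ld g'' - ld g] the second clause says [ld g'' - ld g' ≼ ld x]: the logarithmic
    derivatives of the radii lie in nested balls again, those of [log_cut]. *)
Definition log_fast (C : F -> F -> Prop) := forall g, g != 0 -> exists c' g', C c' g' /\
  forall c'' g'', C c'' g'' -> g'' ≺ g' ->
    1 ≺ ld (g'' / g) /\ ld (g'' / g') ≼ ld (ld (g'' / g)).

Lemma nonconst_partial n (P : {mpoly F[n]}) (g : F) : g != 0 ->
  (exists m, m != 0%MM /\ (P@_m : F) != 0) -> exists i, (psub 0 g P)^`M(i) != 0.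
Proof.
move=> g0 [m [m0 Pm]]; apply: contrapT => h.
have {}h i : (psub 0 g P)^`M(i) = 0 by apply: contrapT => /eqP h'; apply: h; exists i.
have z k : k != 0%MM -> (psub 0 g P)@_k = 0.
  move=> k0; have [i ki] : exists i, (0 < k i)%N.
    apply/existsP; apply: contraR k0; rewrite negb_exists => /forallP hk; apply/eqP/mnmP => i.
    by move: (hk i); rewrite -eqn0Ngt mnm0E => /eqP.
  have := congr1 (fun p : {mpoly F[n]} => p@_(k - U_(i))) (h i).
  rewrite mcoeff_deriv mcoeff0 submK ?lep1mP -?lt0n // -mulr_natr => /eqP.
  by rewrite mulf_eq0 (negPf (natr_neq0 V _)) orbF => /eqP.
have e : psub 0 g P = ((psub 0 g P)@_0)%:MP.
  by apply/mpolyP => k; rewrite mcoeffC; have [->|k0] := eqVneq k 0%MM; rewrite ?mulr1 // mulr0 z.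
have := psub_id V 0 P g0; rewrite e /psub comp_mpolyC => e2.
by move: Pm; rewrite -e2 mcoeffC (negPf m0) mulr0 eqxx.
Qed.

(** Contracting by [t = g'' / g] costs the linear part powers of a bound [tau] of [ld t], while the
    factor [q * ld q ^+ n] gained from the stable partials works in favour of linear dominance.
    Failure of dominance therefore bounds, in terms of [tau], how small [q] can be. *)
Lemma not_lin_dom_log_fast C n (P : {mpoly F[n]}) : cut C -> partials_stable C P ->
  (exists m, m != 0%MM /\ (P@_m : F) != 0) ->
  (forall c g, C c g -> ~ lin_dom P c g) -> log_fast C.
Proof.
move=> cC hP nc nd g g0; have [c' [g' [C' st]]] := partials_stable_common cC hP g0.
exists c', g'; split=> // c'' g'' C'' lt.
have g0' := cut_neq0 cC C'; have g0'' := cut_neq0 cC C''.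
have cc : c'' - c' ≼ g' := cut_nest cC C' C'' (domW OV lt).
pose t := g'' / g; pose q := g'' / g'; pose p := psub c'' g P.
have t0 : t != 0 by rewrite mulf_neq0 ?invr_eq0.
have q0 : q != 0 by rewrite mulf_neq0 ?invr_eq0.
have q1 : q ≺ 1 by rewrite domx_div // mul1r.
have l1 : 1 ≺ ld q by exact: ld_gt1.
have l0 := lt_dom_neq0 OV l1.
have pt : psub c'' g'' P = psub 0 t p.
  by rewrite psub_comp mulr0 addr0 /t mulrC divfK.
have [i0 Qi0] := nonconst_partial g0 nc.
have pb i := @partial_bound n P g c' g' c'' g'' i g0 g0' g0'' lt cc (st i).
have [k hk] := dom_max OV i0 (fun i => (psub c'' g'' P)@_U_(i)).
set M : F := (psub c'' g'' P)@_U_(k) in hk.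
(* If this product were [≼ 1], [psub_rest] would give linear dominance at [(c'', g'')]. *)
have key tau : 1 ≼ tau -> ld t ≼ tau -> 1 ≺ tau ^+ (n + n) * (q * ld q ^+ n).
  move=> ta1 tat.
  have tau0 : tau != 0 by apply: (dom_neq0 OV ta1); exact: oner_neq0.
  have low i : p@_U_(i) ≼ M * (t^-1 * tau ^+ n).
    by apply: lin_scale_lower => // j; rewrite -pt.
  have M0 : M != 0.
    have [[Q0|[b0 _]] _] := pb i0; first by rewrite Q0 eqxx in Qi0.
    by apply: contraNneq b0 => e; have := low i0; rewrite e mul0r domx0.
  pose N := M * (tau ^+ (n + n) * (q * ld q ^+ n)).
  have N0 : N != 0 by apply: mulf_neq0 => //; apply: mulf_neq0; [|apply: mulf_neq0 => //]; exact: expf_neq0.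
  apply/negP => h; apply: (nd _ _ C''); exists k; rewrite -/M; split=> // m m2.
  apply: (@lt_dom_trans _ _ OV N); last first.
    by rewrite -[X in _ ≼ X]mulr1; apply: domM; rewrite ?dom_refl.
  rewrite pt; apply: (@psub_rest _ V n t p N (fun _ => t * tau ^+ n)) => //.
    move=> i m'; apply: (dom_trans OV) (aff_coefs_dom _ _ ta1 tat) _.
    by apply: domM; rewrite ?dom_refl //; apply: dom_expX => //; exact: ltnW.
  move=> i m' m0'.
  have tt0 : t * tau ^+ n != 0 by rewrite mulf_neq0 ?expf_neq0.
  have -> : N = (t * tau ^+ n) * (M * (t^-1 * tau ^+ n) * (q * ld q ^+ n)).
    by rewrite /N exprD; field.
  rewrite domM2l //; apply: (pb i).2 => //; first by rewrite !mulf_neq0 ?expf_neq0 ?invr_eq0.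
  by apply: domM; rewrite ?dom_refl // low.
have lt1 : 1 ≺ ld t.
  apply/negP => h; have := key 1 (dom_refl OV _) h; rewrite expr1n mul1r.
  by move=> /(lt_trans_dom OV (ldX_lt0 n q0 q1)); rewrite dom_refl.
split=> //; have tau1 := lt1; set tau := ld t in tau1 *.
have tau0 := lt_dom_neq0 OV tau1.
pose x := q^-1; have x1 : 1 ≺ x by rewrite domV1.
have x0 := lt_dom_neq0 OV x1.
have lx : ld x = - ld q by rewrite ldV.
have xk : x ≺ tau ^+ (n + n) * ld q ^+ n.
  have -> : tau ^+ (n + n) * ld q ^+ n = x * (tau ^+ (n + n) * (q * ld q ^+ n)).
    transitivity ((x * q) * (tau ^+ (n + n) * ld q ^+ n)); last by ring.
    by rewrite /x mulVf // mul1r.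
  rewrite -[X in ~~ dominatedb _ _ X]mulr1 domM2l //.
  exact: key (domW OV tau1) (dom_refl OV _).
rewrite -/q; apply/negPn/negP => h.
(* If [ld q ≼ ld tau] fails, [x] exceeds both the power [4n] of [tau] and the power [2n] of [ld q],
   so [x ^+ 2] exceeds the square of the bound in [xk]. *)
have h1 : tau ^+ ((n + n) * 2) ≺ x.
  apply/negP => h'; have := ld_mono1 x1 h'; rewrite ldX // lx domN // => h2.
  move: h; rewrite (dom_trans OV h2) // -{2}[ld tau]mul1r.
  by apply: domM; rewrite ?dom_refl // dom_nat.
have h2 : ld q ^+ (n * 2) ≺ x.
  by have := ldX_lt (n * 2) x1; rewrite lx [(n * 2)%N]mulnC !exprM sqrrN.
have h3 : (tau ^+ (n + n) * ld q ^+ n) ^+ 2 ≺ x ^+ 2.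
  by rewrite exprMn -!exprM [x ^+ 2]expr2; apply: lt_domM => //; exact: domW.
by have := lt_trans_dom OV h3 (lt_domX OV 1 xk); rewrite dom_refl.
Qed.

(** Otherwise [D] would be [log_fast]. Testing this at the scale 1 with the radii [s] and [ld s]
    gives [ld (ld s) - ld s ≼ ld (ld (ld s))], although the left side has the size of [ld s]. *)
Lemma ld_closed_lin_dom (D : F -> F -> Prop) n (P : {mpoly F[n]}) : cut D ->
  (forall e s, D e s -> 1 ≺ s /\ exists e', D e' (ld s)) -> partials_stable D P ->
  (exists m, m != 0%MM /\ (P@_m : F) != 0) -> exists e s, D e s /\ lin_dom P e s.
Proof.
move=> cD ldD hP nc; apply: contrapT => h.
have nd e s : D e s -> ~ lin_dom P e s by move=> h1 h2; apply: h; exists e, s.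
have [e' [s' [D' h']]] := not_lin_dom_log_fast cD hP nc nd (oner_neq0 F).
have [s1 [e'' D'']] := ldD _ _ D'.
have [x1 x2] := h' _ _ D'' (ld_lt s1).
have l1 : 1 ≺ ld s' by exact: ld_gt1'.
have l0 := lt_dom_neq0 OV l1; have s0 := lt_dom_neq0 OV s1.
rewrite divr1 in x1 x2; rewrite (ld_div V l0 s0) in x2.
have lt := ld_lt l1.
have {}x2 : ld (ld s') - ld s' ≺ ld (ld s') by exact: (dom_lt_trans OV) x2 (ld_lt x1).
have : ld s' ≺ ld s'.
  rewrite -{2}[ld s'](subrK (ld (ld s'))); apply: lt_domD => //.
  by rewrite -opprB lt_domN //; exact: (lt_trans_dom OV) x2 lt.
by rewrite dom_refl.
Qed.

(** * The cut of the logarithmic derivatives of the radii *)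

Section LogCut.
Variables (C : F -> F -> Prop) (cC : cut C).
Hypothesis expB : forall h : F, exists g, g != 0 /\ ld g - h ≼ 1.

(* the cut of the pseudo-limits of the logarithmic derivatives of the radii of [C] *)
Definition log_cut (e s : F) := 1 ≺ s /\ exists c' g', C c' g' /\
  forall c'' g'', C c'' g'' -> g'' ≺ g' -> ld g'' - e ≼ s.

Hypothesis lfC : log_fast C.

(** For a later radius put [x = ld g'' - ld g]. Then [x - s ≼ ld x ≺ x], so [s] and [x] are
    equivalent and [ld x ≼ ld s], a bound that no longer depends on [g'']. *)
Lemma log_cut_from (g : F) : g != 0 -> exists g1, let s := ld g1 - ld g in
  1 ≺ s /\ log_cut (ld g1) (ld s).
Proof.
move=> g0; have [c1 [g1 [C1 h1]]] := lfC g0; exists g1 => s.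
have g10 := cut_neq0 cC C1.
have key c'' g'' : C c'' g'' -> g'' ≺ g1 -> 1 ≺ s /\ ld g'' - ld g1 ≼ ld s.
  move=> C'' lt; have [x1 x2] := h1 _ _ C'' lt; have g0'' := cut_neq0 cC C''.
  rewrite !ld_div // in x1 x2; set x := ld g'' - ld g in x1 x2 *.
  have xs : x - s ≺ x.
    have -> : x - s = ld g'' - ld g1 by rewrite /x /s; ring.
    exact: (dom_lt_trans OV) x2 (ld_lt x1).
  have sx : sim (vO V) s x by rewrite /sim -opprB lt_domN.
  have s1 : 1 ≺ s by exact: (lt_dom_trans OV) x1 (sim_domr OV sx).
  split=> //; apply: (dom_trans OV) x2 _; apply: ld_mono1 => //.
  exact: sim_domr.
have [c2 [g2 [C2 lt2]]] := cut_shrink cC C1; have [s1 _] := key _ _ C2 lt2.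
split=> //; split; first exact: ld_gt1'.
by exists c1, g1; split=> // c'' g'' C'' lt; have [] := key _ _ C'' lt.
Qed.

Lemma log_cut_ld e s : log_cut e s -> exists e', log_cut e' (ld s).
Proof.
move=> [s1 [c' [g' [C' h]]]]; have [g [g0 ge]] := expB e.
have [c1 [g1 [C1 h1]]] := lfC g0; have g10 := cut_neq0 cC C1.
have [c2 [g2 [C2 l1 l2]]] := cut_common cC C' C1.
exists (ld g1); split; first exact: ld_gt1'.
exists c2, g2; split=> // c'' g'' C'' lt.
have [x1 x2] := h1 _ _ C'' (lt_trans_dom OV lt l2).
have g0'' := cut_neq0 cC C''; rewrite !ld_div // in x1 x2.
apply: (dom_trans OV) x2 _; apply: ld_mono1 => //.
rewrite (_ : _ - _ = (ld g'' - e) - (ld g - e)); last by ring.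
apply: domB => //; first by apply: h C'' _; exact: (lt_trans_dom OV) lt l1.
by apply: (dom_trans OV) ge _; exact: domW.
Qed.

Lemma log_cut_cut : cut log_cut.
Proof.
split.
- have [g1 [_ h]] := log_cut_from (oner_neq0 F).
  by exists (ld g1), (ld (ld g1 - ld 1)).
- by move=> e s [/(lt_dom_neq0 OV)].
- move=> e s e' s' [s1 [c [g [Cc h]]]] [s1' [c' [g' [Cc' h']]]] ss.
  have [c2 [g2 [C2 l1 l2]]] := cut_common cC Cc Cc'.
  rewrite (_ : e' - e = (ld g2 - e) - (ld g2 - e')); last by ring.
  apply: domB => //; first exact: h C2 l1.
  by apply: (dom_trans OV) ss; exact: h' C2 l2.
- move=> e s h; have [e' h'] := log_cut_ld h; exists e', (ld s); split=> //.
  by apply: ld_lt; case: h.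
Qed.

(** Approximate a limit [x] by some [ld g] up to [O]. The ball built from this [g] has its centre at
    distance [s] from [ld g], but its radius is only [ld s ≺ s]. *)
Lemma log_cut_nolimit x : ~ cut_limit log_cut x.
Proof.
move=> lim; have [g [g0 gx]] := expB x.
have [g1 [s1 h]] := log_cut_from g0; set s := _ - _ in s1 h.
have l1 : 1 ≺ ld s by exact: ld_gt1'.
have := ld_lt s1; apply/negP; rewrite negbK.
have {1}-> : s = - (x - ld g1) - (ld g - x) by rewrite /s; ring.
apply: domB => //; first by rewrite domN //; exact: lim h.
by apply: (dom_trans OV) gx _; exact: domW.
Qed.

End LogCut.

End Stability.

(** * Riccati polynomials *)

Section Riccati.
Variables (F : fieldType) (V : vdf F).
Local Notation "x ≼ y" := (dominatedb (vO V) x y) (at level 70, y at next level).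
Local Notation "x ≺ y" := (~~ dominatedb (vO V) y x) (at level 70, y at next level).
Local Notation "x ~~~ y" := (sim (vO V) x y) (at level 70, y at next level).
Local Notation d := (vder V).
Local Notation ld := (logder V).
Local Notation jet := (jet V).
Implicit Types x y z c g s e t : F.
Let OV := vO_ring V.

Definition pder n (P : {mpoly F[n]}) : {mpoly F[n]} :=
  \sum_(m <- msupp P) d P@_m *: 'X_[m].

Lemma mcoeff_pder n (P : {mpoly F[n]}) m : (pder P)@_m = d P@_m.
Proof.
rewrite /pder raddf_sum /=; under eq_bigr => k _ do rewrite mcoeffZ mcoeffX.
case: (boolP (m \in msupp P)) => mP.
  rewrite (bigD1_seq m) ?msupp_uniq //= eqxx mulr1 big1 ?addr0 // => k km.
  by rewrite (negPf km) mulr0.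
rewrite big_seq big1; last by move=> k kP; case: eqP => [e|]; rewrite ?mulr0 //; rewrite -e kP in mP.
by rewrite memN_msupp_eq0 // der0.
Qed.

Lemma pderD n (P Q : {mpoly F[n]}) : pder (P + Q) = pder P + pder Q.
Proof. by apply/mpolyP => m; rewrite mcoeffD !mcoeff_pder mcoeffD derD. Qed.

Lemma der_meval n (P : {mpoly F[n]}) (v : 'I_n -> F) :
  d P.@[v] = (pder P).@[v] + \sum_(i < n) (P^`M(i)).@[v] * d (v i).
Proof.
elim/mpolyind: P => [|c m p _ _ IH].
  rewrite meval0 der0 (_ : pder 0 = 0); last by apply/mpolyP => m; rewrite mcoeff_pder !mcoeff0 der0.
  by rewrite meval0 big1 ?addr0 // => i _; rewrite mderiv0 meval0 mul0r.
rewrite pderD !mevalD derD IH.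
have -> : \sum_(i < n) ((c *: 'X_[m] + p)^`M(i)).@[v] * d (v i) =
  \sum_(i < n) ((c *: 'X_[m])^`M(i)).@[v] * d (v i) + \sum_(i < n) (p^`M(i)).@[v] * d (v i).
  by rewrite -big_split /=; apply: eq_bigr => i _; rewrite mderivD mevalD mulrDl.
rewrite [RHS]addrACA; congr (_ + _).
rewrite (_ : pder (c *: 'X_[m]) = d c *: 'X_[m]); last first.
  apply/mpolyP => k; rewrite mcoeff_pder !mcoeffZ mcoeffX.
  by case: eqP; rewrite ?mulr1 // !mulr0 der0.
rewrite !mevalZ derM mevalX; congr (_ + _).
rewrite (deriv_prod_expn _ _ (derM V)) mulr_sumr; apply: eq_bigr => i _.
by rewrite mderivZ mderivX !mevalZ mevalX !mulrA.
Qed.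

Definition const_coefs n (P : {mpoly F[n]}) := forall m, d P@_m = 0.

Lemma const_coefsD n (P Q : {mpoly F[n]}) :
  const_coefs P -> const_coefs Q -> const_coefs (P + Q).
Proof. by move=> hP hQ m; rewrite mcoeffD derD hP hQ addr0. Qed.

Lemma const_coefsM n (P Q : {mpoly F[n]}) :
  const_coefs P -> const_coefs Q -> const_coefs (P * Q).
Proof.
move=> hP hQ m; rewrite mcoeffM der_sum big1 // => k _.
by rewrite derM hP hQ mul0r mulr0 addr0.
Qed.

Lemma const_coefsX n m : const_coefs ('X_[m] : {mpoly F[n]}).
Proof. by move=> k; rewrite mcoeffX der_nat. Qed.

(** The recursion is [R_{j+1} = Y R_j + (R_j)'], obtained by differentiating [z R_j(z†)] and
    dividing by [z]. Constant coefficients reduce the derivative of [R_j] to the chain rule. *)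
Lemma riccati n j : (j < n)%N -> exists R : {mpoly F[n]}, [/\ const_coefs R,
  forall i : 'I_n, (j <= i)%N -> R^`M(i) = 0 &
  forall z, z != 0 -> R.@[jet (ld z)] = iter j d z / z].
Proof.
elim: j => [|j IH] jn.
  exists 1; split=> [m|i _|z z0]; first by rewrite mcoeff1 der_nat.
    by rewrite -mpolyC1 mderivC.
  by rewrite meval1 divff.
have [R [cR dR eR]] := IH (ltnW jn).
have i0 : 'I_n by case: (n) jn => // n' _; exact: ord0.
have n0 : (0 < n)%N by exact: leq_ltn_trans jn.
pose o0 := Ordinal n0.
(* The derivative of [R]. No variable of index [j] or more occurs in [R], so the default 0 is
   reached only where the partial derivative vanishes. *)
pose S := \sum_(i < n) (if insub i.+1 is Some i' then 'X_(i' : 'I_n) * R^`M(i) else 0).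
exists ('X_o0 * R + S); split.
- apply: const_coefsD; first by apply: const_coefsM => //; exact: const_coefsX.
  rewrite /S; elim/big_ind: _ => [m|P Q|i _]; [by rewrite mcoeff0 der0|exact: const_coefsD|].
  case: insubP => [i' _ _|_ m]; last by rewrite mcoeff0 der0.
  apply: const_coefsM; first exact: const_coefsX.
  by move=> m; rewrite mcoeff_deriv derMn cR mul0rn.
- move=> i ji; rewrite mderivD mderivM mderivX mnm1E dR ?(ltnW ji) // mulr0 addr0.
  have -> /= : (o0 == i) = false by apply/negP => /eqP h; move: ji; rewrite -h.
  rewrite scale0r mul0r add0r raddf_sum /= big1 // => l _.
  case: insubP => [l' _ e|_]; last by rewrite mderiv0.
  rewrite mderivM mderivX mnm1E (mderiv_comm l i R) (dR i (ltnW ji)) mderiv0 mulr0 addr0.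
  case: eqP => [h|]; last by rewrite scale0r mul0r.
  by rewrite dR ?mulr0 //; move: ji; rewrite -h e.
move=> z z0; set x := ld z.
have := der_meval R (jet x); rewrite eR //.
have -> : (pder R) = 0 by apply/mpolyP => m; rewrite mcoeff_pder cR mcoeff0.
rewrite meval0 add0r => h.
have hS : S.@[jet x] = \sum_(i < n) (R^`M(i)).@[jet x] * d (jet x i).
  rewrite /S raddf_sum /=; apply: eq_bigr => i _; case: insubP => [i' _ e|].
    by rewrite mevalM mevalXU mulrC /jet e.
  rewrite -leqNgt => ni; rewrite meval0 dR ?meval0 ?mul0r //.
  by have := ltn_ord i; move: ni jn; lia.
rewrite mevalD mevalM mevalXU hS -h eR // derM derV // /jet /= /x /logder.
by field.
Qed.

Lemma riccati_op n (th : 'I_n -> F) : exists G : {mpoly F[n]},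
  forall z, z != 0 -> G.@[jet (ld z)] = (\sum_(i < n) th i * iter i d z) / z.
Proof.
pose R (i : 'I_n) := sval (cid (riccati (ltn_ord i))).
exists (\sum_(i < n) th i *: R i) => z z0.
rewrite raddf_sum mulr_suml /=; apply: eq_bigr => i _; rewrite mevalZ -mulrA; congr (_ * _).
by rewrite /R; case: cid => /= ? [_ _]; apply.
Qed.

(** Interpolation at [0, ..., k - 1]: differences of distinct nodes are units of [O], so no
    denominator spoils the bound. The induction divides by the factor of the last node. *)
Lemma small_values_small_coefs k (p : {poly F}) : (size p <= k)%N ->
  (forall i, (i < k)%N -> p.[i%:R] ≺ 1) -> forall j, p`_j ≺ 1.
Proof.
have n10 : (1 : F) != 0 := oner_neq0 F.
elim: k p => [|k IH] p sp hp j.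
  by move: sp; rewrite leqn0 size_poly_eq0 => /eqP ->; rewrite coef0 lt0_dom.
pose c := p.[k%:R]; have c1 : c ≺ 1 by apply: hp.
have /factor_theorem[r e] : root (p - c%:P) k%:R by rewrite rootE !hornerE subrr.
have pE : p = r * ('X - k%:R%:P) + c%:P by rewrite -e subrK.
have sr : (size r <= k)%N.
  have [->|r0] := eqVneq r 0; first by rewrite size_poly0.
  have := size_Mmonic r0 (monicXsubC (k%:R : F)); rewrite -e size_XsubC addn2 /= => sE.
  have : (size (p - c%:P)%R <= k.+1)%N.
    apply: leq_trans (size_polyD _ _) _; rewrite geq_max sp size_polyN.
    by apply: leq_trans (size_polyC_leq1 _) _.
  by rewrite sE.
have hr i : (i < k)%N -> r.[i%:R] ≺ 1.
  move=> ik; have /(congr1 (fun q => q.[i%:R])) := e; rewrite !hornerE => ei.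
  have -> : r.[i%:R] ≺ 1 = ((k - i.+1).+1%:R * r.[i%:R] ≺ 1) by rewrite dom_natM.
  have -> : (k - i.+1).+1%:R * r.[i%:R] = - (p.[i%:R] - c).
    rewrite ei -subSn // subSS natrB ?(ltnW ik) //; ring.
  by rewrite lt_domN //; apply: lt_domB => //; apply: hp; exact: ltnW.
have sr1 l : r`_l ≺ 1 by exact: IH.
rewrite pE mulrBr !coefD coefN coefMX coefMC coefC.
have m1 x : x ≺ 1 -> x * k%:R ≺ 1.
  by move=> x1; have := lt_domM OV x1 (dom_nat V k) n10; rewrite mulr1.
by apply: lt_domD => //; [apply: lt_domB => //; [case: ifP => _; rewrite ?lt0_dom|exact: m1]|case: ifP; rewrite ?lt0_dom].
Qed.

End Riccati.

(** * The Riccati polynomial is unstable along the logarithmic cut *)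

Section NoLoss.
Variables (E F : fieldType) (VE : vdf E) (V : vdf F) (f : {rmorphism E -> F}).
Hypothesis fV : vembed VE V f.
Local Notation "x ≼ y" := (dominatedb (vO V) x y) (at level 70, y at next level).
Local Notation "x ≺ y" := (~~ dominatedb (vO V) y x) (at level 70, y at next level).
Local Notation "x ~~~ y" := (sim (vO V) x y) (at level 70, y at next level).
Local Notation d := (vder V).
Local Notation ld := (logder V).
Let OV := vO_ring V.
Let OVE := vO_ring VE.

Lemma stable_map n (P : {mpoly E[n]}) (c g : E) :
  stable VE P c g -> stable V (map_mpoly f P) (f c) (f g).
Proof.
move=> st m m0; rewrite -(map_psub _ _ _ fV) mcoeff_map_mpoly -(map_mpoly_eval _ _ fV).
by rewrite (vembed_dom fV); exact: st.
Qed.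

Lemma lin_dom_map n (P : {mpoly E[n]}) (c g : E) :
  lin_dom VE P c g -> lin_dom V (map_mpoly f P) (f c) (f g).
Proof.
move=> [j [h1 h2 h3]]; exists j; rewrite -(map_psub _ _ _ fV); split.
- by rewrite mcoeff_map_mpoly fmorph_eq0.
- by move=> i; rewrite !mcoeff_map_mpoly (vembed_dom fV).
- by move=> m m2; rewrite !mcoeff_map_mpoly (vembed_dom fV); exact: h3.
Qed.

Lemma map_mderiv n (P : {mpoly E[n]}) i : map_mpoly f (P^`M(i)) = (map_mpoly f P)^`M(i).
Proof. by apply/mpolyP => m; rewrite mcoeff_map_mpoly !mcoeff_deriv mcoeff_map_mpoly raddfMn. Qed.

Variables (C : E -> E -> Prop) (cC : cut VE C).
Hypothesis expB : forall h : E, exists g, g != 0 /\ dominatedb (vO VE) (logder VE g - h) 1.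
Hypothesis expF : forall x : F, exists2 z, z != 0 & ld z = x.
Variables (n : nat) (P : {mpoly E[n]}) (w : F).
Hypothesis pst : partials_stable VE C P.
Hypothesis nd : forall c g, C c g -> ~ lin_dom VE P c g.
Hypothesis limw : forall c g, C c g -> w - f c ≼ f g.
Hypothesis nc : exists m, m != 0%MM /\ (P@_m : E) != 0.
Let th (i : 'I_n) : F := ((map_mpoly f P)^`M(i)).@[jet V w].

Lemma lin_op_conj (a b z : F) (Q : {mpoly F[n]}) :
  \sum_(l < n) (psub V a b Q)@_U_(l) * iter l d z =
  \sum_(i < n) (Q^`M(i)).@[jet V a] * iter i d (b * z).
Proof.
under eq_bigr => l _ do rewrite psub_lin_eq mulr_suml.
rewrite exchange_big /=; apply: eq_bigr => i _.
rewrite leibniz -(@sum_aff_coef _ V n b i (fun l => iter l d z)) mulr_sumr.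
by apply: eq_bigr => l _; ring.
Qed.

(** Were [G] stable, the linear part of [P] at [w] would act on every [z] with [ld z ≼ s] nearly as
    multiplication by one constant. Its coefficients of positive order are then so small that
    contraction to a smaller ball costs the linear part no power of [s], and linear dominance
    follows, against [nd]. *)
Lemma riccati_unstable (G : {mpoly F[n]}) :
  (forall z : F, z != 0 -> G.@[jet V (ld z)] = (\sum_(i < n) th i * iter i d z) / z) ->
  forall e s, log_cut VE C e s -> ~ stable V G (f e) (f s).
Proof.
move=> hG e s [s1 [c1 [g1 [C1 h1]]]] stG.
have [g [g0 ge]] := expB e.
have [c2 [g2 [C2 st2]]] := partials_stable_common cC pst g0.
have [c3 [g3 [C3 l31 l32]]] := cut_common cC C1 C2.
have g20 := cut_neq0 cC C2; have g30 := cut_neq0 cC C3.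
have fg0 : f g != 0 by rewrite fmorph_eq0.
have [i0 _] := nonconst_partial VE g0 nc.
have n0 : (0 < n)%N by case: (n) i0 => // -[].
pose o0 := Ordinal n0.
pose b l : E := (psub VE c3 g P)@_U_(l).
pose bN l : F := (psub V w (f g) (map_mpoly f P))@_U_(l).
have cc : dominatedb (vO VE) (c3 - c2) g2 := cut_nest cC C2 C3 (domW OVE l32).
have pb i := @partial_bound _ VE n P g c2 g2 c3 g3 i g0 g20 g30 l32 cc (st2 i).
(* By stability of the partial derivatives, the linear coefficients at the pseudo-limit [w] agree up
   to [sim] with those at the centre [c3] from [E]. *)
have bb l : (b l = 0 /\ bN l = 0) \/ bN l ~~~ f (b l).
  pose Q := (psub VE 0 g P)^`M(l).
  have bNE : bN l = (map_mpoly f Q).@[jet V (w / f g)].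
    rewrite -(@psub_coef0 _ V n (w / f g) 1) map_mderiv (map_psub _ _ _ fV) rmorph0 -mderiv_translate.
    by rewrite psub_comp mulr1 add0r mulrC divfK // mcoeff_deriv mnm0E add0m mulr1n.
  case: (st2 l) => /= [Q0|stQ].
    left; split; last by rewrite bNE /Q Q0 raddf0 meval0.
    have [[_|[b0 _]] hb] := pb l; last first.
      have := hb.
      move: b0; rewrite -/(b l); have -> : b l = Q.@[jet VE (c3 / g)].
        rewrite -(@psub_coef0 _ VE n (c3 / g) 1) -mderiv_translate psub_comp mulr1 add0r mulrC divfK //.
        by rewrite mcoeff_deriv mnm0E add0m mulr1n.
      by rewrite /Q Q0 meval0 eqxx.
    have -> : b l = Q.@[jet VE (c3 / g)].
      rewrite -(@psub_coef0 _ VE n (c3 / g) 1) -mderiv_translate psub_comp mulr1 add0r mulrC divfK //.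
      by rewrite mcoeff_deriv mnm0E add0m mulr1n.
    by rewrite /Q Q0 meval0.
  right; have [[Q0|[b0 sm]] _] := pb l.
    have hU : U_(o0)%MM != 0%MM :> 'X_{1..n} by rewrite deg_eq0 mdeg1.
    by have := stQ _ hU; rewrite Q0 psub0 mcoeff0 meval0 domx0 // eqxx.
  rewrite -(vembed_sim fV) -/(b l) -/Q in sm.
  apply: (sim_trans OV) _ (sim_sym OV sm); rewrite (map_mpoly_eval _ _ fV) fmorph_div bNE.
  have := stable_map stQ; rewrite !fmorph_div => stQ'.
  have gg0 : f g2 / f g != 0 by rewrite mulf_neq0 ?invr_eq0 ?fmorph_eq0.
  have [|_ //] := stable_mono gg0 n0 stQ' (dom_refl OV _) (c' := w / f g).
  by rewrite -mulrBl domM2r ?invr_eq0 //; exact: limw.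
pose s' := f s; have s1' : 1 ≺ s' by rewrite -(rmorph1 f) (vembed_dom fV).
have s0' := lt_dom_neq0 OV s1'.
have gef : ld (f g) - f e ≼ 1.
  by rewrite -(vembed_ld fV) -rmorphB -[1](rmorph1 f) (vembed_dom fV).
have Gz (z : F) : z != 0 -> ld z ≼ s' ->
    (\sum_(l < n) bN l * iter l d z) / z ~~~ f g * G.@[jet V (f e)].
  move=> z0 lz; have y0 : f g * z != 0 by rewrite mulf_neq0.
  have -> : (\sum_(l < n) bN l * iter l d z) / z = f g * G.@[jet V (ld (f g * z))].
    by rewrite hG // /bN lin_op_conj /th; field; rewrite fg0 z0.
  apply: (simM OV); first exact: sim_refl.
  have [|_ //] := stable_mono s0' n0 stG (dom_refl OV _) (c' := ld (f g * z)).
  rewrite ldM // addrAC; apply: domD => //.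
  by apply: (dom_trans OV) gef _; exact: domW.
set B := f g * G.@[jet V (f e)] in Gz.
have b0B : bN o0 ~~~ B.
  have := Gz 1 (oner_neq0 _); rewrite ld1 => /(_ (dom0x OV _)); rewrite divr1.
  rewrite (bigD1 o0) //= mulr1 big1 ?addr0 // => l l0.
  have -> : (l : nat) = l.-1.+1 by rewrite prednK // lt0n; apply: contra l0 => /eqP h; apply/eqP/val_inj.
  by rewrite iter_der1 mulr0.
have B0 : B != 0 := sim_neq0 OV b0B.
pose be l : F := bN l * s' ^+ l.
have beB (l : 'I_n) : (0 < l)%N -> be l ≺ B.
  move=> l0; pose I := {i : 'I_n | (0 < i)%N}.
  have [k hk] := @dom_max _ _ OV {i : 'I_n | (0 < i)%N} (exist _ l l0) (fun i => be (sval i)).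
  set K := be (sval k) in hk.
  apply: (dom_lt_trans OV (hk (exist _ l l0))); apply/negP => BK.
  have K0 : K != 0 by apply: (dom_neq0 OV BK).
  (* A choice of [z] with [ld z = i * s'] and [0 < i] makes [iter l d z / z] equivalent to
     [(i * s') ^+ l]. Up to smaller terms the linear part becomes a polynomial in [i], small at all
     [i < n], although its largest coefficient is 1. *)
  pose p := \poly_(i < n) (if insub i is Some i' then if (0 < i)%N then be i' / K else 0 else 0).
  have hp i : (i < n)%N -> p.[i%:R] ≺ 1.
    move=> _; have [z z0 lz] := expF (i%:R * s').
    have lzs : ld z ≼ s' by rewrite lz -{2}[s']mul1r; apply: domM; rewrite ?dom_refl // dom_nat.
    have [i00|i1] := posnP i.
      rewrite i00 horner_coef0 coef_poly n0.
      by case: insub => [u|] /=; rewrite lt0_dom // oner_neq0.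
    have lz1 : 1 ≺ ld z by rewrite lz -(prednK i1) natM_dom.
    have hz l' := iter_der_sim l' lz1.
    have := Gz z z0 lzs; rewrite mulr_suml (bigD1 o0) //= -mulrA mulfV // mulr1 => h.
    have {}h : \sum_(l' < n | l' != o0) bN l' * iter l' d z / z ≺ K.
      apply: (lt_dom_trans OV) BK.
      have -> : \sum_(l' < n | l' != o0) bN l' * iter l' d z / z =
        (bN o0 + \sum_(l' < n | l' != o0) bN l' * iter l' d z / z - B) - (bN o0 - B) by ring.
      by apply: lt_domB.
    have pE : p.[i%:R] = (\sum_(l' < n | l' != o0) bN l' * ld z ^+ l') / K.
      rewrite horner_poly mulr_suml [RHS]big_mkcond; apply: eq_bigr => u _; rewrite valK.
      have -> : (u != o0) = (0 < u)%N by rewrite lt0n.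
      case: ifP => _; last by rewrite mul0r.
      by rewrite /be lz exprMn; field.
    rewrite pE domx_div // mul1r.
    have -> : \sum_(l' < n | l' != o0) bN l' * ld z ^+ l' =
      \sum_(l' < n | l' != o0) bN l' * iter l' d z / z -
      \sum_(l' < n | l' != o0) bN l' * (iter l' d z / z - ld z ^+ l').
      by rewrite -sumrB; apply: eq_bigr => u _; ring.
    apply: lt_domB => //; apply: lt_dom_sum => // u u0.
    have u1 : (0 < u)%N by rewrite lt0n.
    have : be u ≼ K by exact: (hk (exist _ u u1)).
    have [bu0|bu0] := eqVneq (bN u) 0; first by rewrite bu0 mul0r lt0_dom.
    move=> buK; apply: (lt_dom_trans OV) buK; rewrite /be domM2l //.
    apply: (lt_dom_trans OV) (hz u) _; rewrite lz exprMn -{2}[s' ^+ u]mul1r.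
    by apply: domM; rewrite ?dom_refl // domX1 // dom_nat.
  have := small_values_small_coefs (size_poly _ _) hp (sval k); rewrite coef_poly ltn_ord valK.
  by rewrite (svalP k) /K divff // dom_refl.
have [c4 [g4 [C4 l4]]] := cut_shrink cC C3.
have g40 := cut_neq0 cC C4.
apply: (nd C4).
pose t := g4 / g; have t0 : t != 0 by rewrite mulf_neq0 ?invr_eq0.
have ts : dominatedb (vO VE) (logder VE t) s.
  rewrite ld_div // (_ : _ - _ = (logder VE g4 - e) - (logder VE g - e)); last by ring.
  apply: domB => //; first by apply: h1 C4 _; exact: (lt_trans_dom OVE) l4 l31.
  by apply: (dom_trans OVE) ge _; exact: domW.
have [tau [tau1 tat taus]] : exists tau, [/\ dominatedb (vO VE) 1 tau,
    dominatedb (vO VE) (logder VE t) tau & dominatedb (vO VE) tau s].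
  by exists s; split=> //; [exact: domW | exact: dom_refl].
pose p := psub VE c4 g P; pose b' l : E := p@_U_(l).
have l42 := lt_trans_dom OVE l4 l32.
have cc4 : dominatedb (vO VE) (c4 - c2) g2 := cut_nest cC C2 C4 (domW OVE l42).
have pb4 i := @partial_bound _ VE n P g c2 g2 c4 g4 i g0 g20 g40 l42 cc4 (st2 i).
have b'b l : (b' l = 0 /\ bN l = 0) \/ bN l ~~~ f (b' l).
  case: (pb4 l) => [[Q0|[b0 sm]] _]; case: (pb l) => [[Q0'|[b0' sm']] _].
  - left; have -> : b' l = 0.
      rewrite /b' /p; have -> : (psub VE c4 g P)@_U_(l) = (((psub VE 0 g P)^`M(l)) .@[jet VE (c4 / g)]).
        rewrite -(@psub_coef0 _ VE n (c4 / g) 1) -mderiv_translate psub_comp mulr1 add0r mulrC divfK //.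
        by rewrite mcoeff_deriv mnm0E add0m mulr1n.
      by rewrite Q0 meval0.
    by case: (bb l) => [[]//|/(sim_neq0 OV)]; rewrite fmorph_eq0 => h; move: (h);
       have -> : b l = (((psub VE 0 g P)^`M(l)) .@[jet VE (c3 / g)]);
       [rewrite -(@psub_coef0 _ VE n (c3 / g) 1) -mderiv_translate psub_comp mulr1 add0r mulrC divfK //;
        rewrite mcoeff_deriv mnm0E add0m mulr1n | rewrite Q0 meval0 eqxx].
  - by move: (sim_neq0 OVE sm'); rewrite Q0 meval0 eqxx.
  - by move: (sim_neq0 OVE sm); rewrite Q0' meval0 eqxx.
  right; case: (bb l) => [[e0 _]|h]; first by rewrite -/(b l) e0 eqxx in b0'.
  apply: (sim_trans OV) h _; rewrite (vembed_sim fV).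
  exact: (sim_trans OVE) sm' (sim_sym OVE sm).
have [[b00 bN00]|sm0] := b'b o0; first by move: (sim_neq0l OV b0B); rewrite bN00 eqxx.
have b'0 : b' o0 != 0 by have := sim_neq0 OV sm0; rewrite fmorph_eq0.
have b's (l : 'I_n) : (0 < l)%N -> ~~ dominatedb (vO VE) (b' o0) (b' l * s ^+ l).
  move=> l0; rewrite -(vembed_dom fV) rmorphM rmorphXn /=.
  apply: (@lt_dom_trans _ _ OV B); last first.
    exact: (dom_trans OV) (sim_domr OV b0B) (sim_doml OV sm0).
  case: (b'b l) => [[-> _]|sm]; first by rewrite rmorph0 mul0r lt0_dom.
  apply: (dom_lt_trans OV) (beB l l0); apply: domM; rewrite ?dom_refl //.
  exact: sim_domr.
have pt : psub VE c4 g4 P = psub VE 0 t p.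
  by rewrite psub_comp mulr0 addr0 /t mulrC divfK.
pose L0 : E := (psub VE c4 g4 P)@_U_(o0).
(* As [b' l * s ^+ l ≺ b' o0] for positive [l], the terms with derivatives of [t] are negligible:
   nothing is lost beyond the factor [t]. *)
have L0s : sim (vO VE) L0 (t * b' o0).
  have -> : L0 = \sum_(l < n) iter l VE t * b' l.
    rewrite /L0 pt psub_lin_eq; apply: eq_bigr => l _; rewrite /aff_coef leq0n bin0 mul1r subn0.
    by congr (_ * _); rewrite -mcoeff0_eval mcoeff_deriv mnm0E add0m mulr1n.
  rewrite (bigD1 o0) //= /sim addrAC subrr add0r; apply: lt_dom_sum => //; first by rewrite mulf_neq0.
  move=> l l0; have l1 : (0 < l)%N by rewrite lt0n.
  apply: (@dom_lt_trans _ _ OVE (t * (b' l * s ^+ l))); last by rewrite domM2l // b's.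
  rewrite [b' l * _]mulrC mulrA; apply: domM; rewrite ?dom_refl //.
  apply: (dom_trans OVE) (iter_der_dom l tau1 tat) _; apply: domM; rewrite ?dom_refl //.
  exact: domX.
have [k hk] := dom_max OVE o0 (fun i => (psub VE c4 g4 P)@_U_(i)).
set M : E := (psub VE c4 g4 P)@_U_(k) in hk.
have tbM : dominatedb (vO VE) (t * b' o0) M.
  exact: (dom_trans OVE) (sim_domr OVE L0s) (hk o0).
have M0 : M != 0 by apply: (dom_neq0 OVE tbM); rewrite mulf_neq0.
exists k; rewrite -/M; split; [exact: M0 | exact: hk | move=> m m2].
rewrite pt; apply: (@psub_rest _ VE n t p M (fun i => t * tau ^+ i)) => //.
  by move=> i m'; exact: aff_coefs_dom.
move=> i m' m0'.
have tau0 : tau != 0 by apply: (dom_neq0 OVE tau1); exact: oner_neq0.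
have tt0 : t * tau ^+ i != 0 by rewrite mulf_neq0 ?expf_neq0.
rewrite mulrC -dom_div //; apply: (pb4 i).2 => //; first by rewrite mulf_neq0 ?invr_eq0.
rewrite domx_div //; apply: (dom_trans OVE) _ tbM.
have q0 : g4 / g2 != 0 by rewrite mulf_neq0 ?invr_eq0.
have q1 : ~~ dominatedb (vO VE) 1 (g4 / g2) by rewrite domx_div // mul1r.
apply: (@dom_trans _ _ OVE (b' i * (t * tau ^+ i))).
  rewrite -/(b' i) -mulrA; apply: domM; rewrite ?dom_refl // -{2}[t * _]mul1r.
  by apply: domM; rewrite ?dom_refl //; apply: (domW OVE); exact: ldX_lt0.
rewrite mulrCA; apply: domM; rewrite ?dom_refl //.
have [i00|i1] := posnP i.
  have -> : i = o0 by exact: val_inj.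
  by rewrite mulr1 dom_refl.
apply: (dom_trans OVE) _ (domW OVE (b's i i1)); apply: domM; rewrite ?dom_refl //.
exact: domX.
Qed.

End NoLoss.

(** * Zeros of differential polynomials *)

Section SubfieldOps.
Variables (F : fieldType) (d : F -> F) (A : set F) (sA : diff_subfield d A).
Implicit Types x y : F.
Lemma dsub0 : A 0. Proof. by case: sA => A1 AB _ _; rewrite -(subrr 1); apply: AB. Qed.
Lemma dsub1 : A 1. Proof. by case: sA. Qed.
Lemma dsubN x : A x -> A (- x).
Proof. by case: (sA) => _ AB _ _ Ax; rewrite -sub0r; apply: AB => //; exact: dsub0. Qed.
Lemma dsubB x y : A x -> A y -> A (x - y). Proof. by case: (sA) => _ AB _ _; apply: AB. Qed.
Lemma dsubD x y : A x -> A y -> A (x + y).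
Proof. by move=> Ax Ay; rewrite -[y]opprK; apply: dsubB => //; apply: dsubN. Qed.
Lemma dsubV x : A x -> A x^-1.
Proof. by case: (sA) => A1 _ Ad _ Ax; rewrite -div1r; apply: Ad. Qed.
Lemma dsub_div x y : A x -> A y -> A (x / y). Proof. by case: (sA) => _ _ Ad _; apply: Ad. Qed.
Lemma dsubM x y : A x -> A y -> A (x * y).
Proof. by move=> Ax Ay; rewrite -[y]invrK; apply: dsub_div => //; apply: dsubV. Qed.
Lemma dsub_der x : A x -> A (d x). Proof. by case: (sA) => _ _ _ Ad; apply: Ad. Qed.
Lemma dsub_iter i x : A x -> A (iter i d x).
Proof. by move=> Ax; elim: i => //= i; exact: dsub_der. Qed.
Lemma dsubX x n : A x -> A (x ^+ n).
Proof. by move=> Ax; elim: n => [|n IH]; [exact: dsub1 | rewrite exprS; exact: dsubM]. Qed.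
Lemma dsub_sum (I : Type) (r : seq I) (p : pred I) (f : I -> F) :
  (forall i, p i -> A (f i)) -> A (\sum_(i <- r | p i) f i).
Proof. by move=> h; elim/big_ind: _ => //; [exact: dsub0 | move=> *; exact: dsubD]. Qed.
Lemma dsub_prod (I : Type) (r : seq I) (p : pred I) (f : I -> F) :
  (forall i, p i -> A (f i)) -> A (\prod_(i <- r | p i) f i).
Proof. by move=> h; elim/big_ind: _ => //; [exact: dsub1 | move=> *; exact: dsubM]. Qed.
Lemma dsub_nat n : A n%:R.
Proof. by elim: n => [|n IH]; [exact: dsub0 | rewrite -natr1; apply: dsubD => //; exact: dsub1]. Qed.

Definition mpoly_in n (P : {mpoly F[n]}) := forall m, A P@_m.

Lemma mpoly_inD n (P Q : {mpoly F[n]}) : mpoly_in P -> mpoly_in Q -> mpoly_in (P + Q).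
Proof. by move=> hP hQ m; rewrite mcoeffD; exact: dsubD. Qed.
Lemma mpoly_inM n (P Q : {mpoly F[n]}) : mpoly_in P -> mpoly_in Q -> mpoly_in (P * Q).
Proof. by move=> hP hQ m; rewrite mcoeffM; apply: dsub_sum => k _; exact: dsubM. Qed.
Lemma mpoly_inZ n a (P : {mpoly F[n]}) : A a -> mpoly_in P -> mpoly_in (a *: P).
Proof. by move=> Aa hP m; rewrite mcoeffZ; exact: dsubM. Qed.
Lemma mpoly_inC n a : A a -> mpoly_in (a%:MP : {mpoly F[n]}).
Proof. by move=> Aa m; rewrite mcoeffC; apply: dsubM => //; exact: dsub_nat. Qed.
Lemma mpoly_inX n m : mpoly_in ('X_[m] : {mpoly F[n]}).
Proof. by move=> k; rewrite mcoeffX; exact: dsub_nat. Qed.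

Lemma meval_in n (P : {mpoly F[n]}) (v : 'I_n -> F) : mpoly_in P -> (forall i, A (v i)) ->
  A P.@[v].
Proof.
move=> hP hv; rewrite mevalE; apply: dsub_sum => m _; apply: dsubM => //.
by apply: dsub_prod => i _; exact: dsubX.
Qed.
End SubfieldOps.

Section Zeros.
Variables (F : fieldType) (V : vdf F).
Local Notation "x ≼ y" := (dominatedb (vO V) x y) (at level 70, y at next level).
Local Notation "x ≺ y" := (~~ dominatedb (vO V) y x) (at level 70, y at next level).
Local Notation "x ~~~ y" := (sim (vO V) x y) (at level 70, y at next level).
Local Notation d := (vder V).
Local Notation ld := (logder V).
Local Notation jet := (jet V).
Local Notation psub := (psub V).
Implicit Types x y z c g s e t u : F.
Let OV := vO_ring V.

(** Differential-henselianity relative to a subset [A]: coefficients and solutions both lie in [A].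
    It covers countable submodels and the whole field alike. *)
Record dh_subfield (A : set F) : Prop := DhSubfield {
  dhs_sub : diff_subfield d A;
  dhs_dh : forall n (P : {mpoly F[n.+1]}), (forall m, A P@_m) ->
    (forall m, P@_m ≼ 1) -> P@_0 ≺ 1 -> (exists i, 1 ≼ P@_U_(i)) ->
    exists y, [/\ A y, y ≺ 1 & P.@[jet y] = 0];
  dhs_lin : forall r (a : 'I_r.+1 -> F) b, (forall i, A (a i)) -> A b ->
    (forall i, a i ≼ 1) -> (exists i, 1 ≼ a i) -> b ≼ 1 ->
    exists y, [/\ A y, y ≼ 1 & \sum_(i < r.+1) a i * iter i d y - b ≺ 1] }.

Lemma psub_in (A : set F) (sA : diff_subfield d A) n a b (P : {mpoly F[n]}) : A a -> A b -> mpoly_in A P -> mpoly_in A (psub a b P).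
Proof.
move=> Aa Ab hP; rewrite /psub comp_mpolyEX.
elim/big_ind: _ => [m|Q R|m _]; [by rewrite mcoeff0; exact: (dsub0 sA) | exact: (mpoly_inD sA) |].
apply: (mpoly_inZ sA) => //; rewrite comp_mpolyX.
elim/big_ind: _ => [|Q R|i _]; [exact: (mpoly_inC sA (dsub1 sA)) | exact: (mpoly_inM sA) |].
elim: (m i) => [|k IH]; first exact: (mpoly_inC sA (dsub1 sA)).
rewrite exprS; apply: (mpoly_inM sA) => //; rewrite tnth_mktuple; apply: (mpoly_inD sA).
  by apply: (mpoly_inC sA); exact: (dsub_iter sA).
elim/big_ind: _ => [m'|Q R|l _]; [by rewrite mcoeff0; exact: (dsub0 sA) | exact: (mpoly_inD sA) |].
apply: (mpoly_inZ sA); last exact: (mpoly_inX sA).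
rewrite /aff_coef; case: ifP => _; last exact: (dsub0 sA).
by apply: (dsubM sA); [exact: (dsub_nat sA) | exact: (dsub_iter sA)].
Qed.

Lemma meval_split n (P : {mpoly F[n]}) z (M : F) : z ≼ 1 -> M != 0 ->
  (forall m, (1 < mdeg m)%N -> P@_m ≺ M) ->
  P.@[jet z] - (P@_0 + \sum_(i < n) P@_U_(i) * iter i d z) ≺ M.
Proof.
move=> z1 M0 hP.
pose R := P - (P@_0)%:MP - \sum_(i < n) P@_U_(i) *: 'X_i.
have -> : P.@[jet z] - (P@_0 + \sum_(i < n) P@_U_(i) * iter i d z) = R.@[jet z].
  have e : (\sum_(i < n) P@_U_(i) *: 'X_i).@[jet z] = \sum_(i < n) P@_U_(i) * iter i d z.
    by rewrite raddf_sum /=; apply: eq_bigr => i _; rewrite mevalZ mevalXU.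
  by rewrite /R !mevalB mevalC e opprD addrA.
rewrite mevalE; apply: lt_dom_sum => // m _.
have RE : R@_m ≺ M.
  rewrite /R !mcoeffB mcoeffC raddf_sum /=.
  have -> : \sum_(i < n) (P@_U_(i) *: 'X_i)@_m = \sum_(i < n) P@_U_(i) * (U_(i)%MM == m)%:R.
    by apply: eq_bigr => i _; rewrite mcoeffZ mcoeffX.
  case: (ltngtP (mdeg m) 1) => [|m2|/eqP].
  - rewrite ltnS leqn0 mdeg_eq0 => /eqP ->; rewrite eqxx mulr1 big1 ?subr0 ?subrr ?lt0_dom // => i _.
    by rewrite mnm1_eq0 mulr0.
  - rewrite big1 ?subr0; last first.
      by move=> i _; case: eqP => [e|]; rewrite ?mulr0 //; rewrite -e mdeg1 in m2.
    have -> : (m == 0%MM) = false by apply/negP => /eqP e; rewrite e mdeg0 in m2.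
    by rewrite mulr0 subr0; exact: (hP _ m2).
  rewrite mdeg_eq1 => /existsP[j /eqP ->]; rewrite (bigD1 j) //= eqxx mulr1 big1 ?addr0.
    by rewrite mnm1_eq0 mulr0 subr0 subrr lt0_dom.
  move=> i ij; case: eqP => [e|]; rewrite ?mulr0 //.
  by have := congr1 (fun k : 'X_{1..n} => k i) e; rewrite !mnm1E eqxx eq_sym (negPf ij).
rewrite -[M]mulr1; apply: lt_domM => //; last exact: oner_neq0.
elim/big_ind: _ => [|x y x1 y1|i _]; first exact: dom_refl.
  by rewrite -[1]mulr1; exact: domM.
by apply: domX1 => //; exact: iter_der_dom1.
Qed.

(** After the linear part is normalised, an approximate solution [z0] of the linear equation is
    taken from the residue field; translation by [z0] makes the constant term infinitesimal, which
    is the situation of [dhs_dh]. *)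
Lemma dh_zero A n (P : {mpoly F[n]}) : dh_subfield A -> mpoly_in A P ->
  lin_dom V P 0 1 -> (forall j : 'I_n, (forall i, P@_U_(i) ≼ P@_U_(j)) -> P@_0 ≼ P@_U_(j)) ->
  exists z, [/\ A z, z ≼ 1 & P.@[jet z] = 0].
Proof.
case: n P => [|n] P hA inP; first by case=> -[].
rewrite /lin_dom psub01 => -[j [N0 hl hr]] h0; have {}h0 := h0 j hl.
have sA := dhs_sub hA; set N : F := P@_U_(j) in N0 hl hr h0.
have AN : A N by exact: inP.
pose P' := N^-1 *: P.
have NV x : x ≼ N -> N^-1 * x ≼ 1 by move=> h; rewrite mulrC dom_div // mul1r.
have NVlt x : x ≺ N -> N^-1 * x ≺ 1 by move=> h; rewrite mulrC domx_div // mul1r.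
have in' : mpoly_in A P' by apply: (mpoly_inZ sA) => //; exact: (dsubV sA).
have j1 : P'@_U_(j) = 1 by rewrite mcoeffZ -/N mulVf.
have [z0 [Az0 z01 hz0]] : exists y, [/\ A y, y ≼ 1 &
    \sum_(i < n.+1) P'@_U_(i) * iter i d y - - P'@_0 ≺ 1].
  apply: (dhs_lin hA) => [i|||| ].
  - exact: in'.
  - by apply: (dsubN sA); exact: in'.
  - by move=> i; rewrite mcoeffZ; apply: NV.
  - by exists j; rewrite j1 dom_refl.
  - by rewrite domN // mcoeffZ; apply: NV.
rewrite opprK addrC in hz0.
pose Q := psub z0 1 P'.
have r' m : (1 < mdeg m)%N -> P'@_m ≺ 1 by move=> m2; rewrite mcoeffZ; apply: NVlt; exact: hr.
have n10 : (1 : F) != 0 by exact: oner_neq0.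
have sub := submod_lt V n10; have sub' := submod_dom V 1.
have c' m : P'@_m ≼ 1.
  case: (ltngtP (mdeg m) 1) => [|m2|/eqP].
  - by rewrite ltnS leqn0 mdeg_eq0 => /eqP ->; rewrite mcoeffZ; exact: NV.
  - by apply: (domW OV); exact: r'.
  by rewrite mdeg_eq1 => /existsP[i /eqP ->]; rewrite mcoeffZ; exact: NV.
have Q0 : Q@_0 ≺ 1.
  rewrite psub_coef0; have := meval_split z01 n10 r' => h.
  by rewrite -[_.@[_]](subrK (P'@_0 + \sum_(i < n.+1) P'@_U_(i) * iter i d z0)); exact: lt_domD.
have Qc m : Q@_m ≼ 1.
  rewrite -[Q@_m](subrK P'@_m); apply: domD => //.
  by apply: (@psub_translate _ V _ _ _ _ (mdeg m) sub') => // k _; exact: c'.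
have Qj : 1 ≼ Q@_U_(j).
  have h : Q@_U_(j) - P'@_U_(j) ≺ 1.
    by apply: (@psub_translate _ V _ _ _ _ 1 sub) => //; rewrite mdeg1.
  by rewrite j1 in h; exact: (sim_domr OV h).
have inQ : mpoly_in A Q by apply: (psub_in sA) => //; exact: (dsub1 sA).
have [y [Ay y1 hy]] := dhs_dh hA inQ Qc Q0 (ex_intro _ j Qj).
exists (z0 + y); split; [exact: (dsubD sA) | apply: domD => //; exact: domW |].
move: hy; rewrite psub_eval mul1r mevalZ => /eqP; rewrite mulf_eq0 invr_eq0 (negPf N0) /=.
by move/eqP.
Qed.

(** With a dominant linear part, instability can only mean that the constant term does not strictly
    dominate the linear one. *)
Lemma dh_zero_at A n (P : {mpoly F[n]}) c g : dh_subfield A -> mpoly_in A P -> A c -> A g ->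
  g != 0 -> lin_dom V P c g -> ~ stable V P c g ->
  exists u, [/\ A u, u - c ≼ g & P.@[jet u] = 0].
Proof.
move=> hA inP Ac Ag g0 ld ust; have sA := dhs_sub hA.
have [|||z [Az z1 hz]] := @dh_zero A n (psub c g P) hA.
- exact: psub_in.
- by rewrite /lin_dom psub01.
- move=> j hj; apply/negPn/negP => h; apply: ust => m m0; rewrite -(@psub_coef0 _ V n c g).
  have [j' [N0 hl hr]] := ld.
  case: (ltngtP (mdeg m) 1) => [|m2|/eqP].
  - by rewrite ltnS leqn0 mdeg_eq0 (negPf m0).
  - apply: (lt_trans_dom OV) (hr _ m2) _; exact: (dom_lt_trans OV (hj j')) h.
  by rewrite mdeg_eq1 => /existsP[i /eqP ->]; exact: (dom_lt_trans OV (hj i)) h.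
exists (c + g * z); split; first by apply: (dsubD sA) => //; exact: (dsubM sA).
  by rewrite addrC addKr -{2}[g]mulr1 domM2l.
by rewrite -psub_eval.
Qed.

Definition lin_op n (th : 'I_n -> F) y := \sum_(i < n) th i * iter i d y.
Definition lin_conj n (th : 'I_n -> F) y (l : 'I_n) := \sum_(i < n) aff_coef V y i l * th i.

Lemma lin_op_conjE n (th : 'I_n -> F) y z :
  lin_op th (y * z) = lin_op (lin_conj th y) z.
Proof.
rewrite /lin_op /lin_conj; under [RHS]eq_bigr => l _ do rewrite mulr_suml.
rewrite exchange_big /=; apply: eq_bigr => i _.
rewrite leibniz -(@sum_aff_coef _ V n y i (fun l => iter l d z)) mulr_sumr.
by apply: eq_bigr => l _; ring.
Qed.

Lemma lin_op1 n (th : 'I_n.+1 -> F) : lin_op th 1 = th ord0.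
Proof.
rewrite /lin_op big_ord_recl /= mulr1 big1 ?addr0 // => i _.
by rewrite -[d (iter _ d 1)]/(iter i.+1 d 1) iter_der1 mulr0.
Qed.

Lemma lin_conj_neq0 n (th : 'I_n -> F) y : y != 0 -> (exists i, th i != 0) ->
  exists i, lin_conj th y i != 0.
Proof.
move=> y0 [i0 hi0]; have [i hi hmax] := @arg_maxnP _ i0 (fun i => th i != 0) (fun i : 'I_n => i : nat) hi0.
exists i; rewrite /lin_conj (bigD1 i) //= big1 ?addr0; last first.
  move=> l li; rewrite /aff_coef; case: ifP => il; last by rewrite mul0r.
  have [->|tl] := eqVneq (th l) 0; first by rewrite mulr0.
  by have := hmax l tl; rewrite /= => h; case/eqP: li; apply/val_inj/eqP; rewrite eqn_leq h il.
by rewrite /aff_coef leqnn binn subnn mul1r mulf_neq0.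
Qed.

Lemma der_lt x y : x != 0 -> x ≺ y -> y ≺ 1 -> d x ≺ d y.
Proof.
move=> x0 xy y1; have y0 := lt_dom_neq0 OV xy.
have l1 := ld_gt1 y0 y1; have l0 := lt_dom_neq0 OV l1.
have dy0 : d y != 0 by apply: contra l0 => /eqP e; rewrite /logder e mul0r.
pose q := x / y; have q1 : q ≺ 1 by rewrite domx_div // mul1r.
have xE : x = q * y by rewrite /q divfK.
have -> : d x = d y * (q + d q / ld y).
  rewrite {1}xE derM (derE V y0); field; exact: l0.
rewrite -{1}[d y]mulr1 domM2l //; apply: lt_domD => //.
rewrite domx_div // mul1r; apply: (lt_trans_dom OV) _ l1; exact: v_small.
Qed.

Fixpoint lt_chain (s : seq F) : Prop :=
  match s with
  | [::] => True
  | y :: s' => [/\ y != 0, (forall z, z \in s' -> z ≺ y) & lt_chain s']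
  end.

Lemma lt_chain_map (f : F -> F) (s : seq F) : lt_chain s ->
  (forall y, y \in s -> y != 0 -> f y != 0) ->
  (forall y z, y \in s -> z \in s -> z != 0 -> z ≺ y -> f z ≺ f y) -> lt_chain [seq f y | y <- s].
Proof.
elim: s => //= y s IH [y0 h1 h2] f0 fl.
have nz z : z \in s -> z != 0.
  elim: s h2 {IH h1 f0 fl} => //= x s IH [x0 _ h2]; rewrite in_cons => /orP[/eqP ->//|]; exact: IH.
split; first by apply: f0; rewrite ?in_cons ?eqxx.
- move=> z /mapP[x xs ->]; apply: fl; rewrite ?in_cons ?eqxx ?xs ?orbT //; [exact: nz|exact: h1].
- apply: IH => // [x xs|x z xs zs]; first by apply: f0; rewrite in_cons xs orbT.
  by apply: fl; rewrite in_cons ?xs ?zs orbT.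
Qed.

(** Reduction of order: dividing the kernel elements by the largest one, [y0], and differentiating
    lowers the order of the operator by one and, by [der_lt], keeps the values distinct. *)
Lemma kernel_chain n (th : 'I_n -> F) (s : seq F) : (exists i, th i != 0) -> lt_chain s ->
  (forall y, y \in s -> lin_op th y = 0) -> (size s < n)%N.
Proof.
elim: n th s => [th s [[]]//|n IH th [//|y0 s] ht [y00 hlt ch] hk] /=.
pose B := lin_conj th y0.
have B0 : B ord0 = 0 by rewrite /B -lin_op1 -lin_op_conjE mulr1; apply: hk; rewrite in_cons eqxx.
have [i hi] := lin_conj_neq0 y00 ht.
have nz z : z \in s -> z != 0.
  elim: s ch {hk hlt} => //= x s IHs [x0 _ h2]; rewrite in_cons => /orP[/eqP ->//|]; exact: IHs.
have := IH (fun l => B (lift ord0 l)) [seq d (y / y0) | y <- s]; rewrite size_map ltnS; apply.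
- case: (unliftP ord0 i) => [l e|e]; last by rewrite e -/B B0 eqxx in hi.
  by exists l; rewrite -e.
- have q1 y : y \in s -> y / y0 ≺ 1 by move=> /hlt h; rewrite domx_div // mul1r.
  apply: (@lt_chain_map (fun y => d (y / y0))) => // [y ys y0'|y z ys zs z0 zy].
    have l0 := lt_dom_neq0 OV (ld_gt1 (mulf_neq0 y0' (invr_neq0 y00)) (q1 _ ys)).
    by apply: contra l0 => /eqP e; rewrite /logder e mul0r.
  apply: der_lt; [by rewrite mulf_neq0 ?invr_eq0 | by rewrite domM2r ?invr_eq0 | exact: q1].
move=> _ /mapP[y ys ->]; have := hk y; rewrite in_cons ys orbT => /(_ isT).
rewrite -{1}(divfK y00 y) mulrC lin_op_conjE /lin_op -/B big_ord_recl /= B0 mul0r add0r => e.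
by rewrite -[RHS]e; apply: eq_bigr => l _; rewrite -iterSr.
Qed.

(* exceptional values of a linear operator are values of elements of its kernel *)
Lemma exceptional_kernel A n (th : 'I_n.+1 -> F) y : dh_subfield A -> (forall i, A (th i)) ->
  A y -> y != 0 -> (exists j, lin_conj th y ord0 ≺ lin_conj th y j) ->
  exists2 y', y' ~~~ y & lin_op th y' = 0.
Proof.
move=> hA Ath Ay y0 [j0 hj0]; have sA := dhs_sub hA.
pose B := lin_conj th y.
have [j hj] := dom_max OV j0 B.
have B0 : B ord0 ≺ B j by exact: (lt_dom_trans OV) hj0 (hj j0).
have N0 : B j != 0 := lt_dom_neq0 OV B0.
have AB l : A (B l).
  apply: (dsub_sum sA) => i _; apply: (dsubM sA) => //; rewrite /aff_coef.
  by case: ifP => _; [apply: (dsubM sA); [exact: (dsub_nat sA) | exact: (dsub_iter sA)] | exact: (dsub0 sA)].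
(* The normalised operator conjugated by [y], with its value at 1 as constant term: a zero [e ≺ 1]
   makes [y * (1 + e)] a kernel element. *)
pose P : {mpoly F[n.+1]} := (B ord0 / B j)%:MP + \sum_(l < n.+1) (B l / B j) *: 'X_l.
have PE m : P@_m = (B ord0 / B j) * (m == 0%MM)%:R + \sum_(l < n.+1) (B l / B j) * (U_(l)%MM == m)%:R.
  rewrite mcoeffD mcoeffC raddf_sum /=; congr (_ + _).
  by apply: eq_bigr => l _; rewrite mcoeffZ mcoeffX.
have bl l : B l / B j ≼ 1 by rewrite dom_div // mul1r.
have d1 x (b : bool) : x ≼ 1 -> x * b%:R ≼ 1.
  by move=> x1; case: b; rewrite ?mulr1 // mulr0 dom0x.
have [||||e [_ e1 he]] := @dhs_dh A hA n P.
- move=> m; rewrite PE; apply: (dsubD sA).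
    by apply: (dsubM sA); [exact: (dsub_div sA) | exact: (dsub_nat sA)].
  by apply: (dsub_sum sA) => l _; apply: (dsubM sA); [exact: (dsub_div sA) | exact: (dsub_nat sA)].
- move=> m; rewrite PE; apply: domD => //; first exact: d1.
  by apply: dom_sum => // l _; exact: d1.
- rewrite PE eqxx mulr1 big1 ?addr0; last by move=> l _; rewrite mnm1_eq0 mulr0.
  by rewrite domx_div // mul1r.
- exists j; rewrite PE mnm1_eq0 mulr0 add0r (bigD1 j) //= eqxx mulr1 divff // big1 ?addr0 ?dom_refl //.
  move=> l lj; case: eqP => [e|]; rewrite ?mulr0 //.
  by have := congr1 (fun k : 'X_{1..n.+1} => k l) e; rewrite !mnm1E eqxx eq_sym (negPf lj).
exists (y * (1 + e)).
  by rewrite /sim mulrDr mulr1 addrC addKr -{1}[y]mulr1 domM2l.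
have linD a b : lin_op B (a + b) = lin_op B a + lin_op B b.
  by rewrite /lin_op -big_split; apply: eq_bigr => i _; rewrite iter_derD mulrDr.
rewrite lin_op_conjE -/B linD lin_op1; move: he; rewrite mevalD mevalC raddf_sum /= => he.
have -> : lin_op B e = B j * (\sum_(l < n.+1) ((B l / B j) *: 'X_l).@[jet e]).
  rewrite mulr_sumr; apply: eq_bigr => l _; rewrite mevalZ mevalXU mulrA mulrCA.
  by rewrite mulfV // mulr1.
have -> : \sum_(l < n.+1) ((B l / B j) *: 'X_l).@[jet e] = - (B ord0 / B j).
  by apply/eqP; rewrite -addr_eq0 addrC; apply/eqP.
by field.
Qed.

(** If [u] and [u + y] are zeros, the linear part of [P(u + y Z)] nearly cancels at [Z = 1], so its
    coefficient of order zero is not dominant and [y] has the value of a kernel element of the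
    linearisation at [u]. [kernel_chain] bounds the number of such values. *)
Lemma zero_chain A n (P : {mpoly F[n.+1]}) u g (s : seq F) : dh_subfield A -> mpoly_in A P ->
  A u -> g != 0 -> lin_dom V P u g -> P.@[jet u] = 0 -> lt_chain s ->
  (forall y, y \in s -> [/\ A y, y ≼ g & P.@[jet (u + y)] = 0]) -> (size s < n.+1)%N.
Proof.
move=> hA inP Au g0 ldP Pu ch hs; have sA := dhs_sub hA.
have nz z : z \in s -> z != 0.
  elim: s ch {hs} => //= x s IHs [x0 _ h2]; rewrite in_cons => /orP[/eqP ->//|]; exact: IHs.
pose th i := (P^`M(i)).@[jet u].
have Ath i : A (th i).
  apply: (meval_in sA); last by move=> l; exact: (dsub_iter sA).
  by move=> m; rewrite mcoeff_deriv -mulr_natr; apply: (dsubM sA); [exact: inP | exact: (dsub_nat sA)].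
have cE y l : (psub u y P)@_U_(l) = lin_conj th y l by rewrite psub_lin_eq.
have exc y : y \in s -> exists2 y', y' ~~~ y & lin_op th y' = 0.
  move=> ys; have [Ay yg Py] := hs y ys; have y0 := nz y ys.
  apply: (exceptional_kernel hA) => //.
  have [|j [N0 hl hr]] := lin_dom_mono g0 y0 ldP yg (c' := u); first by rewrite subrr dom0x.
  exists j; rewrite -!cE.
  have := meval_split (dom_refl OV 1) N0 hr; rewrite psub_eval mulr1 Py psub_coef0 Pu sub0r add0r.
  rewrite lt_domN // (_ : \sum_(i < n.+1) _ = lin_op (fun i => (psub u y P)@_U_(i)) 1) // lin_op1.
  exact.
have th0 : exists i, th i != 0.
  have [j [N0 _ _]] := ldP; apply: contrapT => h; case/eqP: N0.
  rewrite cE /lin_conj big1 // => i _.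
  by have [->|e] := eqVneq (th i) 0; [rewrite mulr0 | case: h; exists i].
pose k y : F := if pselect (y \in s) is left ys then s2val (cid2 (exc y ys)) else 0.
have ks y : y \in s -> k y ~~~ y /\ lin_op th (k y) = 0.
  by move=> ys; rewrite /k; case: pselect => // ys'; case: cid2.
rewrite -(size_map k); apply: (@kernel_chain n.+1 th) => //; last first.
  by move=> _ /mapP[y ys ->]; case: (ks y ys).
apply: lt_chain_map => // [y ys _|y z ys zs z0 zy]; first exact (sim_neq0l OV (ks y ys).1).
apply: (dom_lt_trans OV (sim_doml OV (ks z zs).1)).
exact: (lt_dom_trans OV) zy (sim_domr OV (ks y ys).1).
Qed.

End Zeros.

Section ZeroInCut.
Variables (E F : fieldType) (VE : vdf E) (V : vdf F) (f : {rmorphism E -> F}).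
Hypothesis fV : vembed VE V f.
Local Notation "x ≼ y" := (dominatedb (vO V) x y) (at level 70, y at next level).
Local Notation "x ≺ y" := (~~ dominatedb (vO V) y x) (at level 70, y at next level).
Let OV := vO_ring V.
Let OVE := vO_ring VE.

Lemma stable_map_inv n (P : {mpoly E[n]}) (c g : E) :
  stable V (map_mpoly f P) (f c) (f g) -> stable VE P c g.
Proof.
move=> st m m0; have := st m m0; rewrite -(map_psub _ _ _ fV) mcoeff_map_mpoly.
by rewrite -(map_mpoly_eval _ _ fV) (vembed_dom fV).
Qed.

(** Every small ball of the cut contains a zero. If each zero left the cut at some later ball, zeros
    collected from ever smaller balls would have arbitrarily long chains of distances to the last
    one, against [zero_chain]. *)
Lemma zero_in_cut (A : set F) (C : E -> E -> Prop) n (P : {mpoly E[n]}) c0 g0 :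
  dh_subfield V A -> (forall x, A (f x)) -> cut VE C ->
  C c0 g0 -> lin_dom VE P c0 g0 -> (forall c g, C c g -> ~ stable VE P c g) ->
  exists u, [/\ A u, (forall c g, C c g -> u - f c ≼ f g) & (map_mpoly f P).@[jet V u] = 0].
Proof.
case: n P => [|n] P hA Af cC C0 ld0 ust; first by case: ld0 => -[].
have sA := dhs_sub hA.
apply: contrapT => no.
pose Pf := map_mpoly f P.
have inP : mpoly_in A Pf by move=> m; rewrite mcoeff_map_mpoly; exact: Af.
have zero c g : C c g -> dominatedb (vO VE) g g0 ->
    lin_dom V Pf (f c) (f g) /\ exists u, [/\ A u, u - f c ≼ f g & Pf.@[jet V u] = 0].
  move=> Cc gg; have g00 := cut_neq0 cC C0; have g0' := cut_neq0 cC Cc.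
  have ldc : lin_dom V Pf (f c) (f g).
    by apply: (lin_dom_map fV); apply: lin_dom_mono ld0 gg (cut_nest cC C0 Cc gg).
  split=> //; apply: (dh_zero_at hA) => //; first by rewrite fmorph_eq0.
  by move/stable_map_inv; exact: ust.
have claim k : forall c g, C c g -> dominatedb (vO VE) g g0 -> exists u s,
    [/\ [/\ A u, u - f c ≼ f g, Pf.@[jet V u] = 0 & lin_dom V Pf (f c) (f g)], size s = k, lt_chain V s &
    forall y, y \in s -> [/\ A y, y ≼ f g & Pf.@[jet V (u + y)] = 0]].
  elim: k => [|k IH] c g Cc gg.
    by have [ldc [u [Au h1 h2]]] := zero _ _ Cc gg; exists u, [::]; split.
  have [ldc [u0 [Au0 h1 h2]]] := zero _ _ Cc gg.
  have [c1 [g1 [C1 ex]]] : exists c1 g1, C c1 g1 /\ ~~ (u0 - f c1 ≼ f g1).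
    apply: contrapT => h; apply: no; exists u0; split=> // c' g' C'.
    by apply/negPn/negP => hh; apply: h; exists c', g'.
  have [c2 [g2 [C2 l2 l21]]] := cut_common cC Cc C1.
  have l2' : f g2 ≺ f g1 by rewrite (vembed_dom fV).
  have l2'' : f g2 ≺ f g by rewrite (vembed_dom fV).
  have cc21 : f c2 - f c1 ≼ f g1.
    by rewrite -rmorphB (vembed_dom fV); exact: (cut_nest cC C1 C2 (domW OVE l21)).
  have ex2 : f g2 ≺ u0 - f c2.
    apply/negP => h; case/negP: ex; rewrite (_ : u0 - f c1 = (u0 - f c2) + (f c2 - f c1)); last by rewrite addrA subrK.
    apply: domD => //; first by apply: (dom_trans OV) h (domW OV l2').
  have [u [s [[Au hu1 hu2 ldu] ss chs hs]]] := IH c2 g2 C2 (domW OVE (lt_dom_trans OVE l2 gg)).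
  have y0E : u0 - u = (u0 - f c2) - (u - f c2) by rewrite opprB addrA subrK.
  have ylt : f g2 ≺ u0 - u.
    apply/negP => h; case/negP: ex2; rewrite (_ : u0 - f c2 = (u0 - u) + (u - f c2)).
      exact: domD.
    by rewrite addrA subrK.
  exists u, ((u0 - u) :: s); split.
  - split=> //.
    rewrite (_ : u - f c = (u - f c2) + (f c2 - f c)); last (by rewrite addrA subrK); apply: domD => //.
      exact: (dom_trans OV) hu1 (domW OV l2'').
    by rewrite -rmorphB (vembed_dom fV); exact: (cut_nest cC Cc C2 (domW OVE l2)).
  - by rewrite /= ss.
  - split=> //; first exact: (lt_dom_neq0 OV ylt).
    by move=> z /hs[_ zg _]; exact: (dom_lt_trans OV zg).
  move=> y; rewrite in_cons => /orP[/eqP ->|/hs[Ay yg Py]]; last first.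
    by split=> //; exact: (dom_trans OV) yg (domW OV l2'').
  split; [exact: (dsubB sA)| |by rewrite addrC subrK].
  rewrite (_ : u0 - u = (u0 - f c) - (u - f c)); last by rewrite opprB addrA subrK.
  apply: domB => //.
  rewrite (_ : u - f c = (u - f c2) + (f c2 - f c)); last (by rewrite addrA subrK); apply: domD => //.
    exact: (dom_trans OV) hu1 (domW OV l2'').
  by rewrite -rmorphB (vembed_dom fV); exact: (cut_nest cC Cc C2 (domW OVE l2)).
have [u [s [[Au hu1 hu2 ldu] ss chs hs]]] := claim n.+1 c0 g0 C0 (dom_refl OVE _).
have fg0 : f g0 != 0 by rewrite fmorph_eq0 (cut_neq0 cC C0).
have ldu' : lin_dom V Pf u (f g0) by apply: lin_dom_mono ldu (dom_refl OV _) hu1.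
by have := zero_chain hA inP Au fg0 ldu' hu2 chs hs; rewrite ss ltnn.
Qed.

End ZeroInCut.

(** * Weighted degrees and minimal polynomials *)

Section Weights.
Variable n : nat.
Implicit Types (w : 'I_n -> nat) (m : 'X_{1..n}).

Definition wdeg w m := (\sum_(i < n) w i * m i)%N.

Lemma wdegD w m m' : wdeg w (m + m')%MM = (wdeg w m + wdeg w m')%N.
Proof. by rewrite /wdeg -big_split; apply: eq_bigr => i _; rewrite mnmDE mulnDr. Qed.
Lemma wdeg0 w : wdeg w 0%MM = 0%N.
Proof. by rewrite /wdeg big1 // => i _; rewrite mnm0E muln0. Qed.
Lemma wdegU w i : wdeg w U_(i)%MM = w i.
Proof.
rewrite /wdeg (bigD1 i) //= mnm1E eqxx muln1 big1 ?addn0 // => j ji.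
by rewrite mnm1E eq_sym (negPf ji) muln0.
Qed.
Lemma wdeg_mdeg m : wdeg (fun=> 1%N) m = mdeg m.
Proof. by rewrite mdegE /wdeg; apply: eq_bigr => i _; rewrite mul1n. Qed.
Lemma wdeg_mono w w' m : (forall i, w i <= w' i)%N -> (wdeg w m <= wdeg w' m)%N.
Proof. by move=> h; apply: leq_sum => i _; rewrite leq_mul2r h orbT. Qed.

Variable R : comNzRingType.
Implicit Types P Q : {mpoly R[n]}.

Definition wle w (e : nat) P := forall m, m \in msupp P -> (wdeg w m <= e)%N.

Lemma wleS w e e' P : (e <= e')%N -> wle w e P -> wle w e' P.
Proof. by move=> h hP m /hP h'; exact: leq_trans h. Qed.
Lemma wle_weight w w' e P : (forall i, w i <= w' i)%N -> wle w' e P -> wle w e P.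
Proof. by move=> h hP m /hP; apply: leq_trans; exact: wdeg_mono. Qed.
Lemma wle0 w e : wle w e (0 : {mpoly R[n]}).
Proof. by move=> m; rewrite -mpolyC0 msupp0. Qed.
Lemma wleC w e (c : R) : wle w e (c%:MP : {mpoly R[n]}).
Proof. by move=> m; rewrite msuppC; case: ifP => // _; rewrite mem_seq1 => /eqP ->; rewrite wdeg0. Qed.
Lemma wleX w e m : (wdeg w m <= e)%N -> wle w e ('X_[m] : {mpoly R[n]}).
Proof. by move=> h m'; rewrite msuppX mem_seq1 => /eqP ->. Qed.
Lemma wleD w e P Q : wle w e P -> wle w e Q -> wle w e (P + Q).
Proof. by move=> hP hQ m /msuppD_le; rewrite mem_cat => /orP[/hP|/hQ]. Qed.
Lemma wleN w e P : wle w e P -> wle w e (- P).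
Proof. by move=> hP m; rewrite mcoeff_msupp mcoeffN oppr_eq0 -mcoeff_msupp; exact: hP. Qed.
Lemma wleB w e P Q : wle w e P -> wle w e Q -> wle w e (P - Q).
Proof. by move=> hP hQ; apply: wleD => //; exact: wleN. Qed.
Lemma wleZ w e c P : wle w e P -> wle w e (c *: P).
Proof. by move=> hP m /msuppZ_le; exact: hP. Qed.
Lemma wleM w e f P Q : wle w e P -> wle w f Q -> wle w (e + f) (P * Q).
Proof. by move=> hP hQ m /msuppM_le/allpairsP[[a b] /= [/hP ha /hQ hb ->]]; rewrite wdegD leq_add. Qed.
Lemma wle_sum w e (I : Type) (r : seq I) (p : pred I) (f : I -> {mpoly R[n]}) :
  (forall i, p i -> wle w e (f i)) -> wle w e (\sum_(i <- r | p i) f i).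
Proof. by move=> h; elim/big_ind: _ => //; [exact: wle0 | move=> *; exact: wleD]. Qed.

Lemma wle_deriv w e i P : wle w e P -> wle w (e - w i) P^`M(i).
Proof.
move=> hP m; rewrite mcoeff_msupp mcoeff_deriv => h.
have /hP : (m + U_(i))%MM \in msupp P.
  by rewrite mcoeff_msupp; apply: contra h => /eqP ->; rewrite mul0rn.
by rewrite wdegD wdegU; lia.
Qed.

Lemma wle_deriv0 w i P : (0 < w i)%N -> wle w 0 P -> P^`M(i) = 0.
Proof.
move=> wi hP; apply/mpolyP => m; rewrite mcoeff0 mcoeff_deriv.
have [->|h] := eqVneq (P@_(m + U_(i))) 0; first by rewrite mul0rn.
have /hP : (m + U_(i))%MM \in msupp P by rewrite mcoeff_msupp.
by rewrite wdegD wdegU; lia.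
Qed.

Lemma wle_const P : wle (fun=> 1%N) 0 P -> P = (P@_0)%:MP.
Proof.
move=> h; apply/mpolyP => m; rewrite mcoeffC; have [->|m0] := eqVneq m 0%MM; first by rewrite mulr1.
rewrite mulr0; apply/eqP; rewrite mcoeff_eq0; apply/negP => /h.
by rewrite wdeg_mdeg leqn0 mdeg_eq0 (negPf m0).
Qed.

(** 0/1 weights: [wle (above r) 0 P] says that no variable beyond [r] occurs, and then
    [wle (atleast r) e P] bounds the degree in the variable [r]. All measures of complexity become
    weighted degrees with one calculus. *)
Definition above (r : 'I_n) (i : 'I_n) : nat := (r < i)%N.
Definition atleast (r : 'I_n) (i : 'I_n) : nat := (r <= i)%N.

Lemma lead_split (r : 'I_n) e P : wle (above r) 0 P -> wle (atleast r) e P ->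
  exists J P', [/\ P = J * 'X_r ^+ e + P', wle (atleast r) 0 J,
    wle (above r) 0 P' & forall e', e = e'.+1 -> wle (atleast r) e' P'].
Proof.
move=> h1 h2; pose J := \sum_(m <- msupp P | m r == e) P@_m *: 'X_[(m - U_(r) *+ e)%MM].
pose P' := \sum_(m <- msupp P | m r != e) P@_m *: 'X_[m].
have wE m : m \in msupp P -> wdeg (atleast r) m = m r.
  move=> /h1; rewrite leqn0 => /eqP h.
  rewrite /wdeg (bigD1 r) //= /atleast leqnn mul1n big1 ?addn0 // => i ir.
  case: (leqP r i) => // ri; rewrite mul1n.
  have : (above r i * m i <= wdeg (above r) m)%N by rewrite /wdeg (bigD1 i) //= leq_addr.
  rewrite h /above; have -> : (r < i)%N = true by rewrite ltn_neqAle ri andbT eq_sym.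
  by rewrite mul1n leqn0 => /eqP.
have subm m : m \in msupp P -> wdeg (atleast r) (m - U_(r) *+ e)%MM = (m r - e)%N.
  move=> mP; rewrite -(wE m mP) /wdeg (bigD1 r) //= [in RHS](bigD1 r) //= /atleast leqnn !mul1n.
  rewrite mnmBE mulmnE mnm1E eqxx mul1n.
  have -> : (\sum_(i < n | i != r) (r <= i) * (m - U_(r) *+ e)%MM i = 0)%N.
    apply: big1 => i ir; rewrite mnmBE mulmnE mnm1E eq_sym (negPf ir) mul0n subn0; case: (leqP r i) => // ri.
    have := h1 m mP; rewrite leqn0 /wdeg sum_nat_eq0 => /forallP/(_ i); rewrite /above.
    have -> : (r < i)%N = true by rewrite ltn_neqAle ri andbT eq_sym.
    by move=> /eqP.
  have -> // : (\sum_(i < n | i != r) (r <= i) * m i = 0)%N.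
    have := wE m mP; rewrite /wdeg (bigD1 r) //= /atleast leqnn mul1n => /eqP.
    by rewrite -{2}[m r]addn0 eqn_add2l => /eqP.
  by rewrite !addn0.
exists J, P'; split.
- rewrite [LHS]mpolyE (bigID (fun m : 'X_{1..n} => m r == e)) /=; congr (_ + _).
  rewrite mulr_suml [LHS]big_seq_cond [RHS]big_seq_cond; apply: eq_bigr => m /andP[mP /eqP me].
  rewrite -scalerAl mpolyXn -mpolyXD; congr (_ *: 'X_[_]).
  by rewrite submK //; apply/mnm_lepP => i; rewrite mulmnE mnm1E; case: eqP => [<-|_]; lia.
- rewrite /J big_seq_cond; apply: wle_sum => m /andP[mP /eqP me]; apply/wleZ/wleX.
  by rewrite subm // me subnn.
- rewrite /P' big_seq_cond; apply: wle_sum => m /andP[mP _]; apply/wleZ/wleX; exact: h1.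
- move=> e' ee; rewrite /P' big_seq_cond; apply: wle_sum => m /andP[mP me]; apply/wleZ/wleX.
  by have := h2 m mP; rewrite wE // leq_eqVlt (negPf me) /= ee ltnS.
Qed.

(* a bad polynomial of minimal order, then degree in its leading variable, then total degree *)
Definition minimal_bad (B : {mpoly R[n]} -> Prop) (r : 'I_n) d D P :=
  [/\ [/\ B P, wle (above r) 0 P, wle (atleast r) d.+1 P & wle (fun=> 1%N) D.+1 P],
      forall Q, B Q -> wle (above r) 0 Q -> ~ wle (atleast r) d Q &
      forall Q, B Q -> wle (above r) 0 Q -> wle (atleast r) d.+1 Q -> ~ wle (fun=> 1%N) D Q].

(** Three successive minimisations. No minimum is 0, since the polynomial would be constant or
    contradict the previous minimum; hence the successors in [minimal_bad]. *)
Lemma minimal_bad_exists (B : {mpoly R[n]} -> Prop) : (exists P, B P) ->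
  (forall P, B P -> ~ wle (fun=> 1%N) 0 P) -> exists r d D P, minimal_bad B r d D P.
Proof.
move=> [P0 B0] Bc.
have bound w P : exists e, wle w e P.
  exists (\sum_(m <- msupp P) wdeg w m)%N => m mP.
  by rewrite (bigD1_seq m) ?msupp_uniq //= leq_addr.
pose ex1 r := `[< exists2 P, B P & wle (fun i : 'I_n => (r <= i)%N : nat) 0 P >].
have h1 : exists r, ex1 r.
  exists n; apply/asboolP; exists P0 => // m _; rewrite /wdeg big1 // => i _.
  by rewrite leqNgt ltn_ord.
case: (ex_minnP h1) => -[|r] /asboolP[P1 B1 w1] min1; first by case: (Bc _ B1).
have rn : (r < n)%N.
  rewrite ltnNge; apply/negP => nr.
  suff /min1 : ex1 r by rewrite ltnn.
  apply/asboolP; exists P1 => // m _; rewrite /wdeg big1 // => i _.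
  by rewrite leqNgt (leq_trans (ltn_ord i) nr).
pose r0 := Ordinal rn.
have {}w1 : wle (above r0) 0 P1 by exact: w1.
pose ex2 d := `[< exists P, [/\ B P, wle (above r0) 0 P & wle (atleast r0) d P] >].
have h2 : exists d, ex2 d.
  by have [e he] := bound (atleast r0) P1; exists e; apply/asboolP; exists P1.
case: (ex_minnP h2) => -[|d] /asboolP[P2 [B2 w2 v2]] min2.
  by suff /min1 : ex1 r; [rewrite ltnn | apply/asboolP; exists P2].
pose ex3 D := `[< exists P, [/\ B P, wle (above r0) 0 P, wle (atleast r0) d.+1 P & wle (fun=> 1%N) D P] >].
have h3 : exists D, ex3 D.
  by have [e he] := bound (fun=> 1%N) P2; exists e; apply/asboolP; exists P2.
case: (ex_minnP h3) => -[|D] /asboolP[P3 [B3 w3 v3 u3]] min3; first by case: (Bc _ B3).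
exists r0, d, D, P3; split=> // [Q BQ wQ vQ|Q BQ wQ vQ uQ].
  by suff /min2 : ex2 d; [rewrite ltnn | apply/asboolP; exists Q].
by suff /min3 : ex3 D; [rewrite ltnn | apply/asboolP; exists Q].
Qed.
End Weights.

Section PsubWeights.
Variables (F : fieldType) (V : vdf F) (n : nat).

(** The derivative of order [i] of [a + b Z] involves only variables of order at most [i], so
    weights that increase with the order are not raised. *)
Lemma wle_psub (w : 'I_n -> nat) e (P : {mpoly F[n]}) a b :
  (forall i j : 'I_n, (i <= j)%N -> (w i <= w j)%N) -> wle w e P -> wle w e (psub V a b P).
Proof.
move=> wm hP; rewrite /psub comp_mpolyEX big_seq; apply: wle_sum => m mP; apply: wleZ.
apply: wleS (hP m mP) _; rewrite comp_mpolyX /wdeg.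
elim/big_ind2: _ => [|p x q y|i _]; [exact: wleC | exact: wleM |].
elim: (m i) => [|k IH]; first by rewrite muln0 expr0; exact: wleC.
rewrite mulnS exprS; apply: wleM => //; rewrite tnth_mktuple; apply: wleD; first exact: wleC.
apply: wle_sum => l _; rewrite /aff_coef; case: ifP => li; last by rewrite scale0r; exact: wle0.
by apply/wleZ/wleX; rewrite wdegU wm.
Qed.

Lemma above_mono (r i j : 'I_n) : (i <= j)%N -> (above r i <= above r j)%N.
Proof. by rewrite /above => ij; case: (ltnP r i) => // ri; rewrite (leq_trans ri ij). Qed.
Lemma atleast_mono (r i j : 'I_n) : (i <= j)%N -> (atleast r i <= atleast r j)%N.
Proof. by rewrite /atleast => ij; case: (leqP r i) => // ri; rewrite (leq_trans ri ij). Qed.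

Definition unstable_on (C : F -> F -> Prop) (P : {mpoly F[n]}) := P != 0 /\ ~ stable_on V C P.

Lemma unstable_nonconst C P : cut V C -> unstable_on C P -> ~ wle (fun=> 1%N) 0 P.
Proof.
move=> cC [P0 us] /wle_const PE; apply: us; have [c [g Cc]] := cut_ne cC; exists c, g; split=> // m m0.
have p0 : (P@_0 : F) != 0 by apply: contra P0 => /eqP e; rewrite PE e mpolyC0.
by rewrite PE /psub comp_mpolyC mcoeffC mevalC (negPf m0) mulr0 (lt0_dom (vO_ring V)).
Qed.

Lemma nonconst_coef (P : {mpoly F[n]}) : ~ wle (fun=> 1%N) 0 P -> exists m, m != 0%MM /\ (P@_m : F) != 0.
Proof.
move=> h; apply: contrapT => h'; apply: h => m; rewrite mcoeff_msupp wdeg_mdeg leqn0 mdeg_eq0 => Pm.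
by apply/negPn/negP => m0; apply: h'; exists m.
Qed.

(** A partial derivative of a conjugate of [P] vanishes beyond the leading variable [r], has smaller
    degree in it at [r], and smaller total degree below [r]; minimality then makes it stable unless
    it is zero. *)
Lemma minimal_partials_stable C r d D P : cut V C -> minimal_bad (unstable_on C) r d D P ->
  partials_stable V C P.
Proof.
move=> cC [[BP h1 h2 h3] mind minD] g i g0 Q; have [->|Q0] := eqVneq Q 0; [by left | right].
pose Q' := psub V 0 g^-1 Q; have gV0 : g^-1 != 0 by rewrite invr_eq0.
suff [c [g' [Cc st]]] : stable_on V C Q'.
  exists c, g'; split=> // m m0; have := st m m0.
  by rewrite /Q' psub_comp psub_eval !add0r ![g^-1 * _]mulrC.
apply: contrapT => us; have BQ : unstable_on C Q' by split=> //; rewrite psub_eq0.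
have q1 : wle (above r) 0 Q'.
  apply: wle_psub; first exact: above_mono.
  by have := @wle_deriv _ _ (above r) 0 i _ (@wle_psub (above r) 0%N P 0 g (@above_mono r) h1).
case: (ltngtP r i) => ri.
- by move: Q0; rewrite /Q (@wle_deriv0 _ _ (above r)) ?eqxx /above ?ri //; apply: wle_psub => //; exact: above_mono.
- apply: (minD _ BQ q1).
    apply: wle_psub; first exact: atleast_mono.
    apply: wleS (leq_subr (atleast r i) _) _; apply: wle_deriv; apply: wle_psub => //; exact: atleast_mono.
  apply: wle_psub => //; have -> : D = (D.+1 - 1)%N by rewrite subn1.
  apply: (@wle_deriv _ _ (fun=> 1%N) D.+1).
  exact: wle_psub.
apply: (mind _ BQ q1); apply: wle_psub; first exact: atleast_mono.
have -> : d = (d.+1 - atleast r i)%N by rewrite /atleast ri leqnn subn1.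
by apply: wle_deriv; apply: wle_psub => //; exact: atleast_mono.
Qed.
End PsubWeights.

(** * Subfields as fields *)

Section SubfieldType.
Variable F : fieldType.

Record sfield := Sfield { sf_set :> set F;
  sf_ax : [/\ sf_set 1, forall x y, sf_set x -> sf_set y -> sf_set (x - y) &
    forall x y, sf_set x -> sf_set y -> sf_set (x / y)] }.

Variable S : sfield.
Definition sf_pred : {pred F} := fun x => `[< sf_set S x >].
Lemma sf_closed : divring_closed sf_pred.
Proof.
have [h1 hB hV] := sf_ax S; split=> [|x y /asboolP hx /asboolP hy|x y /asboolP hx /asboolP hy].
- exact/asboolP.
- by apply/asboolP; exact: hB.
- by apply/asboolP; exact: hV.
Qed.
HB.instance Definition _ := GRing.isDivringClosed.Build F sf_pred sf_closed.

Record sf_type := SfType { sf_val : F; sf_valP : sf_val \in sf_pred }.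
HB.instance Definition _ := [isSub for sf_val].
HB.instance Definition _ := [Choice of sf_type by <:].
HB.instance Definition _ := [SubChoice_isSubUnitRing of sf_type by <:].
HB.instance Definition _ := [SubNzRing_isSubComNzRing of sf_type by <:].
HB.instance Definition _ := [SubComUnitRing_isSubIntegralDomain of sf_type by <:].
HB.instance Definition _ := [SubIntegralDomain_isSubField of sf_type by <:].

Definition sf_field : fieldType := sf_type.
Definition sf_inj : {rmorphism sf_field -> F} := \val.

Lemma sf_injP (x : sf_field) : sf_set S (sf_inj x). Proof. exact/asboolP/(sf_valP x). Qed.
Lemma sf_lift x : sf_set S x -> exists e, sf_inj e = x.
Proof. by move=> /asboolP h; exists (SfType h). Qed.
End SubfieldType.
Arguments sf_inj {F S}.

Section Pullback.
Variables (E F : fieldType) (V : vdf F) (f : {rmorphism E -> F}) (dE : E -> E).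
Hypothesis fd : forall x, f (dE x) = V (f x).

Let fO : set E := [set x | vO V (f x)].
Let fI : injective f := fmorph_inj f.

Lemma pull_ax : derivation dE.
Proof. by split=> x y; apply: fI; rewrite !(rmorphD, rmorphM, fd) ?(derD, derM). Qed.
Lemma pull_ring : valuation_ring fO.
Proof.
have [O1 OB OM OV] := vO_ring V; split; rewrite /fO /=.
- by rewrite rmorph1.
- by move=> x y; rewrite rmorphB; exact: OB.
- by move=> x y; rewrite rmorphM; exact: OM.
- by move=> x x0; rewrite fmorphV; apply: OV; rewrite fmorph_eq0.
Qed.
Lemma pull_dom x y : dominatedb fO x y = dominatedb (vO V) (f x) (f y).
Proof.
have [->|y0] := eqVneq y 0.
  by rewrite rmorph0 !domx0 ?fmorph_eq0 //; [exact: vO_ring | exact: pull_ring].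
have OF := vO_ring V; have OE := pull_ring.
by rewrite !domP ?fmorph_eq0 // -fmorph_div.
Qed.
Lemma pull_ld x : f (logder dE x) = logder V (f x).
Proof. by rewrite /logder fmorph_div fd. Qed.

Definition pull_vdf : vdf E.
Proof.
refine (@Vdf E dE fO pull_ax pull_ring _ _ _ _ _).
- move=> n; have [h1 h2] := vO_nat V n; split.
    by rewrite -(fmorph_eq0 f) rmorph_nat.
  by rewrite /fO /= fmorphV rmorph_nat.
- by move=> x; rewrite /fO /= fd; exact: vO_der.
- by move=> x; rewrite !pull_dom rmorph1 fd; exact: v_small.
- by move=> x; rewrite !pull_dom rmorph1 pull_ld -(fmorph_eq0 f); exact: v_log.
- by move=> x y; rewrite !pull_dom rmorph1 !pull_ld -(fmorph_eq0 f); exact: v_mono.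
Defined.

Lemma pull_vembed : vembed pull_vdf V f. Proof. by split. Qed.
End Pullback.

(** * Partial isomorphisms *)

Section Evaluation.
Variables (E F : fieldType) (f : {rmorphism E -> F}).

(** The point is a sequence indexed by [nat], so that polynomials in different numbers of variables
    are evaluated at the same point and made compatible by [resize]. *)
Definition ev n (P : {mpoly E[n]}) (b : nat -> F) : F := (map_mpoly f P).@[fun i : 'I_n => b i].

Lemma evD n (P Q : {mpoly E[n]}) b : ev (P + Q) b = ev P b + ev Q b.
Proof. by rewrite /ev rmorphD mevalD. Qed.
Lemma evN n (P : {mpoly E[n]}) b : ev (- P) b = - ev P b.
Proof. by rewrite /ev rmorphN mevalN. Qed.
Lemma evB n (P Q : {mpoly E[n]}) b : ev (P - Q) b = ev P b - ev Q b.
Proof. by rewrite evD evN. Qed.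
Lemma evM n (P Q : {mpoly E[n]}) b : ev (P * Q) b = ev P b * ev Q b.
Proof. by rewrite /ev rmorphM mevalM. Qed.
Lemma evC n (c : E) b : ev (c%:MP : {mpoly E[n]}) b = f c.
Proof. by rewrite /ev map_mpolyC mevalC. Qed.
Lemma evX n (i : 'I_n) b : ev ('X_i : {mpoly E[n]}) b = b i.
Proof. by rewrite /ev map_mpolyX mevalXU. Qed.

Lemma ev0 n b : ev (0 : {mpoly E[n]}) b = 0.
Proof. by rewrite /ev rmorph0 meval0. Qed.

Lemma ev1 n b : ev (1 : {mpoly E[n]}) b = 1.
Proof. by rewrite (evC _ 1) rmorph1. Qed.
Lemma evXn n (P : {mpoly E[n]}) e b : ev (P ^+ e) b = ev P b ^+ e.
Proof. by elim: e => [|e IH]; rewrite ?expr0 ?ev1 // !exprS evM IH. Qed.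
Lemma evZ n c (P : {mpoly E[n]}) b : ev (c *: P) b = f c * ev P b.
Proof. by rewrite -mul_mpolyC evM evC. Qed.
Lemma ev_sum n (I : Type) (r : seq I) (p : pred I) (G : I -> {mpoly E[n]}) b :
  ev (\sum_(i <- r | p i) G i) b = \sum_(i <- r | p i) ev (G i) b.
Proof. exact: (big_morph (fun P => ev P b) (fun P Q => evD P Q b) (ev0 _ b)). Qed.
Lemma ev_prod n (I : Type) (r : seq I) (p : pred I) (G : I -> {mpoly E[n]}) b :
  ev (\prod_(i <- r | p i) G i) b = \prod_(i <- r | p i) ev (G i) b.
Proof. exact: (big_morph (fun P => ev P b) (fun P Q => evM P Q b) (ev1 _ b)). Qed.

Lemma evE n (P : {mpoly E[n]}) b :
  ev P b = \sum_(m <- msupp P) f P@_m * \prod_(i < n) b i ^+ m i.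
Proof.
rewrite {1}(mpolyE P) ev_sum; apply: eq_bigr => m _.
by rewrite evZ /ev map_mpolyX mevalX.
Qed.

Lemma eq_ev n (P : {mpoly E[n]}) b b' : (forall i, (i < n)%N -> b i = b' i) -> ev P b = ev P b'.
Proof.
by move=> h; rewrite !evE; apply: eq_bigr => m _; congr (_ * _); apply: eq_bigr => i _; rewrite h.
Qed.
End Evaluation.

Definition resize (E : fieldType) n k (P : {mpoly E[n]}) : {mpoly E[k]} :=
  P \mPo [tuple (if insub (i : nat) is Some j then 'X_j else 0 : {mpoly E[k]}) | i < n].

Lemma ev_resize (E F : fieldType) (f : {rmorphism E -> F}) n k (P : {mpoly E[n]}) b :
  ev f (resize k P) b = ev f P (fun i => if (i < k)%N then b i else 0).
Proof.
rewrite [RHS]evE /resize comp_mpolyEX ev_sum; apply: eq_bigr => m _.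
rewrite evZ comp_mpolyX ev_prod; congr (_ * _).
apply: eq_bigr => i _; rewrite evXn; congr (_ ^+ _); rewrite tnth_mktuple.
case: insubP => [j _ ji|]; first by rewrite evX -ji ltn_ord.
by move=> /negPf ->; rewrite ev0.
Qed.

Lemma ev_widen (E F : fieldType) (f : {rmorphism E -> F}) n k (P : {mpoly E[n]}) b : (n <= k)%N ->
  ev f (resize k P) b = ev f P b.
Proof. by move=> nk; rewrite ev_resize; apply: eq_ev => i ni; rewrite (leq_trans ni nk). Qed.

Lemma resize_vars (E : fieldType) n k (P : {mpoly E[n]}) (r : 'I_k) : (n <= r.+1)%N ->
  wle (above r) 0 (resize k P).
Proof.
move=> nr; rewrite /resize comp_mpolyEX; apply: wle_sum => m _; apply: wleZ; rewrite comp_mpolyX.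
elim/big_ind: _ => [|p q hp hq|i _]; [exact: wleC | exact: (wleM hp hq) |].
elim: (m i) => [|e IH]; first by rewrite expr0; exact: wleC.
rewrite exprS; apply: (@wleM _ _ _ 0 0) => //; rewrite tnth_mktuple.
case: insubP => [j _ ji|_]; last exact: wle0.
by apply: wleX; rewrite wdegU /above ji; have := ltn_ord i; lia.
Qed.

Lemma frac_sub (F : fieldType) (x y z t : F) : y != 0 -> t != 0 ->
  x / y - z / t = (x * t - z * y) / (y * t).
Proof. by move=> y0 t0; field; rewrite y0 t0. Qed.
Lemma frac_div (F : fieldType) (x y z t : F) : (x / y) / (z / t) = (x * t) / (y * z).
Proof. by rewrite invf_div mulf_div. Qed.

Section PartialIso.
Variables (M : rcfType) (V : vdf M).
Local Notation "x ≼ y" := (dominatedb (vO V) x y) (at level 70, y at next level).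
Local Notation "x ≺ y" := (~~ dominatedb (vO V) y x) (at level 70, y at next level).
Local Notation "x ~~~ y" := (sim (vO V) x y) (at level 70, y at next level).
Local Notation d := (vder V).
Let OV := vO_ring V.
Implicit Types (x y z : M) (G W : set (M * M)).

(** A partial isomorphism is its graph. Inverses and unions of chains then need no domains, and
    preservation of signs already makes the graph single-valued and injective. *)
Record piso G : Prop := Piso {
  piso1 : G (1, 1);
  pisoB : forall x y x' y', G (x, y) -> G (x', y') -> G (x - x', y - y');
  piso_div : forall x y x' y', G (x, y) -> G (x', y') -> G (x / x', y / y');
  piso_der : forall x y, G (x, y) -> G (d x, d y);
  piso_sg : forall x y, G (x, y) -> Num.sg x = Num.sg y;
  piso_O : forall x y, G (x, y) -> (x ≼ 1) = (y ≼ 1) }.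

Section PisoTheory.
Variables (G : set (M * M)) (hG : piso G).

Lemma piso_eq0 x y : G (x, y) -> (x == 0) = (y == 0).
Proof. by move=> h; rewrite -sgr_eq0 (piso_sg hG h) sgr_eq0. Qed.
Lemma piso_fun x y y' : G (x, y) -> G (x, y') -> y = y'.
Proof.
by move=> h h'; have := piso_eq0 (pisoB hG h h'); rewrite subrr eqxx => /esym; rewrite subr_eq0 => /eqP.
Qed.
Lemma piso_inj x x' y : G (x, y) -> G (x', y) -> x = x'.
Proof.
by move=> h h'; have := piso_eq0 (pisoB hG h h'); rewrite subrr eqxx subr_eq0 => /eqP.
Qed.
Lemma piso0 : G (0, 0). Proof. by have := pisoB hG (piso1 hG) (piso1 hG); rewrite !subrr. Qed.
Lemma pisoN x y : G (x, y) -> G (- x, - y).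
Proof. by move=> h; have := pisoB hG piso0 h; rewrite !sub0r. Qed.
Lemma pisoD x y x' y' : G (x, y) -> G (x', y') -> G (x + x', y + y').
Proof. by move=> h /pisoN h'; have := pisoB hG h h'; rewrite !opprK. Qed.
Lemma pisoV x y : G (x, y) -> G (x^-1, y^-1).
Proof. by move=> h; have := piso_div hG (piso1 hG) h; rewrite !div1r. Qed.
Lemma pisoM x y x' y' : G (x, y) -> G (x', y') -> G (x * x', y * y').
Proof. by move=> h /pisoV h'; have := piso_div hG h h'; rewrite !invrK. Qed.
Lemma piso_dom x y x' y' : G (x, y) -> G (x', y') -> (x ≼ x') = (y ≼ y').
Proof.
move=> h h'; have [x0|x0] := eqVneq x' 0.
  have y0 : y' = 0 by apply/eqP; rewrite -(piso_eq0 h') x0.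
  by rewrite x0 y0 !domx0 //; exact: piso_eq0.
have y0 : y' != 0 by rewrite -(piso_eq0 h').
by have := piso_O hG (piso_div hG h h'); rewrite !dom_div // !mul1r.
Qed.

Definition piso_sfield : sfield M.
Proof.
refine (@Sfield M [set x | exists y, G (x, y)] _); split.
- by exists 1; exact: (piso1 hG).
- by move=> x x' [y h] [y' h']; exists (y - y'); exact: (pisoB hG).
- by move=> x x' [y h] [y' h']; exists (y / y'); exact: (piso_div hG).
Defined.

Definition piso_f2 (e : sf_field piso_sfield) : M := sval (cid (sf_injP e)).
Lemma piso_f2P e : G (sf_inj e, piso_f2 e). Proof. by rewrite /piso_f2; case: cid. Qed.
Lemma piso_f2_zmod : zmod_morphism piso_f2.
Proof. by move=> x y; apply: (piso_fun (piso_f2P _)); rewrite rmorphB; apply: (pisoB hG); exact: piso_f2P. Qed.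
Lemma piso_f2_monoid : monoid_morphism piso_f2.
Proof.
split; first by apply: (piso_fun (piso_f2P _)); rewrite rmorph1; exact: (piso1 hG).
by move=> x y; apply: (piso_fun (piso_f2P _)); rewrite rmorphM; apply: pisoM; exact: piso_f2P.
Qed.
HB.instance Definition _ := GRing.isZmodMorphism.Build _ _ piso_f2 piso_f2_zmod.
HB.instance Definition _ := GRing.isMonoidMorphism.Build _ _ piso_f2 piso_f2_monoid.

Lemma piso_derP (e : sf_field piso_sfield) : exists e' : sf_field piso_sfield, sf_inj e' = d (sf_inj e).
Proof. by apply: sf_lift; exists (d (piso_f2 e)); exact: (piso_der hG (piso_f2P e)). Qed.
Definition piso_d e := sval (cid (piso_derP e)).
Lemma piso_dE (e : sf_field piso_sfield) : sf_inj (piso_d e) = d (sf_inj e). Proof. by rewrite /piso_d; case: cid. Qed.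

(** The domain of [G] as an abstract field with two embeddings, so that a polynomial over it can be
    evaluated on either side. *)
Record pdata := Pdata {
  pE : fieldType; pV : vdf pE; pf1 : {rmorphism pE -> M}; pf2 : {rmorphism pE -> M};
  pV1 : vembed pV V pf1; pV2 : vembed pV V pf2;
  pG : forall e, G (pf1 e, pf2 e);
  pS : forall x y, G (x, y) -> exists2 e, pf1 e = x & pf2 e = y }.

Lemma piso_data : inhabited pdata.
Proof.
split; refine (@Pdata _ (pull_vdf piso_dE) (@sf_inj M piso_sfield) piso_f2 (pull_vembed piso_dE) _ _ _).
- split=> [e|e] /=.
    by apply: (piso_fun (piso_f2P _)); rewrite piso_dE; apply: (piso_der hG); exact: piso_f2P.
  have := piso_O hG (piso_f2P e); rewrite !dom1P // => h.
  by split=> h'; apply/asboolP; move/asboolP: h'; rewrite h.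
- exact: piso_f2P.
- move=> x y h; have [|e e1] := @sf_lift M piso_sfield x; first by exists y.
  by exists e => //; apply: (piso_fun (piso_f2P e)); rewrite e1.
Qed.
End PisoTheory.

Lemma piso_sym G : piso G -> piso [set p | G (p.2, p.1)].
Proof.
case=> h1 hB hd hD hs hO; split=> //=; first by move=> *; exact: hB.
- by move=> *; exact: hd.
- by move=> *; exact: hD.
- by move=> x y /hs.
- by move=> x y /hO.
Qed.

Hypothesis cvx : convex (vO V).

Lemma dom_abs x y : `|x| <= `|y| -> x ≼ y.
Proof.
have [->|y0] := eqVneq y 0; first by rewrite normr0 normr_le0 => /eqP ->; exact: dom_refl.
move=> h; rewrite domP //; apply/asboolP.
have [O1 _ _ _] := OV; have ON1 := valringN OV O1.
have : `|x / y| <= 1 by rewrite normrM normfV ler_pdivrMr ?normr_gt0 // mul1r.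
by rewrite ler_norml => /andP[h1 h2]; exact: (cvx ON1 O1 h1 h2).
Qed.

Lemma lt_dom_abs x y : x ≺ y -> `|x| < `|y|.
Proof. by move=> h; rewrite ltNge; apply: contra h; exact: dom_abs. Qed.

Lemma sim_sg x y : x ~~~ y -> Num.sg x = Num.sg y.
Proof.
move=> s; have y0 := sim_neq0 OV s; have l := lt_dom_abs s.
have [h|h|h] := ltrgtP y 0; last by rewrite h eqxx in y0.
- by move: l; rewrite (ltr0_norm h) ltr_norml => /andP[_ h']; rewrite !ltr0_sg //; lra.
- by move: l; rewrite (gtr0_norm h) ltr_norml => /andP[h' _]; rewrite !gtr0_sg //; lra.
Qed.

(* Pairs whose signs and values match, so that elements asymptotic to them also do. *)
Record matched W : Prop := Matched {
  mat_neq0 : forall x y, W (x, y) -> x != 0 /\ y != 0;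
  mat_div : forall x y x' y', W (x, y) -> W (x', y') -> W (x / x', y / y');
  mat_sg : forall x y, W (x, y) -> Num.sg x = Num.sg y;
  mat_O : forall x y, W (x, y) -> (x ≼ 1) = (y ≼ 1) }.

(** For a matched [W] this transfers signs and membership in [O], and it survives quotients; so it
    need only be checked for values of polynomials. *)
Definition tracked W x y :=
  (x = 0 /\ y = 0) \/ exists v v', [/\ W (v, v'), x ~~~ v & y ~~~ v'].

Section GraphLemma.
Variables (W : set (M * M)) (mW : matched W).

Lemma tracked_sg x y : tracked W x y -> Num.sg x = Num.sg y.
Proof.
by case=> [[-> ->]//|[v [v' [Wv s1 s2]]]]; rewrite (sim_sg s1) (sim_sg s2) (mat_sg mW Wv).
Qed.
Lemma tracked_div x y x' y' : tracked W x y -> tracked W x' y' -> tracked W (x / x') (y / y').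
Proof.
case=> [[-> ->] _|[v [v' [Wv s1 s2]]]]; first by left; rewrite !mul0r.
case=> [[-> ->]|[u [u' [Wu t1 t2]]]]; first by left; rewrite !invr0 !mulr0.
by right; exists (v / u), (v' / u'); split; [exact: (mat_div mW) | |]; apply: simM => //; exact: simV.
Qed.
Lemma tracked_O x y : tracked W x y -> (x ≼ 1) = (y ≼ 1).
Proof.
case=> [[-> ->]//|[v [v' [Wv s1 s2]]]].
have h u u' : u ~~~ u' -> (u ≼ 1) = (u' ≼ 1).
  move=> s; apply/idP/idP; apply: (dom_trans OV); [exact: sim_domr | exact: sim_doml].
by rewrite (h _ _ s1) (h _ _ s2) (mat_O mW Wv).
Qed.
Lemma tracked_eq0 x y : tracked W x y -> (x == 0) = (y == 0).
Proof. by move=> /tracked_sg h; rewrite -sgr_eq0 h sgr_eq0. Qed.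

Variables (E : fieldType) (VE : vdf E) (f1 f2 : {rmorphism E -> M}).
Hypotheses (fV1 : vembed VE V f1) (fV2 : vembed VE V f2).
Variables (b b' : nat -> M).
Hypothesis htr : forall n (P : {mpoly E[n]}), tracked W (ev f1 P b) (ev f2 P b').

(** The graph of the map from [E(b)] to [E(b')] that sends [b i] to [b' i]. It is well defined once
    all values of polynomials are tracked, which is the hypothesis [htr]. *)
Definition gen_graph : set (M * M) := [set p | exists n (P Q : {mpoly E[n]}),
  [/\ ev f1 Q b != 0, p.1 = ev f1 P b / ev f1 Q b & p.2 = ev f2 P b' / ev f2 Q b']].

Lemma gen_neq0 n (Q : {mpoly E[n]}) : ev f1 Q b != 0 -> ev f2 Q b' != 0.
Proof. by rewrite (tracked_eq0 (htr Q)). Qed.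

Lemma gen_ev n (P : {mpoly E[n]}) : gen_graph (ev f1 P b, ev f2 P b').
Proof. by exists n, P, 1%:MP; rewrite /= !evC !rmorph1 !divr1 oner_neq0. Qed.
Lemma gen_base e : gen_graph (f1 e, f2 e).
Proof. by have := @gen_ev 0 e%:MP; rewrite !evC. Qed.
Lemma gen_b i : gen_graph (b i, b' i).
Proof. by have := @gen_ev i.+1 'X_(ord_max); rewrite !evX. Qed.

Lemma gen_common x y x' y' : gen_graph (x, y) -> gen_graph (x', y') -> exists n (P Q P' Q' : {mpoly E[n]}),
  [/\ ev f1 Q b != 0, ev f1 Q' b != 0, (x = ev f1 P b / ev f1 Q b /\ y = ev f2 P b' / ev f2 Q b')
   & (x' = ev f1 P' b / ev f1 Q' b /\ y' = ev f2 P' b' / ev f2 Q' b')].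
Proof.
move=> [n [P [Q [Q0 e1 e2]]]] [n' [P' [Q' [Q0' e1' e2']]]]; simpl in *.
exists (maxn n n'), (resize _ P), (resize _ Q), (resize _ P'), (resize _ Q').
by rewrite !ev_widen ?leq_maxl ?leq_maxr.
Qed.

Lemma gen_B x y x' y' : gen_graph (x, y) -> gen_graph (x', y') -> gen_graph (x - x', y - y').
Proof.
move=> h h'; have [n [P [Q [P' [Q' [Q0 Q0' [-> ->] [-> ->]]]]]]] := gen_common h h'.
exists n, (P * Q' - P' * Q), (Q * Q'); rewrite /= !evB !evM.
have r0 := gen_neq0 Q0; have r0' := gen_neq0 Q0'.
by split; [rewrite mulf_neq0 | rewrite frac_sub | rewrite frac_sub].
Qed.

Lemma gen_div x y x' y' : gen_graph (x, y) -> gen_graph (x', y') -> gen_graph (x / x', y / y').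
Proof.
move=> h h'; have [n [P [Q [P' [Q' [Q0 Q0' [-> ->] [-> ->]]]]]]] := gen_common h h'.
have r0 := gen_neq0 Q0; have r0' := gen_neq0 Q0'.
have [P0|P0] := eqVneq (ev f1 P' b) 0.
  have R0 : ev f2 P' b' = 0 by apply/eqP; rewrite -(tracked_eq0 (htr P')) P0.
  by rewrite P0 R0 !mul0r !invr0 !mulr0; have := gen_base 0; rewrite !rmorph0.
have R0 := gen_neq0 P0.
exists n, (P * Q'), (Q * P'); rewrite /= !evM.
by split; [rewrite mulf_neq0 | exact: frac_div | exact: frac_div].
Qed.

Lemma gen_tracked x y : gen_graph (x, y) -> tracked W x y.
Proof. by move=> [n [P [Q [_ /= -> ->]]]]; apply: tracked_div; exact: htr. Qed.

Lemma gen0 : gen_graph (0, 0). Proof. by have := gen_base 0; rewrite !rmorph0. Qed.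
Lemma gen_N x y : gen_graph (x, y) -> gen_graph (- x, - y).
Proof. by move=> h; have := gen_B gen0 h; rewrite !sub0r. Qed.
Lemma gen_D x y x' y' : gen_graph (x, y) -> gen_graph (x', y') -> gen_graph (x + x', y + y').
Proof. by move=> h /gen_N h'; have := gen_B h h'; rewrite !opprK. Qed.
Lemma gen_M x y x' y' : gen_graph (x, y) -> gen_graph (x', y') -> gen_graph (x * x', y * y').
Proof.
move=> h h'; have h1 := gen_base 1; rewrite !rmorph1 in h1.
by have := gen_div h (gen_div h1 h'); rewrite !div1r !invrK.
Qed.

Hypothesis hder : forall i, gen_graph (d (b i), d (b' i)).

Lemma pder_map (f : {rmorphism E -> M}) n (P : {mpoly E[n]}) : vembed VE V f ->
  pder V (map_mpoly f P) = map_mpoly f (pder VE P).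
Proof.
move=> fV; apply/mpolyP => m; rewrite mcoeff_pder [in RHS]mcoeff_map_mpoly mcoeff_pder.
by rewrite mcoeff_map_mpoly; symmetry; exact: (vembed_der fV).
Qed.

Lemma der_ev (f : {rmorphism E -> M}) n (P : {mpoly E[n]}) (c : nat -> M) : vembed VE V f ->
  d (ev f P c) = ev f (pder VE P) c + \sum_(i < n) ev f (P^`M(i)) c * d (c i).
Proof.
move=> fV; rewrite /ev (der_meval V) (pder_map _ fV); congr (_ + _).
by apply: eq_bigr => i _; rewrite map_mderiv.
Qed.

Lemma gen_der_ev n (P : {mpoly E[n]}) : gen_graph (d (ev f1 P b), d (ev f2 P b')).
Proof.
rewrite (der_ev _ _ fV1) (der_ev _ _ fV2); apply: gen_D; first exact: gen_ev.
elim/big_ind2: _ => [|x y x' y'|i _]; [exact: gen0 | exact: gen_D |].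
by apply: gen_M => //; exact: gen_ev.
Qed.

Lemma gen_der x y : gen_graph (x, y) -> gen_graph (d x, d y).
Proof.
move=> [n [P [Q [Q0 /= -> ->]]]]; have r0 := gen_neq0 Q0.
have dE (p q : M) : q != 0 -> d (p / q) = (d p * q - p * d q) / (q * q).
  by move=> q0; rewrite derM derV //; field.
rewrite !dE //; apply: gen_div; [apply: gen_B|]; apply: gen_M; try exact: gen_ev; exact: gen_der_ev.
Qed.

Lemma gen_piso : piso gen_graph.
Proof.
split.
- by have := gen_base 1; rewrite !rmorph1.
- exact: gen_B.
- exact: gen_div.
- exact: gen_der.
- by move=> x y /gen_tracked; exact: tracked_sg.
- by move=> x y /gen_tracked; exact: tracked_O.
Qed.

Lemma gen_min (T : set (M * M)) : (forall e, T (f1 e, f2 e)) -> (forall i, T (b i, b' i)) ->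
  (forall x y x' y', T (x, y) -> T (x', y') -> T (x + x', y + y') /\ T (x * x', y * y')) ->
  (forall x y, x != 0 -> y != 0 -> T (x, y) -> T (x^-1, y^-1)) -> gen_graph `<=` T.
Proof.
move=> T0 Tb Top TV [x y] [n [P [Q [Q0 /= -> ->]]]].
have Tev (R : {mpoly E[n]}) : T (ev f1 R b, ev f2 R b').
  have T00 : T (0, 0) by have := T0 0; rewrite !rmorph0.
  have T11 : T (1, 1) by have := T0 1; rewrite !rmorph1.
  rewrite !evE; elim/big_ind2: _ => // [p q p' q' h h'|m _]; first exact: (Top _ _ _ _ h h').1.
  apply: (Top _ _ _ _ (T0 _) _).2; elim/big_ind2: _ => // [p q p' q' h h'|i _].
    exact: (Top _ _ _ _ h h').2.
  by elim: (m i) => // e IH; rewrite !exprS; exact: (Top _ _ _ _ (Tb _) IH).2.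
by apply: (Top _ _ _ _ (Tev _) _).2; apply: TV => //; exact: gen_neq0.
Qed.
End GraphLemma.
End PartialIso.

(** * Extension by a zero of a minimal polynomial or by new values *)

Section Tracking.
Variables (M : rcfType) (V : vdf M).
Local Notation "x ≼ y" := (dominatedb (vO V) x y) (at level 70, y at next level).
Local Notation "x ≺ y" := (~~ dominatedb (vO V) y x) (at level 70, y at next level).
Local Notation "x ~~~ y" := (sim (vO V) x y) (at level 70, y at next level).
Local Notation d := (vder V).
Local Notation ld := (logder V).
Let OV := vO_ring V.
Implicit Types (x y : M) (G W : set (M * M)).
Hypothesis cvx : convex (vO V).

Section Matched.
Variables (W : set (M * M)) (mW : matched V W).

Lemma mat1 x y : W (x, y) -> W (1, 1).
Proof.
by move=> h; have [x0 y0] := mat_neq0 mW h; have := mat_div mW h h; rewrite !divff.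
Qed.
Lemma matM x y x' y' : W (x, y) -> W (x', y') -> W (x * x', y * y').
Proof.
by move=> h h'; have := mat_div mW h (mat_div mW (mat1 h) h'); rewrite !div1r !invrK.
Qed.
Lemma mat_dom x y x' y' : W (x, y) -> W (x', y') -> (x ≼ x') = (y ≼ y').
Proof.
move=> h h'; have [x0 y0] := mat_neq0 mW h'.
by have := mat_O mW (mat_div mW h h'); rewrite !dom_div // !mul1r.
Qed.

Lemma list_max (s : seq (M * M)) p0 : exists2 p, p \in p0 :: s &
  forall q, q \in p0 :: s -> q.1 ≼ p.1.
Proof.
elim: s p0 => [|p1 s IH] p0.
  by exists p0; rewrite ?in_cons ?eqxx // => q; rewrite mem_seq1 => /eqP ->; exact: dom_refl.
have [p ps hp] := IH p1; have /orP[h|h] := dom_total OV p0.1 p.1.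
  exists p; first by rewrite in_cons ps orbT.
  by move=> q; rewrite in_cons => /orP[/eqP -> //|/hp].
exists p0; first by rewrite in_cons eqxx.
move=> q; rewrite in_cons => /orP[/eqP ->|/hp h']; first exact: dom_refl.
exact: (dom_trans OV) h' h.
Qed.

(* If elements of [W] of value [0] behave like constants, then equivalent summands can be merged. *)
Hypothesis hW1 : forall x y, W (x, y) -> x ≼ 1 -> 1 ≼ x ->
  (x + 1 = 0 /\ y + 1 = 0) \/ W (x + 1, y + 1).

(** Induction on the number of summands. A largest summand either is asymptotic to the sum or has an
    equivalent partner, with which it merges through [p + q = (p / q + 1) * q]. *)
Lemma tracked_sum (s : seq (M * M)) : (forall p, p \in s -> W p) ->
  tracked V W (\sum_(p <- s) p.1) (\sum_(p <- s) p.2).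
Proof.
move: {2}(size s).+1 (ltnSn (size s)) => n; elim: n s => // n IH [|p0 s] sn hs.
  by left; rewrite !big_nil.
have [[p p'] ps hp] := list_max s p0.
have pm := perm_to_rem ps; set s1 := rem _ _ in pm.
have Wp : W (p, p') by exact: hs.
have hs1 q : q \in s1 -> W q by move=> qs; apply: hs; rewrite (perm_mem pm) in_cons qs orbT.
rewrite !(perm_big _ pm) /= !big_cons /=.
case: (pselect (exists2 q, q \in s1 & p ≼ q.1)) => [[[q q'] qs /= pq]|no].
  have Wq := hs1 _ qs; have [q0 q0'] := mat_neq0 mW Wq.
  have qp : q ≼ p by have := hp (q, q'); apply; rewrite (perm_mem pm) in_cons qs orbT.
  have pm2 := perm_to_rem qs; set s2 := rem _ _ in pm2.
  have sz : (size s2).+2 = (size s).+1.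
    by move: (perm_size pm) (perm_size pm2) => /= [->] ->.
  have hs2 r : r \in s2 -> W r by move=> rs; apply: hs1; rewrite (perm_mem pm2) in_cons rs orbT.
  rewrite !(perm_big _ pm2) /= !big_cons /= !addrA.
  have e1 : p + q = (p / q + 1) * q by rewrite mulrDl divfK // mul1r.
  have e2 : p' + q' = (p' / q' + 1) * q' by rewrite mulrDl divfK // mul1r.
  have [||[z z']|w] := hW1 (mat_div mW Wp Wq).
  - by rewrite dom_div // mul1r.
  - by rewrite domx_div // mul1r.
  - by rewrite e1 e2 z z' !mul0r !add0r; apply: IH => //; rewrite -ltnS ltnW // sz.
  have := IH ((p + q, p' + q') :: s2); rewrite !big_cons /=; apply; first by rewrite /= sz -ltnS.
  move=> r; rewrite in_cons => /orP[/eqP ->|]; last exact: hs2.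
  by rewrite e1 e2; exact: matM.
have [p0' p0''] := mat_neq0 mW Wp.
right; exists p, p'; split=> //; rewrite /sim addrAC subrr add0r big_seq; apply: lt_dom_sum => // q qs.
  by apply/negP => h; apply: no; exists q.
case: q qs => q q' qs; have Wq := hs1 _ qs; rewrite /= -(mat_dom Wp Wq).
by apply/negP => h; apply: no; exists (q, q').
Qed.
End Matched.

Section Extensions.
Variables (E : fieldType) (VE : vdf E) (f1 f2 : {rmorphism E -> M}).
Hypotheses (fV1 : vembed VE V f1) (fV2 : vembed VE V f2).

Lemma ev_vars (f : {rmorphism E -> M}) n (r : 'I_n) (P : {mpoly E[n]}) b b' : wle (above r) 0 P ->
  (forall i, (i <= r)%N -> b i = b' i) -> ev f P b = ev f P b'.
Proof.
move=> hP hb; rewrite !evE; rewrite big_seq [RHS]big_seq; apply: eq_bigr => m mP; congr (_ * _).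
apply: eq_bigr => i _; case: (leqP i r) => ir; first by rewrite hb.
have := hP m mP; rewrite leqn0 /wdeg sum_nat_eq0 => /forallP/(_ i).
by rewrite /above ir mul1n => /eqP ->.
Qed.

Lemma deriv_eq0_vars n (r : 'I_n) (P : {mpoly E[n]}) : wle (above r) 0 P -> P^`M(r) = 0 ->
  wle (atleast r) 0 P.
Proof.
move=> hP h0 m mP; rewrite leqn0 /wdeg sum_nat_eq0; apply/forallP => i; apply/implyP => _.
rewrite /atleast; case: (ltngtP r i) => ri //; rewrite mul1n.
  by have := hP m mP; rewrite leqn0 /wdeg sum_nat_eq0 => /forallP/(_ i); rewrite /above ri mul1n.
have {ri}-> : i = r by exact/val_inj.
apply/eqP; case em : (m r) => [//|k].
have le : (U_(r) <= m)%MM by apply/mnm_lepP => j; rewrite mnm1E; case: eqP => // <-; rewrite em.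
have := congr1 (fun Q : {mpoly E[n]} => Q@_(m - U_(r))) h0.
rewrite /= mcoeff0 mcoeff_deriv submK // mnmBE mnm1E eqxx em subn1 /= -mulr_natr => /eqP.
by rewrite mulf_eq0 (negPf (natr_neq0 VE k)) orbF; move: mP; rewrite mcoeff_msupp => /negPf ->.
Qed.

(** Pseudo-division by [P] lowers the degree in the leading variable to at most [dd], where
    minimality of [P] excludes bad polynomials; the initial [I] is itself good and can be cancelled.
    The derivative of order [r + 1] is recovered rationally through the separant [S]. *)
Lemma zero_extension W n (B : {mpoly E[n]} -> Prop) r dd D (P : {mpoly E[n]}) (u u' : M) :
  matched V W -> minimal_bad B r dd D P ->
  let b i := iter i d u in let b' i := iter i d u' in
  (forall Q : {mpoly E[n]}, Q != 0 -> ~ B Q ->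
     exists v v', [/\ W (v, v'), ev f1 Q b ~~~ v & ev f2 Q b' ~~~ v']) ->
  P != 0 -> ev f1 P b = 0 -> ev f2 P b' = 0 ->
  exists G, [/\ piso V G, forall e, G (f1 e, f2 e), G (u, u') &
    forall T : set (M * M), (forall e, T (f1 e, f2 e)) -> (forall i, T (b i, b' i)) ->
      (forall x y x' y', T (x, y) -> T (x', y') -> T (x + x', y + y') /\ T (x * x', y * y')) ->
      (forall x y, x != 0 -> y != 0 -> T (x, y) -> T (x^-1, y^-1)) -> G `<=` T].
Proof.
move=> mW [[BP h1 h2 _] mind _] b b' good P0 z1 z2.
have [I [P' [PE I0 P1' P2']]] := lead_split h1 h2.
have aa w : w = above r -> (forall i, w i <= atleast r i)%N.
  by move=> -> i; rewrite /above /atleast; case: (ltnP r i) => // /ltnW ->.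
have aI : wle (above r) 0 I by apply: wle_weight I0; exact: aa.
have In0 : I != 0.
  apply/eqP => e; apply: (mind P BP h1); rewrite PE e mul0r add0r; exact: P2'.
have good' Q : Q != 0 -> wle (above r) 0 Q -> wle (atleast r) dd Q ->
    exists v v', [/\ W (v, v'), ev f1 Q b ~~~ v & ev f2 Q b' ~~~ v'].
  by move=> Q0 q1 q2; apply: good => // BQ; exact: (mind Q BQ q1 q2).
have nz Q : Q != 0 -> wle (above r) 0 Q -> wle (atleast r) dd Q -> ev f1 Q b != 0 /\ ev f2 Q b' != 0.
  move=> Q0 q1 q2; have [v [v' [_ s1 s2]]] := good' Q Q0 q1 q2.
  by split; [exact: (sim_neq0l OV s1) | exact: (sim_neq0l OV s2)].
have trQ e : forall Q, wle (above r) 0 Q -> wle (atleast r) e Q ->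
    tracked V W (ev f1 Q b) (ev f2 Q b').
  elim: e => [|e IH] Q q1 q2.
    have [->|Q0] := eqVneq Q 0; first by left; rewrite !ev0.
    by right; apply: good' => //; exact: wleS q2.
  case: (leqP e.+1 dd) => ed.
    have [->|Q0] := eqVneq Q 0; first by left; rewrite !ev0.
    by right; apply: good' => //; exact: wleS q2.
  have [J [Q' [QE J0 Q1' /(_ _ erefl) Q2']]] := lead_split q1 q2.
  have aJ : wle (above r) 0 J by apply: wle_weight J0; exact: aa.
  (* One step of pseudo-division: [I * Q] and [Q2] differ by a multiple of [P], which vanishes on
     both sides. *)
  pose Q2 := I * Q' - J * 'X_r ^+ (e - dd) * P'.
  have Xk w k : wle w (k * w r) ('X_r ^+ k : {mpoly E[n]}).
    elim: k => [|k IHk]; first by rewrite expr0 mul0n; exact: wleC.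
    by rewrite exprS mulSn; apply: wleM => //; apply: wleX; rewrite wdegU.
  have Q2E : I * Q = Q2 + J * 'X_r ^+ (e - dd) * P.
    rewrite /Q2 QE PE !mulrDr addrAC -addrA -addrA subrr addr0 [RHS]addrC mulrA; congr (_ + _).
    have -> : 'X_r ^+ e.+1 = 'X_r ^+ (e - dd) * 'X_r ^+ dd.+1 :> {mpoly E[n]}.
      by rewrite -exprD addnS subnK.
    by rewrite [I * J]mulrC mulrACA.
  have tQ2 : tracked V W (ev f1 Q2 b) (ev f2 Q2 b').
    apply: IH.
      apply: wleB; first exact: (wleM aI Q1').
      have Xr := Xk (above r) (e - dd)%N; rewrite /above ltnn muln0 in Xr.
      exact: (wleM (wleM aJ Xr) P1').
    apply: wleB; first exact: (wleM I0 Q2').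
    have Xr := Xk (atleast r) (e - dd)%N; rewrite /atleast leqnn muln1 in Xr.
    have := wleM (wleM J0 Xr) (P2' _ erefl); rewrite add0n subnK //.
  have Q21 : ev f1 Q2 b = ev f1 I b * ev f1 Q b by rewrite -evM Q2E (evD f1 Q2) (evM f1 (J * _)) z1 mulr0 addr0.
  have Q22 : ev f2 Q2 b' = ev f2 I b' * ev f2 Q b'.
    by rewrite -evM Q2E (evD f2 Q2) (evM f2 (J * _)) z2 mulr0 addr0.
  have I0' : wle (atleast r) dd I by exact: wleS I0.
  have [i1 i2] := nz I In0 aI I0'.
  have := tracked_div mW tQ2 (or_intror (good' I In0 aI I0')).
  by rewrite Q21 Q22 ![ev _ I _ * _]mulrC !mulfK.
have trA Q : wle (above r) 0 Q -> tracked V W (ev f1 Q b) (ev f2 Q b').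
  move=> q1; apply: (trQ (\sum_(m <- msupp Q) wdeg (atleast r) m)%N) => // m mQ.
  by rewrite (bigD1_seq m) ?msupp_uniq //= leq_addr.
(* Only the derivatives up to order [r] serve as generators; the later entries are padded with 0. *)
pose c i := if (i < r.+1)%N then b i else 0; pose c' i := if (i < r.+1)%N then b' i else 0.
have htr k (Q : {mpoly E[k]}) : tracked V W (ev f1 Q c) (ev f2 Q c').
  have := trA (resize n (resize r.+1 Q)) (@resize_vars _ _ _ _ r (leqnn _)).
  rewrite (@ev_widen _ _ f1 _ _ _ _ (ltn_ord r)) (@ev_widen _ _ f2 _ _ _ _ (ltn_ord r)).
  by rewrite !ev_resize.
have cb Q : wle (above r) 0 Q -> ev f1 Q b = ev f1 Q c /\ ev f2 Q b' = ev f2 Q c'.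
  move=> q1; split; [apply: (@ev_vars f1 n r Q b c q1)|apply: (@ev_vars f2 n r Q b' c' q1)] => i ir.
    by rewrite /c ltnS ir.
  by rewrite /c' ltnS ir.
have gev Q : wle (above r) 0 Q -> gen_graph f1 f2 c c' (ev f1 Q b, ev f2 Q b').
  by move=> q1; have [-> ->] := cb Q q1; exact: gen_ev.
have hder i : gen_graph f1 f2 c c' (d (c i), d (c' i)).
  have ci j : (j <= r)%N -> c j = b j /\ c' j = b' j by move=> jr; rewrite /c /c' ltnS jr.
  have [ir|ir|ir] := ltngtP i r.
  - have [-> ->] := ci i (ltnW ir); have := gen_b f1 f2 c c' i.+1.
    by have [-> ->] := ci i.+1 ir.
  - have -> : c i = 0 by rewrite /c ltnS leqNgt ir.
    have -> : c' i = 0 by rewrite /c' ltnS leqNgt ir.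
    by rewrite !der0; exact: gen0.
  rewrite {i}ir; have [-> ->] := ci r (leqnn r); pose S := P^`M(r).
  have S1 : wle (above r) 0 S by have := @wle_deriv _ _ _ 0 r _ h1.
  have S2 : wle (atleast r) dd S.
    by have := @wle_deriv _ _ _ _ r _ h2; rewrite /atleast leqnn subn1.
  have S0 : S != 0.
    apply/eqP => e; apply: (mind P BP h1); exact: wleS (deriv_eq0_vars h1 e).
  have [s1 s2] := nz S S0 S1 S2.
  have pP : wle (above r) 0 (pder VE P).
    move=> m; rewrite mcoeff_msupp mcoeff_pder => h; apply: h1; rewrite mcoeff_msupp.
    by apply: contra h => /eqP ->; rewrite der0.
  have rel (f : {rmorphism E -> M}) v : vembed VE V f -> ev f S (fun i => iter i d v) != 0 ->
      ev f P (fun i => iter i d v) = 0 ->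
      iter r.+1 d v = - (ev f (pder VE P) (fun i => iter i d v) +
        \sum_(i < n | i != r) ev f (P^`M(i)) (fun i => iter i d v) * iter i.+1 d v)
        / ev f S (fun i => iter i d v).
    move=> fV sn z; have := der_ev P (fun i => iter i d v) fV; rewrite z der0 (bigD1 r) //=.
    rewrite -/S => /esym/eqP; rewrite addrCA addr_eq0 => /eqP e.
    by rewrite -e mulrC mulKf.
  rewrite -!iterS (rel f1 u) // (rel f2 u') //; apply: (gen_div cvx mW htr); last exact: gev.
  apply: (gen_N cvx mW htr); apply: (gen_D cvx mW htr); first exact: gev.
  elim/big_ind2: _ => [|x y x' y' h h'|j jr]; [exact: gen0 | exact: (gen_D cvx mW htr) |].
  have [rj|jr'] := ltnP r j.
    rewrite (@wle_deriv0 _ _ (above r)) // ?/above ?rj // !ev0 !mul0r; exact: gen0.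
  apply: (gen_M cvx mW htr); first by apply: gev; have := @wle_deriv _ _ _ 0 j _ h1.
  have jr2 : (j.+1 <= r)%N by rewrite ltn_neqAle jr jr'.
  by have := gen_b f1 f2 c c' j.+1; have [-> ->] := ci j.+1 jr2.
exists (gen_graph f1 f2 c c'); split.
- exact: (gen_piso cvx mW fV1 fV2 htr hder).
- exact: gen_base.
- by have := gen_b f1 f2 c c' 0.
move=> T T0 Tb Top TV; apply: (gen_min cvx mW htr) => // i; rewrite /c /c'; case: ifP => // _.
by have := T0 0; rewrite !rmorph0.
Qed.

Section Monomial.
Variables (b b' : nat -> M).
Definition mon (c : nat -> M) n (z : nat -> int) := \prod_(i < n) c i ^ z i.
(** Laurent monomials in the [b i] with coefficients in [E]. By [mon1] below, those of value 0 come
    from [E], so summands of equal size can be merged there. *)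
Definition monW : set (M * M) := [set p | exists n (z : nat -> int) (e : E),
  [/\ e != 0, p.1 = f1 e * mon b n z & p.2 = f2 e * mon b' n z]].

Lemma mon_pad (c : nat -> M) n k z : (n <= k)%N ->
  mon c n z = mon c k (fun i => if (i < n)%N then z i else 0).
Proof.
move=> nk; rewrite /mon (big_ord_widen k (fun i => c i ^ z i)) // [RHS](bigID (fun i : 'I_k => (i < n)%N)) /=.
rewrite [X in _ = _ * X]big1 ?mulr1; last by move=> i /negPf ->; rewrite expr0z.
by apply: eq_bigr => i ->.
Qed.

Hypotheses (b0 : forall i, b i != 0) (b0' : forall i, b' i != 0).

Lemma mon_neq0 (c : nat -> M) n z : (forall i, c i != 0) -> mon c n z != 0.
Proof. by move=> c0; rewrite /mon; apply/prodf_neq0 => i _; rewrite expfz_neq0. Qed.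

Lemma mon_div (c : nat -> M) n z z' : (forall i, c i != 0) ->
  mon c n z / mon c n z' = mon c n (fun i => z i - z' i).
Proof.
move=> c0; rewrite /mon -prodf_div; apply: eq_bigr => i _.
by rewrite expfzDr // invr_expz.
Qed.

Hypothesis bsg : forall i, Num.sg (b i) = Num.sg (b' i).
Hypothesis fsg : forall e, Num.sg (f1 e) = Num.sg (f2 e).
Hypothesis monO : forall e n z, e != 0 -> (f1 e * mon b n z ≼ 1) = (f2 e * mon b' n z ≼ 1).
Hypothesis mon1 : forall e n z, e != 0 -> f1 e * mon b n z ≼ 1 -> 1 ≼ f1 e * mon b n z ->
  exists e', f1 e' = f1 e * mon b n z /\ f2 e' = f2 e * mon b' n z.

Lemma sg_expz (x y : M) (z : int) : Num.sg x = Num.sg y -> Num.sg (x ^ z) = Num.sg (y ^ z).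
Proof.
by move=> h; case: z => n; rewrite ?NegzE -?exprnN -?exprnP ?sgrV !sgrX h.
Qed.

Lemma monW_matched : matched V monW.
Proof.
split.
- by move=> x y [n [z [e [e0 /= -> ->]]]]; rewrite !mulf_neq0 ?mon_neq0 ?fmorph_eq0.
- move=> x y x' y' [n [z [e [e0 /= -> ->]]]] [n' [z' [e' [e0' /= -> ->]]]].
  rewrite !(@mon_pad _ n (maxn n n')) ?leq_maxl // !(@mon_pad _ n' (maxn n n')) ?leq_maxr //.
  exists (maxn n n'); eexists; exists (e / e'); split; first by rewrite mulf_neq0 ?invr_eq0.
    by rewrite /= fmorph_div -mulf_div (mon_div _ _ _ b0).
  by rewrite /= fmorph_div -mulf_div (mon_div _ _ _ b0').
- move=> x y [n [z [e [e0 /= -> ->]]]]; rewrite !sgrM fsg; congr (_ * _).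
  rewrite /mon; elim/big_ind2: _ => // [p q p' q' h h'|i _]; first by rewrite !sgrM h h'.
  exact: sg_expz.
- by move=> x y [n [z [e [e0 /= -> ->]]]]; exact: monO.
Qed.

Lemma mon_tracked n (P : {mpoly E[n]}) : tracked V monW (ev f1 P b) (ev f2 P b').
Proof.
pose t (m : 'X_{1..n}) := (f1 P@_m * \prod_(i < n) b i ^+ m i, f2 P@_m * \prod_(i < n) b' i ^+ m i).
have -> : ev f1 P b = \sum_(p <- [seq t m | m <- msupp P]) p.1 by rewrite big_map evE.
have -> : ev f2 P b' = \sum_(p <- [seq t m | m <- msupp P]) p.2 by rewrite big_map evE.
apply: (tracked_sum monW_matched) => [x y h x1 x1'|p /mapP[m mP ->]]; last first.
  exists n, (fun i => if insub i is Some j then (m j : int) else 0), P@_m.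
  split; [by rewrite -mcoeff_msupp | |]; rewrite /t /=; congr (_ * _); apply: eq_bigr => i _;
    by case: insubP => [j _ ji|]; rewrite ?ltn_ord // -exprnP (val_inj ji).
case: h => n' [z [e [e0 /= xE yE]]].
have [e' [e1 e2]] : exists e', f1 e' = x /\ f2 e' = y.
  by rewrite xE yE; apply: mon1; rewrite -?xE.
rewrite -e1 -e2.
have [z0|z0] := eqVneq (e' + 1) 0.
  have h (f : {rmorphism E -> M}) : f e' + 1 = 0 by rewrite -(rmorph1 f) -rmorphD z0 rmorph0.
  by left; rewrite !h.
right; exists 0%N, (fun=> 0), (e' + 1); rewrite /mon !big_ord0 !mulr1 !rmorphD !rmorph1.
by split.
Qed.
End Monomial.
End Extensions.
End Tracking.

(** * Extending partial isomorphisms *)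

Section Corestriction.
Variables (E F : fieldType) (f : {rmorphism E -> F}) (S : sfield F).
Hypothesis fS : forall e, sf_set S (f e).
Definition corestr (e : E) : sf_field S := SfType (asboolT (fS e)).
Lemma corestr_zmod : zmod_morphism corestr.
Proof. by move=> x y; apply: val_inj; rewrite /= rmorphB. Qed.
Lemma corestr_monoid : monoid_morphism corestr.
Proof. by split=> [|x y]; apply: val_inj; rewrite /= ?rmorph1 ?rmorphM. Qed.
HB.instance Definition _ := GRing.isZmodMorphism.Build _ _ corestr corestr_zmod.
HB.instance Definition _ := GRing.isMonoidMorphism.Build _ _ corestr corestr_monoid.
Definition corestrict : {rmorphism E -> sf_field S} := corestr.
End Corestriction.

Lemma ev_list (E F : fieldType) (f : {rmorphism E -> F}) n (P : {mpoly E[n]}) b :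
  ev f P b = \sum_(p <- [seq (P@_m, \prod_(i < n) b i ^+ m i) | m <- msupp P]) f p.1 * p.2.
Proof. by rewrite evE [RHS]big_map. Qed.

Section DiffSubfield.
Variables (F : fieldType) (V : vdf F) (A : set F) (sA : diff_subfield V A).
Definition ds_sfield : sfield F.
Proof. by refine (@Sfield F A _); case: sA. Defined.
Definition ds_field : fieldType := sf_field ds_sfield.
Definition ds_inj : {rmorphism ds_field -> F} := @sf_inj F ds_sfield.
Lemma ds_injP e : A (ds_inj e). Proof. exact: (@sf_injP F ds_sfield). Qed.
Lemma ds_lift x : A x -> exists e, ds_inj e = x. Proof. exact: (@sf_lift F ds_sfield). Qed.
Lemma ds_derP e : exists e', ds_inj e' = V (ds_inj e).
Proof. by apply: ds_lift; apply: (dsub_der sA); exact: ds_injP. Qed.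
Definition ds_der e := sval (cid (ds_derP e)).
Lemma ds_derE e : ds_inj (ds_der e) = V (ds_inj e). Proof. by rewrite /ds_der; case: cid. Qed.
Definition ds_vdf : vdf ds_field := pull_vdf ds_derE.
Lemma ds_vembed : vembed ds_vdf V ds_inj. Proof. exact: pull_vembed. Qed.
End DiffSubfield.

Arguments pG {M V G} p e.
Arguments pS {M V G} p [x y].

Lemma piso_zorn (M : rcfType) (V : vdf M) (G0 X : set (M * M)) : piso V G0 -> G0 `<=` X ->
  exists G, [/\ piso V G, G0 `<=` G, G `<=` X &
    forall G', piso V G' -> G `<=` G' -> G' `<=` X -> G' `<=` G].
Proof.
(* [G0] is joined to each member, so that the empty chain has an upper bound too. *)
move=> pG0 sG0; pose ok (A : set (M * M)) := piso V (G0 `|` A) /\ G0 `|` A `<=` X.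
have ok0 : ok set0 by rewrite /ok setU0.
have [A [[pA dA] mA]] : exists A, ok A /\ forall B, A `<` B -> ~ ok B.
  apply: Zorn_bigcup => F Fok tot; set U := \bigcup_(Y in F) Y.
  have one p : (G0 `|` U) p -> exists A, [/\ ok A, A `<=` U & (G0 `|` A) p].
    case=> [h|[Y FY Yp]]; first by exists set0; split=> //; left.
    by exists Y; split; [exact: Fok | move=> q Yq; exists Y | right].
  have two p q : (G0 `|` U) p -> (G0 `|` U) q -> exists A, [/\ ok A, A `<=` U, (G0 `|` A) p & (G0 `|` A) q].
    case=> [hp|[Y FY Yp]] hq.
      by have [A [a1 a2 a3]] := one q hq; exists A; split=> //; left.
    case: hq => [hq|[Z FZ Zq]].
      by exists Y; split; [exact: Fok | move=> r Yr; exists Y | right | left].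
    case: (tot Y Z FY FZ) => YZ.
      by exists Z; split; [exact: Fok | move=> r Zr; exists Z | right; exact: YZ | right].
    by exists Y; split; [exact: Fok | move=> r Yr; exists Y | right | right; exact: YZ].
  have up B p : B `<=` U -> (G0 `|` B) p -> (G0 `|` U) p.
    by move=> BU [h|h]; [left | right; exact: BU].
  split; last by move=> p /one[B [[_ dB] _ h]]; exact: dB h.
  split.
  - by left; exact: (piso1 pG0).
  - by move=> x y x' y' h h'; have [B [[pB _] BU a b]] := two _ _ h h'; apply: (up B) => //; exact: (pisoB pB).
  - by move=> x y x' y' h h'; have [B [[pB _] BU a b]] := two _ _ h h'; apply: (up B) => //; exact: (piso_div pB).
  - by move=> x y /one[B [[pB _] BU a]]; apply: (up B) => //; exact: (piso_der pB).
  - by move=> x y /one[B [[pB _] BU a]]; exact: (piso_sg pB a).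
  - by move=> x y /one[B [[pB _] BU a]]; exact: (piso_O pB a).
exists (G0 `|` A); split=> //; move=> G' pG' sub dG'.
apply: contrapT => nsub.
have e : G0 `|` G' = G' by apply: setUidr => p h; apply: sub; left.
apply: (mA G'); last by rewrite /ok e.
split; first by move=> p h; apply: sub; right.
by move=> sub'; apply: nsub => p /sub'; right.
Qed.

Section Extend.
Variables (M : rcfType) (V : vdf M).
Local Notation "x ≼ y" := (dominatedb (vO V) x y) (at level 70, y at next level).
Local Notation "x ≺ y" := (~~ dominatedb (vO V) y x) (at level 70, y at next level).
Local Notation "x ~~~ y" := (sim (vO V) x y) (at level 70, y at next level).
Local Notation d := (vder V).
Local Notation ld := (logder V).
Let OV := vO_ring V.
Implicit Types (x y : M) (G W : set (M * M)).

Hypothesis cvx : convex (vO V).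
Hypothesis hgt : forall x, (forall h, vO V h -> h < x) -> 0 < d x.

Lemma ld_pos x : 1 ≺ x -> 0 < ld x.
Proof.
have pos y : 0 < y -> 1 ≺ y -> 0 < ld y.
  move=> y0 y1; rewrite /logder divr_gt0 //; apply: hgt => h Oh; rewrite ltNge; apply: contra y1 => yh.
  apply: (@dom_trans _ _ OV h); last by rewrite dom1P //; exact/asboolP.
  by apply: (dom_abs cvx); rewrite !ger0_norm // ?(ltW y0) // (le_trans (ltW y0) yh).
move=> x1; have x0 := lt_dom_neq0 OV x1; have [h|h|h] := ltrgtP x 0.
- by rewrite -ldN; apply: pos; rewrite ?oppr_gt0 // domN.
- exact: pos.
- by rewrite h eqxx in x0.
Qed.

Lemma ld_neg x : x != 0 -> x ≺ 1 -> ld x < 0.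
Proof.
by move=> x0 x1; rewrite -[x]invrK ldV ?invr_eq0 // oppr_lt0; apply: ld_pos; rewrite domV1.
Qed.

(** Here the positivity of derivatives above [O] is used. Comparison of values is reduced to signs
    one logarithmic derivative further down, the form in which it is copied along chains. *)
Lemma ld_sign x : x != 0 -> 1 ≺ ld x -> (x ≼ 1) = (ld x < 0) /\ (1 ≼ x) = (0 < ld x).
Proof.
move=> x0 l1; have ne : ~ (x ≼ 1 /\ 1 ≼ x) by move=> [h h']; case/negP: l1; exact: ld_dom1.
case: (boolP (x ≼ 1)) => [h|h]; last first.
  have p := ld_pos h; rewrite p; split; first by rewrite (ltNge _ 0) (ltW p).
  exact: (domW OV h).
have h' : x ≺ 1 by apply/negP => h'; apply: ne.
by have n := ld_neg x0 h'; rewrite n (negPf h') (ltNge 0) (ltW n).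
Qed.

Record submodel (k M1 : set M) : Prop := Submodel {
  sm_dh : dh_subfield V M1;
  sm_exp : forall x, M1 x -> exists z, [/\ M1 z, z != 0 & ld z = x];
  sm_root : forall x n, M1 x -> 0 < x -> (0 < n)%N -> exists y, [/\ M1 y, 0 < y & y ^+ n = x];
  sm_res : forall x, M1 x -> x ≼ 1 -> exists c, [/\ k c, M1 c & x - c ≺ 1];
  sm_small : exists x, [/\ M1 x, x != 0 & x ≺ 1] }.

Fixpoint zseq (h : nat -> M) x i := if i is i'.+1 then ld (zseq h x i') - h i' else x.

(** Saturation enters the extension step only through this hypothesis and the next, each with
    countably many parameters: one fills a finitely satisfiable family of balls, the other realises
    a chain of shifted logarithmic derivatives. *)
Hypothesis sat_cut : forall c g : nat -> M,
  (forall n, exists x, forall i, (i < n)%N -> x - c i ≼ g i) -> exists x, forall i, x - c i ≼ g i.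
Hypothesis sat_chain : forall (h e s : nat -> M) (be ga : nat -> nat -> bool),
  (forall n, exists x, forall i j, (i < n)%N -> (j < n)%N ->
    [/\ Num.sg (zseq h x i) = s i, (zseq h x i ≼ e j) = be i j & (e j ≼ zseq h x i) = ga i j]) ->
  exists x, forall i j,
    [/\ Num.sg (zseq h x i) = s i, (zseq h x i ≼ e j) = be i j & (e j ≼ zseq h x i) = ga i j].

Variables (k M1 : set M).
Hypotheses (modM : submodel k setT) (modM1 : submodel k M1).
Hypothesis M1count : exists en : nat -> M, forall x, M1 x -> exists i, en i = x.
Let sM1 := dhs_sub (sm_dh modM1).

Lemma dom_powE x n : (0 < n)%N -> (x ^+ n ≼ 1) = (x ≼ 1).
Proof.
move=> n0; apply/idP/idP => [h|]; last exact: domX1.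
apply/negPn/negP => h'; case: n n0 h => // n _; apply/negP.
by rewrite -(expr1n _ n.+1); apply: lt_domX.
Qed.
Lemma pow_domE x n : (0 < n)%N -> (1 ≼ x ^+ n) = (1 ≼ x).
Proof.
move=> n0; have [->|x0] := eqVneq x 0; first by rewrite expr0n eqn0Ngt n0.
by rewrite -domV1 ?expf_neq0 // -exprVn dom_powE // domV1.
Qed.

(** * A maximal partial isomorphism is defined on the whole submodel *)

Section Maximal.
Variables (G : set (M * M)) (hG : piso V G) (D : pdata V G).
Hypothesis domG : forall x y, G (x, y) -> M1 x.
Hypothesis kG : forall c, k c -> M1 c -> G (c, c).
Hypothesis maxG : forall G', piso V G' -> G `<=` G' -> (forall x y, G' (x, y) -> M1 x) -> G' `<=` G.

Local Notation E := (pE D).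
Local Notation VE := (pV D).
Local Notation f1 := (pf1 D).
Local Notation f2 := (pf2 D).
Let fV1 := pV1 D.
Let fV2 := pV2 D.
Let OE := vO_ring VE.

Lemma f1M (e : E) : M1 (f1 e). Proof. exact: (domG (pG D e)). Qed.
Lemma fsg (e : E) : Num.sg (f1 e) = Num.sg (f2 e). Proof. exact: (piso_sg hG (pG D e)). Qed.
Lemma f1_pos (e : E) : (0 < f1 e) = (0 < f2 e).
Proof. by rewrite -(sgr_gt0 (f1 e)) fsg (sgr_gt0 (f2 e)). Qed.
Lemma f1_neg (e : E) : (f1 e < 0) = (f2 e < 0).
Proof. by rewrite -(sgr_lt0 (f1 e)) fsg (sgr_lt0 (f2 e)). Qed.
Lemma fdom (x y : E) : (f1 x ≼ f1 y) = (f2 x ≼ f2 y).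
Proof. by rewrite (vembed_dom fV1) (vembed_dom fV2). Qed.

Lemma fdom1 (x : E) : (f1 x ≼ 1) = (f2 x ≼ 1).
Proof. by have := fdom x 1; rewrite !rmorph1. Qed.

Lemma max_in G' : piso V G' -> (forall e, G' (f1 e, f2 e)) -> (forall x y, G' (x, y) -> M1 x) ->
  forall x y, G' (x, y) -> exists e, f1 e = x /\ f2 e = y.
Proof.
move=> pG' bG' dG' x y h; have : G (x, y).
  by apply: (maxG pG') => // -[p q] /(pS D)[e <- <-].
by move=> /(pS D)[e e1 e2]; exists e.
Qed.

Lemma M1_closed (T := [set p : M * M | M1 p.1]) :
  [/\ forall e, T (f1 e, f2 e),
   forall x y x' y', T (x, y) -> T (x', y') -> T (x + x', y + y') /\ T (x * x', y * y') &
   forall x y, x != 0 -> y != 0 -> T (x, y) -> T (x^-1, y^-1)].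
Proof.
rewrite /T; split=> /= [e|x _ x' _ h h'|x _ _ _ h]; first exact: f1M.
  by split; [exact: (dsubD sM1) | exact: (dsubM sM1)].
exact: (dsubV sM1).
Qed.

Lemma max_gen W b b' : matched V W ->
  (forall n (P : {mpoly E[n]}), tracked V W (ev f1 P b) (ev f2 P b')) ->
  (forall i, gen_graph f1 f2 b b' (d (b i), d (b' i))) -> (forall i, M1 (b i)) ->
  forall i, exists e, f1 e = b i /\ f2 e = b' i.
Proof.
move=> mW htr hder bM i; apply: (max_in (gen_piso cvx mW fV1 fV2 htr hder)).
- exact: gen_base.
- have [T0 Top TV] := M1_closed.
  by move=> x y h; exact: (gen_min cvx mW htr T0 bM Top TV h).
exact: gen_b.
Qed.

Lemma single_mon (w : M) n z : mon (fun i => if i is 0 then w else 1) n z =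
  w ^ (if n is 0%N then 0 else z 0%N).
Proof.
case: n => [|n]; first by rewrite /mon big_ord0 expr0z.
by rewrite /mon big_ord_recl big1 ?mulr1 //= => i _; rewrite exp1rz.
Qed.

(** Adjunction of one element with logarithmic derivative in [E]: the relation [d w = f1 h * w]
    keeps the generated field closed under the derivation, and maximality puts [w] in the domain. *)
Lemma max_single (w w' : M) (h : E) : M1 w -> w != 0 -> w' != 0 -> Num.sg w = Num.sg w' ->
  ld w = f1 h -> ld w' = f2 h ->
  (forall e (z : int), e != 0 -> (f1 e * w ^ z ≼ 1) = (f2 e * w' ^ z ≼ 1)) ->
  (forall e (z : int), e != 0 -> f1 e * w ^ z ≼ 1 -> 1 ≼ f1 e * w ^ z ->
     exists e', f1 e' = f1 e * w ^ z /\ f2 e' = f2 e * w' ^ z) -> exists e, f1 e = w.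
Proof.
move=> wM w0 w0' ws l1 l2 hO h1.
pose b i := if i is 0%N then w else 1; pose b' i := if i is 0%N then w' else 1.
have b0 i : b i != 0 by case: i => [|i] //=; exact: oner_neq0.
have b0' i : b' i != 0 by case: i => [|i] //=; exact: oner_neq0.
have bs i : Num.sg (b i) = Num.sg (b' i) by case: i.
have mO e n z : e != 0 -> (f1 e * mon b n z ≼ 1) = (f2 e * mon b' n z ≼ 1).
  by move=> e0; rewrite !single_mon; exact: hO.
have m1 e n z : e != 0 -> f1 e * mon b n z ≼ 1 -> 1 ≼ f1 e * mon b n z ->
    exists e', f1 e' = f1 e * mon b n z /\ f2 e' = f2 e * mon b' n z.
  by move=> e0; rewrite !single_mon; exact: h1.
have mW := monW_matched b0 b0' bs fsg mO.
have htr n (P : {mpoly E[n]}) := mon_tracked b0 b0' bs fsg mO m1 P.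
suff [e [e1 _]] : exists e, f1 e = b 0%N /\ f2 e = b' 0%N by exists e.
apply: (max_gen mW htr).
- case=> [|i]; last by rewrite /b /b' der1; exact: gen0.
  rewrite /= (derE V w0) (derE V w0') l1 l2; apply: (gen_M cvx mW htr); first exact: gen_base.
  exact: (gen_b f1 f2 b b' 0).
- by case=> [|i] //=; exact: (dsub1 sM1).
Qed.

Lemma pos_rep (e : E) : e != 0 -> exists e', [/\ e' != 0, 0 < f1 e', dominatedb (vO VE) e e' &
  dominatedb (vO VE) e' e].
Proof.
move=> e0; have [h|h|h] := ltrgtP (f1 e) 0; last by move: e0; rewrite -(fmorph_eq0 f1) h eqxx.
  by exists (- e); rewrite oppr_eq0 rmorphN oppr_gt0 domN // domxN // dom_refl.
by exists e; rewrite dom_refl.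
Qed.

(** Let [j] be the least positive exponent for which [w ^+ j] has a value in [E]. An exact [j]-th
    root [w2] of an element of [E] has the value of [w], and no smaller positive power of it has a
    value in [E]; so it can be matched with a root of the image and adjoined. *)
Lemma max_divisible (e : E) n : e != 0 -> (0 < n)%N ->
  exists e1, [/\ e1 != 0, dominatedb (vO VE) (e1 ^+ n) e & dominatedb (vO VE) e (e1 ^+ n)].
Proof.
move=> e0 n0; have [e' [e0' ep ee' e'e]] := pos_rep e0.
have [w [wM wp wn]] := sm_root modM1 (f1M e') ep n0.
have w0 : w != 0 by rewrite gt_eqF.
pose ex j := (0 < j)%N && `[< exists2 e2, e2 != 0 & w ^+ j ≼ f1 e2 /\ f1 e2 ≼ w ^+ j >].
have exn : exists j, ex j.
  by exists n; rewrite /ex n0; apply/asboolP; exists e' => //; rewrite wn dom_refl.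
case: (ex_minnP exn) => j /andP[j0 /asboolP[e2' e20' [l1' l2']]] minj.
have [e2 [e20 e2p ea eb]] := pos_rep e20'.
have l1 : w ^+ j ≼ f1 e2 by apply: (dom_trans OV) l1' _; rewrite (vembed_dom fV1).
have l2 : f1 e2 ≼ w ^+ j by apply: (dom_trans OV) _ l2'; rewrite (vembed_dom fV1).
have [w2 [w2M w2p w2j]] := sm_root modM1 (f1M e2) e2p j0.
have [w3 [_ w3p w3j]] := sm_root modM (x := f2 e2) (n := j) I (etrans (esym (f1_pos _)) e2p) j0.
have w20 : w2 != 0 by rewrite gt_eqF.
have w30 : w3 != 0 by rewrite gt_eqF.
have q : w2 / w ≼ 1 /\ 1 ≼ w2 / w.
  rewrite -(@dom_powE _ j) // -(@pow_domE _ j) // expr_div_n w2j dom_div ?expf_neq0 //.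
  by rewrite domx_div ?expf_neq0 // !mul1r.
have [ww ww'] : w2 ≼ w /\ w ≼ w2 by case: q; rewrite dom_div // domx_div // !mul1r.
have ldw (f : {rmorphism E -> M}) (fV : vembed VE V f) v : v != 0 -> v ^+ j = f e2 ->
    ld v = f (logder VE e2 / j%:R).
  move=> v0 vj; have := ldX V j v0; rewrite vj -(vembed_ld fV) => h.
  have jn : (j%:R : M) != 0 by case: (j) j0 => // j' _; exact: natr_neq0.
  by rewrite fmorph_div rmorph_nat h mulrC mulKf.
have [e3 e3w] : exists e3, f1 e3 = w2.
  apply: (max_single (w' := w3) w2M w20 w30 _ (ldw _ fV1 _ w20 w2j) (ldw _ fV2 _ w30 w3j)).
- by rewrite !gtr0_sg.
- move=> e4 z e40; rewrite -(@dom_powE _ j) // -[in RHS](@dom_powE _ j) //.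
  have h (f : {rmorphism E -> M}) (v : M) : v ^+ j = f e2 -> (f e4 * v ^ z) ^+ j = f (e4 ^+ j * e2 ^ z).
    move=> vj; rewrite exprMn rmorphM rmorphXn fmorphXz -vj; congr (_ * _).
    by rewrite !exprnP !exprz_exp mulrC.
  by rewrite (h _ _ w2j) (h _ _ w3j) fdom1.
- move=> e4 z e40 a1 a2.
  (* Only the remainder of the exponent modulo [j] matters, since [w2 ^+ j] lies in [E]. *)
  have zE := divz_eq z j; set qz := (z %/ j)%Z in zE; set s := (z %% j)%Z in zE.
  have s0 : 0 <= s by apply: modz_ge0; rewrite eqz_nat -lt0n.
  have sj : s < j by apply: ltz_pmod.
  have vE (f : {rmorphism E -> M}) (v : M) : v != 0 -> v ^+ j = f e2 ->
      v ^ z = f (e2 ^ qz) * v ^+ `|s|%N.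
    move=> v0 vj; rewrite zE expfzDr //; congr (_ * _).
      by rewrite mulrC -exprz_exp -exprnP vj fmorphXz.
    by rewrite exprnP gez0_abs.
  rewrite (vE f1 _ w20 w2j) mulrA -rmorphM in a1 a2 *; rewrite (vE f2 _ w30 w3j) mulrA -rmorphM.
  set e5 := e4 * _ in a1 a2 *.
  have e50 : e5 != 0 by rewrite mulf_neq0 ?expfz_neq0.
  have fe50 : f1 e5 != 0 by rewrite fmorph_eq0.
  case es : `|s|%N => [|t]; first by exists e5; rewrite !mulr1.
  have : ex `|s|%N.
    rewrite /ex es /=; apply/asboolP; exists e5^-1; first by rewrite invr_eq0.
    rewrite es in a1 a2; rewrite fmorphV; split.
      apply: (dom_trans OV) (_ : w2 ^+ t.+1 ≼ _); first exact: domX.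
      by rewrite -[_^-1]mul1r domx_div // mulrC.
    apply: (dom_trans OV) (_ : _ ≼ w2 ^+ t.+1) _; last exact: domX.
    by rewrite -[_^-1]mul1r dom_div // mulrC.
  move=> /minj; rewrite leqNgt; move: sj; rewrite -(gez0_abs s0) ltz_nat => -> //.
exists e3; have e30 : e3 != 0 by rewrite -(fmorph_eq0 f1) e3w.
split=> //; rewrite -(vembed_dom fV1) rmorphXn e3w /=.
  apply: (dom_trans OV) (_ : w ^+ n ≼ _); first exact: domX.
  by rewrite wn (vembed_dom fV1).
apply: (dom_trans OV) (_ : _ ≼ w ^+ n) _; last exact: domX.
by rewrite wn (vembed_dom fV1).
Qed.

(** If there is no such [g], take [w] with [ld w = h]. Each [e * w] has the infinite logarithmic
    derivative [ld e + h], so signs in [E] decide all comparisons and [w] can be adjoined.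
    Divisibility of the value group reduces powers of [w] to the first power. *)
Lemma max_exp (h : E) : exists g, g != 0 /\ dominatedb (vO VE) (logder VE g - h) 1.
Proof.
apply: contrapT => no.
have no' (e : E) : e != 0 -> 1 ≺ f1 (logder VE e + h).
  move=> e0; rewrite -(rmorph1 f1) (vembed_dom fV1); apply/negP => hh; apply: no.
  exists e^-1; rewrite invr_eq0 ldV // -opprD domN //.
have [w0 [w0M w00 w0l]] := sm_exp modM1 (f1M h).
have [w [wM wn wp wl]] : exists w, [/\ M1 w, w != 0, 0 < w & ld w = f1 h].
  have [hh|hh|hh] := ltrgtP w0 0; last by rewrite hh eqxx in w00.
    by exists (- w0); rewrite oppr_eq0 oppr_gt0 ldN; split=> //; exact: (dsubN sM1).
  by exists w0.
have [v0 [_ v00 v0l]] := sm_exp modM (x := f2 h) I.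
have [v [vn vp vl]] : exists v, [/\ v != 0, 0 < v & ld v = f2 h].
  have [hh|hh|hh] := ltrgtP v0 0; last by rewrite hh eqxx in v00.
    by exists (- v0); rewrite oppr_eq0 oppr_gt0 ldN.
  by exists v0.
have base (e : E) : e != 0 -> [/\ (f1 e * w ≼ 1) = (f2 e * v ≼ 1), (1 ≼ f1 e * w) = (1 ≼ f2 e * v) &
    ~ (f1 e * w ≼ 1 /\ 1 ≼ f1 e * w)].
  move=> e0; have fe1 : f1 e != 0 by rewrite fmorph_eq0.
  have fe2 : f2 e != 0 by rewrite fmorph_eq0.
  have L1 : ld (f1 e * w) = f1 (logder VE e + h) by rewrite ldM // wl -(vembed_ld fV1) rmorphD.
  have L2 : ld (f2 e * v) = f2 (logder VE e + h) by rewrite ldM // vl -(vembed_ld fV2) rmorphD.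
  have l1 : 1 ≺ ld (f1 e * w) by rewrite L1; exact: no'.
  have l2 : 1 ≺ ld (f2 e * v) by rewrite L2 -(rmorph1 f2) -fdom rmorph1; exact: no'.
  have [a1 b1] := ld_sign (mulf_neq0 fe1 wn) l1; have [a2 b2] := ld_sign (mulf_neq0 fe2 vn) l2.
  rewrite a1 b1 a2 b2 L1 L2 f1_pos f1_neg; split=> // -[x1 x2].
  by have := lt_trans x1 x2; rewrite ltxx.
have pw (e : E) (n : nat) : e != 0 -> (0 < n)%N -> exists e1, [/\ e1 != 0,
    (forall x (f : {rmorphism E -> M}), vembed VE V f -> x != 0 ->
       ((f e * x ^+ n ≼ 1) = (f e1 * x ≼ 1)) * ((1 ≼ f e * x ^+ n) = (1 ≼ f e1 * x)))%type
    & True].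
  move=> e0 n0; have [e1 [e10 ea eb]] := max_divisible e0 n0; exists e1; split=> // x f fV x0.
  have ea' : f e1 ^+ n ≼ f e by rewrite -rmorphXn (vembed_dom fV).
  have eb' : f e ≼ f e1 ^+ n by rewrite -rmorphXn (vembed_dom fV).
  have AB : f e * x ^+ n ≼ f e1 ^+ n * x ^+ n by rewrite domM2r ?expf_neq0.
  have BA : f e1 ^+ n * x ^+ n ≼ f e * x ^+ n by rewrite domM2r ?expf_neq0.
  split; [rewrite -[RHS](@dom_powE _ n) // exprMn | rewrite -[RHS](@pow_domE _ n) // exprMn].
    by apply/idP/idP => h'; [exact: (dom_trans OV BA) | exact: (dom_trans OV AB)].
  by apply/idP/idP => h'; [exact: (dom_trans OV) h' AB | exact: (dom_trans OV) h' BA].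
have inv2 (e : E) : e != 0 -> [/\ (f1 e * w^-1 ≼ 1) = (f2 e * v^-1 ≼ 1),
    (1 ≼ f1 e * w^-1) = (1 ≼ f2 e * v^-1) & ~ (f1 e * w^-1 ≼ 1 /\ 1 ≼ f1 e * w^-1)].
  move=> e0; have eV0 : e^-1 != 0 by rewrite invr_eq0.
  have [a b c] := base _ eV0; rewrite !fmorphV in a b c.
  have r (x y : M) : x != 0 -> y != 0 -> ((x * y^-1 ≼ 1) = (1 ≼ x^-1 * y)) * ((1 ≼ x * y^-1) = (x^-1 * y ≼ 1)).
    move=> x0 y0; have -> : x^-1 * y = (x * y^-1)^-1 by rewrite invfM invrK.
    by rewrite dom1V ?domV1 // mulf_neq0 ?invr_eq0.
  have fe1 : f1 e != 0 by rewrite fmorph_eq0.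
  have fe2 : f2 e != 0 by rewrite fmorph_eq0.
  split.
  - by rewrite (r _ _ fe1 wn).1 (r _ _ fe2 vn).1 b.
  - by rewrite (r _ _ fe1 wn).2 (r _ _ fe2 vn).2 a.
  - by rewrite (r _ _ fe1 wn).1 (r _ _ fe1 wn).2 => -[h1 h2]; apply: c.
have [e ew] : exists e, f1 e = w.
  apply: (max_single (w' := v) wM wn vn _ wl vl); first by rewrite !gtr0_sg.
    move=> e [[|n]|n] e0; first by rewrite !expr0z !mulr1 fdom1.
      rewrite -!exprnP; have [e1 [e10 he1 _]] := @pw e n.+1 e0 isT.
      by rewrite (he1 w f1 fV1 wn).1 (he1 v f2 fV2 vn).1; case: (base _ e10).
    rewrite !NegzE -!exprnN -!exprVn; have [e1 [e10 he1 _]] := @pw e n.+1 e0 isT.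
    rewrite (he1 w^-1 f1 fV1 (invr_neq0 wn)).1 (he1 v^-1 f2 fV2 (invr_neq0 vn)).1; by case: (inv2 _ e10).
  move=> e [[|n]|n] e0; first by exists e; rewrite !expr0z !mulr1.
    rewrite -!exprnP; have [e1 [e10 he1 _]] := @pw e n.+1 e0 isT.
    by rewrite !(he1 w f1 fV1 wn) => h1 h2; case: (base _ e10) => _ _ [].
  rewrite !NegzE -!exprnN -!exprVn; have [e1 [e10 he1 _]] := @pw e n.+1 e0 isT.
  by rewrite !(he1 w^-1 f1 fV1 (invr_neq0 wn)) => h1 h2; case: (inv2 _ e10) => _ _ [].
have e0 : e != 0 by rewrite -(fmorph_eq0 f1) ew.
by apply: no; exists e; split=> //; rewrite -(vembed_dom fV1) rmorphB (vembed_ld fV1) ew wl subrr dom0x.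
Qed.

Lemma E_enum : exists eE : nat -> E, forall e, exists i, eE i = e.
Proof.
have [en hen] := M1count.
exists (fun i => if pselect (exists e, f1 e = en i) is left h then sval (cid h) else 0) => e.
have [i hi] := hen _ (f1M e); exists i; case: pselect => [h|[]]; last by exists e.
by case: cid => e' /= he'; apply: (fmorph_inj f1); rewrite he' hi.
Qed.

Definition baseW : set (M * M) := [set p | exists2 e : E, e != 0 & p = (f1 e, f2 e)].
Lemma baseW_matched : matched V baseW.
Proof.
split.
- by move=> x y [e e0 [-> ->]]; rewrite !fmorph_eq0.
- move=> x y x' y' [e e0 [-> ->]] [e' e0' [-> ->]]; exists (e / e'); rewrite ?fmorph_div //.
  by rewrite mulf_neq0 ?invr_eq0.
- by move=> x y [e e0 [-> ->]]; exact: fsg.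
- by move=> x y [e e0 [-> ->]]; exact: fdom1.
Qed.

Lemma stable_value (f : {rmorphism E -> M}) (fV : vembed VE V f) n (P : {mpoly E[n]}) c g u :
  P != 0 -> g != 0 -> stable VE P c g -> u - f c ≼ f g ->
  (P.@[jet VE c] : E) != 0 /\ ev f P (fun i => iter i d u) ~~~ f P.@[jet VE c].
Proof.
move=> P0 g0 st uc; have fg0 : f g != 0 by rewrite fmorph_eq0.
rewrite (map_mpoly_eval _ _ fV).
have [n0|n0] := posnP n.
  have PE : P = (P@_0)%:MP.
    by apply: wle_const => m _; rewrite /wdeg big1 // => i; have := ltn_ord i; rewrite {2}n0.
  have p0 : (P@_0 : E) != 0 by apply: contra P0 => /eqP e; rewrite PE e mpolyC0.
  rewrite PE mevalC evC map_mpolyC mevalC; split=> //; apply: sim_refl => //.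
  by rewrite fmorph_eq0.
have [_ s] := stable_mono fg0 n0 (stable_map fV st) (dom_refl OV (f g)) uc.
split; last exact: s.
by have := sim_neq0 OV s; rewrite -(map_mpoly_eval _ _ fV) fmorph_eq0.
Qed.

(** All points of the cut give each polynomial equivalent values, so [u] may be sent to any point
    [u'] that saturation finds in the image cut. *)
Lemma cut_all_stable (C : E -> E -> Prop) u : cut VE C ->
  (forall n (P : {mpoly E[n]}), P != 0 -> stable_on VE C P) -> M1 u ->
  (forall c g, C c g -> u - f1 c ≼ f1 g) -> exists e, f1 e = u.
Proof.
move=> cC st uM hu; have [eE heE] := E_enum; have [c0 [g0 C0]] := cut_ne cC.
pose pr i : E * E := let p := odflt (0%N, 0%N) (unpickle i) in (eE p.1, eE p.2).
(* Enumerates the balls of the cut, with [(c0, g0)] as default for pairs that are not among them. *)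
pose cg i : E * E := if `[< C (pr i).1 (pr i).2 >] then pr i else (c0, g0).
have Ccg i : C (cg i).1 (cg i).2 by rewrite /cg; case: ifP => [/asboolP|].
have [u' hu'] : exists u', forall i, u' - f2 (cg i).1 ≼ f2 (cg i).2.
  apply: (sat_cut (c := fun i => f2 (cg i).1) (g := fun i => f2 (cg i).2)) => n.
  suff [c [g [Cc h]]] : exists c g, C c g /\ forall i, (i < n)%N -> dominatedb (vO VE) g (cg i).2.
    exists (f2 c) => i ni; rewrite -rmorphB (vembed_dom fV2).
    exact: (cut_nest cC (Ccg i) Cc (h i ni)).
  elim: n => [|n [c [g [Cc h]]]]; first by exists c0, g0.
  have [c' [g' [C' l1 l2]]] := cut_common cC Cc (Ccg n).
  exists c', g'; split=> // i; rewrite ltnS leq_eqVlt => /orP[/eqP ->|ni]; first exact: (domW OE).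
  exact: (dom_trans OE) (domW OE l1) (h i ni).
have {}hu' c g : C c g -> u' - f2 c ≼ f2 g.
  move=> Cc; have [i1 e1] := heE c; have [i2 e2] := heE g.
  have := hu' (pickle (i1, i2)); rewrite /cg /pr pickleK /= e1 e2.
  by case: asboolP.
pose b i := iter i d u; pose b' i := iter i d u'.
have htr n (P : {mpoly E[n]}) : tracked V baseW (ev f1 P b) (ev f2 P b').
  have [->|P0] := eqVneq P 0; first by left; rewrite !ev0.
  have [c [g [Cc stc]]] := st n P P0; have gn := cut_neq0 cC Cc.
  have [p0 s1] := stable_value fV1 P0 gn stc (hu _ _ Cc).
  have [_ s2] := stable_value fV2 P0 gn stc (hu' _ _ Cc).
  by right; exists (f1 P.@[jet VE c]), (f2 P.@[jet VE c]); split=> //; exists P.@[jet VE c].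
have bM i : M1 (b i) by exact: (dsub_iter sM1).
have hder i : gen_graph f1 f2 b b' (d (b i), d (b' i)) by exact: (gen_b f1 f2 b b' i.+1).
by have [e [e1 _]] := max_gen baseW_matched htr hder bM 0; exists e.
Qed.

(** Polynomials simpler than [P] are stable, so a zero of [P] in the cut is determined up to
    isomorphism; one is found in [M1] and one in the image cut. *)
Lemma cut_zero (C : E -> E -> Prop) n r dd D' (P : {mpoly E[n]}) c0 g0 : cut VE C ->
  minimal_bad (unstable_on VE C) r dd D' P -> C c0 g0 -> lin_dom VE P c0 g0 ->
  exists e, forall c g, C c g -> dominatedb (vO VE) (e - c) g.
Proof.
move=> cC mP C0 ldP; have [[[P0 us] _ _ _] _ _] := mP.
have ust c g : C c g -> ~ stable VE P c g by move=> Cc st; apply: us; exists c, g.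
have [u [uM hu zu]] := zero_in_cut fV1 (sm_dh modM1) f1M cC C0 ldP ust.
have [u' [_ hu' zu']] := zero_in_cut fV2 (sm_dh modM) (fun _ => I) cC C0 ldP ust.
have good (Q : {mpoly E[n]}) : Q != 0 -> ~ unstable_on VE C Q -> exists v v',
    [/\ baseW (v, v'), ev f1 Q (fun i => iter i d u) ~~~ v & ev f2 Q (fun i => iter i d u') ~~~ v'].
  move=> Q0 nu; have [c [g [Cc stc]]] : stable_on VE C Q by apply: contrapT => h; apply: nu.
  have gn := cut_neq0 cC Cc.
  have [p0 s1] := stable_value fV1 Q0 gn stc (hu _ _ Cc).
  have [_ s2] := stable_value fV2 Q0 gn stc (hu' _ _ Cc).
  by exists (f1 Q.@[jet VE c]), (f2 Q.@[jet VE c]); split=> //; exists Q.@[jet VE c].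
have [G' [pG' bG' Gu Gm]] := zero_extension cvx fV1 fV2 baseW_matched mP good P0 zu zu'.
have [T0 Top TV] := M1_closed.
have [e [e1 _]] : exists e, f1 e = u /\ f2 e = u'.
  apply: (max_in pG' bG' _ Gu) => x y; apply: (Gm [set p | M1 p.1]) => // i.
  exact: (dsub_iter sM1).
by exists e => c g Cc; rewrite -(vembed_dom fV1) rmorphB e1; exact: hu.
Qed.

Lemma cut_has_limit (C : E -> E -> Prop) u : cut VE C ->
  (forall n r dd D' (P : {mpoly E[n]}), minimal_bad (unstable_on VE C) r dd D' P ->
     exists c g, C c g /\ lin_dom VE P c g) -> M1 u ->
  (forall c g, C c g -> u - f1 c ≼ f1 g) -> exists e, forall c g, C c g -> dominatedb (vO VE) (e - c) g.
Proof.
move=> cC hl uM hu.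
case: (pselect (forall n (P : {mpoly E[n]}), P != 0 -> stable_on VE C P)) => [st|ns].
  have [e e1] := cut_all_stable cC st uM hu; exists e => c g Cc.
  by rewrite -(vembed_dom fV1) rmorphB e1; exact: hu.
have [n [P uP]] : exists n (P : {mpoly E[n]}), unstable_on VE C P.
  apply: contrapT => h; apply: ns => n P P0; apply: contrapT => h'; apply: h; by exists n, P.
have [r [dd [D' [P' mP]]]] := minimal_bad_exists (ex_intro _ P uP) (fun Q => @unstable_nonconst _ VE n C Q cC).
have [c [g [Cc ldP]]] := hl _ _ _ _ _ mP.
exact: (cut_zero cC mP Cc ldP).
Qed.

Lemma cut_map (F1 F2 : fieldType) (W1 : vdf F1) (W2 : vdf F2) (j : {rmorphism F1 -> F2})
  (jV : vembed W1 W2 j) C : cut W1 C ->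
  cut W2 (fun x s : F2 => exists e t, [/\ C e t, x = j e & s = j t]).
Proof.
move=> [[c [g Cc]] n0 nest shr]; split.
- by exists (j c), (j g), c, g.
- by move=> _ _ [e [t [Ce _ ->]]]; rewrite fmorph_eq0; exact: (n0 _ _ Ce).
- move=> _ _ _ _ [e [t [Ce -> ->]]] [e' [t' [Ce' -> ->]]].
  by rewrite -rmorphB !(vembed_dom jV); exact: nest.
- move=> _ _ [e [t [Ce _ ->]]]; have [e' [t' [Ce' lt]]] := shr _ _ Ce.
  by exists (j e'), (j t'); split; [exists e', t' | rewrite (vembed_dom jV)].
Qed.

Lemma lt_chain_pow (F1 : fieldType) (W1 : vdf F1) (x : F1) a n : x != 0 ->
  ~~ dominatedb (vO W1) 1 x -> lt_chain W1 [seq x ^+ i | i <- iota a n].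
Proof.
move=> x0 x1; have O1 := vO_ring W1; elim: n a => //= n IH a; split; [by rewrite expf_neq0 | | exact: IH].
move=> _ /mapP[i hi ->]; move: hi; rewrite mem_iota => /andP[ai _].
have -> : i = ((i - a).-1.+1 + a)%N by lia.
rewrite exprD -{1}[x ^+ a]mul1r domM2r ?expf_neq0 //.
have := lt_domX O1 (i - a).-1 x1; rewrite expr1n //.
Qed.

(** The linearisation at [w] has coefficients outside [E], so the Riccati polynomial lives over the
    field [N] of [M1], and the logarithmic cut is moved there. It is unstable by [riccati_unstable];
    [ld_closed_lin_dom] supplies linear dominance for a minimal unstable polynomial, which then has
    a zero in [M1]. *)
Lemma riccati_limit (C : E -> E -> Prop) n r dd D' (P : {mpoly E[n]}) w : cut VE C ->
  minimal_bad (unstable_on VE C) r dd D' P -> (forall c g, C c g -> ~ lin_dom VE P c g) ->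
  M1 w -> (forall c g, C c g -> w - f1 c ≼ f1 g) ->
  exists2 u, M1 u & forall e s, log_cut VE C e s -> u - f1 e ≼ f1 s.
Proof.
move=> cC mP nd wM hw.
have [[uP _ _ _] _ _] := mP; have [P0 _] := uP.
have ps := minimal_partials_stable cC mP.
have nc := nonconst_coef (unstable_nonconst cC uP).
have lf := not_lin_dom_log_fast cC ps nc nd.
have cD := log_cut_cut cC max_exp lf.
pose N := ds_field sM1; pose VN := ds_vdf sM1; pose j : {rmorphism N -> M} := ds_inj sM1.
have jV : vembed VN V j by exact: ds_vembed.
pose g1 : {rmorphism E -> N} := @corestrict _ _ f1 (ds_sfield sM1) f1M.
have jg e : j (g1 e) = f1 e by [].
have gV : vembed VE VN g1.
  split=> e.
    by apply: (fmorph_inj j); rewrite (vembed_der jV) !jg (vembed_der fV1).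
  by rewrite (jV.2 (g1 e)) jg; exact: (fV1.2 e).
have [w1 ew1] := ds_lift sM1 wM.
have ON := vO_ring VN.
have expN (x : N) : exists2 z, z != 0 & logder VN z = x.
  have [z [zM z0 zl]] := sm_exp modM1 (ds_injP x); have [z1 ez1] := ds_lift sM1 zM.
  exists z1; first by rewrite -(fmorph_eq0 j) /j ez1.
  by apply: (fmorph_inj j); rewrite (vembed_ld jV) /j ez1.
have hw1 c g : C c g -> dominatedb (vO VN) (w1 - g1 c) (g1 g).
  by move=> Cc; rewrite -(vembed_dom jV) rmorphB jg jg /j ew1; exact: hw.
pose th (i : 'I_n) : N := ((map_mpoly g1 P)^`M(i)).@[jet VN w1].
have [R hR] := riccati_op VN th.
have usR := riccati_unstable gV cC max_exp expN ps nd hw1 nc hR.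
pose D1 := fun x s : N => exists e t, [/\ log_cut VE C e t, x = g1 e & s = g1 t].
have cD1 : cut VN D1 by exact: (cut_map gV cD).
(* Otherwise the linear operator would vanish identically, although the powers of an infinitesimal
   form too long a chain for its kernel. *)
have R0 : R != 0.
  apply/eqP => e.
  have op z : lin_op VN th z = 0.
    have [->|z0] := eqVneq z 0.
      by rewrite /lin_op big1 // => i _; rewrite iter_der0 mulr0.
    have := hR z z0; rewrite e meval0 => /esym/eqP; rewrite mulf_eq0 invr_eq0 (negPf z0) orbF.
    by move/eqP.
  have [x [xM x0 x1]] := sm_small modM1; have [x' ex'] := ds_lift sM1 xM.
  have x0' : x' != 0 by rewrite -(fmorph_eq0 j) /j ex'.
  have x1' : ~~ dominatedb (vO VN) 1 x' by rewrite -(vembed_dom jV) rmorph1 /j ex'.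
  suff ht : exists i, th i != 0.
    have := @kernel_chain _ VN n th _ ht (lt_chain_pow 1 n x0' x1') (fun z _ => op z).
    by rewrite size_map size_iota ltnn.
  have [i hi] := nonconst_partial VE (oner_neq0 E) nc; exists i.
  have := ps 1 i (oner_neq0 E); rewrite psub01 in hi *; case=> [h|[c [g [Cc st]]]].
    by rewrite h eqxx in hi.
  rewrite !divr1 in st; have gn := cut_neq0 cC Cc.
  have gn1 : g1 g != 0 by rewrite fmorph_eq0.
  have n0 : (0 < n)%N by have := ltn_ord i; lia.
  have [_ s] := stable_mono gn1 n0 (stable_map gV st) (dom_refl ON (g1 g)) (hw1 _ _ Cc).
  by have := sim_neq0l ON s; rewrite map_mderiv.
have uR : unstable_on VN D1 R.
  by split=> // -[_ [_ [[e [s [De -> ->]]] st]]]; exact: (usR _ _ De st).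
have [r1 [d1 [D1' [P1 mP1]]]] := minimal_bad_exists (ex_intro _ R uR) (fun Q => @unstable_nonconst _ VN n D1 Q cD1).
have [[uP1 _ _ _] _ _] := mP1.
have [||e [s [De ld1]]] := ld_closed_lin_dom cD1 _ (minimal_partials_stable cD1 mP1).
- move=> _ _ [e [t [De _ ->]]]; have [t1 _] := De; split.
    by rewrite -(rmorph1 g1) (vembed_dom gV).
  have [e' De'] := log_cut_ld cC max_exp lf De.
  by exists (g1 e'), e', (logder VE t); rewrite (vembed_ld gV).
- exact: (nonconst_coef (unstable_nonconst cD1 uP1)).
have ust c g : D1 c g -> ~ stable VN P1 c g by move=> Dc st; apply: uP1.2; exists c, g.
have [u [uM hu _]] := zero_in_cut jV (sm_dh modM1) (@ds_injP _ V M1 sM1) cD1 De ld1 ust.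
exists u => // e' s' De'; rewrite -!jg; apply: hu; by exists e', s'.
Qed.

(** The balls with data in [E] that contain [w] have no common point in [E]. If every minimal
    unstable polynomial has linear dominance somewhere, there would be one; otherwise the
    logarithmic cut has a point in [M1], the same argument gives it a limit in [E], and
    [log_cut_nolimit] excludes that. *)
Lemma max_no_pc w : M1 w -> (forall c : E, exists c', w - f1 c' ≺ w - f1 c) -> False.
Proof.
move=> wM pc; pose C (c g : E) := g != 0 /\ w - f1 c ≼ f1 g.
have val c c' : w - f1 c' ≺ w - f1 c -> w - f1 c ≼ f1 (c' - c) /\ f1 (c' - c) ≼ w - f1 c.
  move=> lt; have s : f1 (c' - c) ~~~ w - f1 c.
    rewrite /sim rmorphB (_ : f1 c' - f1 c - _ = - (w - f1 c')) ?lt_domN //; ring.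
  by split; [exact: (sim_domr OV s) | exact: (sim_doml OV s)].
have nz c : w - f1 c != 0 by have [c' h] := pc c; exact: (lt_dom_neq0 OV h).
have nzd c c' : w - f1 c' ≺ w - f1 c -> c' - c != 0.
  by move=> h; rewrite -(fmorph_eq0 f1); apply: (dom_neq0 OV (val _ _ h).1); exact: nz.
have shr c g : C c g -> exists c' g', C c' g' /\ ~~ dominatedb (vO VE) g g'.
  move=> [g0 cg]; have [c' h'] := pc c; have [c'' h''] := pc c'.
  exists c', (c'' - c'); split; first by split; [exact: nzd h'' | case: (val _ _ h'')].
  rewrite -(vembed_dom fV1); apply: (dom_lt_trans OV (val _ _ h'').2).
  exact: (lt_dom_trans OV) h' cg.
have cC : cut VE C.
  split=> //.
  - have [c' h'] := pc 0; exists 0, (c' - 0); split; [exact: nzd h' | by case: (val _ _ h')].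
  - by move=> c g [].
  - move=> c g c' g' [g0 h] [g0' h'] gg; rewrite -(vembed_dom fV1) rmorphB.
    rewrite (_ : f1 c' - f1 c = (w - f1 c) - (w - f1 c')); last by ring.
    by apply: domB => //; apply: (dom_trans OV) h' _; rewrite (vembed_dom fV1).
have hw c g : C c g -> w - f1 c ≼ f1 g by case.
have nolim e : ~ forall c g, C c g -> dominatedb (vO VE) (e - c) g.
  move=> lim; have [c' h'] := pc e; have Ce : C e (c' - e).
    by split; [exact: nzd h' | case: (val _ _ h')].
  have [c1 [g1 [C1 lt1]]] := shr _ _ Ce.
  have : w - f1 e ≼ f1 g1.
    rewrite (_ : w - f1 e = (w - f1 c1) - f1 (e - c1)); last by rewrite rmorphB; ring.
    apply: domB => //; first by case: C1.
    by rewrite (vembed_dom fV1); exact: lim.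
  move=> /(dom_trans OV (val _ _ h').2); rewrite (vembed_dom fV1); exact/negP.
case: (pselect (forall n r dd D' (P : {mpoly E[n]}), minimal_bad (unstable_on VE C) r dd D' P ->
     exists c g, C c g /\ lin_dom VE P c g)) => [hl|nl].
  by have [e he] := cut_has_limit cC hl wM hw; exact: (nolim e he).
have [n [r [dd [D' [P [mP nd]]]]]] : exists n r dd D' (P : {mpoly E[n]}),
    minimal_bad (unstable_on VE C) r dd D' P /\ forall c g, C c g -> ~ lin_dom VE P c g.
  apply: contrapT => h; apply: nl => n r dd D' P mP; apply: contrapT => h'; apply: h.
  by exists n, r, dd, D', P; split=> // c g Cc ldP; apply: h'; exists c, g.
have [u uM hu] := riccati_limit cC mP nd wM hw.
have [[uP _ _ _] _ _] := mP.
have nc := nonconst_coef (unstable_nonconst cC uP).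
have lf := not_lin_dom_log_fast cC (minimal_partials_stable cC mP) nc nd.
have cD := log_cut_cut cC max_exp lf.
have [|e he] := cut_has_limit cD _ uM hu; last exact: (log_cut_nolimit cC max_exp lf he).
move=> n1 r1 d1 D1 P1 mP1; have [[uP1 _ _ _] _ _] := mP1.
apply: (ld_closed_lin_dom cD _ (minimal_partials_stable cD mP1)).
  move=> e s De; split; [by case: De | exact: (log_cut_ld cC max_exp lf De)].
exact: (nonconst_coef (unstable_nonconst cD uP1)).
Qed.

Variant newval x : Prop := Newval of forall e : E, ~ (x ≼ f1 e /\ f1 e ≼ x).

Lemma newvalE x : newval x -> forall e : E, ~ (x ≼ f1 e /\ f1 e ≼ x).
Proof. by case. Qed.
Arguments newvalE [x] _ e _.

Lemma newval_neq0 x : newval x -> x != 0.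
Proof. by move=> h; apply/eqP => x0; apply: (newvalE h 0); rewrite rmorph0 x0 dom_refl. Qed.

Lemma newval_cmp x e : newval x -> (x ≼ f1 e) = ~~ (f1 e ≼ x).
Proof.
move=> h; apply/idP/idP => [a|]; last exact: (domW OV).
by apply/negP => b; apply: (newvalE h e).
Qed.

(** If the error [w - c] had the value of some [e] in [E], the residue of [(w - c) / e] would be
    represented by an [a] in [k], which lies in the domain, and [c + a * e] would be a better
    approximation. *)
Lemma best_approx w : M1 w -> (forall e, f1 e != w) ->
  exists c, newval (w - f1 c) /\ forall c', w - f1 c ≼ w - f1 c'.
Proof.
move=> wM wE.
have [c hc] : exists c, forall c', w - f1 c ≼ w - f1 c'.
  apply: contrapT => h; apply: (max_no_pc wM) => c; apply: contrapT => h'; apply: h; exists c => c'.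
  by apply/negPn/negP => lt; apply: h'; exists c'.
exists c; split=> //; split=> e [l1 l2].
have w0 : w - f1 c != 0 by rewrite subr_eq0 eq_sym.
have e0 : f1 e != 0 by exact: (dom_neq0 OV l1 w0).
have [a [ka Ma sa]] : exists a, [/\ k a, M1 a & (w - f1 c) / f1 e - a ≺ 1].
  apply: (sm_res modM1); last by rewrite dom_div // mul1r.
  apply: (dsub_div sM1); last exact: f1M.
  by apply: (dsubB sM1) => //; exact: f1M.
have [a' ea _] := pS D (kG ka Ma).
have := hc (c + a' * e); apply/negP; rewrite rmorphD rmorphM ea opprD addrA.
have -> : w - f1 c - a * f1 e = ((w - f1 c) / f1 e - a) * f1 e by rewrite mulrBl divfK.
have h : ((w - f1 c) / f1 e - a) * f1 e ≺ 1 * f1 e by rewrite domM2r.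
by rewrite mul1r in h; exact: (lt_dom_trans OV) h l2.
Qed.

(** An approximation of [ld x] up to [O] would, through [max_exp], produce an element of [E] with
    the value of [x]. So the best approximation leaves an infinite error, again of new value. *)
Lemma newval_step x : M1 x -> newval x -> exists h : E,
  [/\ newval (ld x - f1 h), 1 ≺ ld x - f1 h & ld x - f1 h ≼ ld x].
Proof.
move=> xM nx; have x0 := newval_neq0 nx.
have lx h : ~ (ld x - f1 h ≼ 1).
  move=> lt; have [e [e0 le]] := max_exp h.
  have fe0 : f1 e != 0 by rewrite fmorph_eq0.
  have : ld (x / f1 e) ≼ 1.
    rewrite ld_div // (_ : _ - _ = (ld x - f1 h) - (ld (f1 e) - f1 h)); last by ring.
    by apply: domB => //; rewrite -(vembed_ld fV1) -rmorphB -(rmorph1 f1) (vembed_dom fV1).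
  rewrite ld_dom1E ?mulf_neq0 ?invr_eq0 // dom_div // domx_div // !mul1r => /andP[a b].
  exact: (newvalE nx e).
have lM : M1 (ld x) by apply: (dsub_div sM1) => //; exact: (dsub_der sM1).
have [|h [nh bh]] := best_approx lM.
  by move=> h; apply/eqP => e; apply: (lx h); rewrite e subrr dom0x.
exists h; split=> //; first exact/negP/lx.
by have := bh 0; rewrite rmorph0 subr0.
Qed.

(* [y] realizes in the codomain the type of [x] over the finite set [A] *)
Definition same_cut (A : seq E) x y := [/\ y != 0, Num.sg y = Num.sg x &
  forall e, e \in A -> (y ≼ f2 e) = (x ≼ f1 e) /\ (f2 e ≼ y) = (f1 e ≼ x)].

Lemma same_cut_exists (A : seq E) x : newval x -> exists y, same_cut A x y.
Proof.
move=> nx; have x0 := newval_neq0 nx.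
have abs y : y != 0 -> exists y', [/\ y' != 0, Num.sg y' = Num.sg x, y' ≼ y & y ≼ y'].
  move=> y0; have hN : [/\ - y != 0, - y ≼ y & y ≼ - y] by rewrite oppr_eq0 domN // domxN // dom_refl.
  have hP : [/\ y != 0, y ≼ y & y ≼ y] by rewrite dom_refl.
  have [hx|hx|hx] := ltrgtP x 0; last by rewrite hx eqxx in x0.
    rewrite (ltr0_sg hx); have [hy|hy|hy] := ltrgtP y 0; last by rewrite hy eqxx in y0.
      by exists y; rewrite (ltr0_sg hy); case: hP.
    by exists (- y); rewrite ltr0_sg ?oppr_lt0 //; case: hN.
  rewrite (gtr0_sg hx); have [hy|hy|hy] := ltrgtP y 0; last by rewrite hy eqxx in y0.
    by exists (- y); rewrite gtr0_sg ?oppr_gt0 //; case: hN.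
  by exists y; rewrite (gtr0_sg hy); case: hP.
suff [y [y0 hy]] : exists y, y != 0 /\ forall e, e \in A ->
    (f1 e ≼ x -> f2 e ≺ y) /\ (x ≼ f1 e -> y ≺ f2 e).
  have [y' [y0' sy a b]] := abs y y0; exists y'; split=> // e eA.
  have [h1 h2] := hy e eA; case: (boolP (x ≼ f1 e)) => hx.
    have l : y' ≺ f2 e by exact: (dom_lt_trans OV) a (h2 hx).
    by rewrite (domW OV l) (negPf l); move: hx; rewrite (newval_cmp _ nx) => /negPf ->.
  have l : f2 e ≺ y' by exact: (lt_dom_trans OV) (h1 (domW OV hx)) b.
  by rewrite (domW OV l) (negPf l) (domW OV hx).
have [t [_ t0 t1]] := sm_small modM.
(* [lo] and [up] are the best bounds of [x] in [A] so far *)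
suff [lo [up [h1 h2]]] : exists (lo up : option E),
    [/\ (forall a, lo = Some a -> a != 0 /\ f1 a ≼ x), (forall a, up = Some a -> x ≼ f1 a) &
     (forall e, e \in A -> (f1 e ≼ x -> e != 0 -> exists2 a, lo = Some a & f1 e ≼ f1 a) /\
        (x ≼ f1 e -> exists2 a, up = Some a & f1 a ≼ f1 e))].
  move=> h3.
  have upn a : up = Some a -> a != 0.
    by move=> /h2 h; rewrite -(fmorph_eq0 f1); exact: (dom_neq0 OV h x0).
  suff [y [y0 hl hu]] : exists y, [/\ y != 0, (forall a, lo = Some a -> f2 a ≺ y) &
      (forall a, up = Some a -> y ≺ f2 a)].
    exists y; split=> // e eA; have [k1 k2] := h3 e eA; split=> [ex|xe].
      have [->|e0] := eqVneq e 0; first by rewrite rmorph0 lt0_dom.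
      have [a la ea] := k1 ex e0; apply: (dom_lt_trans OV) _ (hl a la); by rewrite -fdom.
    have [a ua ae] := k2 xe; apply: (lt_dom_trans OV) (hu a ua) _; by rewrite -fdom.
  case: lo up h1 h2 upn {h3} => [a|] [b|] h1 h2 upn.
  - have [a0 ax] := h1 _ erefl; have xb := h2 _ erefl; have b0 := upn _ erefl.
    have ab : ~~ dominatedb (vO VE) b a.
      rewrite -(vembed_dom fV1); apply/negP => h; apply: (newvalE nx b); split=> //.
      exact: (dom_trans OV) h ax.
    (* Divisibility of the value group gives a value halfway between those of [a] and [b]; when one
       bound is missing, the infinitesimal factor [t] is enough. *)
    have [e [e0 l1 l2]] := max_divisible (mulf_neq0 a0 b0) (isT : 0 < 2)%N.
    exists (f2 e); split; first by rewrite fmorph_eq0.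
      move=> _ [<-]; rewrite (vembed_dom fV2); apply/negP => h.
      have : dominatedb (vO VE) (a * b) (a * a).
        by apply: (dom_trans OE) l2 _; rewrite expr2; exact: domM.
      by rewrite domM2l //; exact/negP.
    move=> _ [<-]; rewrite (vembed_dom fV2); apply/negP => h.
    have : dominatedb (vO VE) (b * b) (a * b).
      by apply: (dom_trans OE) _ l1; rewrite expr2; exact: domM.
    by rewrite domM2r //; exact/negP.
  - have [a0 ax] := h1 _ erefl; exists (f2 a / t).
    have fa0 : f2 a != 0 by rewrite fmorph_eq0.
    split; [by rewrite mulf_neq0 ?invr_eq0 | | by []].
    by move=> _ [<-]; rewrite dom_div // -{1}[f2 a]mulr1 domM2l.
  - have fb0 : f2 b != 0 by rewrite fmorph_eq0 upn.
    exists (f2 b * t); split; [by rewrite mulf_neq0 | by [] |].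
    by move=> _ [<-]; rewrite -{1}[f2 b]mulr1 domM2l.
  - by exists 1; rewrite oner_neq0.
elim: A => [|e A [lo [up [h1 h2 h3]]]]; first by exists None, None.
have [e0|e0] := eqVneq e 0.
  exists lo, up; split=> // e'; rewrite in_cons => /orP[/eqP ->|]; last exact: h3.
  rewrite e0 eqxx; split=> //; rewrite rmorph0 domx0 // (negPf x0) //.
case: (boolP (f1 e ≼ x)) => ex.
  pose lo' := if lo is Some a then (if f1 e ≼ f1 a then a else e) else e.
  exists (Some lo'), up; split=> //.
    move=> _ [<-]; rewrite /lo'; case: lo h1 {h3 lo'} => // a h1; case: ifP => // _; exact: h1.
  have lo'e : f1 e ≼ f1 lo'.
    by rewrite /lo'; case: lo {h1 h3 lo'} => [a|]; [case: ifP => // _|]; exact: dom_refl.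
  have lo'a a : lo = Some a -> f1 a ≼ f1 lo'.
    rewrite /lo' => ->; case: ifP => [_|/negbT/(domW OV) //]; exact: dom_refl.
  move=> e'; rewrite in_cons => /orP[/eqP ->|eA].
    split=> [_ _|xe]; first by exists lo'.
    by case: (newvalE nx e).
  have [k1 k2] := h3 e' eA; split=> // ex' e0'; exists lo' => //.
  by have [a la ea] := k1 ex' e0'; exact: (dom_trans OV) ea (lo'a _ la).
pose up' := if up is Some a then (if f1 a ≼ f1 e then a else e) else e.
have xe := domW OV ex.
exists lo, (Some up'); split=> //.
  move=> _ [<-]; rewrite /up'; case: up h2 {h3 up'} => // a h2; case: ifP => // _; exact: h2.
have up'e : f1 up' ≼ f1 e.
  by rewrite /up'; case: up {h2 h3 up'} => [a|]; [case: ifP => // _|]; exact: dom_refl.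
have up'a a : up = Some a -> f1 up' ≼ f1 a.
  rewrite /up' => ->; case: ifP => [_|/negbT/(domW OV) //]; exact: dom_refl.
move=> e'; rewrite in_cons => /orP[/eqP ->|eA].
  split=> [ex' _|_]; first by rewrite ex' in ex.
  by exists up'.
have [k1 k2] := h3 e' eA; split=> // xe'; exists up' => //.
by have [a la ea] := k2 xe'; exact: (dom_trans OV) (up'a _ la) ea.
Qed.

Lemma cmp_sum x y p q (H : E) : newval x -> 1 ≺ x -> 1 ≺ y -> Num.sg p = Num.sg q ->
  p ≼ x -> x ≼ p -> q ≼ y -> y ≼ q -> (y ≼ f2 H) = (x ≼ f1 H) -> (f2 H ≼ y) = (f1 H ≼ x) ->
  [/\ 1 ≺ f1 H + p, 1 ≺ f2 H + q & Num.sg (f1 H + p) = Num.sg (f2 H + q)].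
Proof.
move=> nx x1 y1 spq px xp qy yq c1 c2.
case: (boolP (f1 H ≼ x)) => hx.
  have l : f1 H ≺ x by apply/negP => h; apply: (newvalE nx H).
  have l' : f2 H ≺ y by rewrite c1.
  have s1 : f1 H + p ~~~ p.
    by rewrite /sim addrK; exact: (lt_dom_trans OV) l xp.
  have s2 : f2 H + q ~~~ q.
    by rewrite /sim addrK; exact: (lt_dom_trans OV) l' yq.
  split; last by rewrite (sim_sg cvx s1) (sim_sg cvx s2).
    exact: (lt_dom_trans OV) (lt_dom_trans OV x1 xp) (sim_domr OV s1).
  exact: (lt_dom_trans OV) (lt_dom_trans OV y1 yq) (sim_domr OV s2).
have l : y ≺ f2 H by rewrite c2.
have s1 : f1 H + p ~~~ f1 H.
  by rewrite /sim addrC addKr; exact: (dom_lt_trans OV px).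
have s2 : f2 H + q ~~~ f2 H.
  by rewrite /sim addrC addKr; exact: (dom_lt_trans OV qy).
split; last by rewrite (sim_sg cvx s1) (sim_sg cvx s2) fsg.
  exact: (lt_dom_trans OV) (lt_trans_dom OV x1 hx) (sim_domr OV s1).
exact: (lt_dom_trans OV) (lt_trans_dom OV y1 l) (sim_domr OV s2).
Qed.

(** * Chains of new values *)

Section Chain.
Variables (w : nat -> M) (h : nat -> E).
Hypothesis wM : forall i, M1 (w i).
Hypothesis nw : forall i, newval (w i).
Hypothesis wS : forall i, w i.+1 = ld (w i) - f1 (h i).
Hypothesis w1 : forall i, 1 ≺ w i.+1.
Hypothesis wl : forall i, w i.+1 ≼ ld (w i).

Lemma zseqS (g : nat -> M) x i : zseq g x i.+1 = zseq (fun i => g i.+1) (ld x - g 0%N) i.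
Proof. by elim: i => //= i <-. Qed.

(** The segment is built from its last entry backwards: given [y] for the tail, [x] is a solution of
    [ld x = y + f2 (h i)] with the prescribed sign. Comparing [x] with [e] amounts to the sign of
    [ld x - ld e], hence to comparing [y] with another element of [E]. *)
Lemma chain_finite l : forall i (A : seq E), exists x, forall i', (i' <= l)%N ->
  same_cut A (w (i + i')) (zseq (fun t => f2 (h (i + t))) x i').
Proof.
elim: l => [|l IH] i A.
  have [y hy] := same_cut_exists A (nw i); exists y => i'; rewrite leqn0 => /eqP ->.
  by rewrite addn0.
(* Chosen so that [ld (x / f2 e) = f2 (q e) + y]; the tail must therefore realise its type over a
   set that contains these elements. *)
pose q (e : E) := - (logder VE e - h i).
have [y hy] := IH i.+1 (1 :: A ++ [seq q e | e <- A] ++ [seq - q e | e <- A]).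
have [y0 sy cy] := hy 0%N isT; rewrite /= addn0 in y0 sy cy.
have y1 : 1 ≺ y.
  have [|c1 c2] := cy 1 _; first by rewrite in_cons eqxx.
  by rewrite -(rmorph1 f2) c1 rmorph1; exact: w1.
have [x0 [_ x00 x0l]] := sm_exp modM (x := y + f2 (h i)) I.
have wi0 := newval_neq0 (nw i).
have [x [xn sx xl]] : exists x, [/\ x != 0, Num.sg x = Num.sg (w i) & ld x = y + f2 (h i)].
  have [hx|hx|hx] := ltrgtP (w i) 0; last by rewrite hx eqxx in wi0.
    rewrite (ltr0_sg hx); have [hz|hz|hz] := ltrgtP x0 0; last by rewrite hz eqxx in x00.
      by exists x0; rewrite (ltr0_sg hz).
    by exists (- x0); rewrite ltr0_sg ?oppr_lt0 // oppr_eq0 ldN.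
  rewrite (gtr0_sg hx); have [hz|hz|hz] := ltrgtP x0 0; last by rewrite hz eqxx in x00.
    by exists (- x0); rewrite gtr0_sg ?oppr_gt0 // oppr_eq0 ldN.
  by exists x0; rewrite (gtr0_sg hz).
exists x => -[|i'] il.
  rewrite addn0 /=; split=> // e eA; have [->|e0] := eqVneq e 0.
    by rewrite !rmorph0 !domx0 // (negPf xn) (negPf wi0) !dom0x.
  have f10 : f1 e != 0 by rewrite fmorph_eq0.
  have f20 : f2 e != 0 by rewrite fmorph_eq0.
  have L1 : ld (w i / f1 e) = f1 (q e) + w i.+1.
    by rewrite ld_div // wS -(vembed_ld fV1) /q rmorphN rmorphB; ring.
  have L2 : ld (x / f2 e) = f2 (q e) + y.
    by rewrite ld_div // xl -(vembed_ld fV2) /q rmorphN rmorphB; ring.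
  have [|c1 c2] := cy (q e) _.
    by rewrite in_cons !mem_cat map_f ?orbT.
  have [l1 l2 sl] := cmp_sum (nw i.+1) (w1 i) y1 (esym sy) (dom_refl OV _) (dom_refl OV _)
    (dom_refl OV _) (dom_refl OV _) c1 c2.
  rewrite -L1 in l1 sl; rewrite -L2 in l2 sl.
  have [a1 b1] := ld_sign (mulf_neq0 wi0 (invr_neq0 f10)) l1.
  have [a2 b2] := ld_sign (mulf_neq0 xn (invr_neq0 f20)) l2.
  rewrite !dom_div // !domx_div // !mul1r in a1 b1 a2 b2.
  rewrite a1 b1 a2 b2 -(sgr_lt0 (ld (x / _))) -(sgr_gt0 (ld (x / _))) -sl.
  by rewrite (sgr_lt0 (ld _)) (sgr_gt0 (ld _)).
rewrite zseqS /= addn0 xl addrK addnS -addSn.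
have [z0 sz cz] := hy i' il.
have ef : zseq (fun t => f2 (h (i + t.+1))) y i' = zseq (fun t => f2 (h (i.+1 + t))) y i'.
  by congr zseq; apply: funext => t; rewrite addnS addSn.
rewrite ef; split=> // e eA; apply: cz.
by rewrite in_cons mem_cat eA orbT.
Qed.

Lemma chain_exists : exists w' : nat -> M, [/\ forall i, w' i != 0,
  forall i, Num.sg (w' i) = Num.sg (w i), forall i, w' i.+1 = ld (w' i) - f2 (h i) &
  forall i e, (w' i ≼ f2 e) = (w i ≼ f1 e) /\ (f2 e ≼ w' i) = (f1 e ≼ w i)].
Proof.
have [eE heE] := E_enum.
have [x hx] : exists x, forall i j, [/\ Num.sg (zseq (fun t => f2 (h t)) x i) = Num.sg (w i),
    (zseq (fun t => f2 (h t)) x i ≼ f2 (eE j)) = (w i ≼ f1 (eE j)) &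
    (f2 (eE j) ≼ zseq (fun t => f2 (h t)) x i) = (f1 (eE j) ≼ w i)].
  apply: (sat_chain (h := fun t => f2 (h t)) (e := fun j => f2 (eE j)) (s := fun i => Num.sg (w i))
    (be := fun i j => w i ≼ f1 (eE j)) (ga := fun i j => f1 (eE j) ≼ w i)) => n.
  have [x hx] := chain_finite n 0 [seq eE j | j <- iota 0 n]; exists x => i j ni nj.
  have [_ s c] := hx i (ltnW ni); rewrite add0n in s c.
  have [c1 c2] : _ := c (eE j) (map_f _ (etrans (mem_iota 0 n j) nj)).
  by split.
exists (zseq (fun t => f2 (h t)) x); split=> [i|i||i e] //.
- by have [s _ _] := hx i 0%N; rewrite -sgr_eq0 s sgr_eq0 newval_neq0.
- by have [] := hx i 0%N.
- by have [j <-] := heE e; have [] := hx i j.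
Qed.

Lemma int_dom (z : int) : (z%:~R : M) ≼ 1.
Proof. by case: z => n; rewrite ?NegzE ?mulrNz ?domN // -pmulrn; exact: dom_nat. Qed.
Lemma dom_int (z : int) : z != 0 -> 1 ≼ (z%:~R : M).
Proof. by case: z => [[|n]|n] // _; rewrite ?NegzE ?mulrNz ?domxN // -pmulrn; exact: nat_dom. Qed.

Lemma ld_expz x (z : int) : x != 0 -> ld (x ^ z) = z%:~R * ld x.
Proof.
move=> x0; case: z => n; first by rewrite -exprnP ldX // -pmulrn.
by rewrite NegzE -exprnN ldV ?expf_neq0 // ldX // mulrNz mulNr -pmulrn.
Qed.

Lemma ld_mon (c : nat -> M) n z : (forall i, c i != 0) ->
  ld (mon c n z) = \sum_(i < n) (z i)%:~R * ld (c i).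
Proof.
move=> c0; elim: n => [|n IH]; first by rewrite /mon !big_ord0 ld1.
rewrite /mon !big_ord_recr /= ldM ?expfz_neq0 //; last exact: mon_neq0.
by rewrite ld_expz // -IH.
Qed.

Lemma desc_lt (v : nat -> M) : (forall i, v i.+2 ≺ v i.+1) -> forall l i, v (i.+1 + l.+1)%N ≺ v i.+1.
Proof.
move=> lt; elim=> [|l IH] i; first by rewrite addn1.
by rewrite addnS -addSn; apply: (lt_trans_dom OV) (lt i); exact: IH.
Qed.

Section Values.
Variable w' : nat -> M.
Hypothesis sw : forall i, Num.sg (w' i) = Num.sg (w i).
Hypothesis wS' : forall i, w' i.+1 = ld (w' i) - f2 (h i).
Hypothesis cw : forall i e, (w' i ≼ f2 e) = (w i ≼ f1 e) /\ (f2 e ≼ w' i) = (f1 e ≼ w i).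

Lemma ch_w1' i : 1 ≺ w' i.+1. Proof. by rewrite -(rmorph1 f2) (cw i.+1 1).1 rmorph1 w1. Qed.
Lemma ch_lt i : w i.+2 ≺ w i.+1.
Proof. exact: (dom_lt_trans OV) (wl i.+1) (ld_lt (w1 i)). Qed.
Lemma ch_h i : f1 (h i.+1) ≺ w i.+1.
Proof.
have -> : f1 (h i.+1) = ld (w i.+1) - w i.+2 by rewrite (wS i.+1); ring.
by apply: lt_domB => //; [exact: ld_lt | exact: ch_lt].
Qed.
Lemma ch_lt' i : w' i.+2 ≺ w' i.+1.
Proof.
rewrite (wS' i.+1); apply: lt_domB => //; first by apply: ld_lt; exact: ch_w1'.
by rewrite (cw _ _).1; exact: ch_h.
Qed.

Lemma tail_lt (v : nat -> M) n j z : (forall i, v i.+2 ≺ v i.+1) -> v j.+1 != 0 ->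
  \sum_(i < n) (z i)%:~R * v (j.+1 + i.+1)%N ≺ v j.+1.
Proof.
move=> lt v0; apply: lt_dom_sum => // i _; rewrite -[v j.+1]mul1r; apply: (dom_lt_trans OV).
  by apply: domM; [exact: OV | exact: int_dom | exact: dom_refl].
by rewrite !mul1r; exact: desc_lt.
Qed.

(** The entries of positive index decrease strictly in size, so the first nonzero coefficient
    decides; [cmp_sum] weighs its term against [H]. *)
Lemma lin_cmp n : forall j (H : E) (z : nat -> int), (exists2 i, (i < n)%N & z i != 0) ->
  let X := f1 H + \sum_(i < n) (z i)%:~R * w (j.+1 + i)%N in
  let Y := f2 H + \sum_(i < n) (z i)%:~R * w' (j.+1 + i)%N in
  [/\ 1 ≺ X, 1 ≺ Y & Num.sg X = Num.sg Y].
Proof.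
elim: n => [|n IH] j H z [i ni zi]; first by [].
have [z0|z0] := eqVneq (z 0%N) 0.
  rewrite /= !big_ord_recl /= z0 mulr0z !mul0r !add0r.
  have sh (v : nat -> M) : \sum_(i < n) (z (bump 0 i))%:~R * v (j.+1 + bump 0 i)%N =
      \sum_(i < n) (z i.+1)%:~R * v (j.+2 + i)%N.
    by apply: eq_bigr => t _; rewrite /bump leq0n addnS addSn.
  rewrite !sh; apply: (IH j.+1 H (fun i => z i.+1)).
  by case: i ni zi => [|i] ni zi; [rewrite z0 eqxx in zi | exists i].
rewrite /= !big_ord_recl /= !addn0.
have b0 : w j.+1 != 0 := newval_neq0 (nw j.+1).
have b0' : w' j.+1 != 0 by exact: (lt_dom_neq0 OV (ch_w1' j)).
have zM : ((z 0%N)%:~R : M) != 0 by rewrite intr_eq0.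
have pa (v : M) : (z 0%N)%:~R * v ≼ v /\ v ≼ (z 0%N)%:~R * v.
  have h1 : (z 0%N)%:~R * v ≼ 1 * v by apply: domM; [exact: OV | exact: int_dom | exact: dom_refl].
  have h2 : 1 * v ≼ (z 0%N)%:~R * v by apply: domM; [exact: OV | exact: dom_int | exact: dom_refl].
  by rewrite mul1r in h1 h2.
have s1 : (z 0%N)%:~R * w j.+1 + \sum_(i < n) (z (bump 0 i))%:~R * w (j.+1 + bump 0 i)%N
    ~~~ (z 0%N)%:~R * w j.+1.
  rewrite /sim addrAC subrr add0r; apply: (lt_dom_trans OV) _ (pa _).2.
  rewrite (eq_bigr (fun i : 'I_n => (z i.+1)%:~R * w (j.+1 + i.+1)%N)) //.
  exact: (@tail_lt w n j (fun i => z i.+1) ch_lt b0).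
have s2 : (z 0%N)%:~R * w' j.+1 + \sum_(i < n) (z (bump 0 i))%:~R * w' (j.+1 + bump 0 i)%N
    ~~~ (z 0%N)%:~R * w' j.+1.
  rewrite /sim addrAC subrr add0r; apply: (lt_dom_trans OV) _ (pa _).2.
  rewrite (eq_bigr (fun i : 'I_n => (z i.+1)%:~R * w' (j.+1 + i.+1)%N)) //.
  exact: (@tail_lt w' n j (fun i => z i.+1) ch_lt' b0').
apply: (cmp_sum (x := w j.+1) (y := w' j.+1)) => //.
- exact: ch_w1'.
- by rewrite (sim_sg cvx s1) (sim_sg cvx s2) !sgrM sw.
- exact: (dom_trans OV) (sim_doml OV s1) (pa _).1.
- exact: (dom_trans OV) (pa _).2 (sim_domr OV s1).
- exact: (dom_trans OV) (sim_doml OV s2) (pa _).1.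
- exact: (dom_trans OV) (pa _).2 (sim_domr OV s2).
- exact: (cw _ _).1.
- exact: (cw _ _).2.
Qed.
End Values.

(** The logarithmic derivative of a nontrivial Laurent monomial in the chain is an element of [E]
    plus a nontrivial integral combination of later entries, hence infinite with a copied sign. So
    all values are copied, the whole chain lies in the domain by maximality, and [w 0] would have a
    value in [E]. *)
Lemma chain_contra : False.
Proof.
have [w' [w0' sw wS' cw]] := chain_exists.
have w0 i := newval_neq0 (nw i).
have LM (f : {rmorphism E -> M}) (fV : vembed VE V f) (v : nat -> M) e n z : e != 0 -> (forall i, v i != 0) ->
    (forall i, v i.+1 = ld (v i) - f (h i)) ->
    ld (f e * mon v n z) = f (logder VE e + \sum_(i < n) (z i)%:~R * h i) +
      \sum_(i < n) (z i)%:~R * v i.+1.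
  move=> e0 v0 vS; rewrite ldM ?fmorph_eq0 //; last exact: mon_neq0.
  rewrite -(vembed_ld fV) rmorphD -addrA ld_mon //; congr (_ + _).
  rewrite rmorph_sum -big_split; apply: eq_bigr => i _ /=.
  by rewrite rmorphM rmorph_int vS -mulrDr addrC subrK.
have key e n z : e != 0 -> (exists2 i, (i < n)%N & z i != 0) ->
    [/\ 1 ≺ ld (f1 e * mon w n z), 1 ≺ ld (f2 e * mon w' n z) &
      Num.sg (ld (f1 e * mon w n z)) = Num.sg (ld (f2 e * mon w' n z))].
  move=> e0 ez; rewrite (LM _ fV1) // (LM _ fV2) //.
  exact: (lin_cmp sw wS' cw 0 _ ez).
have triv n z : ~ (exists2 i, (i < n)%N & z i != 0) -> forall v : nat -> M, mon v n z = 1.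
  move=> no v; rewrite /mon big1 // => i _; have [->|zi] := eqVneq (z i) 0; first by rewrite expr0z.
  by case: no; exists i.
have mO e n z : e != 0 -> (f1 e * mon w n z ≼ 1) = (f2 e * mon w' n z ≼ 1).
  move=> e0; case: (pselect (exists2 i, (i < n)%N & z i != 0)) => [ez|no]; last first.
    by rewrite !(triv _ _ no) !mulr1 fdom1.
  have [l1 l2 sl] := key e n z e0 ez.
  have n1 : f1 e * mon w n z != 0 by rewrite mulf_neq0 ?fmorph_eq0 ?mon_neq0.
  have n2 : f2 e * mon w' n z != 0 by rewrite mulf_neq0 ?fmorph_eq0 ?mon_neq0.
  rewrite (ld_sign n1 l1).1 (ld_sign n2 l2).1 -(sgr_lt0 (ld (f1 e * _))) sl.
  by rewrite (sgr_lt0 (ld (f2 e * _))).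
have m1 e n z : e != 0 -> f1 e * mon w n z ≼ 1 -> 1 ≼ f1 e * mon w n z ->
    exists e', f1 e' = f1 e * mon w n z /\ f2 e' = f2 e * mon w' n z.
  move=> e0 x1 x2; case: (pselect (exists2 i, (i < n)%N & z i != 0)) => [ez|no]; last first.
    by exists e; rewrite !(triv _ _ no) !mulr1.
  have [l1 _ _] := key e n z e0 ez.
  by case/negP: l1; exact: ld_dom1.
have sw' i := esym (sw i).
have mW := monW_matched w0 w0' sw' fsg mO.
have htr n (P : {mpoly E[n]}) := mon_tracked w0 w0' sw' fsg mO m1 P.
have hder i : gen_graph f1 f2 w w' (d (w i), d (w' i)).
  rewrite (derE V (w0 i)) (derE V (w0' i)).
  have -> : ld (w i) = w i.+1 + f1 (h i) by rewrite wS subrK.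
  have -> : ld (w' i) = w' i.+1 + f2 (h i) by rewrite wS' subrK.
  apply: (gen_M cvx mW htr); last exact: gen_b.
  by apply: (gen_D cvx mW htr); [exact: gen_b | exact: gen_base].
have [e [e1 _]] := max_gen mW htr hder wM 0.
by apply: (newvalE (nw 0) e); rewrite e1 dom_refl.
Qed.
End Chain.

Lemma max_total w : M1 w -> exists e, f1 e = w.
Proof.
move=> wM; apply: contrapT => nE.
have [c [nc _]] := best_approx wM (fun e => introN eqP (fun h => nE (ex_intro _ e h))).
pose good (x : M) (h : E) := [/\ newval (ld x - f1 h), 1 ≺ ld x - f1 h & ld x - f1 h ≼ ld x].
pose hh x : E := if pselect (exists h, good x h) is left g then sval (cid g) else 0.
pose st x := ld x - f1 (hh x).
pose v i := iter i st (w - f1 c).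
have v0M : M1 (w - f1 c) by apply: (dsubB sM1) => //; exact: f1M.
have hg x : M1 x -> newval x -> good x (hh x).
  move=> xM nx; rewrite /hh; case: pselect => [g|[]]; first by case: cid.
  exact: newval_step.
have vi i : M1 (v i) /\ newval (v i).
  elim: i => [|i [IM IN]] //; have [g1 _ _] := hg _ IM IN; split; last exact: g1.
  rewrite /v iterS -/(v i); apply: (dsubB sM1); last exact: f1M.
  by apply: (dsub_div sM1) => //; exact: (dsub_der sM1).
apply: (@chain_contra v (fun i => hh (v i))).
- by move=> i; case: (vi i).
- by move=> i; case: (vi i).
- by [].
- by move=> i; have [a b] := vi i; case: (hg _ a b).
- by move=> i; have [a b] := vi i; case: (hg _ a b).
Qed.

End Maximal.

(** * Adjoining elements of the lift of the residue field *)

Section Elimination.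
Variables (E : fieldType) (VE : vdf E) (f1 f2 : {rmorphism E -> M}).
Hypotheses (fV1 : vembed VE V f1) (fV2 : vembed VE V f2).
Variable A : set M.
Hypothesis sA : diff_subfield d A.
Hypothesis AO : forall c, A c -> c ≼ 1.
Hypothesis resA : forall e, dominatedb (vO VE) e 1 ->
  exists c : E, [/\ A (f1 c), f2 c = f1 c & ~~ dominatedb (vO VE) 1 (e - c)].

Lemma A_unit c : A c -> c != 0 -> 1 ≼ c.
Proof. by move=> Ac c0; rewrite -domV1 //; apply: AO; exact: (dsubV sA). Qed.

(* linear relations over [A] among the residues are used to eliminate summands *)
Lemma elimination (s : seq (E * M)) : (forall p, p \in s -> A p.2) ->
  let X := \sum_(p <- s) f1 p.1 * p.2 in let Y := \sum_(p <- s) f2 p.1 * p.2 in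
  (X = 0 /\ Y = 0) \/
  exists e c, [/\ e != 0, A c /\ c != 0, X ~~~ f1 e * c & Y ~~~ f2 e * c].
Proof.
have OE := vO_ring VE.
move: {2}(size s).+1 (ltnSn (size s)) => n; elim: n s => // n IH [|p0 s] sn hs.
  by left; rewrite !big_nil.
have [[e1 d1] ps hp] : exists2 p, p \in p0 :: s & forall q, q \in p0 :: s -> dominatedb (vO VE) q.1 p.1.
  elim: (s) p0 {sn hs} => [|p1 s' IHs] p0.
    by exists p0; rewrite ?in_cons ?eqxx // => q; rewrite mem_seq1 => /eqP ->; exact: dom_refl.
  have [p ps hp] := IHs p1; have /orP[h|h] := dom_total OE p0.1 p.1.
    exists p; first by rewrite in_cons ps orbT.
    by move=> q; rewrite in_cons => /orP[/eqP -> //|/hp].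
  exists p0; first by rewrite in_cons eqxx.
  move=> q; rewrite in_cons => /orP[/eqP ->|/hp h']; first exact: dom_refl.
  exact: (dom_trans OE) h' h.
have pm := perm_to_rem ps; set s1 := rem _ _ in pm.
have hs1 q : q \in s1 -> A q.2 by move=> qs; apply: hs; rewrite (perm_mem pm) in_cons qs orbT.
have hp1 q : q \in s1 -> dominatedb (vO VE) q.1 e1.
  by move=> qs; apply: (hp q); rewrite (perm_mem pm) in_cons qs orbT.
have Ad1 : A d1 := hs _ ps.
have sz : size s1 = size s by have := perm_size pm => /= -[].
cbv zeta; rewrite !(perm_big _ pm) /= !big_cons /=.
have [e10|e10] := eqVneq e1 0.
  left; have z (f : {rmorphism E -> M}) : f e1 * d1 + \sum_(j <- s1) f j.1 * j.2 = 0.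
    rewrite e10 rmorph0 mul0r add0r big_seq big1 // => q /hp1; rewrite e10 domx0 // => /eqP ->.
    by rewrite rmorph0 mul0r.
  by rewrite !z.
pose cc e : E := if pselect (dominatedb (vO VE) e 1) is left h then sval (cid (resA h)) else 0.
have ccP q : q \in s1 -> [/\ A (f1 (cc (q.1 / e1))), f2 (cc (q.1 / e1)) = f1 (cc (q.1 / e1)) &
    ~~ dominatedb (vO VE) 1 (q.1 / e1 - cc (q.1 / e1))].
  move=> qs; rewrite /cc; case: pselect => [h|[]]; first by case: cid.
  by rewrite dom_div // mul1r; exact: hp1.
(* The coefficient of [e1] once each quotient [q.1 / e1] is replaced by its residue. If it vanishes,
   the summand of [e1] is used up and the list gets shorter; otherwise it gives the leading term. *)
pose S := d1 + \sum_(q <- s1) f1 (cc (q.1 / e1)) * q.2.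
have AS : A S.
  apply: (dsubD sA) => //; rewrite big_seq; apply: (dsub_sum sA) => q qs; apply: (dsubM sA); last exact: hs1.
  by case: (ccP q qs).
have key (f : {rmorphism E -> M}) : (forall q, q \in s1 -> f (cc (q.1 / e1)) = f1 (cc (q.1 / e1))) ->
    f e1 * d1 + \sum_(q <- s1) f q.1 * q.2 =
    f e1 * (S + \sum_(q <- s1) f (q.1 / e1 - cc (q.1 / e1)) * q.2).
  move=> fc; rewrite /S -addrA mulrDr; congr (_ + _); rewrite -big_split /= mulr_sumr.
  rewrite big_seq [RHS]big_seq; apply: eq_bigr => q qs; rewrite -(fc q qs) -mulrDl -rmorphD.
  by rewrite (addrC (cc _)) subrK mulrA -rmorphM [e1 * _]mulrC divfK.
have c1 q : q \in s1 -> f1 (cc (q.1 / e1)) = f1 (cc (q.1 / e1)) by [].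
have c2 q : q \in s1 -> f2 (cc (q.1 / e1)) = f1 (cc (q.1 / e1)) by move=> /ccP[].
have [S0|S0] := eqVneq S 0.
  pose s2 := [seq (q.1 - e1 * cc (q.1 / e1), q.2) | q <- s1].
  have h2 (f : {rmorphism E -> M}) : (forall q, q \in s1 -> f (cc (q.1 / e1)) = f1 (cc (q.1 / e1))) ->
      f e1 * d1 + \sum_(q <- s1) f q.1 * q.2 = \sum_(q <- s2) f q.1 * q.2.
    move=> fc; rewrite (key f fc) S0 add0r big_map mulr_sumr; apply: eq_bigr => q _ /=.
    by rewrite mulrA -rmorphM mulrBr [e1 * (_ / _)]mulrC divfK.
  rewrite (h2 f1 c1) (h2 f2 c2); apply: IH; first by rewrite size_map sz.
  by move=> _ /mapP[q qs ->]; exact: (hs1 q qs).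
have sm (f : {rmorphism E -> M}) : vembed VE V f ->
    (forall q, q \in s1 -> f (cc (q.1 / e1)) = f1 (cc (q.1 / e1))) ->
    f e1 * d1 + \sum_(q <- s1) f q.1 * q.2 ~~~ f e1 * S.
  move=> fV fc; rewrite (key f fc); apply: simM => //; first by apply: sim_refl => //; rewrite fmorph_eq0.
  rewrite /sim addrAC subrr add0r big_seq; apply: lt_dom_sum => // q qs.
  apply: (lt_dom_trans OV) _ (A_unit AS S0); rewrite -[1]mulr1; apply: lt_domM => //.
  - by rewrite -(rmorph1 f) (vembed_dom fV); case: (ccP q qs).
  - by apply: AO; exact: hs1.
  - exact: oner_neq0.
by right; exists e1, S; split=> //; [exact: (sm f1 fV1 c1) | exact: (sm f2 fV2 c2)].
Qed.
End Elimination.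

Hypothesis sk : diff_subfield d k.
Hypothesis kO : forall c, k c -> c ≼ 1.

Definition res_lifted G := forall x y, G (x, y) -> x ≼ 1 -> exists c, [/\ k c, G (c, c) & x - c ≺ 1].

(** By [elimination] a sum of products [e * c] with [c] in [k] has a leading term of the same form,
    so the identity on [k] within [M1] is compatible with [G] once the residues of the domain are
    fixed. *)
Lemma add_residues G : piso V G -> res_lifted G -> (forall x y, G (x, y) -> M1 x) ->
  exists G', [/\ piso V G', G `<=` G', forall c, k c -> M1 c -> G' (c, c) &
    forall x y, G' (x, y) -> M1 x].
Proof.
move=> hG rG dG; have [D] := piso_data hG.
pose E := pE D; pose VE := pV D; pose f1 := pf1 D; pose f2 := pf2 D.
have fV1 : vembed VE V f1 := pV1 D; have fV2 : vembed VE V f2 := pV2 D.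
have OE := vO_ring VE.
have resA e : dominatedb (vO VE) e 1 ->
    exists c : E, [/\ k (f1 c), f2 c = f1 c & ~~ dominatedb (vO VE) 1 (e - c)].
  rewrite -(vembed_dom fV1) rmorph1 => h; have [c [kc Gc sc]] := rG _ _ (pG D e) h.
  have [c' e1 e2] := pS D Gc; exists c'; rewrite /f1 /f2 e1 e2; split=> //.
  by rewrite -(vembed_dom fV1) rmorph1 rmorphB /f1 e1.
have [en hen] := M1count.
pose b i := if `[< k (en i) /\ M1 (en i) >] then en i else 0.
have kb i : k (b i) by rewrite /b; case: asboolP => [[]//|_]; exact: (dsub0 sk).
have Mb i : M1 (b i) by rewrite /b; case: asboolP => [[]//|_]; exact: (dsub0 sM1).
have bS c : k c -> M1 c -> exists i, b i = c.
  by move=> kc Mc; have [i ei] := hen c Mc; exists i; rewrite /b ei; case: asboolP => // -[].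
pose W : set (M * M) := [set p | exists e c, [/\ e != 0, k c, c != 0 & p = (f1 e * c, f2 e * c)]].
have fs e : Num.sg (f1 e) = Num.sg (f2 e) := piso_sg hG (pG D e).
have ku c : k c -> c != 0 -> 1 ≼ c by exact: (A_unit sk kO).
have mW : matched V W.
  split.
  - by move=> x y [e [c [e0 _ c0 [-> ->]]]]; rewrite !mulf_neq0 ?fmorph_eq0.
  - move=> x y x' y' [e [c [e0 kc c0 [-> ->]]]] [e' [c' [e0' kc' c0' [-> ->]]]].
    exists (e / e'), (c / c'); split; rewrite ?mulf_neq0 ?invr_eq0 //; first exact: (dsub_div sk).
    by rewrite -!mulf_div !fmorph_div.
  - by move=> x y [e [c [e0 kc c0 [-> ->]]]]; rewrite !sgrM fs.
  - move=> x y [e [c [e0 kc c0 [-> ->]]]].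
    have h (f : {rmorphism E -> M}) : vembed VE V f -> (f e * c ≼ 1) = dominatedb (vO VE) e 1.
      move=> fV; rewrite -(vembed_dom fV) rmorph1; apply/idP/idP => h.
        apply: (dom_trans OV) _ h; rewrite -{1}[f e]mulr1; apply: domM; rewrite ?dom_refl ?ku //.
      by rewrite -[1]mulr1; apply: domM => //; exact: kO.
    by rewrite (h _ fV1) (h _ fV2).
have htr n (P : {mpoly E[n]}) : tracked V W (ev f1 P b) (ev f2 P b).
  pose t (m : 'X_{1..n}) := (P@_m, \prod_(i < n) b i ^+ m i).
  have hk p : p \in [seq t m | m <- msupp P] -> k p.2.
    by move=> /mapP[m _ ->]; apply: (dsub_prod sk) => i _; exact: (dsubX sk).
  have evs (f : {rmorphism E -> M}) : ev f P b = \sum_(p <- [seq t m | m <- msupp P]) f p.1 * p.2.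
    exact: ev_list.
  have := elimination fV1 fV2 sk kO resA hk; rewrite /= -!evs.
  case=> [h|[e [c [e0 [kc c0] s1 s2]]]]; [by left | right].
  by exists (f1 e * c), (f2 e * c); split=> //; exists e, c.
have hder i : gen_graph f1 f2 b b (d (b i), d (b i)).
  have [j <-] := bS _ (dsub_der sk (kb i)) (dsub_der sM1 (Mb i)); exact: gen_b.
exists (gen_graph f1 f2 b b); split.
- exact: (gen_piso cvx mW fV1 fV2 htr hder).
- by move=> [x y] /(pS D)[e <- <-]; exact: gen_base.
- by move=> c kc Mc; have [i <-] := bS c kc Mc; exact: gen_b.
move=> x y h.
apply: (gen_min cvx mW htr (T := [set p | M1 p.1]) _ _ _ _ h) => /=.
- by move=> e; exact: (dG _ _ (pG D e)).
- by [].
- by move=> p _ p' _ hp hp'; split; [exact: (dsubD sM1) | exact: (dsubM sM1)].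
- by move=> p _ _ _ hp; exact: (dsubV sM1).
Qed.

Theorem extend_total G : piso V G -> res_lifted G -> (forall x y, G (x, y) -> M1 x) ->
  exists G', [/\ piso V G', G `<=` G', forall x, M1 x -> exists y, G' (x, y),
    forall c, k c -> M1 c -> G' (c, c) & forall x y, G' (x, y) -> M1 x].
Proof.
move=> hG rG dG; have [G0 [pG0 GG0 kG0 dG0]] := add_residues hG rG dG.
have [|A [pA G0A dA mA]] := @piso_zorn _ _ _ [set p | M1 p.1] pG0; first by move=> [x y] /dG0.
have {}dA x y : A (x, y) -> M1 x by move=> /dA.
have kA c : k c -> M1 c -> A (c, c) by move=> kc Mc; apply: G0A; exact: kG0.
exists A; split=> // [p /GG0/G0A //|x Mx].
have [D] := piso_data pA.
have maxA G' : piso V G' -> A `<=` G' -> (forall x y, G' (x, y) -> M1 x) -> G' `<=` A.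
  by move=> pG' sub dG'; apply: mA => // -[p q] /dG'.
have [e <-] := max_total pA D dA kA maxA Mx.
by exists (pf2 D e); exact: (pG D e).
Qed.
End Extend.

(** * Infinitesimal deformations *)

Section Deformation.
Variables (M : rcfType) (V : vdf M).
Local Notation "x ≼ y" := (dominatedb (vO V) x y) (at level 70, y at next level).
Local Notation "x ≺ y" := (~~ dominatedb (vO V) y x) (at level 70, y at next level).
Local Notation "x ~~~ y" := (sim (vO V) x y) (at level 70, y at next level).
Local Notation d := (vder V).
Local Notation ld := (logder V).
Let OV := vO_ring V.
Implicit Types (x y : M) (G W : set (M * M)).
Hypothesis cvx : convex (vO V).
Hypothesis dhM : dh_subfield V setT.
Variable M1 : set M.
Hypothesis sM1 : diff_subfield d M1.

Definition tiny x := forall m, M1 m -> m != 0 -> x ≺ m.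

Lemma tiny0 : tiny 0. Proof. by move=> m _; rewrite lt0_dom. Qed.
Lemma tinyD x y : tiny x -> tiny y -> tiny (x + y).
Proof. by move=> hx hy m Mm m0; apply: lt_domD => //; [exact: hx | exact: hy]. Qed.
Lemma tinyN x : tiny x -> tiny (- x).
Proof. by move=> hx m Mm m0; rewrite lt_domN //; exact: hx. Qed.
Lemma tiny_le x y : x ≼ y -> tiny y -> tiny x.
Proof. by move=> xy hy m Mm m0; exact: (dom_lt_trans OV) xy (hy m Mm m0). Qed.
Lemma tiny1 x : tiny x -> x ≺ 1.
Proof. by apply; [exact: (dsub1 sM1) | exact: oner_neq0]. Qed.

Lemma tinyM x y m : tiny x -> M1 m -> y ≼ m -> tiny (y * x).
Proof.
move=> hx Mm ym; have [m0|m0] := eqVneq m 0.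
  by move: ym; rewrite m0 domx0 // => /eqP ->; rewrite mul0r; exact: tiny0.
move=> n Mn n0; apply: (@dom_lt_trans _ _ OV (m * x)); first by apply: domM; rewrite ?dom_refl.
have h : x ≺ n / m by apply: hx; [exact: (dsub_div sM1) | rewrite mulf_neq0 ?invr_eq0].
by rewrite dom_div // in h; rewrite mulrC.
Qed.
Lemma tinyMM x y : tiny x -> tiny y -> tiny (x * y).
Proof. by move=> hx hy; apply: (tinyM hy (dsub1 sM1)); exact: (domW OV (tiny1 hx)). Qed.
Lemma tiny_half x g : tiny g -> x * x ≼ g -> tiny x.
Proof.
move=> hg xg m Mm m0; apply/negP => mx.
have : m * m ≺ m * m.
  apply: (@dom_lt_trans _ _ OV g); last by apply: hg; [exact: (dsubM sM1) | rewrite mulf_neq0].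
  by apply: (dom_trans OV) _ xg; exact: domM.
by rewrite dom_refl.
Qed.

Lemma tiny_der x : tiny x -> tiny (d x).
Proof.
move=> hx m Mm m0; have [->|x0] := eqVneq x 0; first by rewrite der0 lt0_dom.
have q1 : x / m ≺ 1 by rewrite domx_div // mul1r; exact: hx.
have -> : d x = m * (d (x / m) + (x / m) * ld m).
  rewrite derM derV // /logder; field; exact: m0.
have h : m * (d (x / m) + (x / m) * ld m) ≺ m * 1.
  rewrite domM2l //; apply: lt_domD => //; first exact: v_small.
  have := tinyM hx (dsubM sM1 (dsubV sM1 Mm) (dsub_div sM1 (dsub_der sM1 Mm) Mm)) (dom_refl OV _).
  move=> /tiny1; rewrite (_ : x / m * ld m = m^-1 * (d m / m) * x) //.
  by rewrite /logder; field.
by rewrite mulr1 in h.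
Qed.
Lemma tiny_iter i x : tiny x -> tiny (iter i d x).
Proof. by move=> h; elim: i => //= i; exact: tiny_der. Qed.

(** If the first component is nonzero, the two are equivalent in the sense of [sim]; so a graph
    inside [close] preserves signs and values for free. *)
Definition close : set (M * M) := [set p | M1 p.1 /\ tiny (p.2 - p.1)].

Lemma close_op x y x' y' : close (x, y) -> close (x', y') ->
  close (x + x', y + y') /\ close (x * x', y * y').
Proof.
move=> [Mx t] [Mx' t']; simpl in *; split; split=> /=.
- exact: (dsubD sM1).
- by rewrite opprD addrACA; exact: tinyD.
- exact: (dsubM sM1).
rewrite (_ : y * y' - x * x' = (y - x) * (y' - x') + x * (y' - x') + x' * (y - x)); last by ring.
apply: tinyD; first apply: tinyD.
- exact: tinyMM.
- exact: (tinyM t' Mx (dom_refl OV _)).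
- exact: (tinyM t Mx' (dom_refl OV _)).
Qed.

Lemma close_sim x y : x != 0 -> close (x, y) -> y ~~~ x.
Proof. by move=> x0 [Mx t]; exact: t. Qed.

Lemma closeV x y : x != 0 -> close (x, y) -> close (x^-1, y^-1).
Proof.
move=> x0 h; have s := close_sim x0 h; have y0 := sim_neq0l OV s; have [Mx t] := h.
split=> /=; first exact: (dsubV sM1).
have -> : y^-1 - x^-1 = - ((y * x)^-1 * (y - x)) by field; rewrite x0 y0.
apply: tinyN; apply: (tinyM t (m := (x * x)^-1)); first by apply: (dsubV sM1); exact: (dsubM sM1).
rewrite domV ?mulf_neq0 //; apply: domM; rewrite ?dom_refl //; exact: (sim_domr OV s).
Qed.

Definition closeW : set (M * M) := [set p | p.1 != 0 /\ close p].

Lemma closeW_matched : matched V closeW.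
Proof.
split.
- by move=> x y [x0 c]; split=> //; exact: (sim_neq0l OV (close_sim x0 c)).
- move=> x y x' y' [x0 c] [x0' c']; split; first by rewrite mulf_neq0 ?invr_eq0.
  exact: (close_op c (closeV x0' c')).2.
- by move=> x y [x0 c]; rewrite (sim_sg cvx (close_sim x0 c)).
- move=> x y [x0 c]; have s := close_sim x0 c.
  by apply/idP/idP; apply: (dom_trans OV); [exact: sim_doml | exact: sim_domr].
Qed.

Section CloseExt.
Variables (E : fieldType) (VE : vdf E) (f1 f2 : {rmorphism E -> M}).
Hypotheses (fV1 : vembed VE V f1) (fV2 : vembed VE V f2).
Hypothesis fc : forall e, close (f1 e, f2 e).

Lemma close_ev n (P : {mpoly E[n]}) b b' : (forall i, close (b i, b' i)) ->
  close (ev f1 P b, ev f2 P b').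
Proof.
have c0 : close (0, 0) by have := fc 0; rewrite !rmorph0.
have c1 : close (1, 1) by have := fc 1; rewrite !rmorph1.
move=> cb; rewrite !evE; elim/big_ind2: _ => // [p q p' q' h h'|m _]; first exact: (close_op h h').1.
apply: (close_op (fc _) _).2; elim/big_ind2: _ => // [p q p' q' h h'|i _].
  exact: (close_op h h').2.
by elim: (m i) => // e IH; rewrite !exprS; exact: (close_op (cb _) IH).2.
Qed.

(** Generators without algebraic relations may be moved by any tiny amounts, as long as the graph
    stays closed under the derivation. *)
Lemma close_gen b b' : (forall i, close (b i, b' i)) ->
  (forall n (P : {mpoly E[n]}), P != 0 -> ev f1 P b != 0) ->
  (forall i, gen_graph f1 f2 b b' (d (b i), d (b' i))) ->
  piso V (gen_graph f1 f2 b b') /\ gen_graph f1 f2 b b' `<=` close.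
Proof.
move=> cb nz hder.
have htr n (P : {mpoly E[n]}) : tracked V closeW (ev f1 P b) (ev f2 P b').
  have [->|P0] := eqVneq P 0; first by left; rewrite !ev0.
  have n0 := nz n P P0; have c := close_ev P cb; have s := close_sim n0 c.
  right; exists (ev f1 P b), (ev f2 P b'); split=> //; first exact: sim_refl.
  by apply: sim_refl => //; exact: (sim_neq0l OV s).
split; first exact: (gen_piso cvx closeW_matched fV1 fV2 htr hder).
apply: (gen_min cvx closeW_matched htr) => // [x y x' y'|x y x0 _]; [exact: close_op | exact: closeV].
Qed.

(* Taylor coefficients are, up to a factorial, values of iterated partial derivatives *)
Lemma taylor_coef n (f : {rmorphism E -> M}) (fV : vembed VE V f) u m : forall P : {mpoly E[n]},
  exists (Q : {mpoly E[n]}) N, (psub V u 1 (map_mpoly f P))@_m *+ N.+1 = ev f Q (fun i => iter i d u).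
Proof.
move: {2}(mdeg m) (erefl (mdeg m)) => k; elim: k m => [|k IH] m mk P.
  move/eqP: mk; rewrite mdeg_eq0 => /eqP ->; exists P, 0%N; by rewrite mulr1n psub_coef0.
have [i mi] : exists i, (0 < m i)%N.
  apply: contrapT => h; suff m0 : mdeg m = 0%N by rewrite m0 in mk.
  rewrite mdegE big1 // => i _; apply/eqP; rewrite -leqn0 leqNgt; apply/negP => hi; apply: h; by exists i.
have le : (U_(i) <= m)%MM by apply/mnm_lepP => j; rewrite mnm1E; case: eqP => // <-.
have mE := submK le; set m1 := (m - U_(i))%MM in mE.
have dm1 : mdeg m1 = k by have := congr1 mdeg mE; rewrite mdegD mdeg1 mk addn1 => -[].
have [Q [N e]] := IH m1 dm1 P^`M(i).
exists Q, ((m1 i).+1 * N.+1).-1; rewrite -e map_mderiv -mderiv_translate mcoeff_deriv mE.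
by rewrite -mulrnA prednK ?muln_gt0 // mnmDE mnm1E eqxx addn1 mulnC.
Qed.

(** A Newton step. The image polynomial has a tiny value at [u] and a separant that is not tiny, so
    their quotient [g] is tiny; on the ball of radius [g] the terms of higher degree carry a further
    tiny factor, and a zero is found there. *)
Lemma close_zero n r dd D (P : {mpoly E[n]}) u : M1 u ->
  let b i := iter i d u in
  minimal_bad (fun Q : {mpoly E[n]} => Q != 0 /\ ev f1 Q b = 0) r dd D P ->
  exists u', tiny (u' - u) /\ ev f2 P (fun i => iter i d u') = 0.
Proof.
move=> Mu b [[[P0 z1] h1 h2 _] mind _].
pose S := P^`M(r).
have S1 : wle (above r) 0 S by have := @wle_deriv _ _ _ 0 r _ h1.
have S2 : wle (atleast r) dd S by have := @wle_deriv _ _ _ _ r _ h2; rewrite /atleast leqnn subn1.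
have S0 : S != 0.
  apply/eqP => e; apply: (mind P _ h1) => //; exact: wleS (deriv_eq0_vars VE h1 e).
have s1 : ev f1 S b != 0 by apply/eqP => e; apply: (mind S _ S1 S2).
have bM i : M1 (b i) by exact: (dsub_iter sM1).
have cb i : close (b i, b i) by split=> //=; rewrite subrr; exact: tiny0.
have evc Q := @close_ev n Q b b cb.
have ss := close_sim s1 (evc S); have s2 := sim_neq0l OV ss.
have te : tiny (ev f2 P b) by have [_ /=] := evc P; rewrite z1 subr0.
have [e0|e0] := eqVneq (ev f2 P b) 0.
  by exists u; rewrite subrr; split=> //; exact: tiny0.
pose g := ev f2 P b / ev f2 S b.
have g0 : g != 0 by rewrite mulf_neq0 ?invr_eq0.
have tg : tiny g.
  rewrite /g mulrC; apply: (tinyM te (m := (ev f1 S b)^-1)).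
    by apply: (dsubV sM1); case: (evc S).
  by rewrite domV //; exact: (sim_domr OV ss).
pose Pf := map_mpoly f2 P; pose p := psub V u 1 Pf.
have pE : psub V u g Pf = psub V 0 g p by rewrite psub_comp mulr0 addr0 mul1r.
(* This linear coefficient [g * S(u)] equals the constant term, so the polynomial is not stable on
   the ball. *)
have cr : (psub V u g Pf)@_U_(r) = ev f2 P b.
  rewrite psub_lin_eq (bigD1 r) //= big1 ?addr0.
    rewrite /aff_coef leqnn binn subnn mul1r /= -map_mderiv -/S /g divfK //.
  move=> i ir; rewrite /aff_coef; case: ifP => ri; last by rewrite mul0r.
  rewrite -map_mderiv (@wle_deriv0 _ _ (above r)) // ?/above.
    by rewrite rmorph0 meval0 mulr0.
  by have -> : (r < i)%N by rewrite ltn_neqAle ri andbT eq_sym.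
have [t [t1 tl tk]] := tau_exists g0 (domW OV (tiny1 tg)).
have t0 : t != 0 by apply: (dom_neq0 OV t1); exact: oner_neq0.
have tgt k : tiny (g * t ^+ k).
  have h : (g * t ^+ k) * (g * t ^+ k) ≼ g.
    rewrite (_ : _ * _ = g * (g * t ^+ (k + k))); last by rewrite exprD; ring.
    have h' : g * (g * t ^+ (k + k)) ≼ g * 1 by rewrite domM2l.
    by rewrite mulr1 in h'.
  exact: (tiny_half tg h).
pose s := g * t ^+ n.
have sn0 : s != 0 by rewrite mulf_neq0 ?expf_neq0.
have bnd m : exists2 c, M1 c & p@_m ≼ c.
  have [Q [N e]] := taylor_coef fV2 u m P.
  have l : p@_m ≼ ev f2 Q b.
    by rewrite -e -mulr_natr mulrC dom_natM dom_refl.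
  have [MQ tQ] := evc Q; simpl in *.
  have h : ev f2 Q b - ev f1 Q b ≼ 1 by exact: (domW OV (tiny1 tQ)).
  have /orP[a|a] := dom_total OV (ev f1 Q b) 1.
    exists 1; first exact: (dsub1 sM1).
    apply: (dom_trans OV l); rewrite -[ev f2 Q b](subrK (ev f1 Q b)); exact: domD.
  exists (ev f1 Q b); first exact: MQ.
  apply: (dom_trans OV l); rewrite (_ : ev f2 Q b = (ev f2 Q b - ev f1 Q b) + ev f1 Q b); last by rewrite subrK.
  by apply: domD; [exact: OV | exact: (dom_trans OV h a) | exact: dom_refl].
have small m : (1 < mdeg m)%N -> (psub V u g Pf)@_m ≺ ev f2 P b.
  move=> m2; rewrite pE.
  have itb j : (j < n)%N -> iter j d g ≼ s by move=> jn; exact: iter_der_domn.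
  have e2 : ev f2 P b = g * ev f2 S b by rewrite /g divfK.
  set e := mdeg m in m2 *.
  have y0 : ev f2 P b / s ^+ e != 0 by rewrite mulf_neq0 ?invr_eq0 ?expf_neq0.
  have := @psub_scale _ V n _ g s p e (submod_lt V y0) sn0 itb _ m (erefl _).
  rewrite domM2r ?invr_eq0 ?expf_neq0 //; apply => m' _.
  have [c Mc pc] := bnd m'; rewrite dom_div ?expf_neq0 //.
  apply: (@dom_lt_trans _ _ OV (c * (s * s))).
    have ee : (2 + (e - 2))%N = e by rewrite subnKC.
    have sx : s ^+ (e - 2) ≼ 1 by apply: domX1; [exact: OV | exact: (domW OV (tiny1 (tgt n)))].
    have se : s ^+ e ≼ s * s * 1.
      by rewrite -ee exprD expr2; apply: domM; [exact: OV | exact: dom_refl | exact: sx].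
    by rewrite mulr1 in se; apply: domM; [exact: OV | exact: pc | exact: se].
  have -> : c * (s * s) = g * (c * (g * t ^+ (n + n))) by rewrite /s exprD; ring.
  rewrite e2 domM2l //; apply: (lt_dom_trans OV) _ (sim_domr OV ss).
  have tc : tiny (c * (g * t ^+ (n + n))) by exact: (tinyM (tgt _) Mc (dom_refl OV _)).
  have [MS _] := evc S; exact: (tc _ MS s1).
have [j hj] := dom_max OV r (fun i => (psub V u g Pf)@_U_(i)).
have hjr : ev f2 P b ≼ (psub V u g Pf)@_U_(j) by rewrite -cr; exact: hj.
have ldP : lin_dom V Pf u g.
  exists j; split; [exact: (dom_neq0 OV hjr e0) | exact: hj |].
  by move=> m m2; exact: (lt_dom_trans OV) (small m m2) hjr.
have [|u' [_ uu zu]] := dh_zero_at (A := setT) (P := Pf) (c := u) (g := g) dhM (fun _ => I) I I g0 ldP.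
  move=> st; have := st U_(r)%MM; rewrite cr mnm1_eq0 => /(_ isT).
  by rewrite dom_refl.
by exists u'; split=> //; exact: (tiny_le uu tg).
Qed.
End CloseExt.

(** Zorn's lemma is applied to the partial isomorphisms inside [close]. A missing element could be
    sent to itself if it is differentially transcendental over the domain, and by [close_zero] to a
    nearby zero otherwise. *)
Theorem deformation (A0 : set M) y a : diff_subfield d A0 -> A0 `<=` M1 -> M1 y -> tiny a ->
  (forall n (P : {mpoly M[n]}), (forall m, A0 P@_m) -> P != 0 -> P.@[fun i => iter i d y] != 0) ->
  exists G, [/\ piso V G, forall x, M1 x -> exists x', G (x, x'), G `<=` close, G (y, y + a) &
    forall c, A0 c -> G (c, c)].
Proof.
move=> sA AM My ta tr.
pose f0 := ds_inj sA; have fV0 : vembed (ds_vdf sA) V f0 := ds_vembed sA.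
have fc0 e : close (f0 e, f0 e).
  by split=> /=; [apply: AM; exact: ds_injP | rewrite subrr; exact: tiny0].
pose b i := iter i d y; pose b' i := iter i d (y + a).
have cb i : close (b i, b' i).
  split=> /=; first exact: (dsub_iter sM1).
  by rewrite /b /b' iter_derD addrC addKr; exact: tiny_iter.
have nz n (P : {mpoly (ds_field sA)[n]}) : P != 0 -> ev f0 P b != 0.
  move=> P0; apply: tr => [m|]; first by rewrite mcoeff_map_mpoly; exact: ds_injP.
  apply: contra P0 => /eqP e; apply/eqP/mpolyP => m; apply: (fmorph_inj f0).
  by rewrite -mcoeff_map_mpoly e !mcoeff0 rmorph0.
have hder i : gen_graph f0 f0 b b' (d (b i), d (b' i)) by exact: (gen_b f0 f0 b b' i.+1).
have [pG0 sG0] := close_gen fV0 fV0 fc0 cb nz hder.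
have [G [pG' G0G GX mG]] := piso_zorn pG0 sG0.
exists G; split=> //.
- move=> u Mu; apply: contrapT => nu; have [D] := piso_data pG'.
  have fcl e : close (pf1 D e, pf2 D e) by apply: GX; exact: (pG D e).
  have ext G2 u' : piso V G2 -> (forall e, G2 (pf1 D e, pf2 D e)) -> G2 `<=` close -> G2 (u, u') -> False.
    move=> p2 b2 s2 h; apply: nu; exists u'; apply: (mG G2) => // -[p q] /(pS D)[e <- <-]; exact: b2.
  pose c i := iter i d u.
  have cc i : close (c i, c i) by split=> /=; [exact: (dsub_iter sM1) | rewrite subrr; exact: tiny0].
  case: (pselect (exists n (P : {mpoly (pE D)[n]}), P != 0 /\ ev (pf1 D) P c = 0)) => [[n [P BP]]|no].
    have nonc (Q : {mpoly (pE D)[n]}) : Q != 0 /\ ev (pf1 D) Q c = 0 -> ~ wle (fun=> 1%N) 0 Q.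
      move=> [Q0 zQ] /wle_const QE; move: zQ; rewrite QE evC => /eqP; rewrite fmorph_eq0 => /eqP e.
      by move: Q0; rewrite QE e mpolyC0 eqxx.
    have [r [dd [D' [P' mP]]]] := minimal_bad_exists (ex_intro _ P BP) nonc.
    have [[[P0 z1] _ _ _] _ _] := mP.
    have [u' [tu zu]] := close_zero (pV2 D) fcl Mu mP.
    have cc' i : close (c i, iter i d u').
      split=> /=; first exact: (dsub_iter sM1).
      by rewrite /c -(subrK u u') iter_derD addrK; exact: tiny_iter.
    have good (Q : {mpoly (pE D)[n]}) : Q != 0 -> ~ (Q != 0 /\ ev (pf1 D) Q c = 0) -> exists v v',
        [/\ closeW (v, v'), ev (pf1 D) Q c ~~~ v & ev (pf2 D) Q (fun i => iter i d u') ~~~ v'].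
      move=> Q0 nB; have n0 : ev (pf1 D) Q c != 0 by apply/eqP => e; apply: nB.
      have cl := close_ev fcl Q cc'; have s := close_sim n0 cl.
      exists (ev (pf1 D) Q c), (ev (pf2 D) Q (fun i => iter i d u')); split=> //.
        exact: sim_refl.
      by apply: sim_refl => //; exact: (sim_neq0l OV s).
    have [G2 [p2 b2 Gu Gm]] := zero_extension cvx (pV1 D) (pV2 D) closeW_matched mP good P0 z1 zu.
    apply: (ext G2 u' p2 b2 _ Gu); apply: Gm => // [x x' z z'|x x' x0 _]; [exact: close_op | exact: closeV].
  have nz' n (P : {mpoly (pE D)[n]}) : P != 0 -> ev (pf1 D) P c != 0.
    by move=> P0; apply/eqP => e; apply: no; exists n, P.
  have hd i : gen_graph (pf1 D) (pf2 D) c c (d (c i), d (c i)) by exact: (gen_b _ _ c c i.+1).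
  have [p2 s2] := close_gen (pV1 D) (pV2 D) fcl cc nz' hd.
  by apply: (ext _ u p2 _ s2); [exact: gen_base | exact: (gen_b _ _ c c 0)].
- by apply: G0G; exact: (gen_b f0 f0 b b' 0).
- by move=> c /(ds_lift sA)[e <-]; apply: G0G; exact: gen_base.
Qed.
End Deformation.

(** * Models *)

Section Model.
Variables (R : rcfType) (der : R -> R) (O k : set R).
Hypothesis preH : pre_H_field der O.
Hypothesis dhens : diff_henselian O der.
Hypothesis Lcl : Liouville_closed der.
Hypothesis Oprop : O <> setT.
Hypothesis klift : residue_field_lift O der k.
Implicit Types x y z : R.
Local Notation "x ≼ y" := (dominatedb O x y) (at level 70, y at next level).
Local Notation "x ≺ y" := (~~ dominatedb O y x) (at level 70, y at next level).

Let OV : valuation_ring O. Proof. by case: preH. Qed.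
Let cvxO : convex O. Proof. by case: preH. Qed.
Let derax : derivation der. Proof. by case: preH. Qed.

Lemma strictlyP x y : strictly_dominated O x y <-> x ≺ y.
Proof.
split=> [[_ h]|h]; first by apply/negP => /asboolP.
by split; [apply/asboolP; exact: domW | move=> h'; case/negP: h; exact/asboolP].
Qed.

Lemma mod_mul x y : der (x * y) = der x * y + x * der y. Proof. by case: derax. Qed.
Lemma mod_der1 : der 1 = 0.
Proof. by have := mod_mul 1 1; rewrite !mulr1 mul1r => /eqP; rewrite -subr_eq subrr eq_sym => /eqP. Qed.
Lemma mod_ldM x y : x != 0 -> y != 0 -> logder der (x * y) = logder der x + logder der y.
Proof. by move=> x0 y0; rewrite /logder mod_mul; field; rewrite x0 y0. Qed.
Lemma mod_ldV x : x != 0 -> logder der x^-1 = - logder der x.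
Proof.
move=> x0; have xV : x^-1 != 0 by rewrite invr_eq0.
have := mod_ldM x0 xV; rewrite mulfV // /logder mod_der1 mul0r => /esym/eqP.
by rewrite addrC addr_eq0 => /eqP.
Qed.

Lemma mod_nat m : m.+1%:R != 0 :> R /\ O (m.+1%:R)^-1.
Proof.
split; first by rewrite pnatr_eq0.
have [O1 _ _ _] := OV; apply: (cvxO (valring0 OV) O1); first by rewrite invr_ge0.
by rewrite invf_le1 ?ltr0n // ler1n.
Qed.

Lemma mod_small x : x ≺ 1 -> der x ≺ 1.
Proof. by case: dhens => h _ _ /strictlyP/h/strictlyP. Qed.

Lemma mod_pre f g : f != 0 -> g != 0 -> f ≼ 1 -> g ≺ 1 -> der f ≺ logder der g.
Proof.
case: preH => _ _ _ _ h f0 g0 f1 g1; apply/strictlyP; apply: h => //; first exact/asboolP.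
exact/strictlyP.
Qed.

(** If [der x] were infinite, the pre-H-field axiom for [g = (der x)^-1] would give
    [der x ≺ der g * der x], although [der g] is infinitesimal. *)
Lemma mod_derO x : O x -> O (der x).
Proof.
move=> Ox; have [->|x0] := eqVneq x 0.
  have d0 : der 0 = 0 by case: derax => h _; apply: (addrI (der 0)); rewrite -h !addr0.
  by rewrite d0; exact: valring0.
apply: contrapT => nO.
have x1 : 1 ≺ der x by rewrite dom1P //; apply/asboolP.
have d0 := lt_dom_neq0 OV x1.
have g1 : (der x)^-1 ≺ 1 by rewrite dom1V.
have gV : (der x)^-1 != 0 by rewrite invr_eq0.
have := mod_pre x0 gV _ g1; rewrite dom1P // => /(_ (asboolT Ox)).
rewrite /logder invrK => h.
have h2 : der (der x)^-1 * der x ≺ 1 * der x by rewrite domM2r //; exact: mod_small.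
rewrite mul1r in h2; have := lt_trans_dom OV h h2; by rewrite dom_refl.
Qed.

(** Linear surjectivity over the residue field, applied to the operator [D] and the right side 1,
    provides [y] in [O] with [1 ≼ der y]; the axiom then gives [der y ≺ der x / x]. *)
Lemma mod_log x : x != 0 -> x ≺ 1 -> 1 ≺ logder der x.
Proof.
move=> x0 x1; have [_ ls _] := dhens.
have [O1 _ _ _] := OV.
have [|||y Oy] := ls 1%N (fun i => (i == ord_max)%:R) 1.
- by move=> i; case: (i == _); [exact: O1 | exact: (valring0 OV)].
- by exists ord_max; rewrite eqxx => /strictlyP; rewrite dom_refl.
- exact: O1.
rewrite !big_ord_recl big_ord0 /= mul0r add0r mul1r addr0 => /strictlyP h.
have s : 1 ≼ der y by exact: (sim_domr OV h).
have y0 : y != 0.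
  apply/eqP => e; have dy : der y = 0.
    by rewrite e; case: derax => hD _; apply: (addrI (der 0)); rewrite -hD !addr0.
  by move: s; rewrite dy domx0 // (negPf (oner_neq0 R)).
have := mod_pre y0 x0 _ x1; rewrite dom1P // => /(_ (asboolT Oy)).
exact: (dom_lt_trans OV s).
Qed.

Lemma mod_gt x : (forall h, O h -> h < x) -> 0 < der x.
Proof. by case: preH => _ _ _ h _; exact: h. Qed.

Lemma mod_ldneg x : x != 0 -> x ≺ 1 -> logder der x < 0.
Proof.
have derN y : der (- y) = - der y.
  have d0 : der 0 = 0 by case: derax => h _; apply: (addrI (der 0)); rewrite -h !addr0.
  by apply: (addrI (der y)); case: derax => h _; rewrite -h !subrr.
have pos y : 0 < y -> y ≺ 1 -> logder der y < 0.
  move=> y0 y1; have yn : y != 0 by rewrite gt_eqF.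
  rewrite -[y]invrK mod_ldV ?invr_eq0 // oppr_lt0 /logder divr_gt0 ?invr_gt0 //.
  apply: mod_gt => h Oh; rewrite ltNge; apply: contra y1 => yh.
  rewrite -domV1 // dom1P //; apply/asboolP.
  by apply: (cvxO (valring0 OV) Oh) => //; rewrite invr_ge0 ltW.
move=> x0 x1; have [h|h|h] := ltrgtP x 0; last by rewrite h eqxx in x0.
  have := pos (- x); rewrite oppr_gt0 domxN // /logder derN invrN mulrNN; exact.
exact: pos.
Qed.

(** Infinitesimals have negative logarithmic derivatives; for [x / y] and [y] this gives
    [x† < y† < 0], and [O] is convex. *)
Lemma mod_mono x y : x != 0 -> x ≺ y -> y ≺ 1 -> logder der y ≼ logder der x.
Proof.
move=> x0 xy y1; have y0 := lt_dom_neq0 OV xy.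
have q1 : x / y ≺ 1 by rewrite domx_div // mul1r.
have yV : y^-1 != 0 by rewrite invr_eq0.
have := mod_ldneg (mulf_neq0 x0 yV) q1; rewrite mod_ldM // mod_ldV // subr_lt0 => l1.
have l2 := mod_ldneg y0 y1; have l3 := lt_trans l1 l2.
have lx : logder der x != 0 by rewrite lt_eqF.
rewrite domP //; apply/asboolP; have [O1 _ _ _] := OV.
apply: (cvxO (valring0 OV) O1); first by rewrite mulr_le0 ?invr_le0 // ltW.
by rewrite ler_ndivrMr // mul1r ltW.
Qed.

Definition model_vdf : vdf R :=
  @Vdf R der O derax OV mod_nat mod_derO mod_small mod_log mod_mono.

Lemma nth_root x n : 0 < x -> (0 < n)%N -> exists2 y, 0 < y & y ^+ n = x.
Proof.
move=> x0 n0; pose p : {poly R} := 'X^n - x%:P.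
have pE y : p.[y] = y ^+ n - x by rewrite !hornerE.
have [|y /andP[y0 _]] := @poly_ivt R p 0 (x + 1) (addr_ge0 (ltW x0) ler01).
  rewrite !pE expr0n eqn0Ngt n0 sub0r oppr_le0 (ltW x0) /= subr_ge0.
  have h1 : 1 <= x + 1 by rewrite lerDr ltW.
  by apply: (le_trans _ (ler_eXnr n0 h1)); rewrite lerDl.
rewrite /root pE subr_eq0 => /eqP e; exists y => //.
by rewrite lt_neqAle y0 andbT eq_sym; apply/eqP => y00; move: x0; rewrite -e y00 expr0n eqn0Ngt n0 ltxx.
Qed.

Lemma model_submodel : submodel model_vdf k setT.
Proof.
have [ds kO res] := klift; have [_ ls dh] := dhens.
split.
- split=> //.
  + move=> n P _ hP h0 [i hi]; have [|||y y1 hy] := dh n P.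
    * by move=> m; have := hP m; rewrite dom1P // => /asboolP.
    * exact/strictlyP.
    * by exists i; split; apply/asboolP; [exact: hP | exact: hi].
    * by exists y; split=> //; exact/strictlyP.
  + move=> r a b _ _ ha [i hi] hb; have [|||y Oy hy] := ls r a b.
    * by move=> j; have := ha j; rewrite dom1P // => /asboolP.
    * by exists i => /strictlyP; rewrite hi.
    * by move: hb; rewrite dom1P // => /asboolP.
    * by exists y; split=> //; [rewrite dom1P //; exact/asboolP | exact/strictlyP].
- by move=> x _; have [_ h] := Lcl; have [z z0 e] := h x; exists z.
- by move=> x n _ x0 n0; have [y y0 e] := nth_root x0 n0; exists y.
- move=> x _; rewrite dom1P // => /asboolP/res[c [[kc hc] _]]; exists c; split=> //; exact/strictlyP.
- have [x nx] : exists x, ~ O x.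
    by apply: contrapT => h; apply: Oprop; apply/seteqP; split=> // x _; apply: contrapT => h'; apply: h; exists x.
  have x1 : 1 ≺ x by rewrite dom1P //; apply/asboolP.
  have x0 := lt_dom_neq0 OV x1.
  by exists x^-1; split=> //; rewrite ?invr_eq0 // dom1V.
Qed.

Lemma model_kO c : k c -> c ≼ 1.
Proof. by case: klift => _ kO _ /kO Oc; rewrite dom1P //; exact/asboolP. Qed.

Lemma model_k_uniq c c' : k c -> k c' -> c - c' ≺ 1 -> c = c'.
Proof.
move=> kc kc' h; have [_ kO res] := klift.
have [c0 [_ u]] := res c (kO _ kc).
rewrite -(u c); first last.
  by split=> //; apply/strictlyP; rewrite subrr lt0_dom // oner_neq0.
by apply: u; split=> //; exact/strictlyP.
Qed.
End Model.

(** * First-order transfer *)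

Section Renaming.
Variable L : language.

Fixpoint tmap (V W : Type) (f : V -> W) (t : term L V) : term L W :=
  match t with Var v => Var L (f v) | App g ts => App (fun i => tmap f (ts i)) end.

Definition omapf (V W : Type) (f : V -> W) (o : option V) := omap f o.

Fixpoint frename (V : Type) (phi : formula L V) : forall W, (V -> W) -> formula L W :=
  match phi with
  | Fal => fun W f => Fal L W
  | Eq t u => fun W f => Eq (tmap f t) (tmap f u)
  | Rel r ts => fun W f => Rel (fun i => tmap f (ts i))
  | Imp p q => fun W f => Imp (frename p f) (frename q f)
  | All p => fun W f => All (frename p (omapf f))
  end.

Lemma eval_tmap (N : structure L) (V W : Type) (f : V -> W) (e : W -> N) t :
  Defs.eval e (tmap f t) = Defs.eval (e \o f) t.
Proof. by elim: t => //= g ts IH; congr fint; apply: funext => i; exact: IH. Qed.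

Lemma holds_frename (N : structure L) (V : Type) (phi : formula L V) : forall (W : Type) (f : V -> W) (e : W -> N),
  holds e (frename phi f) <-> holds (e \o f) phi.
Proof.
elim: phi => {V} [V|V t u|V r ts|V p IHp q IHq|V p IH] W f e //=.
- by rewrite !eval_tmap.
- by rewrite (_ : (fun i => Defs.eval e (tmap f (ts i))) = (fun i => Defs.eval (e \o f) (ts i))) //;
    apply: funext => i; rewrite eval_tmap.
- by rewrite IHp IHq.
- split=> h x; have := h x; rewrite IH; congr holds.
  + by rewrite (_ : oapp e x \o omapf f = oapp (e \o f) x) //; apply: funext; case.
  + by rewrite (_ : oapp e x \o omapf f = oapp (e \o f) x) //; apply: funext; case.
Qed.
End Renaming.

Section Transfer.
Variables (K : rcfType) (der : K -> K) (O k : set K) (n : nat) (S : set ('I_n -> K)).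
Variable X : saturated_extension der O k S.

Definition fld (b : bool) : rcfType := if b then ext_field X else K.
Definition fder b : fld b -> fld b :=
  match b return fld b -> fld b with true => ext_der X | false => der end.
Definition fdomi b : fld b -> fld b -> Prop :=
  match b return fld b -> fld b -> Prop with true => ext_dom X | false => dominated O end.
Definition fk b : set (fld b) := match b return set (fld b) with true => ext_small X | false => k end.
Definition fS b : set ('I_n -> fld b) :=
  match b return set ('I_n -> fld b) with true => ext_set X | false => S end.
Let L := expand_language pair_language n.
Definition str b : structure L := @expand pair_language n (pair_structure (@fder b) (@fdomi b) (@fk b)) (@fS b).

(* The boolean selects the structure, [false] for [K] and [true] for its extension, so that [fo] and
   [fod] express definability by one formula in both. *)
Definition fo (V : Type) (A : forall b, (V -> fld b) -> Prop) :=
  exists phi : formula L V, forall b (e : V -> fld b), A b e <-> holds (M := str b) e phi.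
Definition fod (V : Type) (t : forall b, (V -> fld b) -> fld b) :=
  fo (fun b (e : option V -> fld b) => e None = t b (fun v => e (Some v))).

Lemma transfer (A : forall b, (K -> fld b) -> Prop) : fo A -> A false id -> A true (ext_emb X).
Proof. by move=> [phi h] /h hK; apply/h; exact: (ext_elementary X phi).1. Qed.

Lemma fo_ext V (A B : forall b, (V -> fld b) -> Prop) : (forall b e, A b e <-> B b e) -> fo A -> fo B.
Proof. by move=> h [phi hp]; exists phi => b e; rewrite -h. Qed.
Lemma fo_ren V W (f : V -> W) (A : forall b, (V -> fld b) -> Prop) : fo A ->
  fo (fun b (e : W -> fld b) => A b (fun v => e (f v))).
Proof. by move=> [phi h]; exists (frename phi f) => b e; rewrite holds_frename -h. Qed.
Lemma fo_imp V (A B : forall b, (V -> fld b) -> Prop) : fo A -> fo B -> fo (fun b e => A b e -> B b e).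
Proof. by move=> [p hp] [q hq]; exists (Imp p q) => b e /=; rewrite hp hq. Qed.
Lemma fo_False V : fo (fun b (e : V -> fld b) => False).
Proof. by exists (Fal L V). Qed.
Lemma fo_const V (Q : Prop) : fo (fun b (e : V -> fld b) => Q).
Proof.
case: (pselect Q) => q; first by apply: fo_ext (fo_imp (fo_False V) (fo_False V)) => b e; split.
by apply: fo_ext (fo_False V).
Qed.
Lemma fo_not V (A : forall b, (V -> fld b) -> Prop) : fo A -> fo (fun b e => ~ A b e).
Proof. by move=> h; apply: fo_imp h (fo_False V). Qed.
Lemma fo_and V (A B : forall b, (V -> fld b) -> Prop) : fo A -> fo B -> fo (fun b e => A b e /\ B b e).
Proof.
move=> hA hB; apply: fo_ext (fo_not (fo_imp hA (fo_not hB))) => b e; split=> [h|[a c] h]; last exact: h.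
by split; apply: contrapT => h'; apply: h.
Qed.
Lemma fo_or V (A B : forall b, (V -> fld b) -> Prop) : fo A -> fo B -> fo (fun b e => A b e \/ B b e).
Proof.
move=> hA hB; apply: fo_ext (fo_imp (fo_not hA) hB) => b e; split=> [h|[a|c] //].
by case: (pselect (A b e)) => a; [left | right; exact: h].
Qed.
Lemma fo_iff V (A B : forall b, (V -> fld b) -> Prop) : fo A -> fo B -> fo (fun b e => A b e <-> B b e).
Proof. by move=> hA hB; apply: fo_and; apply: fo_imp. Qed.
Lemma fo_all V (B : forall b, (V -> fld b) -> fld b -> Prop) :
  fo (fun b (e : option V -> fld b) => B b (fun v => e (Some v)) (e None)) ->
  fo (fun b e => forall x, B b e x).
Proof.
move=> [phi h]; exists (All phi) => b e; split=> hx x; first by apply/(h b (oapp e x)); exact: hx.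
by have /(h b (oapp e x)) := hx x.
Qed.
Lemma fo_ex V (B : forall b, (V -> fld b) -> fld b -> Prop) :
  fo (fun b (e : option V -> fld b) => B b (fun v => e (Some v)) (e None)) ->
  fo (fun b e => exists x, B b e x).
Proof.
move=> h; have h' : fo (fun b (e : option V -> fld b) => ~ B b (fun v => e (Some v)) (e None)) by exact: fo_not.
apply: fo_ext (fo_not (fo_all (B := fun b e x => ~ B b e x) h')) => b e.
split=> [h1|[x hx] h1]; last exact: (h1 x).
by apply: contrapT => h2; apply: h1 => x hx; apply: h2; exists x.
Qed.
Lemma fo_ex2 V (A B : forall b, (V -> fld b) -> fld b -> Prop) :
  fo (fun b (e : option V -> fld b) => A b (fun v => e (Some v)) (e None)) ->
  fo (fun b (e : option V -> fld b) => B b (fun v => e (Some v)) (e None)) ->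
  fo (fun b e => exists2 x, A b e x & B b e x).
Proof.
move=> hA hB; apply: fo_ext (fo_ex (B := fun b e x => A b e x /\ B b e x) (fo_and hA hB)) => b e.
by split=> [[x [a c]]|[x a c]]; exists x.
Qed.
Lemma fo_fin V (I : finType) (A : I -> forall b, (V -> fld b) -> Prop) : (forall i, fo (A i)) ->
  fo (fun b e => forall i, A i b e).
Proof.
move=> h; suff [phi hp] : fo (fun b e => forall i, i \in enum I -> A i b e).
  exists phi => b e; rewrite -hp; split=> hi i; last by apply: hi; rewrite mem_enum.
  by move=> _; exact: hi.
elim: (enum I) => [|i s IH]; first by apply: fo_ext (fo_const V True) => b e; split.
apply: fo_ext (fo_and (h i) IH) => b e; split=> [[a c] j|hj].
  by rewrite in_cons => /orP[/eqP ->|/c].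
by split=> [|j js]; apply: hj; rewrite in_cons ?eqxx // js orbT.
Qed.
Lemma fo_finex V (I : finType) (A : I -> forall b, (V -> fld b) -> Prop) : (forall i, fo (A i)) ->
  fo (fun b e => exists i, A i b e).
Proof.
move=> h; apply: fo_ext (fo_not (fo_fin (fun i => fo_not (h i)))) => b e.
split=> [h1|[i hi] h1]; last exact: (h1 i).
by apply: contrapT => h2; apply: h1 => i hi; apply: h2; exists i.
Qed.
(** Induction on the length: the first coordinate is quantified as the variable [None], and
    [unlift ord0] reassembles the tuple. *)
Lemma fo_alln V m (B : forall b, (V -> fld b) -> ('I_m -> fld b) -> Prop) :
  fo (fun b (e : 'I_m + V -> fld b) => B b (fun v => e (inr v)) (fun i => e (inl i))) ->
  fo (fun b e => forall s, B b e s).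
Proof.
elim: m V B => [|m IH] V B h.
  pose f (v : 'I_0 + V) : V := match v with inr u => u | inl i => False_rect V (notF (ltn_ord i)) end.
  apply: fo_ext (fo_ren f h) => b e; split=> [hh s|hh]; last exact: hh.
  by rewrite (_ : s = (fun i => e (f (inl i)))) //; apply: funext => -[].
pose g (v : 'I_m.+1 + V) : option ('I_m + V) :=
  match v with inl i => omap inl (unlift ord0 i) | inr u => Some (inr u) end.
have h1 : fo (fun b (e : 'I_m + V -> fld b) => forall x,
    B b (fun v => e (inr v)) (fun i => oapp (fun j => e (inl j)) x (unlift ord0 i))).
  apply: fo_all; apply: fo_ext (fo_ren g h) => b e /=.
  rewrite (_ : (fun i => e (omap inl (unlift ord0 i))) =
    (fun i => oapp (fun j => e (Some (inl j))) (e None) (unlift ord0 i))) //.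
  by apply: funext => i; case: unlift.
apply: fo_ext (IH V (fun b e s => forall x, B b e (fun i => oapp s x (unlift ord0 i))) h1) => b e.
split=> [hs s|hs s x]; last exact: hs.
have := hs (fun j => s (lift ord0 j)) (s ord0); congr (B b e _); apply: funext => i.
by case: unliftP => [j ->|->].
Qed.
Lemma fo_exn V m (B : forall b, (V -> fld b) -> ('I_m -> fld b) -> Prop) :
  fo (fun b (e : 'I_m + V -> fld b) => B b (fun v => e (inr v)) (fun i => e (inl i))) ->
  fo (fun b e => exists s, B b e s).
Proof.
move=> h; have h' : fo (fun b (e : 'I_m + V -> fld b) => ~ B b (fun v => e (inr v)) (fun i => e (inl i))).
  exact: fo_not.
apply: fo_ext (fo_not (fo_alln (B := fun b e s => ~ B b e s) h')) => b e.
split=> [h1|[s hs] h1]; last exact: (h1 s).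
by apply: contrapT => h2; apply: h1 => s hs; apply: h2; exists s.
Qed.

Lemma fo_sub V (B : forall b, (V -> fld b) -> fld b -> Prop) t : fod t ->
  fo (fun b (e : option V -> fld b) => B b (fun v => e (Some v)) (e None)) ->
  fo (fun b e => B b e (t b e)).
Proof.
move=> ht hB; apply: fo_ext (fo_ex (B := fun b e x => x = t b e /\ B b e x) (fo_and ht hB)) => b e.
by split=> [[x [-> //]]|h]; exists (t b e).
Qed.
Lemma fod_ren V W (f : V -> W) (t : forall b, (V -> fld b) -> fld b) : fod t ->
  fod (fun b (e : W -> fld b) => t b (fun v => e (f v))).
Proof. by move=> h; exact: (fo_ren (omap f) h). Qed.
Lemma fo_sub2 V (B : forall b, fld b -> fld b -> Prop) t u :
  (forall W (v w : W), fo (fun b e => B b (e v) (e w))) -> fod (V := V) t -> fod (V := V) u ->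
  fo (fun b e => B b (t b e) (u b e)).
Proof.
move=> hB ht hu; apply: (fo_sub (B := fun b e x => B b x (u b e)) ht).
apply: (fo_sub (B := fun b e y => B b (e None) y) (fod_ren Some hu)); exact: hB.
Qed.

Lemma fo_eq0 W (v w : W) : fo (fun b e => e v = e w).
Proof. by exists (Eq (Var L v) (Var L w)). Qed.
Lemma fo_le0 W (v w : W) : fo (fun b e => e v <= e w).
Proof.
by exists (@Rel L W (Some RLe : rsym L) (fun i : 'I_2 => Var L (if i == ord0 then v else w))) => b e.
Qed.
Lemma fo_dom0 W (v w : W) : fo (fun b e => fdomi (e v) (e w)).
Proof.
by exists (@Rel L W (Some RDom : rsym L) (fun i : 'I_2 => Var L (if i == ord0 then v else w))) => b e.
Qed.
Lemma fo_k0 W (v : W) : fo (fun b e => fk (e v)).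
Proof. by exists (@Rel L W (Some RSmall : rsym L) (fun i : 'I_1 => Var L v)) => b e. Qed.
Lemma fo_S0 W (v : 'I_n -> W) : fo (fun b e => fS (fun i => e (v i))).
Proof. by exists (@Rel L W (None : rsym L) (fun i : 'I_n => Var L (v i))) => b e. Qed.

Lemma fod_var V (v : V) : fod (fun b e => e v). Proof. exact: fo_eq0. Qed.
Lemma fod_term V (tau : term L V) : fod (fun b e => Defs.eval (M := str b) e tau).
Proof.
by exists (Eq (Var L None) (tmap Some tau)) => b e /=; rewrite eval_tmap.
Qed.
Lemma fod_termE V (tau : term L V) t : (forall b e, t b e = Defs.eval (M := str b) e tau) -> fod t.
Proof. by move=> h; apply: fo_ext (fod_term tau) => b e; rewrite h. Qed.
Lemma fod0 V : fod (fun b (e : V -> fld b) => 0).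
Proof. exact (@fod_termE _ (@App L V (FZero : Defs.fsym L) (fun i : 'I_0 => False_rect _ (notF (ltn_ord i)))) _ (fun b e => erefl)). Qed.
Lemma fod1 V : fod (fun b (e : V -> fld b) => 1).
Proof. exact (@fod_termE _ (@App L V (FOne : Defs.fsym L) (fun i : 'I_0 => False_rect _ (notF (ltn_ord i)))) _ (fun b e => erefl)). Qed.

Lemma fod_op2 V (f : forall b, fld b -> fld b -> fld b) t u :
  (forall W (v w : W), fod (fun b e => f b (e v) (e w))) -> fod (V := V) t -> fod (V := V) u ->
  fod (fun b e => f b (t b e) (u b e)).
Proof.
move=> hf ht hu; rewrite /fod.
apply: (fo_sub (B := fun b e x => e None = f b x (u b (fun v => e (Some v)))) (fod_ren Some ht)).
apply: (fo_sub (B := fun b e y => e (Some None) = f b (e None) y) (fod_ren (Some \o Some) hu)).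
exact: (fo_ren (fun o => if o is Some o' then o' else Some (Some None))
  (hf (option (option (option V))) (Some None) None)).
Qed.
Lemma fod_add V t u : fod (V := V) t -> fod (V := V) u -> fod (fun b e => t b e + u b e).
Proof.
apply: (fod_op2 (f := fun b x y => x + y)) => W v w.
exact (@fod_termE _ (@App L W (FAdd : Defs.fsym L) (fun i : 'I_2 => Var L (if i == ord0 then v else w))) _ (fun b e => erefl)).
Qed.
Lemma fod_mul V t u : fod (V := V) t -> fod (V := V) u -> fod (fun b e => t b e * u b e).
Proof.
apply: (fod_op2 (f := fun b x y => x * y)) => W v w.
exact (@fod_termE _ (@App L W (FMul : Defs.fsym L) (fun i : 'I_2 => Var L (if i == ord0 then v else w))) _ (fun b e => erefl)).
Qed.
Lemma fod_opp V t : fod (V := V) t -> fod (fun b e => - t b e).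
Proof.
move=> h; apply: (fod_op2 (f := fun b x y => - x) _ h h) => W v w.
exact (@fod_termE _ (@App L W (FOpp : Defs.fsym L) (fun i : 'I_1 => Var L v)) _ (fun b e => erefl)).
Qed.
Lemma fod_der V t : fod (V := V) t -> fod (fun b e => fder (t b e)).
Proof.
move=> h; apply: (fod_op2 (f := fun b x y => fder x) _ h h) => W v w.
exact (@fod_termE _ (@App L W (FDer : Defs.fsym L) (fun i : 'I_1 => Var L v)) _ (fun b e => erefl)).
Qed.
Lemma fod_sub V t u : fod (V := V) t -> fod (V := V) u -> fod (fun b e => t b e - u b e).
Proof. by move=> ht hu; apply: fod_add => //; exact: fod_opp. Qed.
Lemma fo_eq V t u : fod (V := V) t -> fod (V := V) u -> fo (fun b e => t b e = u b e).
Proof. by apply: (fo_sub2 (B := fun b x y => x = y)) => W v w; exact: fo_eq0. Qed.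
Lemma fo_le V t u : fod (V := V) t -> fod (V := V) u -> fo (fun b e => t b e <= u b e).
Proof. by apply: (fo_sub2 (B := fun b x y => x <= y)) => W v w; exact: fo_le0. Qed.
Lemma fo_lt V t u : fod (V := V) t -> fod (V := V) u -> fo (fun b e => t b e < u b e).
Proof.
move=> ht hu; apply: fo_ext (fo_not (fo_le hu ht)) => b e; rewrite ltNge.
by split=> /negP.
Qed.
Lemma fo_neq V t u : fod (V := V) t -> fod (V := V) u -> fo (fun b e => t b e != u b e).
Proof. by move=> ht hu; apply: fo_ext (fo_not (fo_eq ht hu)) => b e; split=> /eqP. Qed.
Lemma fo_dom V t u : fod (V := V) t -> fod (V := V) u -> fo (fun b e => fdomi (t b e) (u b e)).
Proof. by apply: (fo_sub2 (B := fun b x y => fdomi x y)) => W v w; exact: fo_dom0. Qed.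
Lemma fo_k V t : fod (V := V) t -> fo (fun b e => fk (t b e)).
Proof. by move=> h; apply: (fo_sub2 (B := fun b x y => fk x) _ h h) => W v w; exact: fo_k0. Qed.
Lemma fod_inv V t : fod (V := V) t -> fod (fun b e => (t b e)^-1).
Proof.
move=> h; apply: (fod_op2 (f := fun b x y => x^-1) _ h h) => W v w; rewrite /fod.
(* The inverse of 0 is 0 by convention, whence the first disjunct. *)
apply: fo_ext (fo_or (fo_and (fo_eq (fod_var (Some v)) (fod0 _)) (fo_eq (fod_var None) (fod0 _)))
  (fo_eq (fod_mul (fod_var None) (fod_var (Some v))) (fod1 _))) => b e.
split=> [[[e1 e2]|e1]|->]; first by rewrite e1 e2 invr0.
  have v0 : e (Some v) != 0 by apply/eqP => e0; move/eqP: e1; rewrite e0 mulr0 eq_sym oner_eq0.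
  by apply: (mulIf v0); rewrite e1 mulVf.
by have [e0|e0] := eqVneq (e (Some v)) 0; [left; rewrite e0 invr0 | right; rewrite mulVf].
Qed.
Lemma fod_sum V (I : Type) (s : seq I) (p : pred I) (t : I -> forall b, (V -> fld b) -> fld b) :
  (forall i, fod (t i)) -> fod (fun b e => \sum_(i <- s | p i) t i b e).
Proof.
move=> h; elim: s => [|i s IH].
  rewrite (_ : (fun b e => _) = (fun b e => 0)); first exact: fod0.
  by apply: functional_extensionality_dep => b; apply: funext => e; rewrite big_nil.
rewrite (_ : (fun b e => _) = (fun b e => if p i then t i b e + \sum_(i <- s | p i) t i b e
   else \sum_(i <- s | p i) t i b e)).
  by case: (p i) => //; exact: fod_add.
by apply: functional_extensionality_dep => b; apply: funext => e; rewrite big_cons.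
Qed.
Lemma fod_exp V m t : fod (V := V) t -> fod (fun b e => t b e ^+ m).
Proof.
move=> h; elim: m => [|m IH]; first exact: fod1.
rewrite (_ : (fun b e => _) = (fun b e => t b e * t b e ^+ m)); first exact: fod_mul.
by apply: functional_extensionality_dep => b; apply: funext => e; rewrite exprS.
Qed.
Lemma fod_prod V (I : Type) (s : seq I) (t : I -> forall b, (V -> fld b) -> fld b) :
  (forall i, fod (t i)) -> fod (fun b e => \prod_(i <- s) t i b e).
Proof.
move=> h; elim: s => [|i s IH].
  rewrite (_ : (fun b e => _) = (fun b e => 1)); first exact: fod1.
  by apply: functional_extensionality_dep => b; apply: funext => e; rewrite big_nil.
rewrite (_ : (fun b e => _) = (fun b e => t i b e * \prod_(i <- s) t i b e)); first exact: fod_mul.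
by apply: functional_extensionality_dep => b; apply: funext => e; rewrite big_cons.
Qed.
Lemma fod_iter V m t : fod (V := V) t -> fod (fun b e => iter m (@fder b) (t b e)).
Proof. by move=> h; elim: m => [|m IH] //=; exact: fod_der. Qed.
Lemma fod_nat V m : fod (fun b (e : V -> fld b) => m%:R).
Proof.
elim: m => [|m IH]; first exact: fod0.
rewrite (_ : (fun b e => _) = (fun b e => 1 + m%:R)); first exact: fod_add (fod1 V) IH.
by apply: functional_extensionality_dep => b; apply: funext => e; rewrite mulrS.
Qed.
Lemma fo_and3 V (A B C : forall b, (V -> fld b) -> Prop) : fo A -> fo B -> fo C ->
  fo (fun b e => [/\ A b e, B b e & C b e]).
Proof. by move=> a c f; apply: fo_ext (fo_and a (fo_and c f)) => b e; split=> [[? []]|[]]. Qed.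
Lemma fo_and4 V (A B C D : forall b, (V -> fld b) -> Prop) : fo A -> fo B -> fo C -> fo D ->
  fo (fun b e => [/\ A b e, B b e, C b e & D b e]).
Proof. by move=> a c f g; apply: fo_ext (fo_and a (fo_and c (fo_and f g))) => b e; split=> [[? [? []]]|[]]. Qed.
Lemma fo_and5 V (A B C D E : forall b, (V -> fld b) -> Prop) : fo A -> fo B -> fo C -> fo D -> fo E ->
  fo (fun b e => [/\ A b e, B b e, C b e, D b e & E b e]).
Proof.
by move=> a c f g h; apply: fo_ext (fo_and a (fo_and c (fo_and f (fo_and g h)))) => b e;
  split=> [[? [? [? []]]]|[]].
Qed.
Lemma fo_bool V (c : bool) (A : forall b, (V -> fld b) -> Prop) : fo A -> fo (fun b e => if c then A b e else ~ A b e).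
Proof. by case: c => // h; exact: fo_not. Qed.
End Transfer.

(** Definability is read off the shape of a statement, so that axioms are transferred in their
    original form and no formula is written down. *)
Ltac fod_step := lazymatch goal with
  | |- @fod _ _ _ _ _ _ _ _ (fun b e => e _) => exact (fod_var _ _)
  | |- @fod _ _ _ _ _ _ _ _ (fun b e => (_ + _)%R) => refine (fod_add _ _)
  | |- @fod _ _ _ _ _ _ _ _ (fun b e => (- _)%R) => refine (fod_opp _)
  | |- @fod _ _ _ _ _ _ _ _ (fun b e => (_ * _)%R) => refine (fod_mul _ _)
  | |- @fod _ _ _ _ _ _ _ _ (fun b e => (_ ^-1)%R) => refine (fod_inv _)
  | |- @fod _ _ _ _ _ _ _ _ (fun b e => (_ ^+ _)%R) => refine (fod_exp _ _)
  | |- @fod _ _ _ _ _ _ _ _ (fun b e => fder _) => refine (fod_der _)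
  | |- @fod _ _ _ _ _ _ _ _ (fun b e => iter _ _ _) => refine (fod_iter _ _)
  | |- @fod _ _ _ _ _ _ _ _ (fun b e => 0%R) => exact (fod0 _ _)
  | |- @fod _ _ _ _ _ _ _ _ (fun b e => 1%R) => exact (fod1 _ _)
  | |- @fod _ _ _ _ _ _ _ _ (fun b e => (_ %:R)%R) => exact (fod_nat _ _ _)
  | |- @fod _ _ _ _ _ _ _ _ (fun b e => (\sum_(i <- _ | _) _)%R) => refine (fod_sum _ _ _) => ?
  | |- @fod _ _ _ _ _ _ _ _ (fun b e => (\prod_(i <- _ | _) _)%R) => refine (fod_prod _ _) => ?
  end.

(** * The extension satisfies the same axioms *)

Section TransferModel.
Variables (K : rcfType) (der : K -> K) (O k : set K) (n : nat) (S : set ('I_n -> K)).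
Variable X : saturated_extension der O k S.
Local Notation fld := (fld X).
Local Notation foX := (fo (X := X)).
Local Notation fod := (fod (X := X)).

(** The structures record only the dominance relation; this recovers the valuation ring uniformly in
    both. *)
Definition fO b : set (fld b) := [set x | fdomi x 1].

Lemma fo_O V t : fod (V := V) t -> foX (fun b e => fO (t b e)).
Proof. by move=> h; apply: fo_dom => //; exact: fod1. Qed.
Lemma fo_dominated V t u : fod (V := V) t -> fod (V := V) u -> foX (fun b e => dominated (@fO b) (t b e) (u b e)).
Proof.
move=> ht hu; apply: fo_ex2; first by apply: fo_O; exact: fod_var.
by apply: fo_eq; [exact: (fod_ren Some ht) | apply: fod_mul; [exact: fod_var | exact: (fod_ren Some hu)]].
Qed.
Lemma fo_strict V t u : fod (V := V) t -> fod (V := V) u ->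
  foX (fun b e => strictly_dominated (@fO b) (t b e) (u b e)).
Proof. by move=> ht hu; apply: fo_and; [|apply: fo_not]; apply: fo_dominated. Qed.
Lemma fo_asymp V t u : fod (V := V) t -> fod (V := V) u -> foX (fun b e => asymp (@fO b) (t b e) (u b e)).
Proof. by move=> ht hu; apply: fo_and; apply: fo_dominated. Qed.
Lemma fo_max V t : fod (V := V) t -> foX (fun b e => maximal_ideal (@fO b) (t b e)).
Proof. by move=> h; apply: fo_strict => //; exact: fod1. Qed.

Ltac fo_step := lazymatch goal with
  | |- @fo _ _ _ _ _ _ _ _ (fun b e => and5 _ _ _ _ _) => refine (fo_and5 _ _ _ _ _)
  | |- @fo _ _ _ _ _ _ _ _ (fun b e => and4 _ _ _ _) => refine (fo_and4 _ _ _ _)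
  | |- @fo _ _ _ _ _ _ _ _ (fun b e => and3 _ _ _) => refine (fo_and3 _ _ _)
  | |- @fo _ _ _ _ _ _ _ _ (fun b e => _ <-> _) => refine (fo_iff _ _)
  | |- @fo _ _ _ _ _ _ _ _ (fun b e => _ /\ _) => refine (fo_and _ _)
  | |- @fo _ _ _ _ _ _ _ _ (fun b e => _ \/ _) => refine (fo_or _ _)
  | |- @fo _ _ _ _ _ _ _ _ (fun b e => ~ _) => refine (fo_not _)
  | |- @fo _ _ _ _ _ _ _ _ (fun b e => exists2 x, _ & _) => refine (fo_ex2 _ _)
  | |- @fo _ _ _ _ _ _ _ _ (fun b e => exists x, _) => refine (fo_ex _)
  | |- @fo _ _ _ _ _ _ _ _ (fun b e => asymp _ _ _) => refine (fo_asymp _ _)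
  | |- @fo _ _ _ _ _ _ _ _ (fun b e => strictly_dominated _ _ _) => refine (fo_strict _ _)
  | |- @fo _ _ _ _ _ _ _ _ (fun b e => dominated _ _ _) => refine (fo_dominated _ _)
  | |- @fo _ _ _ _ _ _ _ _ (fun b e => maximal_ideal _ _) => refine (fo_max _)
  | |- @fo _ _ _ _ _ _ _ _ (fun b e => fO _) => refine (fo_O _)
  | |- @fo _ _ _ _ _ _ _ _ (fun b e => fk _) => refine (fo_k _)
  | |- @fo _ _ _ _ _ _ _ _ (fun b e => fdomi _ _) => refine (fo_dom _ _)
  | |- @fo _ _ _ _ _ _ _ _ (fun b e => is_true (_ != _)) => refine (fo_neq _ _)
  | |- @fo _ _ _ _ _ _ _ _ (fun b e => is_true (_ < _)%R) => refine (fo_lt _ _)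
  | |- @fo _ _ _ _ _ _ _ _ (fun b e => is_true (_ <= _)%R) => refine (fo_le _ _)
  | |- @fo _ _ _ _ _ _ _ _ (fun b e => _ = _) => refine (fo_eq _ _)
  | |- @fo _ _ _ _ _ _ _ _ (fun b e => _ -> _) => first [refine (fo_imp _ _) | refine (fo_all _)]
  | |- @fo _ _ _ _ _ _ _ _ (fun b e => forall x, _) => refine (fo_all _)
  end.
Ltac fo_tac := cbv beta; repeat first [fo_step | fod_step].

Hypothesis K_preH : pre_H_field der O.
Hypothesis K_dhens : diff_henselian O der.
Hypothesis K_Liouville : Liouville_closed der.
Hypothesis O_proper : O <> setT.
Hypothesis k_lift : residue_field_lift O der k.

Let OK : valuation_ring O. Proof. by case: K_preH. Qed.

Lemma fO_K : @fO false = O.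
Proof.
apply/seteqP; split=> x /=; rewrite /fO /=; first by move=> [h Oh ->]; rewrite mulr1.
by move=> Ox; exists x; rewrite ?mulr1.
Qed.

Definition MM := ext_field X.
Definition MO : set MM := @fO true.

Lemma M_dom x y : ext_dom X x y <-> dominated MO x y.
Proof.
have := @transfer _ _ _ _ _ _ X (fun b e => forall x y, fdomi x y <-> dominated (@fO b) x y); apply.
  by apply: fo_all; apply: fo_all; apply: fo_iff; fo_tac.
by move=> p q; rewrite fO_K.
Qed.

Lemma M_preH : pre_H_field (ext_der X) MO.
Proof.
apply: (@transfer _ _ _ _ _ _ X (fun b e => pre_H_field (@fder _ _ _ _ _ _ X b) (@fO b))); last by rewrite fO_K.
rewrite /pre_H_field /derivation /valuation_ring /convex; fo_tac.
Qed.

Lemma M_Liouville : Liouville_closed (ext_der X).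
Proof.
apply: (@transfer _ _ _ _ _ _ X (fun b e => Liouville_closed (@fder _ _ _ _ _ _ X b))) => //.
rewrite /Liouville_closed; fo_tac.
Qed.

Lemma M_proper : MO <> setT.
Proof.
have := @transfer _ _ _ _ _ _ X (fun b e => exists x, ~ @fO b x).
case.
- by fo_tac.
- rewrite fO_K; apply: contrapT => h; apply: O_proper; apply/seteqP; split=> // x _.
  by apply: contrapT => h'; apply: h; exists x.
by move=> x nx e; apply: nx; rewrite -/MO e.
Qed.

Lemma M_lift : residue_field_lift MO (ext_der X) (ext_small X).
Proof.
have := @transfer _ _ _ _ _ _ X (fun b e => [/\ diff_subfield (@fder _ _ _ _ _ _ X b) (@fk _ _ _ _ _ _ X b),
  forall x, fk (X := X) (b := b) x -> fO x & forall f, fO f ->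
   exists c, [/\ fk c, maximal_ideal (@fO b) (f - c) & forall c', fk c' /\ maximal_ideal (@fO b) (f - c') -> c = c']]).
case.
- by rewrite /diff_subfield; fo_tac.
- have [h1 h2 h3] := k_lift; rewrite fO_K; split=> // f Of.
  by have [c [[kc mc] u]] := h3 f Of; exists c.
move=> h1 h2 h3; split=> // f Of; have [c [kc mc u]] := h3 f Of.
by exists c; split.
Qed.

Lemma M_dhens : diff_henselian MO (ext_der X).
Proof.
have [h1 h2 h3] := K_dhens; split.
- apply: (@transfer _ _ _ _ _ _ X (fun b e => small_derivation (@fO b) (@fder _ _ _ _ _ _ X b))); last by rewrite fO_K.
  rewrite /small_derivation; fo_tac.
- move=> r; apply: (@transfer _ _ _ _ _ _ X (fun b e => forall (a : 'I_r.+1 -> fld b) (c : fld b),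
    (forall i, fO (a i)) -> (exists i, ~ maximal_ideal (@fO b) (a i)) -> fO c ->
    exists2 y, fO y & maximal_ideal (@fO b) (\sum_(i < r.+1) a i * iter i (@fder _ _ _ _ _ _ X b) y - c))).
    apply: fo_alln; apply: fo_all; apply: fo_imp; first by apply: fo_fin => i; fo_tac.
    apply: fo_imp; first by apply: fo_finex => i; fo_tac.
    by fo_tac.
  by rewrite fO_K; exact: h2.
move=> r P hP h0 [j hj].
(* Polynomials cannot be quantified over, but for a fixed support their coefficients form a tuple:
   there is one sentence for each order and support. *)
pose ms := msupp P; pose N := size ms; pose mi (i : 'I_N) := nth 0%MM ms i.
have key := @transfer _ _ _ _ _ _ X (fun b e => forall c : 'I_N -> fld b,
  (forall i, fO (c i)) -> strictly_dominated (@fO b) (\sum_(i < N) c i * (mi i == 0%MM)%:R) 1 ->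
  (exists l : 'I_r.+1, asymp (@fO b) (\sum_(i < N) c i * (mi i == U_(l)%MM)%:R) 1) ->
  exists2 y, strictly_dominated (@fO b) y 1 &
    \sum_(i < N) c i * \prod_(l < r.+1) iter l (@fder _ _ _ _ _ _ X b) y ^+ mi i l = 0).
have cE (R : rcfType) (c : 'I_N -> R) m :
    (\sum_(i < N) c i *: 'X_[mi i] : {mpoly R[r.+1]})@_m = \sum_(i < N) c i * (mi i == m)%:R.
  by rewrite raddf_sum /=; apply: eq_bigr => i _; rewrite mcoeffZ mcoeffX.
have {}key : forall c : 'I_N -> MM,
    (forall i, MO (c i)) -> strictly_dominated MO (\sum_(i < N) c i * (mi i == 0%MM)%:R) 1 ->
    (exists l : 'I_r.+1, asymp MO (\sum_(i < N) c i * (mi i == U_(l)%MM)%:R) 1) ->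
    exists2 y, strictly_dominated MO y 1 &
      \sum_(i < N) c i * \prod_(l < r.+1) iter l (ext_der X) y ^+ mi i l = 0.
  apply: key.
    apply: fo_alln; apply: fo_imp; first by apply: fo_fin => i; fo_tac.
    apply: fo_imp; first by fo_tac.
    apply: fo_imp; first by apply: fo_finex => l; fo_tac.
    by fo_tac.
  rewrite fO_K => c hc c0 [l cl].
  have [|||y y1 hy] := h3 r (\sum_(i < N) c i *: 'X_[mi i]).
  - move=> m; rewrite cE; elim/big_ind: _ => [|x y|i _]; [exact: valring0 | exact: valringD |].
    by case: (_ == _); rewrite ?mulr1 ?mulr0 //; exact: valring0.
  - by rewrite cE.
  - by exists l; rewrite cE.
  exists y => //; rewrite -[RHS]hy raddf_sum /=; apply: eq_bigr => i _.
  by rewrite mevalZ mevalX.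
pose c (i : 'I_N) : MM := P@_(mi i).
have PE : \sum_(i < N) c i *: 'X_[mi i] = P.
  rewrite [RHS]mpolyE (big_nth 0%MM) big_mkord; by apply: eq_bigr.
have [|||y y1 hy] := key c.
- by move=> i; exact: hP.
- by rewrite -cE PE.
- by exists j; rewrite -cE PE.
exists y => //; rewrite -PE raddf_sum /= -[RHS]hy; apply: eq_bigr => i _.
by rewrite mevalZ mevalX.
Qed.
End TransferModel.

(** * Saturation for uniformly definable conditions *)

Section Saturation.
Variables (K : rcfType) (der : K -> K) (O k : set K) (n : nat) (S : set ('I_n -> K)).
Variable X : saturated_extension der O k S.
Local Notation fld := (fld X).
Local Notation fo := (fo (X := X)).
Local Notation fod := (fod (X := X)).
Local Notation M := (ext_field X).

Lemma saturate (V : Type) (p : V -> M) (I : Type) (A : I -> forall b, (option V -> fld b) -> Prop) :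
  range p #<= [set: K] -> (forall i, fo (A i)) ->
  (forall s : seq I, exists x : M, forall i, List.In i s -> A i true (oapp p x)) ->
  exists x : M, forall i, A i true (oapp p x).
Proof.
move=> card hA fin.
have pR v : p v \in range p by apply: mem_set; exists v.
pose g v : set_type (range p) := exist _ (p v) (pR v).
pose L := expand_language pair_language n.
pose phi i : formula L (option V) := sval (cid (hA i)).
have phiP i b e : A i b e <-> holds (M := str X b) e (phi i) by rewrite /phi; case: cid => /= q; apply.
pose F i := frename (phi i) (omap g).
have FP i x : holds (M := str X true) (oapp set_val x) (F i) <-> A i true (oapp p x).
  rewrite /F holds_frename phiP (_ : oapp set_val x \o omap g = oapp p x) //.
  by apply: funext; case.
have [|x hx] := @ext_saturated _ _ _ _ _ _ X (range p) card (range F).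
- move=> G GF fG.
  have [s Gs] : exists s : seq I, forall q, G q -> exists2 i, List.In i s & F i = q.
    have [l lG] := (@finite_seqP {classic (formula L (option (set_type (range p))))} G).1 fG.
    have lF q : q \in l -> exists i, F i = q.
      by move=> ql; have [|i _ e] := GF q; [rewrite lG | exists i].
    have {lF} [s hs] : exists s : seq I, forall q, q \in l -> exists2 i, List.In i s & F i = q.
      elim: l lF {lG} => [|q l IH] lF; first by exists [::].
      have [|s hs] := IH; first by move=> q' h; apply: lF; rewrite in_cons h orbT.
      have [|i ei] := lF q; first by rewrite in_cons eqxx.
      exists (i :: s) => q'; rewrite in_cons => /orP[/eqP ->|/hs[j js ej]]; first by exists i => //; left.
      by exists j => //; right.
    by exists s => q; rewrite lG => /hs.
  have [x hx] := fin s; exists x => q /Gs[i si <-]; apply/FP; exact: hx.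
by exists x => i; apply/FP; apply: hx; exists i.
Qed.

Lemma countable_range (V : countType) (p : V -> M) : range p #<= [set: K].
Proof.
apply: (card_le_trans (card_image_le p setT)).
have inj (T U : Type) (f : T -> U) : injective f -> [set: T] #<= [set: U].
  move=> fi; have /card_eqPle[_ h] : range f #= [set: T] by apply: inj_card_eq => x y _ _; exact: fi.
  exact: card_le_trans h (subset_card_le (@subsetT _ _)).
apply: (@card_le_trans _ _ _ [set: nat]); first exact: (inj _ _ _ (pcan_inj pickleK)).
by apply: (inj _ _ (fun m => m%:R)) => x y /eqP; rewrite eqr_nat => /eqP.
Qed.

Lemma small_positive (V : Type) (p : V -> M) : range p #<= [set: K] ->
  exists2 a : M, 0 < a & forall v, 0 < p v -> a < p v.
Proof.
move=> card; pose A v b (e : option V -> fld b) := 0 < e None /\ (0 < e (Some v) -> e None < e (Some v)).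
have [||x hx] := @saturate V p (option V) (fun o b e => 0 < e None /\
    if o is Some v then 0 < e (Some v) -> e None < e (Some v) else True) card.
- case=> [v|]; [apply: fo_and; last apply: fo_imp; apply: fo_lt; first [exact: fod0 | exact: fod_var]|].
  by apply: fo_and; [apply: fo_lt; [exact: fod0 | exact: fod_var] | exact: fo_const].
- elim=> [|o s [x hx]]; first by exists 0.
  pose y : M := if o is Some v then if 0 < p v then p v else 1 else 1.
  have y0 : 0 < y by rewrite /y; case: (o) => [v|]; rewrite ?ltr01 //; case: ifP => // _; exact: ltr01.
  pose x' : M := if 0 < x then x else 1.
  have x0 : 0 < x' by rewrite /x'; case: ifP => // _; exact: ltr01.
  pose w := x' / (1 + x') * (y / (1 + y)).
  have lt1 (z : M) : 0 < z -> 0 < z / (1 + z) /\ z / (1 + z) < 1 /\ z / (1 + z) < z.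
    move=> z0; have z1 : 0 < 1 + z by rewrite addr_gt0.
    rewrite divr_gt0 // !ltr_pdivrMr // mul1r ltrDr ltr01; split=> //; split=> //.
    by rewrite -{1}[z]mulr1 ltr_pM2l // ltrDl.
  have [a1 [a2 a3]] := lt1 _ x0; have [b1 [b2 b3]] := lt1 _ y0.
  have wx : w < x' by apply: le_lt_trans a3; rewrite /w ler_piMr // ltW.
  have wy : w < y by apply: le_lt_trans b3; rewrite /w ler_piMl // ltW.
  have w0 : 0 < w by rewrite mulr_gt0.
  exists w => i /= [<-|si].
    by split=> //; move: wy; rewrite /y; case: (o) => // v /=; case: ifP.
  have /= [xp hi] := hx i si; split=> //; move: hi; case: i si => // v _ h v0.
  by apply: lt_trans (h v0); move: wx; rewrite /x' xp.
exists x; first by have [] := hx None.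
by move=> v v0; have [_] := hx (Some v); apply.
Qed.
End Saturation.

Section TransferAtoms.
Variables (K : rcfType) (der : K -> K) (O k : set K) (n : nat) (S : set ('I_n -> K)).
Variable X : saturated_extension der O k S.
Local Notation fld := (fld X).
Local Notation fo := (fo (X := X)).
Local Notation fod := (fod (X := X)).

Lemma transfer_iff (A : forall b, (K -> fld b) -> Prop) : fo A -> A false id <-> A true (ext_emb X).
Proof. by move=> h; split; [exact: transfer | move=> a; apply: contrapT => na; exact: (transfer (fo_not h) na)]. Qed.

Definition pst b : structure pair_language := pair_structure (@fder _ _ _ _ _ _ X b) (@fdomi _ _ _ _ _ _ X b) (@fk _ _ _ _ _ _ X b).

Lemma fod_eval V (t : term pair_language V) : fod (fun b e => Defs.eval (M := pst b) e t).
Proof.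
elim: t => [v|[] ts IH] /=.
- exact: fod_var.
- exact: fod0.
- exact: fod1.
- exact: (fod_add (IH ord0) (IH ord_max)).
- exact: (fod_opp (IH ord0)).
- exact: (fod_mul (IH ord0) (IH ord_max)).
- exact: (fod_der (IH ord0)).
Qed.

Lemma fo_holds V (phi : formula pair_language V) : fo (fun b e => holds (M := pst b) e phi).
Proof.
elim: phi => {V} [V|V t u|V [] ts|V p IHp q IHq|V p IH] /=.
- exact: fo_const.
- by apply: fo_eq; exact: fod_eval.
- by apply: fo_le; exact: fod_eval.
- by apply: fo_dom; exact: fod_eval.
- by apply: fo_k; exact: fod_eval.
- exact: fo_imp.
- apply: fo_all; apply: fo_ext IH => b e.
  rewrite (_ : oapp _ _ = e) //; by apply: funext; case.
Qed.

Lemma ext_definable (phi : formula pair_language ('I_n + K)) :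
  S = [set s | holds (M := pair_structure der (dominated O) k)
        (fun v => match v with inl i => s i | inr a => a end) phi] ->
  forall t, ext_set X t <-> holds (M := pst true)
        (fun v => match v with inl i => t i | inr a => ext_emb X a end) phi.
Proof.
move=> e; apply: (@transfer _ _ _ _ _ _ X (fun b e => forall t, fS (X := X) (b := b) t <->
   holds (M := pst b) (fun v => match v with inl i => t i | inr a => e a end) phi)); last first.
  have h (t : 'I_n -> K) : S t <-> holds (M := pair_structure der (dominated O) k)
    (fun v => match v with inl i => t i | inr a => a end) phi by rewrite {1}e.
  exact: h.
apply: fo_alln; apply: fo_iff; first exact: (fo_S0 X (fun i => inl i)).
by apply: fo_ext (fo_holds phi) => b f; rewrite (_ : (fun v => _) = f) //; apply: funext; case.
Qed.

Definition emb : K -> ext_field X := ext_emb X.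
Lemma emb_zmod : zmod_morphism emb.
Proof.
move=> x y; apply: (@transfer _ _ _ _ _ _ X (fun b e => e (x - y) = e x - e y)) => //.
by apply: fo_eq; [|apply: fod_sub]; exact: fod_var.
Qed.
Lemma emb_monoid : monoid_morphism emb.
Proof.
split; first by apply: (@transfer _ _ _ _ _ _ X (fun b e => e 1 = 1)) => //; apply: fo_eq; [exact: fod_var | exact: fod1].
move=> x y; apply: (@transfer _ _ _ _ _ _ X (fun b e => e (x * y) = e x * e y)) => //.
by apply: fo_eq; [|apply: fod_mul]; exact: fod_var.
Qed.
HB.instance Definition _ := GRing.isZmodMorphism.Build _ _ emb emb_zmod.
HB.instance Definition _ := GRing.isMonoidMorphism.Build _ _ emb emb_monoid.

Lemma emb_der x : emb (der x) = ext_der X (emb x).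
Proof.
apply: (@transfer _ _ _ _ _ _ X (fun b e => e (der x) = fder (e x))) => //.
by apply: fo_eq; [|apply: fod_der]; exact: fod_var.
Qed.
Lemma emb_lt x y : (emb x < emb y) = (x < y).
Proof.
apply/idP/idP; have h := @transfer_iff (fun b e => e x < e y) (fo_lt (fod_var X x) (fod_var X y)).
  by move/h.
by move=> a; apply/h.
Qed.
Lemma emb_k x : ext_small X (emb x) <-> k x.
Proof.
have h := @transfer_iff (fun b e => fk (e x)) (fo_k (fod_var X x)).
by split=> /h.
Qed.
Lemma emb_S s : ext_set X (fun i => emb (s i)) <-> S s.
Proof.
have h := @transfer_iff (fun b e => fS (fun i => e (s i))) (fo_S0 X s).
by split=> /h.
Qed.
Lemma emb_MO x : (@MO _ _ _ _ _ _ X) (emb x) <-> @fO _ _ _ _ _ _ X false x.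
Proof.
have h := @transfer_iff (fun b e => fO (e x)) (fo_O (fod_var X x)).
by split=> /h.
Qed.
End TransferAtoms.

(** * Saturation in the form needed for extensions *)

Section SaturatedModel.
Variables (K : rcfType) (der : K -> K) (O k : set K) (n : nat) (S : set ('I_n -> K)).
Variable X : saturated_extension der O k S.
Local Notation fld := (fld X).
Local Notation fo := (fo (X := X)).
Local Notation fod := (fod (X := X)).
Local Notation M := (ext_field X).
Hypothesis K_preH : pre_H_field der O.
Hypothesis K_dhens : diff_henselian O der.

Definition VM : vdf M := model_vdf (M_preH X K_preH) (M_dhens X K_preH K_dhens).
Definition VK : vdf K := model_vdf K_preH K_dhens.

Lemma emb_vembed : vembed VK VM (@emb _ _ _ _ _ _ X).
Proof.
split=> x; first exact: emb_der.
by rewrite /VM /= emb_MO fO_K.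
Qed.

Lemma ext_domP x y : reflect (ext_dom X x y) (dominatedb (vO VM) x y).
Proof. by apply: (iffP (asboolP _)) => /M_dom. Qed.

Lemma fo_domb V t u (c : bool) : fod (V := V) t -> fod (V := V) u ->
  fo (fun b e => if c then fdomi (t b e) (u b e) else ~ fdomi (t b e) (u b e)).
Proof. by move=> ht hu; apply: (@fo_bool _ _ _ _ _ _ X V c (fun b e => fdomi (t b e) (u b e))); exact: fo_dom. Qed.
Lemma dombE x y c : (dominatedb (vO VM) x y = c) <-> if c then ext_dom X x y else ~ ext_dom X x y.
Proof.
by case: c; split; [move/ext_domP | move=> h; exact/ext_domP | move/negbT/ext_domP | move=> h; apply/negbTE/ext_domP].
Qed.

Lemma ext_sat_cut (c g : nat -> M) :
  (forall m, exists x, forall i, (i < m)%N -> dominatedb (vO VM) (x - c i) (g i)) ->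
  exists x, forall i, dominatedb (vO VM) (x - c i) (g i).
Proof.
move=> fin.
pose p (v : nat + nat) := match v with inl i => c i | inr i => g i end.
have [||x hx] := @saturate _ _ _ _ _ _ X _ p nat (fun i b e =>
  fdomi (e None - e (Some (inl i))) (e (Some (inr i)))) (countable_range _).
- by move=> i; apply: fo_dom; [apply: fod_sub|]; exact: fod_var.
- move=> s; have [m hm] : exists m, forall i, List.In i s -> (i < m)%N.
    elim: s => [|i s [m hm]]; first by exists 0%N.
    exists (maxn i.+1 m) => j [<-|/hm h]; first by rewrite leq_max leqnn.
    by rewrite leq_max h orbT.
  by have [x hx] := fin m; exists x => i /hm/hx/ext_domP.
by exists x => i; apply/ext_domP; exact: hx.
Qed.

Fixpoint fzseq b (h : nat -> fld b) x i := if i is i'.+1 then fder (fzseq h x i') / fzseq h x i' - h i' else x.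
Lemma fzseqE (h : nat -> M) x i : zseq VM h x i = fzseq (b := true) h x i.
Proof. by elim: i => //= i ->. Qed.
Lemma fod_fzseq V (h : nat -> V) x i : fod (fun b e => fzseq (fun j => e (h j)) (e x) i).
Proof.
elim: i => [|i IH] /=; first exact: fod_var.
apply: fod_sub; last exact: fod_var.
by apply: fod_mul; [exact: fod_der | exact: fod_inv].
Qed.

Lemma sg_cases (R : realDomainType) (x c : R) : Num.sg x = c <-> [\/ x = 0 /\ c = 0, 0 < x /\ c = 1 | x < 0 /\ c = -1].
Proof.
split=> [<-|[[-> ->]|[x0 ->]|[x0 ->]]]; [|by rewrite sgr0|by rewrite gtr0_sg|by rewrite ltr0_sg].
by case: sgrP => h; [constructor 1 | constructor 2 | constructor 3].
Qed.
Lemma fo_sg V t u : fod (V := V) t -> fod (V := V) u -> fo (fun b e => Num.sg (t b e) = u b e).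
Proof.
move=> ht hu; have z := fod0 X V; have o := fod1 X V.
apply: fo_ext (fo_or (fo_and (fo_eq ht z) (fo_eq hu z)) (fo_or (fo_and (fo_lt z ht) (fo_eq hu o))
  (fo_and (fo_lt ht z) (fo_eq hu (fod_opp o))))) => b e.
by rewrite sg_cases; split=> [[a|[a|a]]|[a|a|a]]; [constructor 1|constructor 2|constructor 3|left|right; left|right; right].
Qed.

Lemma ext_sat_chain (h e s : nat -> M) (be ga : nat -> nat -> bool) :
  (forall m, exists x, forall i j, (i < m)%N -> (j < m)%N ->
    [/\ Num.sg (zseq VM h x i) = s i, dominatedb (vO VM) (zseq VM h x i) (e j) = be i j &
        dominatedb (vO VM) (e j) (zseq VM h x i) = ga i j]) ->
  exists x, forall i j,
    [/\ Num.sg (zseq VM h x i) = s i, dominatedb (vO VM) (zseq VM h x i) (e j) = be i j &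
        dominatedb (vO VM) (e j) (zseq VM h x i) = ga i j].
Proof.
move=> fin.
pose p (v : nat + (nat + nat)) := match v with inl i => h i | inr (inl i) => e i | inr (inr i) => s i end.
pose z b (f : option (nat + (nat + nat)) -> fld b) i := fzseq (fun j => f (Some (inl j))) (f None) i.
have fz i : fod (fun b f => z b f i) by exact: (fod_fzseq (fun j => Some (inl j)) None i).
have [||x hx] := @saturate _ _ _ _ _ _ X _ p (nat * nat)%type (fun i b f =>
  [/\ Num.sg (z b f i.1) = f (Some (inr (inr i.1))),
    if be i.1 i.2 then fdomi (z b f i.1) (f (Some (inr (inl i.2)))) else ~ fdomi (z b f i.1) (f (Some (inr (inl i.2)))) &
    if ga i.1 i.2 then fdomi (f (Some (inr (inl i.2)))) (z b f i.1) else ~ fdomi (f (Some (inr (inl i.2)))) (z b f i.1)])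
   (countable_range _).
- move=> i; apply: fo_and3; first by apply: fo_sg => //; exact: fod_var.
    by apply: fo_domb => //; exact: fod_var.
  by apply: fo_domb => //; exact: fod_var.
- move=> l; have [m hm] : exists m, forall i, List.In i l -> (i.1 < m)%N /\ (i.2 < m)%N.
    elim: l => [|i l [m hm]]; first by exists 0%N.
    exists (maxn (maxn i.1.+1 i.2.+1) m) => j [<-|/hm[h1 h2]]; first by rewrite !leq_max !leqnn orbT.
    by rewrite !leq_max h1 h2 !orbT.
  have [x hx] := fin m; exists x => i /hm[h1 h2]; have [a1 a2 a3] := hx _ _ h1 h2.
  rewrite /z /= -!fzseqE; split=> //; exact/dombE.
exists x => i j; have := hx (i, j); rewrite /z /= -!fzseqE => -[a1 a2 a3].
by split=> //; apply/dombE.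
Qed.

Lemma ext_dom_cvx : convex (vO VM). Proof. by case: (M_preH X K_preH). Qed.
Lemma ext_hgt (x : M) : (forall h, vO VM h -> h < x) -> 0 < VM x.
Proof. by case: (M_preH X K_preH) => _ _ _ h _; exact: h. Qed.
End SaturatedModel.

(** * Countable submodels *)

Section CountableClosure.
Variables (M : rcfType) (V : vdf M) (k : set M).
Local Notation "x ≼ y" := (dominatedb (vO V) x y) (at level 70, y at next level).
Local Notation "x ≺ y" := (~~ dominatedb (vO V) y x) (at level 70, y at next level).
Local Notation d := (vder V).
Let OV := vO_ring V.
Hypothesis modM : submodel V k setT.

Definition dh_index := {n : nat & seq 'X_{1..n.+1}}.
Definition skolem_index := (nat + (dh_index + nat))%type.

Definition list_poly n (ms : seq 'X_{1..n.+1}) (s : seq M) : {mpoly M[n.+1]} :=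
  \sum_(i < size ms) s`_i *: 'X_[nth 0%MM ms i].

(** One Skolem function for each closure condition of [submodel], its arguments packed in a list. As
    the index type is countable, the closure of a sequence is the image of the finite trees with
    labels in [nat]; the degrees of roots are coded by the indices from 7 on. *)
Definition skolem (x0 : M) (j : skolem_index) (s : seq M) : M :=
  match j with
  | inl 0 => s`_0 - s`_1
  | inl 1 => s`_0 / s`_1
  | inl 2 => d s`_0
  | inl 3 => xget 0 [set z | z != 0 /\ logder V z = s`_0]
  | inl 4 => 1
  | inl 5 => x0
  | inl 6 => xget 0 [set c | k c /\ s`_0 - c ≺ 1]
  | inl n => xget 0 [set y | 0 < y /\ y ^+ (n - 7).+1 = s`_0]
  | inr (inl (existT n ms)) => xget 0 [set y | y ≺ 1 /\ (list_poly ms s).@[fun i : 'I_n.+1 => iter i d y] = 0]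
  | inr (inr r) => xget 0 [set y | y ≼ 1 /\ \sum_(i < r.+1) s`_i * iter i d y - s`_r.+1 ≺ 1]
  end.

Lemma countable_submodel (p : nat -> M) : exists M1 : set M, [/\ submodel V k M1, forall i, M1 (p i) &
  exists en : nat -> M, forall x, M1 x -> exists i, en i = x].
Proof.
have [dhM ex rt rs [x0 [_ x00 x01]]] := modM.
pose f (j : nat) s := if unpickle j is Some j' then skolem x0 j' s else 0.
pose fix evt (t : GenTree.tree nat) : M :=
  match t with GenTree.Leaf i => p i | GenTree.Node j ts => f j (map evt ts) end.
pose M1 := range evt.
have cl j s : (forall x, x \in s -> M1 x) -> M1 (skolem x0 j s).
  move=> hs; have [ts ets] : exists ts, map evt ts = s.
    elim: s hs => [|x s IH] hs; first by exists [::].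
    have [|ts e] := IH; first by move=> y ys; apply: hs; rewrite in_cons ys orbT.
    have [|t _ et] := hs x; first by rewrite in_cons eqxx.
    by exists (t :: ts); rewrite /= e et.
  by exists (GenTree.Node (pickle j) ts) => //=; rewrite ets /f pickleK.
have cl1 j x : M1 x -> M1 (skolem x0 j [:: x]) by move=> Mx; apply: cl => y; rewrite mem_seq1 => /eqP ->.
have cl2 j x y : M1 x -> M1 y -> M1 (skolem x0 j [:: x; y]).
  by move=> Mx My; apply: cl => z; rewrite !inE => /orP[] /eqP ->.
have sM1 : diff_subfield d M1.
  split.
  - by have := @cl (inl 4%N) [::]; apply.
  - by move=> x y Mx My; exact: (cl2 (inl 0%N) x y Mx My).
  - by move=> x y Mx My; exact: (cl2 (inl 1%N) x y Mx My).
  - by move=> x Mx; exact: (cl1 (inl 2%N) x Mx).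
exists M1; split; last first.
- exists (fun m => if unpickle m is Some t then evt t else 0) => x [t _ <-].
  by exists (pickle t); rewrite pickleK.
- by move=> i; exists (GenTree.Leaf i).
split.
- split=> //.
  + move=> n P PM hP h0 hi.
    have [y [_ y1 yP]] := dhs_dh dhM (fun m => I : setT P@_m) hP h0 hi.
    pose s := [seq P@_m | m <- msupp P].
    have PE : list_poly (msupp P) s = P.
      rewrite /list_poly [RHS]mpolyE (big_nth 0%MM) big_mkord; apply: eq_bigr => i _.
      by rewrite (nth_map 0%MM).
    have h := @xgetPex _ 0 [set y | y ≺ 1 /\ (list_poly (msupp P) s).@[fun i : 'I_n.+1 => iter i d y] = 0].
    have [|z1 zP] := h; first by exists y; rewrite /= PE.
    exists (skolem x0 (inr (inl (existT _ n (msupp P)))) s); split=> //.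
      by apply: cl => x /mapP[m _ ->]; exact: PM.
    by move: zP; set z := xget _ _; rewrite PE.
  + move=> r a b aM bM ha hi hb.
    have [y [_ y1 yP]] := dhs_lin dhM (fun i => I : setT (a i)) (I : setT b) ha hi hb.
    pose s := mkseq (fun i => if (i < r.+1)%N then a (inord i) else b) r.+2.
    have sE (z : M) : \sum_(i < r.+1) s`_i * iter i d z - s`_r.+1 = \sum_(i < r.+1) a i * iter i d z - b.
      rewrite [in X in _ - X]/s nth_mkseq // ltnn; congr (_ - _); apply: eq_bigr => i _.
      by rewrite /s nth_mkseq; [rewrite ltn_ord inord_val | rewrite ltnW // ltnS ltn_ord].
    have h := @xgetPex _ 0 [set y | y ≼ 1 /\ \sum_(i < r.+1) s`_i * iter i d y - s`_r.+1 ≺ 1].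
    have [|z1 zP] := h; first by exists y; rewrite /= sE.
    exists (skolem x0 (inr (inr r)) s); split=> //; last by move: zP; rewrite sE.
    by apply: cl => x /mapP[i _ ->]; case: ifP.
- move=> x Mx; have [z [_ z0 zx]] := ex x I.
  have [|w0 wx] := @xgetPex _ 0 [set z | z != 0 /\ logder V z = [:: x]`_0]; first by exists z.
  by exists (skolem x0 (inl 3) [:: x]); split=> //; exact: cl1.
- move=> x [//|n] Mx xp _; have [y [_ y0 yx]] := rt x n.+1 I xp isT.
  have [|w0 wx] := @xgetPex _ 0 [set y | 0 < y /\ y ^+ (7 + n - 7).+1 = [:: x]`_0].
    by exists y; rewrite /= addKn.
  exists (skolem x0 (inl (7 + n)%N) [:: x]); split=> //; first exact: cl1.
  by move: wx; rewrite /= addKn.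
- move=> x Mx x1; have [c [kc _ cx]] := rs x I x1.
  have [|w0 wx] := @xgetPex _ 0 [set c | k c /\ [:: x]`_0 - c ≺ 1]; first by exists c.
  by exists (skolem x0 (inl 6) [:: x]); split=> //; exact: cl1.
- by exists x0; split=> //; have := @cl (inl 5%N) [::]; apply.
Qed.
End CountableClosure.

(** * Back-and-forth *)

Section Support.
Variable L : language.
(** Only finitely many parameters occur in a formula, and a partial isomorphism with countable
    domain can be asked to respect only those. *)
Fixpoint tsupp (W : Type) (t : term L W) (v : W) : Prop :=
  match t with Var w => w = v | App f ts => exists i, tsupp (ts i) v end.
Fixpoint fsupp (W : Type) (phi : formula L W) : W -> Prop :=
  match phi with
  | Fal => fun _ => False
  | Eq t u => fun v => tsupp t v \/ tsupp u v
  | Rel r ts => fun v => exists i, tsupp (ts i) v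
  | Imp p q => fun v => fsupp p v \/ fsupp q v
  | All p => fun v => fsupp p (Some v)
  end.

Lemma finite_union_list (W : Type) m (Q : 'I_m -> W -> Prop) :
  (forall i, exists l : seq W, forall v, Q i v -> List.In v l) ->
  exists l : seq W, forall v, (exists i, Q i v) -> List.In v l.
Proof.
move=> h; pose l i := sval (cid (h i)).
have lP i v : Q i v -> List.In v (l i) by rewrite /l; case: cid => /= x; apply.
exists (flatten [seq l i | i <- enum 'I_m]) => v [i /lP vi].
have : i \in enum 'I_m by rewrite mem_enum.
elim: (enum 'I_m) => // j s IH; rewrite in_cons /= => /orP[/eqP <-|/IH h'].
  by apply/List.in_or_app; left.
by apply/List.in_or_app; right.
Qed.

Lemma tsupp_finite (W : Type) (t : term L W) : exists l : seq W, forall v, tsupp t v -> List.In v l.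
Proof.
elim: t => [w|f ts IH] /=; first by exists [:: w] => v ->; left.
exact: finite_union_list.
Qed.

Lemma fsupp_finite (W : Type) (phi : formula L W) : exists l : seq W, forall v, fsupp phi v -> List.In v l.
Proof.
have or2 U (A B : U -> Prop) : (exists l : seq U, forall v, A v -> List.In v l) ->
    (exists l : seq U, forall v, B v -> List.In v l) -> exists l : seq U, forall v, A v \/ B v -> List.In v l.
  move=> [l hl] [l' hl']; exists (l ++ l') => v [/hl|/hl'] h; apply/List.in_or_app; by [left | right].
elim: phi => {W} [W|W t u|W r ts|W p IHp q IHq|W p [l IH]] /=.
- by exists [::].
- by apply: or2; exact: tsupp_finite.
- by apply: finite_union_list => i; exact: tsupp_finite.
- exact: or2.
- exists (pmap id l) => v /IH; elim: (l) => //= -[w|] l' h [] //=.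
  + by move=> [->]; left.
  + by move=> /h; right.
Qed.
End Support.

Section BackForth.
Variables (M : rcfType) (V : vdf M) (k : set M) (dom : M -> M -> Prop).
Local Notation "x ≼ y" := (dominatedb (vO V) x y) (at level 70, y at next level).
Local Notation "x ≺ y" := (~~ dominatedb (vO V) y x) (at level 70, y at next level).
Local Notation d := (vder V).
Let OV := vO_ring V.
Implicit Types (x y : M) (G : set (M * M)).
Hypothesis domE : forall x y, dom x y <-> x ≼ y.
Hypothesis cvx : convex (vO V).
Hypothesis hgt : forall x, (forall h, vO V h -> h < x) -> 0 < d x.
Hypothesis sat_cut : forall c g : nat -> M,
  (forall n, exists x, forall i, (i < n)%N -> x - c i ≼ g i) -> exists x, forall i, x - c i ≼ g i.
Hypothesis sat_chain : forall (h e s : nat -> M) (be ga : nat -> nat -> bool),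
  (forall n, exists x, forall i j, (i < n)%N -> (j < n)%N ->
    [/\ Num.sg (zseq V h x i) = s i, (zseq V h x i ≼ e j) = be i j & (e j ≼ zseq V h x i) = ga i j]) ->
  exists x, forall i j,
    [/\ Num.sg (zseq V h x i) = s i, (zseq V h x i ≼ e j) = be i j & (e j ≼ zseq V h x i) = ga i j].
Hypothesis modM : submodel V k setT.
Hypothesis sk : diff_subfield d k.
Hypothesis kO : forall c, k c -> c ≼ 1.
Hypothesis kuniq : forall c c', k c -> k c' -> c - c' ≺ 1 -> c = c'.

(** Fixed representatives of the residues make [k] preserved ([bf_k]), and with countability they
    are what allows the extension step to be repeated. *)
Record bf G : Prop := Bf {
  bf_iso : piso V G;
  bf_res : res_lifted V k G;
  bf_enum : exists en : nat -> M, forall x y, G (x, y) -> exists i, en i = x }.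

Lemma bf_forth G w : bf G -> exists G', [/\ bf G', G `<=` G' & exists w', G' (w, w')].
Proof.
move=> [iG rG [en hen]].
have [M1 [mM1 M1p [en1 hen1]]] := countable_submodel modM (fun i => if i is i'.+1 then en i' else w).
have dG x y : G (x, y) -> M1 x by move=> /hen[i <-]; exact: (M1p i.+1).
have ce : exists en : nat -> M, forall x, M1 x -> exists i, en i = x by exists en1.
have [G' [iG' GG' tG' kG' dG']] :=
  extend_total cvx hgt sat_cut sat_chain modM mM1 ce sk kO iG rG dG.
exists G'; split=> //; last exact: (tG' w (M1p 0%N)).
split=> //; last by exists en1 => x y /dG'/hen1.
move=> x y /dG' Mx x1; have [c [kc Mc xc]] := sm_res mM1 Mx x1.
by exists c; split=> //; exact: kG'.
Qed.

Lemma bf_sym G : bf G -> bf [set p | G (p.2, p.1)].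
Proof.
move=> [iG rG [en hen]]; split; first exact: piso_sym.
  move=> y x /= h y1; have x1 : x ≼ 1 by rewrite (piso_O iG h).
  have [c [kc Gc xc]] := rG _ _ h x1; exists c; split=> //.
  by rewrite -(piso_dom iG (piso1 iG) (pisoB iG h Gc)).
exists (fun i => xget 0 [set y | G (en i, y)]) => y x /= h; have [i ei] := hen _ _ h.
have : [set y | G (en i, y)] (xget 0 [set y | G (en i, y)]) by apply: xgetPex; exists y; rewrite /= ei.
rewrite {1}ei => h'; exists i; exact: (piso_fun iG h' h).
Qed.

Lemma bf_back G w' : bf G -> exists G', [/\ bf G', G `<=` G' & exists w, G' (w, w')].
Proof.
move=> /bf_sym/(bf_forth w')[G' [h GG' [w hw]]]; exists [set p | G' (p.2, p.1)].
by split; [exact: bf_sym | move=> [x y] hxy; exact: GG' | exists w].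
Qed.

Lemma bf_k G x y : bf G -> G (x, y) -> k x -> k y.
Proof.
move=> [iG rG _] h kx; have [c [kc Gc xc]] := rG _ _ h (kO kx).
have e := kuniq kx kc xc; rewrite e in h.
by rewrite (piso_fun iG h Gc).
Qed.

Lemma bf_le G x y x' y' : bf G -> G (x, y) -> G (x', y') -> (x <= x') = (y <= y').
Proof.
move=> [iG _ _] h h'; rewrite -subr_ge0 -sgr_ge0 (piso_sg iG (pisoB iG h' h)).
by rewrite sgr_ge0 subr_ge0.
Qed.

Local Notation N := (pair_structure d dom k).

Lemma bf_eval G W (t : term pair_language W) (e e' : W -> M) : bf G ->
  (forall v, tsupp t v -> G (e v, e' v)) -> G (Defs.eval (M := N) e t, Defs.eval (M := N) e' t).
Proof.
move=> [iG _ _]; elim: t => [v|f ts IH] h /=; first exact: h.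
have {}IH i : G (Defs.eval (M := N) e (ts i), Defs.eval (M := N) e' (ts i)).
  by apply: IH => v hv; apply: h; exists i.
case: f ts IH {h} => ts IH /=.
- by have := pisoB iG (piso1 iG) (piso1 iG); rewrite subrr.
- exact: (piso1 iG).
- exact: (pisoD iG (IH ord0) (IH ord_max)).
- exact: (pisoN iG (IH ord0)).
- exact: (pisoM iG (IH ord0) (IH ord_max)).
- exact: (piso_der iG (IH ord0)).
Qed.

Theorem bf_elementary W (phi : formula pair_language W) G (e e' : W -> M) : bf G ->
  (forall v, fsupp phi v -> G (e v, e' v)) -> holds (M := N) e phi <-> holds (M := N) e' phi.
Proof.
elim: phi G e e' => {W} [W|W t u|W r ts|W p IHp q IHq|W p IH] G e e' hG h //=.
- have iG := bf_iso hG.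
  have ht := bf_eval hG (fun v a => h v (or_introl a)); have hu := bf_eval hG (fun v a => h v (or_intror a)).
  by split=> E; [apply: (piso_fun iG ht); rewrite E | apply: (piso_inj iG ht); rewrite E].
- have iG := bf_iso hG.
  have ht i := @bf_eval G W (ts i) e e' hG (fun v a => h v (ex_intro _ i a)).
  case: r ts ht {h} => ts ht /=.
  + by rewrite (bf_le hG (ht ord0) (ht ord_max)).
  + by rewrite !domE (piso_dom iG (ht ord0) (ht ord_max)).
  + by split=> hk; [exact: (bf_k hG (ht ord0)) | exact: (bf_k (bf_sym hG) (ht ord0 : [set p | G (p.2, p.1)] (_, _)))].
- rewrite (IHp G e e' hG) ?(IHq G e e' hG) // => v hv; apply: h; by [left | right].
- split=> H x.
  + have [G' [hG' GG' [w hw]]] := bf_back x hG.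
    apply/(IH G' (oapp e w) (oapp e' x) hG'); last exact: H.
    by case=> [v|] //= hv; apply: GG'; exact: h.
  + have [G' [hG' GG' [w hw]]] := bf_forth x hG.
    apply/(IH G' (oapp e x) (oapp e' w) hG'); last exact: H.
    by case=> [v|] //= hv; apply: GG'; exact: h.
Qed.
End BackForth.

(** * Differentially algebraic elements *)

Section Counting.
Variables (E M : fieldType) (f : {rmorphism E -> M}).

Lemma wle_bound (n : nat) (w : 'I_n -> nat) (P : {mpoly E[n]}) : exists e, wle w e P.
Proof.
exists (\sum_(m <- msupp P) wdeg w m)%N => m mP.
by rewrite (bigD1_seq m) ?msupp_uniq //= leq_addr.
Qed.

Lemma wle_exp (n : nat) (w : 'I_n -> nat) (P : {mpoly E[n]}) e k : wle w e P -> wle w (k * e) (P ^+ k).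
Proof.
move=> h; elim: k => [|k IH]; first by rewrite expr0 mul0n; exact: wleC.
by rewrite exprS mulSn; apply: wleM.
Qed.

Lemma wle_prod (n : nat) (w : 'I_n -> nat) (I : finType) (P : I -> {mpoly E[n]}) e :
  (forall i, wle w e (P i)) -> wle w (#|I| * e) (\prod_i P i).
Proof.
move=> h; rewrite cardE -[\prod_i _]big_enum; elim: (enum I) => [|i s IH].
  by rewrite big_nil; exact: wleC.
by rewrite big_cons mulSn; apply: wleM.
Qed.

(* there are more monomials of degree < D in each of the R+1 quotients than monomials in the R
   variables that occur in their numerators *)
Lemma alg_dependent R (x : nat -> M) (P : 'I_R.+1 -> {mpoly E[R]}) (Q : {mpoly E[R]}) :
  ev f Q x != 0 -> exists G : {mpoly E[R.+1]}, G != 0 /\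
    forall b : nat -> M, (forall i : 'I_R.+1, b i = ev f (P i) x / ev f Q x) -> ev f G b = 0.
Proof.
move=> q0; pose w := fun _ : 'I_R => 1%N.
have [de [hP hQ]] : exists de, (forall i, wle w de (P i)) /\ wle w de Q.
  have [e0 h0] := wle_bound w Q.
  pose e i := sval (cid (wle_bound w (P i))).
  have eP i : wle w (e i) (P i) by rewrite /e; case: cid.
  exists (e0 + \sum_i e i)%N; split=> [i|]; last by apply: wleS h0; rewrite leq_addr.
  by apply: wleS (eP i); rewrite (bigD1 i) //= addnCA leq_addr.
(* As [D > c ^ R], the number [D ^ R.+1] of products [T] exceeds the number [(D * c) ^ R] of
   monomials with all exponents below [B]. *)
pose c := (R.+1 * de).+1; pose D := (c ^ R).+1; pose B := (D * c)%N.
pose I := {ffun 'I_R.+1 -> 'I_D}; pose J := {ffun 'I_R -> 'I_B}.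
have cIJ : (#|J| < #|I|)%N.
  rewrite /I /J !card_ffun !card_ord /B expnMn expnS mulnC ltn_pmul2r ?expn_gt0 //.
(* The powers of [Q] bring all monomials in the quotients to a common denominator. *)
pose T (m : I) := \prod_(l < R.+1) (P l ^+ m l * Q ^+ (D - m l)).
have hT m : wle w (R.+1 * (D * de)) (T m).
  have := @wle_prod _ w _ (fun l => P l ^+ m l * Q ^+ (D - m l)) (D * de)%N; rewrite card_ord; apply=> l.
  have -> : (D * de = m l * de + (D - m l) * de)%N by rewrite -mulnDl subnKC // ltnW.
  by apply: wleM; exact: wle_exp.
have dB : (R.+1 * (D * de) < B)%N by rewrite /B /c mulnS mulnCA -[X in (X < _)%N]add0n ltn_add2r.
pose mJ (j : J) : 'X_{1..R} := [multinom (j l : nat) | l < R].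
pose mI (i : I) : 'X_{1..R.+1} := [multinom (i l : nat) | l < R.+1].
pose A : 'M[E]_(#|I|, #|J|) := \matrix_(i, j) (T (enum_val i))@_(mJ (enum_val j)).
have : kermx A != 0.
  rewrite -mxrank_eq0 mxrank_ker -lt0n subn_gt0; exact: leq_ltn_trans (rank_leq_col A) cIJ.
move=> /rowV0Pn[u /sub_kermxP uA u0].
have uT : \sum_i u 0 i *: T (enum_val i) = 0.
  apply/mpolyP => m; rewrite mcoeff0 raddf_sum /=.
  case: (pselect (forall l, m l < B)%N) => hm.
    pose j : J := [ffun l => Ordinal (hm l)].
    have ej : mJ j = m by apply/mnmP => l; rewrite mnmE ffunE.
    have := congr1 (fun Z : 'rV_#|J| => Z 0 (enum_rank j)) uA; rewrite !mxE => h.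
    rewrite -[RHS]h; apply: eq_bigr => i _; by rewrite mcoeffZ mxE enum_rankK ej.
  apply: big1 => i _; rewrite mcoeffZ.
  have [l hl] : exists l, (B <= m l)%N.
    by apply: contrapT => h; apply: hm => l; rewrite ltnNge; apply/negP => h'; apply: h; exists l.
  have [mT|mT] := boolP (m \in msupp (T (enum_val i))); last by rewrite (memN_msupp_eq0 mT) mulr0.
  have := hT _ _ mT; rewrite leqNgt; case/negP; apply: leq_trans dB _; apply: leq_trans hl _.
  by rewrite /wdeg (bigD1 l) //= mul1n leq_addr.
pose G : {mpoly E[R.+1]} := \sum_i u 0 i *: 'X_[mI (enum_val i)].
exists G; split.
  have [i0 hi0] : exists i, u 0 i != 0.
    apply: contrapT => h; move/eqP: u0; apply; apply/rowP => i; rewrite mxE; apply/eqP.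
    by apply: contrapT => /negP h'; apply: h; exists i.
  apply/eqP => /(congr1 (fun Z : {mpoly E[R.+1]} => Z@_(mI (enum_val i0)))).
  rewrite mcoeff0 raddf_sum /= (bigD1 i0) //= big1 => [|i ii].
    by rewrite mcoeffZ mcoeffX eqxx mulr1 addr0 => /eqP; rewrite (negPf hi0).
  rewrite mcoeffZ mcoeffX; case: eqP => [e|]; last by rewrite mulr0.
  case/eqP: ii; apply: enum_val_inj; apply/ffunP => l; apply/val_inj.
  by have := congr1 (fun m : 'X_{1..R.+1} => m l) e; rewrite !mnmE.
move=> b hb; set q := ev f Q x in q0 hb.
have qD : \prod_(l < R.+1) q ^+ D != 0 by apply/prodf_neq0 => l _; exact: expf_neq0.
apply: (mulIf qD); rewrite mul0r -(ev0 f R x) -uT !ev_sum mulr_suml; apply: eq_bigr => i _.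
rewrite !evZ -mulrA; congr (_ * _).
rewrite /ev map_mpolyX mevalX -/(ev f _ x) /T ev_prod -big_split /=; apply: eq_bigr => l _.
rewrite mnmE hb evM !evXn -/q expr_div_n -mulrA; congr (_ * _).
have lD : (enum_val i l <= D)%N by rewrite ltnW.
have key (j D0 : nat) : (j <= D0)%N -> q ^- j * q ^+ D0 = q ^+ (D0 - j).
  by move=> jD; rewrite -{1}(subnK jD) exprD mulrCA mulVf ?mulr1 // expf_neq0.
exact: key.
Qed.
End Counting.

Section Generated.
Variables (F : fieldType) (d : F -> F).
Implicit Types A B : set F.

Lemma dgen_sub A : diff_subfield d (diff_generated d A).
Proof.
split=> [|x y hx hy|x y hx hy|x hx] B [sB AB].
- exact: (dsub1 sB).
- by apply: (dsubB sB); [exact: hx | exact: hy].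
- by apply: (dsub_div sB); [exact: hx | exact: hy].
- by apply: (dsub_der sB); exact: hx.
Qed.
Lemma dgen_incl A : A `<=` diff_generated d A.
Proof. by move=> x Ax B [_ AB]; exact: AB. Qed.
Lemma dgen_min A B : diff_subfield d B -> A `<=` B -> diff_generated d A `<=` B.
Proof. by move=> sB AB x; apply. Qed.
Lemma dgen_mono A B : A `<=` B -> diff_generated d A `<=` diff_generated d B.
Proof. by move=> AB; apply: dgen_min; [exact: dgen_sub | move=> x /AB; exact: dgen_incl]. Qed.
End Generated.

Section DiffAlgebraic.
Variables (M : rcfType) (V : vdf M).
Local Notation d := (vder V).
Implicit Types x y z : M.

(* For the zero derivation, [diff_generated] is the generated field. *)
Definition sgen (A : set M) (xs : seq M) : set M :=
  diff_generated (fun _ : M => 0) (A `|` [set` xs]).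

Lemma sgen_sub A xs : diff_subfield (fun=> 0) (sgen A xs). Proof. exact: dgen_sub. Qed.
Lemma sgen_base A xs : A `<=` sgen A xs. Proof. by move=> x Ax; apply: dgen_incl; left. Qed.
Lemma sgen_mem A (xs : seq M) x : x \in xs -> sgen A xs x. Proof. by move=> h; apply: dgen_incl; right. Qed.
Lemma sgen_mono A xs ys : {subset xs <= ys} -> sgen A xs `<=` sgen A ys.
Proof. by move=> h; apply: dgen_mono => x [Ax|/h hx]; [left | right]. Qed.

Variables (A : set M) (sA : diff_subfield d A).
Variables (E : fieldType) (VE : vdf E) (f : {rmorphism E -> M}).
Hypothesis fV : vembed VE V f.
Hypothesis fA : forall e, A (f e).
Hypothesis fS : forall x, A x -> exists e, f e = x.

Lemma sgen_der xs : (forall x, x \in xs -> sgen A xs (d x)) -> diff_subfield d (sgen A xs).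
Proof.
move=> hx; have s := sgen_sub A xs; split; first exact: (dsub1 s).
- exact: (dsubB s).
- exact: (dsub_div s).
move=> y; pose B := [set y | sgen A xs y /\ sgen A xs (d y)].
suff : sgen A xs `<=` B by move=> h /h[].
apply: dgen_min.
  split.
  - by split; [exact: (dsub1 s) | rewrite der1; exact: (dsub0 s)].
  - by move=> u v [u1 u2] [v1 v2]; split; [exact: (dsubB s) | rewrite derB; exact: (dsubB s)].
  - move=> u v [u1 u2] [v1 v2]; split; first exact: (dsub_div s).
    have [->|v0] := eqVneq v 0; first by rewrite invr0 mulr0 der0; exact: (dsub0 s).
    rewrite derM derV //; apply: (dsubD s); first exact: (dsub_div s).
    by apply: (dsubM s) => //; apply: (dsub_div s); [exact: (dsubN s) | exact: (dsubX s)].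
  - by move=> u _; split; [exact: (dsub0 s) | rewrite der0; exact: (dsub0 s)].
move=> u [Au|ux]; split; first exact: sgen_base.
- by apply: sgen_base; exact: (dsub_der sA).
- exact: sgen_mem.
- exact: hx.
Qed.

Lemma sgen_frac (xs : seq M) y : sgen A xs y -> exists P Q : {mpoly E[size xs]},
  ev f Q (nth 0 xs) != 0 /\ y = ev f P (nth 0 xs) / ev f Q (nth 0 xs).
Proof.
pose B := [set y | exists P Q : {mpoly E[size xs]},
  ev f Q (nth 0 xs) != 0 /\ y = ev f P (nth 0 xs) / ev f Q (nth 0 xs)].
have Bp (P : {mpoly E[size xs]}) : B (ev f P (nth 0 xs)).
  by exists P, 1; rewrite ev1 oner_eq0 divr1.
suff : sgen A xs `<=` B by apply.
have B0 : B 0 by have := Bp 0; rewrite ev0.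
have quot (a b c e : M) : b != 0 -> c != 0 -> b * c != 0 /\ a / b / (c / e) = a * e / (b * c).
  by move=> b0 c0; rewrite frac_div mulf_neq0.
apply: dgen_min.
  split=> //; first by have := Bp 1; rewrite ev1.
  - move=> _ _ [P [Q [q0 ->]]] [P' [Q' [q0' ->]]].
    exists (P * Q' - P' * Q), (Q * Q'); rewrite evB !evM mulf_neq0 //; split=> //.
    by rewrite frac_sub.
  - move=> _ _ [P [Q [q0 ->]]] [P' [Q' [q0' ->]]].
    have [->|p0] := eqVneq (ev f P' (nth 0 xs)) 0; first by rewrite mul0r invr0 mulr0.
    exists (P * Q'), (Q * P'); rewrite (evM f P Q') (evM f Q P').
    exact: quot.
move=> u [Au|/(nthP 0)[i ix <-]].
  by have [e <-] := fS Au; have := Bp e%:MP; rewrite evC.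
by have := Bp 'X_(Ordinal ix); rewrite evX.
Qed.

Lemma sgen_dependent (xs : seq M) : exists R, forall y : nat -> M, (forall i, sgen A xs (y i)) ->
  exists G : {mpoly E[R]}, G != 0 /\ ev f G y = 0.
Proof.
exists (size xs).+1 => y hy; set x := nth 0 xs.
pose P (i : 'I_(size xs).+1) := sval (cid (sgen_frac (hy i))).
pose Q (i : 'I_(size xs).+1) := sval (cid (svalP (cid (sgen_frac (hy i))))).
have PQ (i : 'I_(size xs).+1) : ev f (Q i) x != 0 /\ y i = ev f (P i) x / ev f (Q i) x.
  by rewrite /P /Q; case: (cid _) => p h /=; case: (cid _).
clearbody P Q.
pose Q0 := \prod_i Q i; pose P0 i := P i * \prod_(j | j != i) Q j.
have q0 : ev f Q0 x != 0 by rewrite ev_prod; apply/prodf_neq0 => i _; case: (PQ i).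
have [G [G0 hG]] := @alg_dependent E M f (size xs) x P0 Q0 q0; exists G; split=> //; apply: hG => i.
have h0 : ev f (\prod_(j | j != i) Q j) x != 0 by rewrite ev_prod; apply/prodf_neq0 => j _; case: (PQ j).
have [qi ->] := PQ i; rewrite /P0 /Q0 (bigD1 i isT) (evM f (P i)) (evM f (Q i)).
by rewrite -mulf_div (divff h0) mulr1.
Qed.

Lemma dalg_lift y : diff_algebraic d A y -> exists n (P : {mpoly E[n]}),
  P != 0 /\ ev f P (fun i => iter i d y) = 0.
Proof.
move=> [n [P [P0 hP Py]]].
pose l m := sval (cid (fS (hP m))).
have lP m : f (l m) = P@_m by rewrite /l; case: cid.
pose P' : {mpoly E[n]} := \sum_(m <- msupp P) l m *: 'X_[m].
have e : map_mpoly f P' = P.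
  rewrite [RHS]mpolyE /P' rmorph_sum /=; apply: eq_bigr => m _.
  apply/mpolyP => m'; rewrite mcoeff_map_mpoly !mcoeffZ !mcoeffX.
  have h (c : nat) : f (l m * c%:R) = P@_m * c%:R by rewrite rmorphM lP rmorph_nat.
  exact: h.
exists n, P'; rewrite /ev e; split=> //; apply/eqP => z; apply: P0; by rewrite -e z rmorph0.
Qed.

Lemma dalg_of n (P : {mpoly E[n]}) y : P != 0 -> ev f P (fun i => iter i d y) = 0 -> diff_algebraic d A y.
Proof.
move=> P0 Py; exists n, (map_mpoly f P); split=> //; last first.
  by move=> m; rewrite mcoeff_map_mpoly; exact: fA.
move=> h; move/eqP: P0; apply; apply/mpolyP => m; apply: (fmorph_inj f).
by have := congr1 (fun Q : {mpoly M[n]} => Q@_m) h; rewrite /= mcoeff_map_mpoly !mcoeff0 rmorph0.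
Qed.

(* by minimality the separant does not vanish, so the next derivative is a rational function *)
Lemma dalg_generators y : diff_algebraic d A y ->
  exists xs, sgen A xs y /\ forall x, x \in xs -> sgen A xs (d x).
Proof.
move=> /dalg_lift[n [P0 [P00 P0y]]]; pose b i := iter i d y.
have [||r [dd [D [P [[[P1 Py] aP bP _] mind _]]]]] := @minimal_bad_exists n E
    (fun P => P != 0 /\ ev f P b = 0); first by exists P0.
  move=> P [P1 Py] /wle_const e; move: P1 Py; rewrite e evC => h /eqP.
  by rewrite fmorph_eq0 => /eqP h'; move: h; rewrite h' mpolyC0 eqxx.
pose xs := mkseq b r.+1; have s := sgen_sub A xs.
have bx i : (i <= r)%N -> sgen A xs (b i).
  by move=> ir; apply: sgen_mem; apply/(nthP 0); exists i; rewrite ?size_mkseq ?nth_mkseq.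
have evs (Q : {mpoly E[n]}) : wle (above r) 0 Q -> sgen A xs (ev f Q b).
  move=> aQ; rewrite (@ev_vars _ _ f n r Q b (fun i => if (i <= r)%N then b i else 0)) => [|//|i ->//].
  rewrite evE; apply: (dsub_sum s) => m _; apply: (dsubM s); first by apply: sgen_base; exact: fA.
  by apply: (dsub_prod s) => i _; apply: (dsubX s); case: ifP => ir; [exact: bx | exact: (dsub0 s)].
exists xs; split; first exact: (bx 0%N).
move=> x /(nthP 0)[i]; rewrite size_mkseq ltnS => ir <-; rewrite nth_mkseq //.
move: ir; rewrite leq_eqVlt => /orP[/eqP ->|ir]; last exact: (bx i.+1).
have aS : wle (above r) 0 P^`M(r) by have := wle_deriv (i := r) aP; rewrite sub0n.
have bS : wle (atleast r) dd P^`M(r) by have := wle_deriv (i := r) bP; rewrite /atleast leqnn subn1.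
have S0 : P^`M(r) != 0.
  apply/eqP => e; have h := deriv_eq0_vars VE aP e.
  by apply: (mind P (conj P1 Py) aP); exact: wleS h.
have Sy : ev f P^`M(r) b != 0 by apply/eqP => e; exact: (mind _ (conj S0 e) aS bS).
have := der_ev P b fV; rewrite Py der0 (bigD1 r) //= addrCA => /esym/eqP.
rewrite addr_eq0 => /eqP e.
have -> : d (b r) = ev f P^`M(r) b * d (b r) / ev f P^`M(r) b by rewrite mulrAC divff // mul1r.
rewrite e; apply: (dsub_div s); last exact: evs.
apply: (dsubN s); apply: (dsubD s).
  apply: evs => m mP; apply: aP; move: mP; rewrite !mcoeff_msupp mcoeff_pder.
  by apply: contra => /eqP ->; rewrite der0.
apply: (dsub_sum s) => j jr; case: (ltnP j r) => h.
  apply: (dsubM s); last exact: (bx j.+1).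
  by apply: evs; have := wle_deriv (i := j) aP; rewrite sub0n.
rewrite (@wle_deriv0 _ _ (above r) j P) ?ev0 ?mul0r //; first exact: (dsub0 s).
by rewrite /above lt0b ltn_neqAle h andbT eq_sym.
Qed.

Lemma dalg_tower n (s : 'I_n -> M) : (forall i, diff_algebraic d A (s i)) ->
  exists (T : set M) R, [/\ diff_subfield d T, A `<=` T, forall i, T (s i) &
    forall y : nat -> M, (forall i, T (y i)) -> exists G : {mpoly E[R]}, G != 0 /\ ev f G y = 0].
Proof.
move=> hs; pose xi i := sval (cid (dalg_generators (hs i))).
have xP i : sgen A (xi i) (s i) /\ forall x, x \in xi i -> sgen A (xi i) (d x) by rewrite /xi; case: cid.
pose xs := flatten [seq xi i | i <- enum 'I_n].
have sub i : {subset xi i <= xs}.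
  by move=> x h; apply/flattenP; exists (xi i) => //; apply: map_f; rewrite mem_enum.
have [R hR] := sgen_dependent xs; exists (sgen A xs), R; split=> //.
- apply: sgen_der => x /flattenP[_ /mapP[i _ ->] xx].
  by apply: (sgen_mono (sub i)); case: (xP i) => _; apply.
- exact: sgen_base.
- by move=> i; apply: (sgen_mono (sub i)); case: (xP i).
Qed.
End DiffAlgebraic.

(** All derivatives of [y] lie in one field of finite transcendence degree, so enough of them are
    algebraically dependent. *)
Lemma dalg_closed (M : rcfType) (V : vdf M) (A : set M) n (s : 'I_n -> M) y : diff_subfield V A ->
  (forall i, diff_algebraic V A (s i)) ->
  diff_generated V (A `|` range s) y -> diff_algebraic V A y.
Proof.
move=> sA hs hy; have [T [R [sT AT Ts hT]]] := dalg_tower sA (ds_vembed sA) (@ds_injP _ _ _ sA) (@ds_lift _ _ _ sA) hs.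
have Ty : T y by apply: (dgen_min sT) hy => x [/AT //|[i _ <-]].
have [|G [G0 Gy]] := hT (fun i => iter i V y); first by move=> i; exact: (dsub_iter sT).
exact: (dalg_of (@ds_injP _ _ _ sA) G0 Gy).
Qed.

(** * Differential transcendence bases *)

Section Bases.
Variables (M : rcfType) (V : vdf M).
Local Notation d := (vder V).
Implicit Types (A B : set M) (y : M).

Lemma dalg_mono A B y : A `<=` B -> diff_algebraic d A y -> diff_algebraic d B y.
Proof. by move=> AB [r [P [P0 hP Py]]]; exists r, P; split=> // m; apply: AB. Qed.

Lemma dalg_mem A y : diff_subfield d A -> A y -> diff_algebraic d A y.
Proof.
move=> sA Ay; exists 1%N, ('X_ord0 - y%:MP); split.
- move=> /(congr1 (fun Q : {mpoly M[1]} => Q@_U_(ord0))) /eqP.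
  rewrite mcoeffB mcoeffX eqxx mcoeffC mcoeff0 mnm1_eq0 mulr0 subr0; exact/negP/oner_neq0.
- move=> m; rewrite mcoeffB mcoeffX mcoeffC; apply: (dsubB sA); first exact: (dsub_nat sA).
  by apply: (dsubM sA) => //; exact: (dsub_nat sA).
- by rewrite mevalB mevalXU mevalC subrr.
Qed.

Lemma big_enum_prod (I : finType) (g : I -> M) : \prod_(v < #|I|) g (enum_val v) = \prod_i g i.
Proof.
rewrite [RHS](reindex_onto (@enum_val I predT) enum_rank) => [|i _]; last by rewrite enum_rankK.
by apply: eq_bigl => v; rewrite enum_valK eqxx.
Qed.

Lemma big_enum_pair (I J : finType) (g : I * J -> M) :
  \prod_(v < #|{: I * J}|) g (enum_val v) = \prod_i \prod_j g (i, j).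
Proof. by rewrite big_enum_prod pair_bigA; apply: eq_bigr => -[]. Qed.

Lemma mon_sum_in A n (I : eqType) (s : seq I) (p : pred I) (c : I -> M) (mu : I -> 'X_{1..n}) :
  diff_subfield d A -> (forall i, A (c i)) -> forall m, A (\sum_(i <- s | p i) c i *: 'X_[mu i])@_m.
Proof.
move=> sA hc m; rewrite raddf_sum /=; apply: (dsub_sum sA) => i _; rewrite mcoeffZ mcoeffX.
by apply: (dsubM sA) => //; exact: (dsub_nat sA).
Qed.

Lemma mon_sum_eval n (I : eqType) (s : seq I) (p : pred I) (c : I -> M) (mu : I -> 'X_{1..n}) v :
  (\sum_(i <- s | p i) c i *: 'X_[mu i]).@[v] = \sum_(i <- s | p i) c i * \prod_(j < n) v j ^+ mu i j.
Proof. by rewrite raddf_sum /=; apply: eq_bigr => i _; rewrite mevalZ mevalX. Qed.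

Lemma independent_nil A (b : 'I_0 -> M) : diff_alg_independent d A b.
Proof.
move=> r P _ Py; have e : P = (P@_0)%:MP.
  apply: wle_const => m _; rewrite /wdeg big1 // => v _.
  by case: (enum_val v) => -[].
by move: Py; rewrite e mevalC => ->; rewrite mpolyC0.
Qed.

Lemma independent_single A m (b : 'I_m -> M) i : diff_subfield d A ->
  diff_alg_independent d A b -> ~ diff_algebraic d A (b i).
Proof.
move=> sA ind [r [P [P0 hP Py]]]; apply: P0.
pose mu (u : 'X_{1..r}) : 'X_{1..#|{: 'I_m * 'I_r}|} :=
  [multinom (if (enum_val v).1 == i then u (enum_val v).2 else 0)%N | v < #|{: 'I_m * 'I_r}|].
have muI : injective mu.
  move=> u u' /mnmP e; apply/mnmP => j; have := e (enum_rank (i, j)).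
  by rewrite !mnmE enum_rankK /= eqxx.
pose P' : {mpoly M[#|{: 'I_m * 'I_r}|]} := \sum_(u <- msupp P) P@_u *: 'X_[mu u].
have z : P' = 0.
  apply: (ind r); first exact: mon_sum_in.
  rewrite mon_sum_eval -[RHS]Py mevalE; apply: eq_bigr => u _; congr (_ * _).
  pose g (q : 'I_m * 'I_r) := iter q.2 d (b q.1) ^+ (if q.1 == i then u q.2 else 0%N).
  transitivity (\prod_(v < #|{: 'I_m * 'I_r}|) g (enum_val v)).
    by apply: eq_bigr => v _; rewrite /g mnmE.
  rewrite big_enum_pair (bigD1 i) //= [X in _ * X]big1 => [|i' ne].
    by rewrite mulr1; apply: eq_bigr => j _; rewrite /g /= eqxx.
  by rewrite big1 // => j _; rewrite /g /= (negPf ne) expr0.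
apply/mpolyP => u; rewrite mcoeff0; apply/eqP/negPn/negP; rewrite -mcoeff_msupp => uP.
have := congr1 (fun Q : {mpoly M[#|{: 'I_m * 'I_r}|]} => Q@_(mu u)) z.
rewrite mcoeff0 raddf_sum /= (bigD1_seq u) ?msupp_uniq //= mcoeffZ mcoeffX eqxx mulr1 big1 ?addr0 => [/eqP|u' ne].
  by apply/negP; rewrite -mcoeff_msupp.
by rewrite mcoeffZ mcoeffX (inj_eq muI) (negPf ne) mulr0.
Qed.

Lemma independent_rcons A m (b : 'I_m -> M) y : diff_subfield d A -> diff_alg_independent d A b ->
  ~ diff_algebraic d (diff_generated d (A `|` range b)) y ->
  diff_alg_independent d A (fun i : 'I_m.+1 => oapp b y (unlift ord_max i)).
Proof.
move=> sA ind ny r P hP Py.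
set N := #|{: 'I_m.+1 * 'I_r}| in P hP Py *; pose N' := #|{: 'I_m * 'I_r}|.
(* Exponents are split into the part [be] of the old elements and the part [ga] of the new one.
   Collecting by [ga] gives a polynomial that annihilates [y]; its coefficient at a fixed [ga] is a
   polynomial in the jets of [b]. *)
pose be (u : 'X_{1..N}) : 'X_{1..N'} :=
  [multinom u (enum_rank (lift ord_max (enum_val v).1, (enum_val v).2)) | v < N'].
pose ga (u : 'X_{1..N}) : 'X_{1..r} := [multinom u (enum_rank (@ord_max m, j)) | j < r].
have inj u u' : be u = be u' -> ga u = ga u' -> u = u'.
  move=> /mnmP e1 /mnmP e2; apply/mnmP => v; rewrite -(enum_valK v); case: (enum_val v) => i j.
  case: (unliftP ord_max i) => [i' ->|->].
    by have := e1 (enum_rank (i', j)); rewrite !mnmE enum_rankK.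
  by have := e2 j; rewrite !mnmE.
pose jb (v : 'I_N') := iter (enum_val v).2 d (b (enum_val v).1).
pose jy (j : 'I_r) := iter j d y.
have split (u : 'X_{1..N}) : \prod_(v < N) (iter (enum_val v).2 d (oapp b y (unlift ord_max (enum_val v).1))) ^+ u v =
    \prod_(v < N') jb v ^+ be u v * \prod_(j < r) jy j ^+ ga u j.
  pose g (q : 'I_m.+1 * 'I_r) := iter q.2 d (oapp b y (unlift ord_max q.1)) ^+ u (enum_rank q).
  transitivity (\prod_(v < #|{: 'I_m.+1 * 'I_r}|) g (enum_val v)).
    by apply: eq_bigr => v _; rewrite /g enum_valK.
  rewrite big_enum_pair big_ord_recr /=; congr (_ * _).
    pose h (q : 'I_m * 'I_r) := iter q.2 d (b q.1) ^+ u (enum_rank (lift ord_max q.1, q.2)).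
    transitivity (\prod_(v < #|{: 'I_m * 'I_r}|) h (enum_val v)); last by apply: eq_bigr => v _; rewrite /h mnmE.
    rewrite big_enum_pair.
    apply: eq_bigr => i _; apply: eq_bigr => j _; rewrite /g /h /=.
    have -> : widen_ord (leqnSn m) i = lift ord_max i by apply/val_inj; rewrite /= /bump leqNgt ltn_ord.
    by rewrite liftK.
  by apply: eq_bigr => j _; rewrite /g /= unlift_none mnmE.
pose Fb := diff_generated d (A `|` range b).
have sF : diff_subfield d Fb by exact: dgen_sub.
have AF : A `<=` Fb by move=> x Ax; apply: dgen_incl; left.
pose B (u : 'X_{1..N}) := \prod_(v < N') jb v ^+ be u v.
have FB u : Fb (B u).
  apply: (dsub_prod sF) => v _; apply: (dsubX sF); apply: (dsub_iter sF); apply: dgen_incl; right.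
  by exists (enum_val v).1.
pose Q : {mpoly M[r]} := \sum_(u <- msupp P) (P@_u * B u) *: 'X_[ga u].
have Q0 : Q = 0.
  apply: contrapT => Qn; apply: ny; exists r, Q; split=> //.
    by apply: mon_sum_in => // u; apply: (dsubM sF) => //; apply: AF.
  rewrite mon_sum_eval -[RHS]Py mevalE; apply: eq_bigr => u _.
  by rewrite split mulrA.
apply/mpolyP => u0; rewrite mcoeff0; apply/eqP/negPn/negP; rewrite -mcoeff_msupp => uP.
pose R : {mpoly M[N']} := \sum_(u <- msupp P | ga u == ga u0) P@_u *: 'X_[be u].
have R0 : R = 0.
  apply: (ind r); first exact: mon_sum_in.
  rewrite mon_sum_eval -[RHS](mcoeff0 _ (ga u0)) -Q0 raddf_sum /= big_mkcond /=.
  apply: eq_bigr => u _; rewrite mcoeffZ mcoeffX; case: ifP => _; by rewrite ?mulr1 ?mulr0.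
have := congr1 (fun Z : {mpoly M[N']} => Z@_(be u0)) R0.
rewrite mcoeff0 raddf_sum /= big_mkcond /= (bigD1_seq u0) ?msupp_uniq //= eqxx mcoeffZ mcoeffX eqxx mulr1 big1 ?addr0.
  by move=> /eqP; apply/negP; rewrite -mcoeff_msupp.
move=> u ne; case: eqP => // ge; rewrite mcoeffZ mcoeffX.
by case: eqP => [e|]; rewrite ?mulr0 //; case/eqP: ne; exact: inj.
Qed.

(** A basis is chosen greedily among the generators [s]; the others are algebraic over it, and by
    [dalg_closed] so is everything they generate. *)
Lemma dtrdeg_exists A n (s : 'I_n -> M) : diff_subfield d A ->
  exists m, is_dtrdeg d A (diff_generated d (A `|` range s)) m.
Proof.
move=> sA.
have h l : exists m (b : 'I_m -> M), [/\ range b `<=` range s, diff_alg_independent d A b &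
    forall i : 'I_n, (i < l)%N -> diff_algebraic d (diff_generated d (A `|` range b)) (s i)].
  elim: l => [|l [m [b [rb ib hb]]]].
    exists 0%N, (fun=> 0); split=> //; last exact: independent_nil.
    by move=> x [[]].
  case: (ltnP l n) => ln; last first.
    by exists m, b; split=> // i _; apply: hb; exact: leq_trans (ltn_ord i) ln.
  pose il := Ordinal ln.
  have [hl|hl] := pselect (diff_algebraic d (diff_generated d (A `|` range b)) (s il)).
    exists m, b; split=> // i; rewrite ltnS leq_eqVlt => /orP[/eqP e|]; last exact: hb.
    by have -> : i = il by exact/val_inj.
  pose b' (i : 'I_m.+1) := oapp b (s il) (unlift ord_max i).
  have bb : range b `<=` range b'.
    by move=> _ [i _ <-]; exists (lift ord_max i) => //; rewrite /b' liftK.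
  have sb' : range b' (s il) by exists ord_max => //; rewrite /b' unlift_none.
  exists m.+1, b'; split.
  - by move=> _ [i _ <-]; rewrite /b'; case: unlift => [j|] /=; [apply: rb; exists j | exists il].
  - exact: independent_rcons.
  move=> i; rewrite ltnS leq_eqVlt => /orP[/eqP e|il'].
    have -> : i = il by exact/val_inj.
    by apply: dalg_mem; [exact: dgen_sub | apply: dgen_incl; right].
  apply: dalg_mono (hb i il'); apply: dgen_mono => x [Ax|bx]; first by left.
  by right; apply: bb.
have [m [b [rb ib hb]]] := h n; exists m, b; split=> //.
  by move=> x /rb sx; apply: dgen_incl; right.
move=> y Ey; apply: (dalg_closed (s := s)); first exact: dgen_sub.
  by move=> i; exact: hb.
apply: dgen_mono Ey => x [Ax|sx]; last by right.
by left; apply: dgen_incl; left.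
Qed.
End Bases.

(** * Elements smaller than a subfield *)

Section Below.
Variables (K M : rcfType) (VK : vdf K) (V : vdf M) (emb : {rmorphism K -> M}) (k : set M).
Local Notation "x ≼ y" := (dominatedb (vO V) x y) (at level 70, y at next level).
Local Notation "x ≺ y" := (~~ dominatedb (vO V) y x) (at level 70, y at next level).
Local Notation d := (vder V).
Local Notation ld := (logder V).
Let OV := vO_ring V.
Let OK := vO_ring VK.
Hypothesis eV : vembed VK V emb.
Hypothesis sk : diff_subfield d k.
Hypothesis kO : forall c, k c -> c ≼ 1.
(** The middle clause is the instance, for two equal embeddings, of a clause in the hypothesis of
    [elimination]. *)
Hypothesis res : forall e : K, dominatedb (vO VK) e 1 ->
  exists c : K, [/\ k (emb c), emb c = emb c & ~~ dominatedb (vO VK) 1 (e - c)].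
Hypothesis expK : forall h : K, exists g, g != 0 /\ logder VK g = h.
Hypothesis bigK : exists w : K, ~~ dominatedb (vO VK) w 1.

Definition base_field := diff_generated d (range emb `|` k).

(** The ring generated by the image of [K] and [k]; fractions of its elements exhaust
    [base_field]. *)
Definition ksum : set M := [set x | exists2 s : seq (K * M), (forall p, p \in s -> k p.2) &
  x = \sum_(p <- s) emb p.1 * p.2].

Lemma ksum_emb e : ksum (emb e).
Proof.
exists [:: (e, 1)]; last by rewrite big_seq1 mulr1.
by move=> p; rewrite mem_seq1 => /eqP -> /=; exact: (dsub1 sk).
Qed.
Lemma ksum_k c : k c -> ksum c.
Proof.
move=> kc; exists [:: (1, c)]; last by rewrite big_seq1 rmorph1 mul1r.
by move=> p; rewrite mem_seq1 => /eqP ->.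
Qed.
Lemma ksumD x y : ksum x -> ksum y -> ksum (x + y).
Proof.
move=> [s hs ->] [t ht ->]; exists (s ++ t); last by rewrite big_cat.
by move=> p; rewrite mem_cat => /orP[/hs|/ht].
Qed.
Lemma ksum_sum (I : eqType) (s : seq I) (F : I -> M) : (forall i, i \in s -> ksum (F i)) ->
  ksum (\sum_(i <- s) F i).
Proof.
move=> h; rewrite big_seq; elim/big_ind: _ => //; last exact: ksumD.
by rewrite -(rmorph0 emb); exact: ksum_emb.
Qed.
Lemma ksum_term e c : k c -> ksum (emb e * c).
Proof.
move=> kc; exists [:: (e, c)]; last by rewrite big_seq1.
by move=> p; rewrite mem_seq1 => /eqP ->.
Qed.
Lemma ksumM x y : ksum x -> ksum y -> ksum (x * y).
Proof.
move=> [s hs ->] [t ht ->]; rewrite mulr_suml; apply: ksum_sum => p /hs kp.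
rewrite mulr_sumr; apply: ksum_sum => q /ht kq.
by rewrite mulrACA -rmorphM; apply: ksum_term; exact: (dsubM sk).
Qed.
Lemma ksumN x : ksum x -> ksum (- x).
Proof. by move=> h; rewrite -mulN1r -(rmorph1 emb) -rmorphN; apply: ksumM => //; exact: ksum_emb. Qed.
Lemma ksum_der x : ksum x -> ksum (d x).
Proof.
move=> [s hs ->]; have -> : d (\sum_(p <- s) emb p.1 * p.2) = \sum_(p <- s) d (emb p.1 * p.2).
  by elim: s {hs} => [|p s IH]; rewrite ?big_nil ?der0 // !big_cons derD IH.
apply: ksum_sum => p /hs kp; rewrite derM -(vembed_der eV); apply: ksumD; apply: ksum_term => //.
exact: (dsub_der sk).
Qed.

(** [elimination] with both embeddings equal yields a leading term [emb e * c], and nonzero elements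
    [c] of [k] are units of [O]. *)
Lemma ksum_value x : ksum x -> x != 0 -> exists e, [/\ e != 0, x ≼ emb e & emb e ≼ x].
Proof.
move=> [s hs ->] x0; have := elimination eV eV sk kO res hs.
case=> [[h _]|[e [c [e0 [kc c0] s1 _]]]]; first by rewrite h eqxx in x0.
exists e; split=> //.
  apply: (dom_trans OV) (sim_doml OV s1) _; rewrite -[X in _ ≼ X]mulr1; apply: domM => //; first exact: dom_refl.
  exact: kO.
apply: (dom_trans OV) _ (sim_domr OV s1); rewrite -{1}[emb e]mulr1; apply: domM => //; first exact: dom_refl.
exact: (A_unit sk kO).
Qed.

Lemma base_value x : base_field x -> x != 0 -> exists e, [/\ e != 0, x ≼ emb e & emb e ≼ x].
Proof.
pose T := [set x | exists X Y, [/\ ksum X, ksum Y, Y != 0 & x = X / Y]].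
have one : ksum 1 by rewrite -(rmorph1 emb); exact: ksum_emb.
have zero : ksum 0 by rewrite -(rmorph0 emb); exact: ksum_emb.
have inT X : ksum X -> T X by move=> h; exists X, 1; split; rewrite ?oner_neq0 ?divr1.
have FT : base_field `<=` T.
  apply: dgen_min.
    split; first exact: inT.
    - move=> _ _ [X [Y [hX hY Y0 ->]]] [X' [Y' [hX' hY' Y0' ->]]].
      exists (X * Y' - X' * Y), (Y * Y'); split; [|exact: ksumM|exact: mulf_neq0|by rewrite frac_sub].
      by apply: ksumD; [|apply: ksumN]; exact: ksumM.
    - move=> _ _ [X [Y [hX hY Y0 ->]]] [X' [Y' [hX' hY' Y0' ->]]].
      have [->|X0'] := eqVneq X' 0; first by rewrite mul0r invr0 mulr0; exact: inT.
      exists (X * Y'), (Y * X'); split; [exact: ksumM|exact: ksumM|exact: mulf_neq0|by rewrite frac_div].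
    - move=> _ [X [Y [hX hY Y0 ->]]]; exists (d X * Y - X * d Y), (Y * Y).
      split; [|exact: ksumM|exact: mulf_neq0|].
        by apply: ksumD; [|apply: ksumN]; apply: ksumM => //; exact: ksum_der.
      by rewrite derM derV //; field.
  by move=> y [[e _ <-]|ky]; apply: inT; [exact: ksum_emb | exact: ksum_k].
move=> /FT[X [Y [hX hY Y0 ->]]]; rewrite mulf_eq0 negb_or => /andP[X0 _].
have [e [e0 Xe eX]] := ksum_value hX X0; have [e' [e0' Ye eY]] := ksum_value hY Y0.
have m0 : emb e' != 0 by rewrite fmorph_eq0.
exists (e / e'); rewrite fmorph_div mulf_neq0 ?invr_eq0 //; split=> //; apply: domM => //; by rewrite domV.
Qed.

Definition above_emb x := forall h : K, emb h ≺ x.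

(** By [v_mono], [ld x] dominates the logarithmic derivatives of all infinitesimals of [K], and
    exponential integration makes these, up to sign, arbitrary infinite elements. Enlarging [h] to
    [h'] makes the inequality strict. *)
Lemma ld_below x : x != 0 -> (forall e, e != 0 -> x ≺ emb e) -> above_emb (ld x).
Proof.
move=> x0 hx h; have [w w1] := bigK.
have w0 : w != 0 by exact: (lt_dom_neq0 OK w1).
have [h' [hh h1]] : exists h', ~~ dominatedb (vO VK) h' h /\ ~~ dominatedb (vO VK) h' 1.
  case: (boolP (dominatedb (vO VK) h 1)) => hd.
    by exists w; split=> //; exact: (dom_lt_trans OK) hd w1.
  have h0 := lt_dom_neq0 OK hd; exists (h * w); split.
    by rewrite -{2}[h]mulr1 domM2l.
  apply: (lt_dom_trans OK) hd _; rewrite -{1}[h]mulr1 domM2l //; exact: (domW OK w1).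
have key g : g != 0 -> ~~ dominatedb (vO VK) 1 g -> emb (logder VK g) ≼ ld x.
  move=> g0 g1; rewrite (vembed_ld eV); apply: v_mono; rewrite ?fmorph_eq0 //; first exact: hx.
  by rewrite -(rmorph1 emb) (vembed_dom eV).
have [g [g0 gl]] := expK h'.
have hl : emb h' ≼ ld x.
  case: (boolP (dominatedb (vO VK) 1 g)) => g1; last by rewrite -gl; exact: key.
  have g2 : ~~ dominatedb (vO VK) g 1.
    by apply/negP => g2; case/negP: h1; rewrite -gl; exact: ld_dom1.
  have e : logder VK g^-1 = - h' by rewrite ldV // gl.
  by have := key g^-1; rewrite e rmorphN domN // invr_eq0 dom1V //; exact.
by apply: (lt_dom_trans OV) _ hl; rewrite (vembed_dom eV).
Qed.

Lemma ld_above x : above_emb x -> above_emb (ld x).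
Proof.
move=> hx; have x0 : x != 0 by apply: (lt_dom_neq0 OV (hx 0)).
have xV : x^-1 != 0 by rewrite invr_eq0.
move=> h; have e : ld x^-1 = - ld x by rewrite ldV.
have := @ld_below x^-1 xV _ h; rewrite e domN //; apply=> {}e e0.
have := hx e^-1; rewrite fmorphV; apply: contra; rewrite -[X in X ≼ _]invrK domV ?invr_eq0 ?fmorph_eq0 //.
Qed.

Lemma distinct_sum (I : eqType) (s : seq I) (t : I -> M) i0 : i0 \in s -> uniq s -> (forall i, t i != 0) ->
  (forall i j, i \in s -> j \in s -> i != j -> ~ (t i ≼ t j /\ t j ≼ t i)) -> \sum_(i <- s) t i != 0.
Proof.
move=> i0s us t0 hd.
have [i1 i1s hi1] : exists2 i, i \in s & forall j, j \in s -> t j ≼ t i.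
  elim: s i0 i0s {us hd} => [//|a s IH] i0 _.
  case: s IH => [_|b s IH].
    by exists a; rewrite ?mem_seq1 // => j; rewrite mem_seq1 => /eqP ->; exact: dom_refl.
  have [|i1 i1s h] := IH b; first by rewrite in_cons eqxx.
  have /orP[h1|h1] := dom_total OV (t a) (t i1).
    by exists i1; [rewrite in_cons i1s orbT | move=> j; rewrite in_cons => /orP[/eqP ->|/h]].
  exists a; first by rewrite in_cons eqxx.
  move=> j; rewrite in_cons => /orP[/eqP ->|/h h2]; first exact: dom_refl.
  exact: (dom_trans OV) h2 h1.
apply: (@sim_neq0l _ _ OV _ (t i1)); rewrite /sim (bigD1_seq i1) //= addrAC subrr add0r.
rewrite big_seq_cond; apply: lt_dom_sum => // j /andP[js ji]; apply/negP => h.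
by apply: (hd j i1 js i1s ji); split=> //; exact: hi1.
Qed.

Lemma nat_diff_dom (a b : nat) : (a%:R - b%:R : M) ≼ 1.
Proof. by apply: domB => //; exact: dom_nat. Qed.
Lemma dom_nat_diff (a b : nat) : a != b -> 1 ≼ (a%:R - b%:R : M).
Proof.
wlog ab : a b / (a < b)%N.
  move=> h ne; case: (ltngtP a b) ne => // ab _; first by apply: h => //; rewrite ltn_eqF.
  by rewrite -opprB domxN //; apply: h => //; rewrite ltn_eqF.
move=> _; rewrite -opprB domxN // -natrB ?(ltnW ab) //; rewrite -(subnSK ab); exact: nat_dom.
Qed.

(* The values of [z] and its iterated logarithmic derivatives are independent over the value group of
   the base field, whereas a differentially algebraic element generates a field of finite
   transcendence degree. *)
Lemma below_not_dalg z : z != 0 -> (forall e, e != 0 -> z ≺ emb e) -> ~ diff_algebraic d base_field z.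
Proof.
move=> z0 hz hal; have sF : diff_subfield d base_field := dgen_sub _ _.
have [T [R [sT FT Tz hT]]] := @dalg_tower _ V _ sF _ _ _ (ds_vembed sF) (@ds_injP _ _ _ sF) (@ds_lift _ _ _ sF)
  1%N (fun=> z) (fun=> hal).
pose zs i := iter i ld z.
have Ts i : T (zs i).
  elim: i => [|i IH]; first exact: (Tz ord0).
  by rewrite /zs iterS; apply: (dsub_div sT) => //; exact: (dsub_der sT).
have ab i : above_emb (zs i.+1).
  by elim: i => [|i IH]; [exact: ld_below | exact: ld_above].
have z1 i : 1 ≺ zs i.+1 by rewrite -(rmorph1 emb); exact: ab.
have zn i : zs i != 0 by case: i => [//|i]; exact: (lt_dom_neq0 OV (z1 i)).
have zlt i : zs i.+2 ≺ zs i.+1 by exact: ld_lt.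
have zlt' i j : (i < j)%N -> zs j.+1 ≺ zs i.+1.
  elim: j => // j IH; rewrite ltnS leq_eqVlt => /orP[/eqP ->|/IH h]; first exact: zlt.
  exact: (lt_trans_dom OV) (zlt j) h.
have [G [G0 Gz]] := hT zs Ts; move/eqP: Gz; apply/negP; rewrite evE.
set f := ds_inj sF.
have [m0 m0G] : exists m, m \in msupp G.
  case e : (msupp G) => [|m s]; last by exists m; rewrite in_cons eqxx.
  by move/eqP: e; rewrite msupp_eq0 (negPf G0).
pose a m := if m \in msupp G then f G@_m else 1.
have Fa m : base_field (a m) by rewrite /a; case: ifP => _; [exact: ds_injP | exact: (dsub1 sF)].
have a0 m : a m != 0 by rewrite /a; case: ifP => h; [rewrite fmorph_eq0 -mcoeff_msupp | exact: oner_neq0].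
pose t m := a m * \prod_(i < R) zs i ^+ m i.
have -> : \sum_(m <- msupp G) f G@_m * \prod_(i < R) zs i ^+ m i = \sum_(m <- msupp G) t m.
  by rewrite big_seq [RHS]big_seq; apply: eq_bigr => m mG; rewrite /t /a mG.
have pl (m : 'X_{1..R}) : \prod_(i < R) zs i ^+ m i != 0 /\
    ld (\prod_(i < R) zs i ^+ m i) = \sum_(i < R) (m i)%:R * zs i.+1.
  elim/big_ind2: _ => [|x x' y y' [h1 <-] [h2 <-]|i _]; first by rewrite oner_neq0 ld1.
    by rewrite mulf_neq0 // ldM.
  by rewrite expf_neq0 // ldX.
have t0 m : t m != 0 by rewrite mulf_neq0 //; case: (pl m).
apply: (distinct_sum m0G (msupp_uniq G) t0).
move=> m m' mG mG' ne [h1 h2].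
have [e [e0 ae ea]] := base_value (Fa m) (a0 m); have [e' [e0' ae' ea']] := base_value (Fa m') (a0 m').
have l1 := ld_equiv (t0 m) h1 h2.
have l2 := ld_equiv (a0 m) ae ea; have l3 := ld_equiv (a0 m') ae' ea'.
rewrite -!(vembed_ld eV) in l2 l3.
pose D i : M := (m' i)%:R - (m i)%:R.
(* Two monomials of equal value have logarithmic derivatives that differ by an element of [O]; up to
   [O], the coefficients contribute an element of [K]. *)
have key : emb (logder VK e' - logder VK e) + \sum_(i < R) D i * zs i.+1 ≼ 1.
  have -> : emb (logder VK e' - logder VK e) + \sum_(i < R) D i * zs i.+1 =
    (ld (t m') - ld (t m)) + ((emb (logder VK e') - ld (a m')) - (emb (logder VK e) - ld (a m))).
    rewrite /t (ldM V (a0 m') (pl m').1) (ldM V (a0 m) (pl m).1).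
    rewrite (pl m).2 (pl m').2 rmorphB /=.
    have -> : \sum_(i < R) D i * zs i.+1 = \sum_(i < R) (m' i)%:R * zs i.+1 - \sum_(i < R) (m i)%:R * zs i.+1.
      by rewrite -sumrB; apply: eq_bigr => i _; rewrite /D mulrBl.
    by ring.
  by apply: domD => //; apply: domB.
have [i1 hi1] : exists i, m i != m' i.
  apply: contrapT => h; case/eqP: ne; apply/mnmP => i; apply/eqP/negPn/negP => h'; by apply: h; exists i.
(* The first index with different exponents gives an infinite summand that dominates all the later
   ones and everything in [K]. *)
case: (@arg_minnP _ i1 (fun i => m i != m' i) (fun i => i : nat) hi1) => i hi mini.
have Di : 1 ≼ D i by apply: dom_nat_diff; rewrite eq_sym.
have D0 j : D j * zs j.+1 ≺ zs i.+1 \/ j = i.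
  case: (ltngtP j i) => ji; last by right; exact/val_inj.
    left; suff -> : D j = 0 by rewrite mul0r lt0_dom.
    by apply/eqP; rewrite subr_eq0 eqr_nat eq_sym; apply/negPn/negP => /mini; rewrite leqNgt ji.
  left; apply: (@dom_lt_trans _ _ OV (1 * zs j.+1)); last by rewrite mul1r; exact: zlt'.
  by apply: domM; rewrite ?dom_refl //; exact: nat_diff_dom.
have rest : emb (logder VK e' - logder VK e) + \sum_(j < R | j != i) D j * zs j.+1 ≺ zs i.+1.
  apply: lt_domD => //; first exact: ab.
  by apply: lt_dom_sum => // j ji; case: (D0 j) => // e1; rewrite e1 eqxx in ji.
move: key; rewrite (bigD1 i) //= addrCA => key.
have : zs i.+1 ≺ zs i.+1; last by rewrite dom_refl.
apply: (@dom_lt_trans _ _ OV (D i * zs i.+1)); first by rewrite -{1}[zs i.+1]mul1r; apply: domM; rewrite ?dom_refl.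
rewrite -[D i * _](addrK (emb (logder VK e' - logder VK e) + \sum_(j < R | j != i) D j * zs j.+1)).
by apply: lt_domB => //; exact: (dom_lt_trans OV) key (z1 i).
Qed.
End Below.

(** * Discreteness *)

Section Discrete.
Variables (K : rcfType) (n : nat).
Implicit Types (s t : 'I_n -> K) (S : set ('I_n -> K)).
Local Notation T := {ptws 'I_n -> order_topology K}.

Definition box s (e : K) : set ('I_n -> K) := [set t | forall i, `|t i - s i| < e].

Lemma box_nbhs s e : 0 < e -> nbhs (s : T) (box s e).
Proof.
move=> e0; refine (@filter_forall T _ (fun i t => `|t i - s i| < e) (nbhs (s : T)) _ _) => i.
have h : nbhs (s i : order_topology K) [set x | `|x - s i| < e].
  rewrite order_nbhs_itv; exists `]s i - e, s i + e[.
    by split=> //=; rewrite in_itv /= ltrBlDr ltrDl e0.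
  by move=> x /=; rewrite in_itv /= ltr_distl.
exact: (@proj_continuous _ (fun _ : 'I_n => order_topology K) i s _ h).
Qed.

Lemma nbhs_box s U : nbhs (s : T) U -> exists2 e, 0 < e & box s e `<=` U.
Proof.
pose F := filter_from [set e : K | 0 < e] (box s).
have FF : Filter F.
  apply: filter_from_filter; first by exists 1; exact: ltr01.
  move=> e e' e0 e0'; exists (Num.min e e'); first by rewrite /= lt_min e0.
  by move=> t h; split=> i; have := h i; rewrite lt_min => /andP[].
suff : F --> (s : T) by move=> h /h[e e0 he]; exists e.
apply/cvg_sup => i W; have /= -> := @nbhsE (initial_topology (fun f : 'I_n -> order_topology K => f i)) s.
case=> B [[C oC <-] Cs] /filterS; apply.
have : nbhs (s i : order_topology K) C by apply: open_nbhs_nbhs.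
rewrite order_nbhs_itv => -[I [oI sI] IC].
suff [e e0 he] : exists2 e, 0 < e & forall x, `|x - s i| < e -> x \in I.
  by exists e => //= t ht; apply: IC; exact: he (ht i).
case: I oI sI {IC} => [[[]l|[]] [[]r|[]]] //= _; rewrite in_itv /= => h.
- move: h => /andP[h1 h2]; exists (Num.min (s i - l) (r - s i)); first by rewrite lt_min !subr_gt0 h1.
  by move=> x; rewrite lt_min !ltr_distl in_itv /= => /andP[/andP[a _] /andP[_ c]]; rewrite subKr in a; rewrite addrC subrK in c; apply/andP.
- exists (s i - l); first by rewrite subr_gt0; case/andP: h.
  by move=> x; rewrite ltr_distl in_itv /= subKr andbT => /andP[].
- exists (r - s i); first by rewrite subr_gt0.
  by move=> x; rewrite ltr_distl in_itv /= => /andP[_]; rewrite addrC subrK.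
- by exists 1 => //; exact: ltr01.
Qed.

Lemma discreteP S : discrete_subset S <->
  forall s, S s -> exists2 e, 0 < e & forall t, S t -> box s e t -> t = s.
Proof.
split=> h s Ss.
  have [_ [U /nbhs_box[e e0 he] Us]] := h s Ss; exists e => // t St /he Ut.
  by have : (U `&` S) t by []; rewrite Us.
have [e e0 he] := h s Ss; split; first exact: mem_set.
exists (box s e); first exact: box_nbhs.
apply/seteqP; split=> [t [ht St]|t ->]; first exact: he.
by split=> // i; rewrite subrr normr0.
Qed.
End Discrete.

(** * The two implications *)

Section Main.
Variables (K : rcfType) (der : K -> K) (O k : set K) (n : nat) (S : set ('I_n -> K)).
Variable X : saturated_extension der O k S.
Hypothesis K_preH : pre_H_field der O.
Hypothesis K_dhens : diff_henselian O der.
Hypothesis K_Liouville : Liouville_closed der.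
Hypothesis O_proper : O <> setT.
Hypothesis k_lift : residue_field_lift O der k.
Hypothesis S_definable : definable (M := pair_structure der (dominated O) k) S.

Local Notation M := (ext_field X).
Local Notation V := (VM X K_preH K_dhens).
Local Notation em := (@emb _ _ _ _ _ _ X).
Local Notation kM := (ext_small X).
Local Notation d := (ext_der X).
Local Notation F := (diff_generated d (range (ext_emb X) `|` kM)).
Local Notation "x ≼ y" := (dominatedb (vO V) x y) (at level 70, y at next level).
Local Notation "x ≺ y" := (~~ dominatedb (vO V) y x) (at level 70, y at next level).
Local Notation fld := (fld X).

Let preM := M_preH X K_preH.
Let dhM := M_dhens X K_preH K_dhens.
Let liftM := M_lift X k_lift.
Let OV := vO_ring V.
Let modM : submodel V kM setT := model_submodel preM dhM (M_Liouville X K_Liouville) (@M_proper _ _ _ _ _ _ X O_proper) liftM.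
Let modK : submodel (VK K_preH K_dhens) k setT := model_submodel K_preH K_dhens K_Liouville O_proper k_lift.
Let skM : diff_subfield d kM. Proof. by case: liftM. Qed.
Let kOM c : kM c -> c ≼ 1. Proof. exact: (model_kO liftM). Qed.
Let cvxM : convex (vO V). Proof. exact: ext_dom_cvx. Qed.

(** Non-isolation of [s] is first order, so in the extension it holds also with radii that are
    infinitesimal over [K]. *)
Lemma ext_box s : S s ->
  (forall e, 0 < e -> exists t, [/\ S t, box s e t & t <> s]) ->
  forall e : M, 0 < e -> exists t, [/\ ext_set X t, box (fun i => em (s i)) e t & exists i, t i != em (s i)].
Proof.
move=> Ss h.
apply: (@transfer _ _ _ _ _ _ X (fun b f => forall e : fld b, 0 < e -> exists t : 'I_n -> fld b,
  [/\ fS t, forall i, `|t i - f (s i)| < e & exists i, t i != f (s i)])).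
  apply: fo_all; apply: fo_imp; first by apply: fo_lt; [exact: fod0 | exact: fod_var].
  apply: fo_exn; apply: fo_and3; first exact: (fo_S0 X (fun i => inl i)).
    apply: fo_fin => i.
    apply: (@fo_ext _ _ _ _ _ _ X _ (fun b (f : 'I_n + option K -> fld b) =>
       - f (inr None) < f (inl i) - f (inr (Some (s i))) /\ f (inl i) - f (inr (Some (s i))) < f (inr None))).
      by move=> b f; rewrite ltr_norml; split=> [[-> ->]|/andP[]].
    by apply: fo_and; apply: fo_lt; first [exact: fod_var | apply: fod_opp; exact: fod_var | apply: fod_sub; exact: fod_var].
  by apply: fo_finex => i; apply: fo_neq; exact: fod_var.
move=> e e0; have [t [St bt ts]] := h e e0; exists t; split=> //.
apply: contrapT => nt; apply: ts; apply: funext => i; apply/eqP/negPn/negP => ne; by apply: nt; exists i.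
Qed.

Lemma ext_isolated : (forall s, S s -> exists2 e, 0 < e & forall t, S t -> box s e t -> t = s) ->
  forall s, ext_set X s -> exists2 e, 0 < e & forall t, ext_set X t -> box s e t -> t = s.
Proof.
move=> h.
have key : forall s : 'I_n -> M, ext_set X s -> exists2 e, 0 < e & forall t, ext_set X t ->
    (forall i, `|t i - s i| < e) -> forall i, t i = s i.
  apply: (@transfer _ _ _ _ _ _ X (fun b f => forall s : 'I_n -> fld b, fS s -> exists2 e, 0 < e &
    forall t : 'I_n -> fld b, fS t -> (forall i, `|t i - s i| < e) -> forall i, t i = s i)).
    apply: fo_alln; apply: fo_imp; first exact: (fo_S0 X (fun i => inl i)).
    apply: fo_ex2; first by apply: fo_lt; [exact: fod0 | exact: fod_var].
    apply: fo_alln; apply: fo_imp; first exact: (fo_S0 X (fun i => inl i)).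
    apply: fo_imp; last by apply: fo_fin => i; apply: fo_eq; exact: fod_var.
    apply: fo_fin => i.
    apply: (@fo_ext _ _ _ _ _ _ X _ (fun b (f : 'I_n + option ('I_n + K) -> fld b) =>
       - f (inr None) < f (inl i) - f (inr (Some (inl i))) /\ f (inl i) - f (inr (Some (inl i))) < f (inr None))).
      by move=> b f; rewrite ltr_norml; split=> [[-> ->]|/andP[]].
    by apply: fo_and; apply: fo_lt; first [exact: fod_var | apply: fod_opp; exact: fod_var | apply: fod_sub; exact: fod_var].
  by move=> s Ss; have [e e0 he] := h s Ss; exists e => // t St bt i; rewrite (he t St bt).
move=> s Ss; have [e e0 he] := key s Ss; exists e => // t St bt; apply: funext => i; exact: he.
Qed.

Lemma sF : diff_subfield d F. Proof. exact: dgen_sub. Qed.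

Lemma small_not_dalg (z : M) : z != 0 -> (forall e : K, 0 < e -> `|z| < em e) -> ~ diff_algebraic d F z.
Proof.
move=> z0 hz; have eV : vembed (VK K_preH K_dhens) V em by exact: emb_vembed.
have [x0 [_ x00 x01]] := sm_small modK.
apply: (below_not_dalg eV skM kOM) => //.
- move=> e e1; have [c [kc _ ec]] := sm_res modK I e1; exists c; split=> //; exact/emb_k.
- by move=> h; have [g [_ g0 gl]] := sm_exp modK (I : setT h); exists g.
- by exists x0^-1; rewrite (domV1 (vO_ring (VK K_preH K_dhens)) x00).
(* The factor [x0 ≺ 1] turns an inequality of absolute values into strict dominance. *)
move=> e e0; apply: (@dom_lt_trans _ _ OV (em (x0 * e))).
  apply: (dom_abs cvxM); apply: ltW.
  have -> : `|em (x0 * e)| = em `|x0 * e|.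
    case: (ger0P (x0 * e)) => h; first by rewrite ger0_norm // -(rmorph0 em) leNgt emb_lt -leNgt.
    by rewrite ltr0_norm ?rmorphN // -(rmorph0 em) emb_lt.
  by apply: hz; rewrite normr_gt0 mulf_neq0.
have OK := vO_ring (VK K_preH K_dhens).
by rewrite (vembed_dom eV) -{1}[e]mul1r domM2r.
Qed.

Lemma dim0_discrete : (forall s, ext_set X s -> forall m,
    is_dtrdeg d F (diff_generated d (F `|` range s)) m -> (m <= 0)%N) ->
  forall s, S s -> exists2 e, 0 < e & forall t, S t -> box s e t -> t = s.
Proof.
move=> hdim s Ss; apply: contrapT => nh.
have [ep ep0 hep] := @small_positive _ _ _ _ _ _ X K em (card_image_le _ _).
have [|t [St bt [i ti]]] := @ext_box s Ss _ ep ep0.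
  move=> e e0; apply: contrapT => h; apply: nh; exists e => // t St bt.
  by apply: contrapT => ts; apply: h; exists t.
pose z := t i - em (s i).
have z0 : z != 0 by rewrite subr_eq0.
have [m dm] := @dtrdeg_exists _ V F n t sF.
(* Dimension zero makes the basis empty, so everything generated by [t] is differentially algebraic
   over [F]. *)
have m0 := hdim t St m dm; move: m m0 dm => [|//] _ [b [_ _ hb]].
have sE := dgen_sub d (F `|` range t).
have Ez : diff_generated d (F `|` range t) z.
  apply: (dsubB sE); first by apply: dgen_incl; right; exists i.
  by apply: dgen_incl; left; apply: dgen_incl; left; exists (s i).
apply: (@small_not_dalg z z0).
  by move=> e e0; apply: lt_trans (bt i) _; apply: hep; rewrite -(rmorph0 em) emb_lt.
apply: dalg_mono (hb z Ez); apply: dgen_min; first exact: sF.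
by move=> x [//|[[]]].
Qed.

Lemma isolated_dalg (t : 'I_n -> M) (ep : M) : ext_set X t -> 0 < ep ->
  (forall t', ext_set X t' -> box t ep t' -> t' = t) -> forall i, diff_algebraic d F (t i).
Proof.
move=> St ep0 iso i0; apply: contrapT => nal.
have [phi hphi] := S_definable; have extS := @ext_definable _ _ _ _ _ _ X phi hphi.
have [l hl] := fsupp_finite phi.
(* The radius, the coordinates of [t] and the parameters of [phi] in one sequence; entries of [l]
   that stand for coordinates are replaced by 0. *)
pose p j := if j is j'.+1 then
   if insub j' is Some i then t i else
   if nth (inl i0) l (j' - n) is inr a then em a else 0 else ep.
have [M1 [mM1 M1p [en hen]]] := countable_submodel modM p.
have sM1 := dhs_sub (sm_dh mM1).
have M1t i : M1 (t i).
  have := M1p i.+1; rewrite /p; case: insubP => [i' _ e|]; last by rewrite ltn_ord.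
  by have -> : i' = i by exact/val_inj.
have M1ep : M1 ep := M1p 0%N.
have M1em a : List.In (inr a) l -> M1 (em a).
  move=> h; have [j ej] : exists j, nth (inl i0) l j = inr a.
    elim: l h {hl p M1p} => //= x l IH [->|/IH[j ej]]; first by exists 0%N.
    by exists j.+1.
  have := M1p (n + j).+1; rewrite /p; case: insubP => [i' h1 _|_]; first by move: h1; rewrite ltnNge leq_addr.
  by rewrite addKn ej.
have [a a0 ha] := @small_positive _ _ _ _ _ _ X nat en (countable_range _).
have [x0 [Mx x00 x01]] := sm_small mM1.
(* Being below all positive elements of [M1], [a] is below [x0 * m] in absolute value and hence
   strictly dominated by [m]. *)
have ta : tiny V M1 a.
  move=> m Mm m0; apply: (@dom_lt_trans _ _ OV (x0 * m)); last by rewrite -[X in _ ≺ X]mul1r domM2r.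
  apply: (dom_abs cvxM); rewrite gtr0_norm //; apply: ltW.
  have Mn : M1 `|x0 * m| by case: (ger0P (x0 * m)) => _; [|apply: (dsubN sM1)]; exact: (dsubM sM1).
  have [j ej] := hen _ Mn; rewrite -ej; apply: ha; rewrite ej normr_gt0 mulf_neq0 //.
(* All of [F] within [M1] will be fixed, including the parameters of [phi] and the representatives
   of residues; transcendence of [t i0] over [F] leaves it free to move. *)
pose A0 := M1 `&` F.
have sA0 : diff_subfield d A0.
  split; first by split; [exact: (dsub1 sM1) | exact: (dsub1 sF)].
  - by move=> x y [x1 x2] [y1 y2]; split; [exact: (dsubB sM1) | exact: (dsubB sF)].
  - by move=> x y [x1 x2] [y1 y2]; split; [exact: (dsub_div sM1) | exact: (dsub_div sF)].
  - by move=> x [x1 x2]; split; [exact: (dsub_der sM1) | exact: (dsub_der sF)].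
have [G [iG tG cG Gy Gc]] : exists G, [/\ piso V G, forall x, M1 x -> exists x', G (x, x'), G `<=` close V M1,
    G (t i0, t i0 + a) & forall c, A0 c -> G (c, c)].
  apply: (deformation cvxM (sm_dh modM) sM1 sA0) => //; first by move=> x [].
  move=> m P hP P0; apply/eqP => e; apply: nal; exists m, P; split=> //; first exact/eqP.
  by move=> u; case: (hP u).
have bfG : bf V kM G.
  split=> //; last by exists en => x y /cG[/hen].
  move=> x y /cG[/= Mx' _] x1; have [c [kc Mc xc]] := sm_res mM1 Mx' x1; exists c; split=> //.
  by apply: Gc; split=> //; apply: dgen_incl; right.
pose t' i := sval (cid (tG _ (M1t i))).
have t'P i : G (t i, t' i) by rewrite /t'; case: cid.
have kun c c' : kM c -> kM c' -> c - c' ≺ 1 -> c = c' by exact: (model_k_uniq preM liftM).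
have hb := @bf_elementary M V kM (ext_dom X) (fun x y => rwP (@ext_domP _ _ _ _ _ _ X K_preH K_dhens x y)) cvxM
   (@ext_hgt _ _ _ _ _ _ X K_preH K_dhens) (@ext_sat_cut _ _ _ _ _ _ X K_preH K_dhens)
   (@ext_sat_chain _ _ _ _ _ _ X K_preH K_dhens) modM skM kOM kun _ phi G
   (fun v => match v with inl i => t i | inr a => ext_emb X a end)
   (fun v => match v with inl i => t' i | inr a => ext_emb X a end) bfG.
have St' : ext_set X t'.
  apply/extS; apply/hb; last exact/extS.
  move=> [i|b] /hl hv; first exact: t'P.
  by apply: Gc; split; [exact: M1em | apply: dgen_incl; left; exists b].
have e : t' = t.
  apply: iso => // i; have [_ /= ti] := cG _ (t'P i).
  have ep1 : ep != 0 by rewrite gt_eqF.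
  by have := lt_dom_abs cvxM (ti ep M1ep ep1); rewrite (gtr0_norm ep0).
(* [t i0] is sent to [t i0 + a] with [a > 0], so [t' = t] is impossible. *)
have := piso_fun iG Gy (t'P i0); rewrite e => /eqP; rewrite -subr_eq0 addrAC subrr add0r.
by rewrite gt_eqF.
Qed.

Lemma discrete_dim0 : S !=set0 ->
  (forall s, S s -> exists2 e, 0 < e & forall t, S t -> box s e t -> t = s) ->
  (exists2 s, ext_set X s & is_dtrdeg d F (diff_generated d (F `|` range s)) 0) /\
  (forall s, ext_set X s -> forall m, is_dtrdeg d F (diff_generated d (F `|` range s)) m -> (m <= 0)%N).
Proof.
move=> [s Ss] iso; split.
  exists (fun i => em (s i)); first exact/emb_S.
  exists (fun=> 0); split; first by move=> x [[]].
    exact: (@independent_nil _ V).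
  move=> y Ey; apply: (dalg_mem (V := V)); first exact: dgen_sub.
  apply: dgen_incl; left; apply: dgen_min Ey; first exact: sF.
  by move=> x [//|[i _ <-]]; apply: dgen_incl; left; exists (s i).
move=> t St [//|m] [b [bE ib _]].
have [ep ep0 hep] := ext_isolated iso St.
have al := isolated_dalg St ep0 hep.
have b0 : diff_generated d (F `|` range t) (b ord0) by apply: bE; exists ord0.
have := @dalg_closed _ V F n t (b ord0) sF al b0.
by move/(@independent_single _ V F _ b ord0 sF ib).
Qed.
End Main.

Theorem theorem5p16
    (K : rcfType) (der : K -> K) (O k : set K)
    (K_preH : pre_H_field der O)
    (K_dhens : diff_henselian O der)
    (K_Liouville : Liouville_closed der)
    (O_proper : O <> setT)
    (k_lift : residue_field_lift O der k)
    (n : nat) (S : set ('I_n -> K))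
    (S_definable : definable (M := pair_structure der (dominated O) k) S)
    (S_nonempty : S !=set0)
    (E : saturated_extension der O k S) :
  is_dim2 E (Some 0) <-> discrete_subset S.
Proof.
rewrite discreteP; split=> [[_ h]|h].
  exact: (dim0_discrete K_preH K_dhens K_Liouville O_proper k_lift h).
exact: (discrete_dim0 E K_preH K_dhens K_Liouville O_proper k_lift S_definable S_nonempty h).
Qed.
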